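(* For a fixed $t>0$ and any $a>0$, let $\{T_k\}_{k\in\mathbb{Z}}$ be a doubly infinite sequence of exponential type tempered distributions on $\mathbb{R}^d$ (elements of $S^a(\mathbb{R}^d)'$) satisfying, for all $k\in\mathbb{Z}$, (1) $M_tT_k=AT_{k+1}$ for some $A\in\mathbb{C}$, and (2) $|\langle T_k,\psi\rangle|\le M\gamma(\psi)$ for all $\psi\in S^a(\mathbb{R}^d)$, for a fixed seminorm $\gamma$ of $S^a(\mathbb{R}^d)$ and a constant $M>0$ ($A$, $\gamma$ and $M$ do not depend on $k$). Then the following assertions hold: (a) If $|A|=\phi_{ia}(te_1)$, then $\Delta T_0=-a^2T_0$. (b) If $|A|>\phi_{ia}(te_1)$, then $T_0=0$. (c) If $|A|<\phi_{ia}(te_1)$, then $T_0$ may not be an eigendistribution of $\Delta$. If $A$ is also assumed to be non-zero, then $T_0$ may not be an eigendistribution of $M_t$.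
   Context: $\Delta=-\sum_{j=1}^d\frac{\partial^2}{\partial x_j^2}$ (note the sign). $e_1=(1,0,\dots,0)\in\mathbb{R}^d$. For $a\ge0$, $S^a(\mathbb{R}^d)$ is the space of $C^\infty$ functions $f$ on $\mathbb{R}^d$ with $\gamma_{m,\alpha}(f)=\sup_{x\in\mathbb{R}^d}e^{a|x|}(1+|x|)^m|D^\alpha f(x)|<\infty$ for all integers $m\ge0$ and all multi-indices $\alpha$; it is a Fréchet space in the topology induced by these seminorms, and a seminorm of $S^a(\mathbb{R}^d)$ means a continuous seminorm for this topology. Its dual $S^a(\mathbb{R}^d)'$ is the space of exponential tempered distributions of type $a$. For $T\in S^a(\mathbb{R}^d)'$, $\langle\Delta T,\psi\rangle=\langle T,\Delta\psi\rangle$. $d\sigma$ is the normalized surface measure on the unit sphere $S^{d-1}$; $\phi_\lambda(x)=\int_{S^{d-1}}e^{i\lambda x\cdot\omega}\,d\sigma(\omega)$ for $\lambda\in\mathbb{C}$, $x\in\mathbb{R}^d$. The spherical average is $M_tf(x)=\int_{S^{d-1}}f(x-t\omega)\,d\sigma(\omega)$, which maps $S^a(\mathbb{R}^d)$ continuously to itself; for $T\in S^a(\mathbb{R}^d)'$, $\langle M_tT,f\rangle=\langle T,M_tf\rangle$ for all $f\in S^a(\mathbb{R}^d)$. $T$ is an eigendistribution of an operator $L$ (here $\Delta$ or $M_t$) if $LT=\mu T$ for some $\mu\in\mathbb{C}$.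
   Formalization: The dimension is assumed to be d ≥ 2; for d = 1 assertion (a) fails: T_k = e^{iλx} with λ = ia + 2π/t satisfies (1) and (2) with A = cosh(at) = φ_{ia}(t), yet ΔT_0 = λ²T_0 ≠ −a²T_0. *)

(* Defs.v *)
From HB Require Import structures.
From mathcomp Require Import all_boot all_order all_algebra.
From mathcomp Require Import all_classical all_reals all_analysis.
From mathcomp Require Import measurable_realfun.
From mathcomp Require Export complex.

Set Implicit Arguments.
Unset Strict Implicit.
Unset Printing Implicit Defensive.

Import Order.TTheory GRing.Theory Num.Theory.
Import numFieldNormedType.Exports.
Import Normc.

Local Open Scope classical_set_scope.
Local Open Scope ring_scope.
Local Open Scope complex_scope.

Definition dot (R : realType) (d : nat) (x y : 'rV[R]_d) : R :=
  \sum_(i < d) x 0 i * y 0 i.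

(* Euclidean norm; the library norm `|x| of 'rV[R]_d is the maximum norm. *)
Definition enorm (R : realType) (d : nat) (x : 'rV[R]_d) : R :=
  Num.sqrt (dot x x).

Definition unit_e1 (R : realType) (d : nat) : 'rV[R]_d :=
  \row_(j < d) (j == 0%N :> nat)%:R.

(* The library puts a sigma-algebra on n.-tuple R but not on 'rV[R]_n, so the
   measures live on tuples; [rv] is the identification with row vectors. *)
Section measures.
Context {R : realType}.
Local Notation mR := (measurableTypeR R).

Lemma pushforward_sigma_additive d d' (T1 : measurableType d)
    (T2 : measurableType d') (m : {measure set T1 -> \bar R}) (f : T1 -> T2) :
  measurable_fun setT f -> semi_sigma_additive (pushforward m f).
Proof.
move=> mf F mF tF mUF; rewrite /pushforward preimage_bigcup.
apply: measure_semi_sigma_additive.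
- by move=> n; rewrite -[X in measurable X]setTI; exact: mf.
- apply/trivIsetP => /= i j _ _ ij; rewrite -preimage_setI.
  by move/trivIsetP : tF => /(_ _ _ _ _ ij) ->//; rewrite preimage_set0.
- by rewrite -preimage_bigcup -[X in measurable X]setTI; exact: mf.
Qed.

Section lebesgue_cons.
Variables (n : nat) (mu : {sigma_finite_measure set (n.-tuple mR) -> \bar R}).

Definition cons_pair (p : mR * n.-tuple mR) : n.+1.-tuple mR :=
  [the n.+1.-tuple mR of p.1 :: p.2].

Lemma measurable_cons_pair : measurable_fun [set: mR * n.-tuple mR] cons_pair.
Proof. exact: measurable_cons. Qed.

Definition lebesgue_cons : set (n.+1.-tuple mR) -> \bar R :=
  pushforward (@lebesgue_measure R \x mu)%E cons_pair.

Let lebesgue_cons0 : lebesgue_cons set0 = 0%E.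
Proof. by rewrite /lebesgue_cons /pushforward preimage_set0 measure0. Qed.

Let lebesgue_cons_ge0 A : (0 <= lebesgue_cons A)%E.
Proof. by rewrite /lebesgue_cons /pushforward; apply: measure_ge0. Qed.

Let lebesgue_cons_sigma_additive : semi_sigma_additive lebesgue_cons.
Proof. exact: pushforward_sigma_additive measurable_cons_pair. Qed.

HB.instance Definition _ := isMeasure.Build _ _ _ lebesgue_cons
  lebesgue_cons0 lebesgue_cons_ge0 lebesgue_cons_sigma_additive.

Let lebesgue_cons_sigma_finite : sigma_finite setT lebesgue_cons.
Proof.
have /sigma_finiteP[F [TF ndF Foo]] := sigma_finiteT (@lebesgue_measure R).
have /sigma_finiteP[G [TG ndG Goo]] := sigma_finiteT mu.
pose g (v : n.+1.-tuple mR) : mR * n.-tuple mR :=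
  (thead v, [tuple of behead v]).
have gK p : g (cons_pair p) = p.
  case: p => x v; rewrite /g /cons_pair /= theadE; congr (_, _).
  exact/val_inj.
have mg : measurable_fun setT g.
  apply/measurable_fun_pairP; split; first exact: measurable_tnth.
  exact: measurable_behead.
exists (fun k => g @^-1` (F k `*` G k)).
  rewrite -preimage_bigcup (_ : \bigcup_k (F k `*` G k) = setT)//.
  rewrite -subTset => -[x y] _.
  have [k _ Fkx] : (\bigcup_k F k) x by rewrite -TF.
  have [l _ Gly] : (\bigcup_k G k) y by rewrite -TG.
  exists (maxn k l) => //; split => /=.
  - by move: x Fkx; exact/subsetPset/ndF/leq_maxl.
  - by move: y Gly; exact/subsetPset/ndG/leq_maxr.
move=> k; have [mF Fk] := Foo k; have [mG Gk] := Goo k; split.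
  by rewrite -[X in measurable X]setTI; apply: mg => //; exact: measurableX.
rewrite /= /lebesgue_cons /pushforward -comp_preimage.
rewrite (_ : g \o cons_pair = id); last by apply/funext => p /=; rewrite gK.
rewrite preimage_id product_measure1E//.
by rewrite lte_mul_pinfty// ge0_fin_numE.
Qed.

HB.instance Definition _ := Measure_isSigmaFinite.Build _ _ _ lebesgue_cons
  lebesgue_cons_sigma_finite.

End lebesgue_cons.

Fixpoint lebesgue_tuple (n : nat) :
    {sigma_finite_measure set (n.-tuple mR) -> \bar R} :=
  match n with
  | 0 => \d_([tuple] : 0.-tuple mR)
  | m.+1 => lebesgue_cons (lebesgue_tuple m)
  end.

Section surface_measure.
Variable d : nat.

Definition rv (v : d.-tuple mR) : 'rV[R]_d := \row_(i < d) tnth v i.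

Definition punctured_ball : set (d.-tuple mR) :=
  [set v | 0 < enorm (rv v) <= 1].

Definition direction (v : d.-tuple mR) : d.-tuple mR :=
  [tuple tnth v i / enorm (rv v) | i < d].

Lemma measurable_enorm :
  measurable_fun [set: d.-tuple mR] (fun v => enorm (rv v) : mR).
Proof.
rewrite (_ : (fun _ => _) = (@powR R ^~ 2^-1) \o
    (fun v : d.-tuple mR => \sum_(i < d) tnth v i * tnth v i)); last first.
  apply/funext => v; rewrite /= /enorm /dot.
  rewrite powR12_sqrt; last by apply: sumr_ge0 => i _; rewrite -expr2 sqr_ge0.
  by congr Num.sqrt; apply: eq_bigr => i _; rewrite !mxE.
apply: measurableT_comp => //.
apply: measurable_sum => i.
by apply: measurable_funM; exact: measurable_tnth.
Qed.

Lemma measurable_punctured_ball : measurable punctured_ball.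
Proof.
rewrite (_ : punctured_ball =
    setT `&` (fun v => enorm (rv v) : mR) @^-1` `]0, 1]%classic).
  by apply: measurable_enorm => //; exact: measurable_itv.
by rewrite setTI; apply/seteqP; split => v /=; rewrite in_itv.
Qed.

Lemma measurable_direction : measurable_fun [set: d.-tuple mR] direction.
Proof.
apply/measurable_fun_tnthP => i.
rewrite (_ : _ \o _ = (fun v : d.-tuple mR =>
    tnth v i * ((@powR R ^~ (-1)) \o (fun v => enorm (rv v) : mR)) v)); last first.
  by apply/funext => v /=; rewrite tnth_mktuple powR_inv1// sqrtr_ge0.
apply: measurable_funM; first exact: measurable_tnth.
by apply: measurableT_comp => //; exact: measurable_enorm.
Qed.

(* cone_volume E = |{r w : 0 < r <= 1, w \in E}| for E in the unit sphere. *)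
Definition cone_volume : set (d.-tuple mR) -> \bar R :=
  pushforward (mrestr (lebesgue_tuple d) measurable_punctured_ball) direction.

Let cone_volume0 : cone_volume set0 = 0%E.
Proof. by rewrite /cone_volume /pushforward preimage_set0 measure0. Qed.

Let cone_volume_ge0 E : (0 <= cone_volume E)%E.
Proof. by rewrite /cone_volume /pushforward; apply: measure_ge0. Qed.

Let cone_volume_sigma_additive : semi_sigma_additive cone_volume.
Proof. exact: pushforward_sigma_additive measurable_direction. Qed.

HB.instance Definition _ := isMeasure.Build _ _ _ cone_volume
  cone_volume0 cone_volume_ge0 cone_volume_sigma_additive.

Lemma inv_ball_volume_ge0 : 0 <= (fine (lebesgue_tuple d punctured_ball))^-1.
Proof. by rewrite invr_ge0 fine_ge0. Qed.

(* The normalized surface measure, carried by {w : enorm (rv w) = 1}. *)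
Definition sphere_measure : set (d.-tuple mR) -> \bar R :=
  mscale (NngNum inv_ball_volume_ge0) cone_volume.

HB.instance Definition _ := Measure.on sphere_measure.

End surface_measure.
End measures.

Section distributions.
Context {R : realType} {d : nat}.
Local Notation C := R[i].
Local Notation V := 'rV[R]_d.
Local Notation Re := (@complex.Re R).
Local Notation Im := (@complex.Im R).
Implicit Types (f g : V -> C) (T : (V -> C) -> C) (L : (V -> C) -> V -> C).

Definition cexp (z : C) : C :=
  (expR (Re z) * cos (Im z)) +i* (expR (Re z) * sin (Im z)).

Definition sphere_integral (g : V -> C) : C :=
  (\int[@sphere_measure R d]_v Re (g (rv v))) +i*
  (\int[@sphere_measure R d]_v Im (g (rv v))).

Definition phi (lambda : C) (x : V) : C :=
  sphere_integral (fun w => cexp ('i * lambda * (dot x w)%:C)).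

Definition spherical_average (t : R) f : V -> C :=
  fun x => sphere_integral (fun w => f (x - t *: w)).

Definition partial (j : 'I_d) f : V -> C := fun x =>
  ('D_(delta_mx 0 j) (Re \o f) x) +i* ('D_(delta_mx 0 j) (Im \o f) x).

(* Note the sign: this is minus the sum of the second derivatives. *)
Definition laplacian f : V -> C :=
  fun x => - \sum_(j < d) partial j (partial j f) x.

Definition multi_partial (alpha : {ffun 'I_d -> nat}) f : V -> C :=
  foldr (fun j g => iter (alpha j) (partial j) g) f (enum 'I_d).

(* C^oo: the iterated partial derivatives in every order of differentiation
   exist and are continuous. *)
Definition smooth f : Prop := forall s : seq 'I_d,
  let g := foldr partial f s in
  [/\ continuous (Re \o g), continuous (Im \o g) &
      forall (x : V) (j : 'I_d),
        derivable (Re \o g) x (delta_mx 0 j) /\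
        derivable (Im \o g) x (delta_mx 0 j)].

Definition gamma (a : R) (m : nat) (alpha : {ffun 'I_d -> nat}) f : \bar R :=
  ereal_sup [set (expR (a * enorm x) * (1 + enorm x) ^+ m *
                  normc (multi_partial alpha f x))%:E | x in [set: V]].

(* The space S^a(R^d), as a set of functions. *)
Definition Sa (a : R) : set (V -> C) :=
  [set f | smooth f /\ forall m alpha, (gamma a m alpha f < +oo)%E].

(* Neighborhoods of f for the topology induced on S^a by the gamma a m alpha:
   a basis is given by the sets of g in S^a with gamma a m alpha (g - f) < e
   for finitely many (m, alpha). *)
Definition Sa_nbhs (a : R) f : set_system (V -> C) :=
  filter_from [set I : seq (nat * {ffun 'I_d -> nat}) * R | 0 < I.2]
    (fun I => [set g | Sa a g /\
       forall p, p \in I.1 -> (gamma a p.1 p.2 (g \- f)%R < I.2%:E)%E]).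

Definition continuous_seminorm (a : R) (gam : (V -> C) -> R) : Prop :=
  [/\ forall f g, Sa a f -> Sa a g -> gam (f \+ g) <= gam f + gam g,
      forall c f, Sa a f -> gam (fun x => c * f x) = normc c * gam f &
      forall f, Sa a f -> gam g @[g --> Sa_nbhs a f] --> gam f].

(* S^a(R^d)': a distribution is represented by a map on all functions V -> C,
   of which only the values on S^a are meaningful; accordingly distributions
   are compared on S^a only. *)
Definition dual_Sa (a : R) T : Prop :=
  (forall c f g, Sa a f -> Sa a g ->
     T (fun x => c * f x + g x) = c * T f + T g) /\
  (forall f, Sa a f -> forall e : R, 0 < e ->
     \forall g \near Sa_nbhs a f, normc (T g - T f) < e).

Definition distr_eq (a : R) T U : Prop := forall f, Sa a f -> T f = U f.

(* The action <L T, f> = <T, L f> of L = laplacian, spherical_average t. *)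
Definition distr_op L T : (V -> C) -> C := fun f => T (L f).

Definition eigendistribution (a : R) L T : Prop :=
  exists mu : C, distr_eq a (distr_op L T) (fun f => mu * T f).

(* M_t T_k = A T_(k+1), with the T_k bounded uniformly in k by one fixed
   continuous seminorm. *)
Definition average_sequence (t a : R) (A : C) (T : int -> (V -> C) -> C) : Prop :=
  [/\ forall k, dual_Sa a (T k),
      forall k, distr_eq a (distr_op (spherical_average t) (T k))
                           (fun f => A * T (k + 1) f) &
      exists (gam : (V -> C) -> R) (M : R),
        [/\ continuous_seminorm a gam, 0 < M &
            forall k f, Sa a f -> normc (T k f) <= M * gam f]].

End distributions.

(* Main.v *)
(* (a), (b): pairing T_k with the averages M_r u of a real test function u gives
   functions p_k of the radius r such that the radial mean of p_k at distance t
   is |A| p_(k+1), while |p_k| <= C (1 + r)^m phi(r), phi(r) = phi_(ia)(r e_1).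
   If |A| > phi(t), iterating the mean makes p_0 vanish. If |A| = phi(t), then M_t / phi(t)
   is a Markov type operator which, cubed, dominates a multiple of
   K (1 + M_s / phi(s)) for a smoothing K; hence its powers applied to
   M_s / phi(s) - 1 gain a factor n^(-1/2), which lowers the exponent m step by
   step, down to a bounded sequence, and a maximum principle then gives
   p_0 = p_0(0) phi. The limit r -> 0 of the spherical means yields the
   eigenvalue of the Laplacian.
   (c): a plane wave e^(i lambda x_1) is an eigendistribution of M_t, with
   eigenvalue phi_lambda(t e_1), and of the Laplacian, with eigenvalue lambda^2.
   If 0 < |A| < phi(t), there is lambda = xi + i eta, xi, eta <> 0, with
   |phi_lambda| = |A| and phi_lambda not real; then -xi + i eta has the conjugate
   eigenvalue, and rescaled powers of the two eigenvalues combine the two plane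
   waves. If A = 0, two real zeros of r |-> phi_r(e_1) are used. *)
Require Import Defs.
From HB Require Import structures.
From mathcomp Require Import all_boot all_order all_algebra.
From mathcomp Require Import all_classical all_reals all_analysis.
From mathcomp Require Import complex.
From mathcomp Require Import ring lra zify.
From mathcomp Require Import measurable_realfun.

Set Implicit Arguments.
Unset Strict Implicit.
Unset Printing Implicit Defensive.

Import Order.TTheory GRing.Theory Num.Theory.
Import numFieldNormedType.Exports.

Local Open Scope classical_set_scope.
Local Open Scope ring_scope.

(** * Rotation invariance of the surface measure *)

(** Uniformity in k is what excludes generalised eigenfunctions in (a): if f is the derivative of
    phi_(ia)(r e1) in a, the functions f + k c phi satisfy the recurrence for a suitable constant c
    and grow polynomially relative to phi, but they are unbounded in k. The cube comes from the
    product formula: M_t M_s is a mixture of means M_rho with rho = |t e1 + s w|, whose law has a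
    density bounded below near t, so two factors dominate K and a third one is needed for K M_t. The
    gain n^(-1/2) is that of a lazy walk: B^n (F - 1) is governed by differences of neighboring
    binomial coefficients. As p_k is the n-th image of p_(k-3n), n may be taken of order |r|: the
    radii reached stay of order 1 + |r| while half a power is gained. Two further obstacles shape
    the proof. T_k is only a continuous functional, so it is passed through spherical averages by a
    quadrature rule that serves T_k and the test function at once. And A may be any complex number:
    multiplying T_k by powers of A/|A| reduces it to its modulus. *)

Section continuous_measurable.
Context {R : realType}.
Local Notation mR := (measurableTypeR R).

Lemma measurable_countable_fibers d (T : measurableType d) (I : countType)
    (e : T -> I) (g : I -> R) :
  (forall i, measurable [set t | e t = i]) ->
  measurable_fun setT (g \o e : T -> mR).
Proof.
move=> me _ Y mY; rewrite setTI.
rewrite (_ : _ @^-1` Y = \bigcup_(i in [set i | Y (g i)]) [set t | e t = i]).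
  rewrite bigcup_mkcond; apply: countable_bigcupT_measurable => [|i].
    exact: countableP.
  by case: ifP.
by apply/seteqP; split => [t /= Yt|t [i Yi /= ->]//]; exists (e t).
Qed.

Definition grid n (k : nat) (x : 'rV[R]_n) : {ffun 'I_n -> int} :=
  [ffun j => Num.floor (x 0 j * k.+1%:R)].

Definition ungrid n (k : nat) (z : {ffun 'I_n -> int}) : 'rV[R]_n :=
  \row_j ((z j)%:~R / k.+1%:R).

Lemma gridK_cvg n (x : 'rV[R]_n) : ungrid k (grid k x) @[k --> \oo] --> x.
Proof.
apply/cvg_ballP => e e0; near=> k; split => // i j.
rewrite ord1 !mxE ffunE /ball/=.
set y := x 0 j * _; have /andP[h1 h2] := floor_itv y.
have -> : x 0 j - (Num.floor y)%:~R / k.+1%:R = (y - (Num.floor y)%:~R) / k.+1%:R.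
  by rewrite mulrBl mulfK.
rewrite normrM [X in _ * X]ger0_norm ?invr_ge0//.
rewrite ltr_pdivrMr ?ltr0n//.
rewrite ger0_norm ?subr_ge0// ltrBlDr (lt_le_trans h2)// intrD addrC lerD2r.
near: k; exists (Num.truncn e^-1) => // k /= ke.
rewrite -ler_pdivrMl// mulr1 (le_trans (ltW (truncnS_gt _)))// ler_nat ltnS//.
Unshelve. all: by end_near. Qed.

Lemma measurable_grid d (T : measurableType d) n (X : T -> 'rV[R]_n) k :
  (forall j, measurable_fun setT (fun t => X t 0 j : mR)) ->
  forall z, measurable [set t | grid k (X t) = z].
Proof.
move=> mX z.
rewrite (_ : [set t | _] = \bigcap_(j in [set: 'I_n])
   ((fun t => X t 0 j * k.+1%:R : mR) @^-1` `[(z j)%:~R, (z j + 1)%:~R[)).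
  apply: fin_bigcap_measurable => [|j _]; first exact: finite_finset.
  rewrite -[X in measurable X]setTI.
  have mj : measurable_fun setT (fun t => X t 0 j * k.+1%:R : mR).
    by apply: measurable_funM => //; exact: mX.
  by apply: mj => //; exact: measurable_itv.
apply/seteqP; split => t /=.
  by move=> /ffunP h j _ /=; rewrite -h ffunE in_itv/= floor_itv.
move=> h; apply/ffunP => j; rewrite ffunE; apply/floor_def.
by have := h j I; rewrite /= in_itv.
Qed.

(** Obtained as a pointwise limit: [X t] rounded to the grid of mesh 1/(k+1) has countably many
    values, each on a measurable fiber, and continuity of [g] gives the convergence. No
    sigma-algebra on row vectors enters. *)
Lemma measurable_continuous_comp d (T : measurableType d) n (X : T -> 'rV[R]_n)
    (g : 'rV[R]_n -> R) :
  continuous g -> (forall j, measurable_fun setT (fun t => X t 0 j : mR)) ->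
  measurable_fun setT (fun t => g (X t) : mR).
Proof.
move=> cg mX.
apply: (@measurable_fun_cvg _ _ _ _ (fun k t => g (ungrid k (grid k (X t))))).
  move=> k; apply: (@measurable_countable_fibers _ _ _
    (fun t => grid k (X t)) (fun z => g (ungrid k z))).
  exact: measurable_grid.
by move=> t _; apply: (cvg_comp _ _ (@gridK_cvg _ (X t))); exact: cg.
Qed.

Lemma measurable_continuous_comp2 d (T : measurableType d) n m
    (X : T -> 'rV[R]_n) (Y : T -> 'rV[R]_m) (g : 'rV[R]_n * 'rV[R]_m -> R) :
  continuous g -> (forall j, measurable_fun setT (fun t => X t 0 j : mR)) ->
  (forall j, measurable_fun setT (fun t => Y t 0 j : mR)) ->
  measurable_fun setT (fun t => g (X t, Y t) : mR).
Proof.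
move=> cg mX mY.
apply: (@measurable_fun_cvg _ _ _ _
  (fun k t => g (ungrid k (grid k (X t)), ungrid k (grid k (Y t))))).
  move=> k; apply: (@measurable_countable_fibers _ _ _
    (fun t => (grid k (X t), grid k (Y t)))
    (fun z => g (ungrid k z.1, ungrid k z.2))) => -[z1 z2].
  rewrite (_ : [set t | _] = [set t | grid k (X t) = z1] `&`
     [set t | grid k (Y t) = z2]); first by apply: measurableI; exact: measurable_grid.
  by apply/seteqP; split => t /= [-> ->].
move=> t _; apply: (@cvg_comp _ _ _
  (fun k => (ungrid k (grid k (X t)), ungrid k (grid k (Y t)))) g
  \oo (nbhs (X t, Y t))); last exact: cg.
exact: (cvg_pair (@gridK_cvg _ (X t)) (@gridK_cvg _ (Y t))).
Qed.

End continuous_measurable.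

(** * Measure preserving maps of products *)

Section measure_preserving.
Context {R : realType}.
Local Notation mR := (measurableTypeR R).

Definition mpres d (T : measurableType d) (m : set T -> \bar R) (f : T -> T) :=
  measurable_fun setT f /\ forall A, measurable A -> m (f @^-1` A) = m A.

Lemma mpres_comp d (T : measurableType d) (m : set T -> \bar R) (f g : T -> T) :
  mpres m f -> mpres m g -> mpres m (g \o f).
Proof.
move=> [mf fE] [mg gE]; split; first exact: measurableT_comp.
move=> A mA; rewrite comp_preimage fE ?gE//.
by rewrite -[X in measurable X]setTI; exact: mg.
Qed.

(** Lebesgue measure is determined by its values on half-open intervals, whose length a translation
    keeps. *)
Lemma lebesgue_translation (c : R) :
  mpres (@lebesgue_measure R) (fun x : mR => x + c : mR).
Proof.
have mc : measurable_fun setT (fun x : mR => x + c : mR).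
  by apply: measurable_funD.
split=> // A mA; apply/esym.
pose m : {measure set mR -> \bar R} := pushforward (@lebesgue_measure R) (fun x : mR => x + c : mR).
suff H (X : set R) : ocitv X -> lebesgue_measure X = m mc X.
  exact: (@lebesgue_measure_unique _ (m mc) H A mA).
move=> [[a b]] _ <-.
rewrite /m/= /pushforward.
rewrite (_ : _ @^-1` _ = `]a - c, b - c]%classic).
  by rewrite !lebesgue_measure_itv/= !lte_fin ltrD2r; case: ifP => // _; rewrite -!EFinB; congr EFin; ring.
by apply/seteqP; split => x /=; rewrite !in_itv/= ltrBlDr lerBrDr.
Qed.

(** The measure of a set is the integral of the measures of its sections, and each section at fixed
    second coordinate is moved by a measure preserving map. [swap] passes to the order of
    integration in which these sections appear. *)
Lemma mpres_fiber1 d1 d2 (X : measurableType d1) (Y : measurableType d2)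
    (m1 : {sigma_finite_measure set X -> \bar R})
    (m2 : {sigma_finite_measure set Y -> \bar R}) (g : X * Y -> X) :
  measurable_fun setT g -> (forall y, mpres m1 (fun x => g (x, y))) ->
  mpres (m1 \x m2)%E (fun p => (g p, p.2)).
Proof.
move=> mg mgy.
have mG : measurable_fun setT (fun p : X * Y => (g p, p.2)).
  exact: measurable_fun_pair.
split=> // A mA.
have mGA : measurable ((fun p => (g p, p.2)) @^-1` A).
  by rewrite -[X in measurable X]setTI; exact: mG.
have swap B : measurable B -> (m1 \x m2)%E B = (m1 \x^ m2)%E B.
  move=> mB; apply: product_measure_unique => // ? ? ? ?.
  exact: product_measure2E.
rewrite !swap//; apply: eq_integral => y _ /=.
rewrite -[RHS](mgy y).2; last exact: measurable_ysection.
by congr (m1 _); apply/seteqP; split => x /=; rewrite /ysection/= !inE.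
Qed.

Lemma mpres_fiber2 d1 d2 (X : measurableType d1) (Y : measurableType d2)
    (m1 : {sigma_finite_measure set X -> \bar R})
    (m2 : {sigma_finite_measure set Y -> \bar R}) (g : X * Y -> Y) :
  measurable_fun setT g -> (forall x, mpres m2 (fun y => g (x, y))) ->
  mpres (m1 \x m2)%E (fun p => (p.1, g p)).
Proof.
move=> mg mgy.
have mG : measurable_fun setT (fun p : X * Y => (p.1, g p)).
  exact: measurable_fun_pair.
split=> // A mA.
have mGA : measurable ((fun p => (p.1, g p)) @^-1` A).
  by rewrite -[X in measurable X]setTI; exact: mG.
apply: eq_integral => x _ /=.
rewrite -[RHS](mgy x).2; last exact: measurable_xsection.
by congr (m2 _); apply/seteqP; split => y /=; rewrite /xsection/= !inE.
Qed.

Definition uncons n (v : n.+1.-tuple mR) : mR * n.-tuple mR :=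
  (thead v, [tuple of behead v]).

Lemma unconsK n : cancel (@uncons n) (@cons_pair R n).
Proof. by move=> v; rewrite /cons_pair/= [RHS]tuple_eta; apply: val_inj. Qed.

Lemma cons_pairK n : cancel (@cons_pair R n) (@uncons n).
Proof.
case=> x v; rewrite /uncons /cons_pair /= theadE; congr (_, _).
exact/val_inj.
Qed.

Lemma measurable_uncons n : measurable_fun setT (@uncons n).
Proof.
apply/measurable_fun_pairP; split; first exact: measurable_tnth.
exact: measurable_behead.
Qed.

Lemma mpres_cons n (mu : {sigma_finite_measure set (n.-tuple mR) -> \bar R})
    (G : mR * n.-tuple mR -> mR * n.-tuple mR) :
  mpres (@lebesgue_measure R \x mu)%E G ->
  mpres (lebesgue_cons mu) (@cons_pair R n \o G \o @uncons n).
Proof.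
move=> [mG GE]; split.
  apply: measurableT_comp; last exact: measurable_uncons.
  by apply: measurableT_comp => //; exact: measurable_cons_pair.
move=> A mA; rewrite /lebesgue_cons /pushforward -[RHS]GE; last first.
  by rewrite -[X in measurable X]setTI; apply: measurable_cons_pair.
by congr (_ _); apply/seteqP; split => p /=; rewrite /preimage/= cons_pairK.
Qed.

End measure_preserving.

Section tuple_maps.
Context {R : realType}.
Local Notation mR := (measurableTypeR R).
Local Notation leb := (@lebesgue_tuple R).

Definition tadd n (c v : n.-tuple mR) : n.-tuple mR :=
  [tuple tnth v i + tnth c i | i < n].

Lemma measurable_tadd n (c : n.-tuple mR) : measurable_fun setT (tadd c).
Proof.
apply/measurable_fun_tnthP => i.
rewrite (_ : _ \o _ = (fun v : n.-tuple mR => tnth v i + tnth c i)).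
  by apply: measurable_funD => //; exact: measurable_tnth.
by apply/funext => v /=; rewrite tnth_mktuple.
Qed.

Lemma cons_pair_lift n (p : mR * n.-tuple mR) i :
  tnth (cons_pair p) (lift ord0 i) = tnth p.2 i.
Proof. by rewrite /cons_pair/= tnthS. Qed.

Lemma cons_pair0 n (p : mR * n.-tuple mR) : tnth (cons_pair p) ord0 = p.1.
Proof. by []. Qed.

Lemma uncons2E n (v : n.+1.-tuple mR) i : tnth (uncons v).2 i = tnth v (lift ord0 i).
Proof. by rewrite -[in RHS](unconsK v) cons_pair_lift. Qed.

Lemma mpres_tadd n (c : n.-tuple mR) : mpres (leb n) (tadd c).
Proof.
elim: n c => [|n IH] c.
  rewrite (_ : tadd c = id); first by split => // A mA; rewrite preimage_id.
  by apply/funext => v; apply: eq_from_tnth => -[].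
pose G1 (p : mR * n.-tuple mR) := (p.1 + tnth c ord0 : mR, p.2).
pose G2 (p : mR * n.-tuple mR) := (p.1, tadd (uncons c).2 p.2).
rewrite (_ : tadd c = @cons_pair R n \o (G2 \o G1) \o @uncons R n); last first.
  apply/funext => v; apply: eq_from_tnth => i; rewrite tnth_mktuple /=.
  case: (unliftP ord0 i) => [j ->|->]; last by rewrite cons_pair0.
  by rewrite cons_pair_lift tnth_mktuple !uncons2E.
apply: mpres_cons; apply: mpres_comp.
- apply: mpres_fiber1; first exact: measurable_funD.
  by move=> y; exact: lebesgue_translation.
- apply: mpres_fiber2 => [|x]; last exact: IH.
  by apply: measurableT_comp => //; exact: measurable_tadd.
Qed.

(** Shears translate each fiber, so they preserve Lebesgue measure. Rotations are composed of them
    below, which replaces the change of variables formula for linear maps. *)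
Lemma mpres_shear1 n (l : n.-tuple mR -> mR) : measurable_fun setT l ->
  mpres (leb n.+1) (@cons_pair R n \o (fun p => (p.1 + l p.2 : mR, p.2)) \o @uncons R n).
Proof.
move=> ml; apply: mpres_cons; apply: mpres_fiber1 => [|y].
  by apply: measurable_funD => //; exact: measurableT_comp.
exact: (lebesgue_translation (l y)).
Qed.

Lemma mpres_shear2 n (u : 'rV[R]_n) :
  mpres (leb n.+1) (@cons_pair R n \o
   (fun p => (p.1, tadd [tuple p.1 * u 0 i : mR | i < n] p.2)) \o @uncons R n).
Proof.
apply: mpres_cons; apply: mpres_fiber2 => [|x]; last exact: (mpres_tadd [tuple x * u 0 i : mR | i < n]).
apply/measurable_fun_tnthP => i.
rewrite (_ : _ \o _ = (fun p : mR * n.-tuple mR => tnth p.2 i + p.1 * u 0 i)).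
  apply: measurable_funD; last exact: measurable_funM.
  exact: (measurableT_comp (measurable_tnth i) measurable_snd).
by apply/funext => v /=; rewrite !tnth_mktuple.
Qed.

Lemma lebesgue_tuple_cons n (A : set mR) (B : set (n.-tuple mR)) :
  measurable A -> measurable B ->
  leb n.+1 (@uncons R n @^-1` (A `*` B)) = (lebesgue_measure A * leb n B)%E.
Proof.
move=> mA mB; rewrite /= /lebesgue_cons /pushforward.
rewrite -product_measure1E//; congr (_ _).
rewrite -comp_preimage (_ : _ \o _ = id) ?preimage_id//.
by apply/funext => p; exact: cons_pairK.
Qed.

Definition tcube n (a b : R) : set (n.-tuple mR) :=
  [set v | forall i, a <= tnth v i <= b].

Lemma measurable_tcube n a b : measurable (@tcube n a b).
Proof.
rewrite (_ : tcube _ _ = \bigcap_(i in [set: 'I_n])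
   ((fun t : n.-tuple mR => tnth t i) @^-1` `[a, b])).
  apply: fin_bigcap_measurable => [|j _]; first exact: finite_finset.
  rewrite -[X in measurable X]setTI.
  by apply: (measurable_tnth j) => //; exact: measurable_itv.
apply/seteqP; split => t /= h i; first by move=> _; rewrite /= in_itv/= h.
by have := h i I; rewrite /= in_itv/=.
Qed.

Lemma lebesgue_tcube n a b : a <= b -> leb n (@tcube n a b) = ((b - a) ^+ n)%:E.
Proof.
move=> ab; elim: n => [|n IH].
  by rewrite /= diracE expr0 mem_set//; case.
rewrite (_ : tcube _ _ = @uncons R n @^-1` (`[a, b] `*` tcube a b)).
  rewrite lebesgue_tuple_cons//; last exact: measurable_tcube.
  rewrite IH lebesgue_measure_itv/= lte_fin exprS.
  case: ltP => [_|ba]; first by rewrite -EFinB.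
  by rewrite (@le_anti _ _ a b) ?ab// subrr mul0e mul0r.
apply/seteqP; split => v /=.
  move=> h; split; first by rewrite in_itv/= h.
  by move=> i; rewrite uncons2E.
move=> [h1 h2] i; case: (unliftP ord0 i) => [j ->|->].
  by rewrite -uncons2E.
by move: h1; rewrite in_itv.
Qed.

Definition trv n (x : 'rV[R]_n) : n.-tuple mR := [tuple x 0 i : mR | i < n].

Lemma trvK n : cancel (@trv n) (@rv R n).
Proof. by move=> x; apply/rowP => i; rewrite mxE tnth_mktuple. Qed.

Lemma directionE n (v : n.-tuple mR) : direction v = trv ((enorm (rv v))^-1 *: rv v).
Proof.
by apply: eq_from_tnth => i; rewrite !tnth_mktuple !mxE mulrC.
Qed.

Lemma dotC n (x y : 'rV[R]_n) : dot x y = dot y x.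
Proof. by apply: eq_bigr => i _; rewrite mulrC. Qed.

Lemma dotDl n (x y z : 'rV[R]_n) : dot (x + y) z = dot x z + dot y z.
Proof. by rewrite /dot -big_split; apply: eq_bigr => i _ /=; rewrite mxE mulrDl. Qed.

Lemma dotZl n k (x z : 'rV[R]_n) : dot (k *: x) z = k * dot x z.
Proof. by rewrite /dot mulr_sumr; apply: eq_bigr => i _ /=; rewrite mxE mulrA. Qed.

Lemma dotDr n (x y z : 'rV[R]_n) : dot z (x + y) = dot z x + dot z y.
Proof. by rewrite dotC dotDl !(dotC z). Qed.

Lemma dotZr n k (x z : 'rV[R]_n) : dot z (k *: x) = k * dot z x.
Proof. by rewrite dotC dotZl dotC. Qed.

Lemma dot_ge0 n (x : 'rV[R]_n) : 0 <= dot x x.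
Proof. by apply: sumr_ge0 => i _; rewrite -expr2 sqr_ge0. Qed.

Lemma enorm_ge0 n (x : 'rV[R]_n) : 0 <= enorm x.
Proof. exact: sqrtr_ge0. Qed.

Lemma enorm_sqr n (x : 'rV[R]_n) : enorm x ^+ 2 = dot x x.
Proof. by rewrite sqr_sqrtr// dot_ge0. Qed.

Lemma enormZ n k (x : 'rV[R]_n) : enorm (k *: x) = `|k| * enorm x.
Proof.
by rewrite /enorm dotZl dotZr mulrA -expr2 sqrtrM ?sqr_ge0// sqrtr_sqr.
Qed.

(* f commutes with the radial projection, so it preserves the cone measure along
   with Lebesgue measure. *)
Lemma mpres_sphere n (f : 'rV[R]_n -> 'rV[R]_n) :
  (forall k x, f (k *: x) = k *: f x) -> (forall x, dot (f x) (f x) = dot x x) ->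
  mpres (leb n) (@trv n \o f \o @rv R n) ->
  mpres (@sphere_measure R n) (@trv n \o f \o @rv R n).
Proof.
move=> fZ fd [mf fE]; split=> // E mE.
rewrite /sphere_measure /mscale/=; congr (_ * _)%E.
rewrite /cone_volume /pushforward /mrestr.
have fn x : enorm (f x) = enorm x by rewrite /enorm fd.
rewrite -[RHS]fE.
  congr (leb n _); rewrite preimage_setI; congr (_ `&` _).
    apply/seteqP; split => v; rewrite /= /preimage/= !directionE !trvK fZ fn//.
  by apply/seteqP; split => v; rewrite /= /preimage/punctured_ball/= !trvK fn.
apply: measurableI; last exact: measurable_punctured_ball.
by rewrite -[X in measurable X]setTI; apply: measurable_direction.
Qed.

End tuple_maps.

Section norms.
Context {R : realType}.

Lemma normr_coord n (x : 'rV[R]_n) i : `|x 0 i| <= enorm x.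
Proof.
rewrite -sqrtr_sqr ler_wsqrtr// /dot (bigD1 i)//= -expr2 lerDl.
by apply: sumr_ge0 => j _; rewrite -expr2 sqr_ge0.
Qed.

Lemma norm_le_enorm n (x : 'rV[R]_n) : `|x| <= enorm x.
Proof.
rewrite [leLHS]/Num.Def.normr/= mx_normrE; apply/bigmax_leP; split; first exact: enorm_ge0.
by move=> [i j] _ /=; rewrite ord1 normr_coord.
Qed.

Lemma coord_le_norm n (x : 'rV[R]_n) i : `|x 0 i| <= `|x|.
Proof.
by rewrite [leRHS]/Num.Def.normr/= mx_normrE; apply/bigmax_geP; right; exists (0, i).
Qed.

Lemma enorm_le_sum n (x : 'rV[R]_n) : enorm x <= \sum_(i < n) `|x 0 i|.
Proof.
have s0 : 0 <= \sum_(i < n) `|x 0 i| by apply: sumr_ge0.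
rewrite -(ler_pXn2r (_ : 0 < 2)%N) ?nnegrE ?enorm_ge0// enorm_sqr.
rewrite /dot [leRHS]expr2 mulr_suml; apply: ler_sum => i _.
rewrite -expr2 -real_normK ?num_real// expr2 ler_wpM2l//.
by rewrite (bigD1 i)//= lerDl sumr_ge0.
Qed.

Lemma enorm_le_norm n (x : 'rV[R]_n) : enorm x <= n%:R * `|x|.
Proof.
apply: le_trans (enorm_le_sum x) _.
apply: (@le_trans _ _ (\sum_(i < n) `|x|)); first by apply: ler_sum => i _; exact: coord_le_norm.
by rewrite sumr_const card_ord mulr_natl.
Qed.

Lemma dot_eq0 n (x : 'rV[R]_n) : dot x x = 0 -> x = 0.
Proof.
move=> d0; apply/rowP => i; rewrite mxE; apply/eqP; rewrite -normr_le0.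
by apply: le_trans (normr_coord x i) _; rewrite /enorm d0 sqrtr0.
Qed.

Lemma CauchySchwarz n (x y : 'rV[R]_n) : `|dot x y| <= enorm x * enorm y.
Proof.
rewrite -(ler_pXn2r (_ : 0 < 2)%N) ?nnegrE ?mulr_ge0 ?enorm_ge0//.
rewrite exprMn !enorm_sqr -normrX ger0_norm ?sqr_ge0//.
have [y0|y0] := eqVneq (dot y y) 0.
  by rewrite (dot_eq0 y0) -(scale0r 0) !dotZr !mul0r mulr0 expr0n.
have yp : 0 < dot y y by rewrite lt_def y0 dot_ge0.
have := dot_ge0 (dot y y *: x + (- dot x y) *: y).
rewrite !(dotDl, dotDr, dotZl, dotZr) (dotC y x) => h.
have {}h : 0 <= dot y y * (dot x x * dot y y - dot x y ^+ 2) by nra.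
by rewrite pmulr_rge0// subr_ge0 in h.
Qed.

Lemma enormD n (x y : 'rV[R]_n) : enorm (x + y) <= enorm x + enorm y.
Proof.
rewrite -(ler_pXn2r (_ : 0 < 2)%N) ?nnegrE ?addr_ge0 ?enorm_ge0//.
rewrite enorm_sqr dotDl !dotDr sqrrD !enorm_sqr (dotC y x).
have := CauchySchwarz x y; rewrite ler_norml => /andP[_]; lra.
Qed.

Lemma enormN n (x : 'rV[R]_n) : enorm (- x) = enorm x.
Proof. by rewrite -scaleN1r enormZ normrN1 mul1r. Qed.

Lemma enorm0 n : enorm (0 : 'rV[R]_n) = 0.
Proof. by rewrite -(scale0r (0 : 'rV[R]_n)) enormZ normr0 mul0r. Qed.

Lemma enormB_ge n (x y : 'rV[R]_n) : enorm x - enorm y <= enorm (x - y).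
Proof. by rewrite lerBlDr; apply: le_trans (enormD _ _); rewrite subrK. Qed.

Lemma lipschitz_continuous n m (f : 'rV[R]_n -> 'rV[R]_m) (C : R) :
  (forall x y, enorm (f x - f y) <= C * enorm (x - y)) -> continuous f.
Proof.
move=> fC x; apply: (iffRL (@cvgrPdist_le R 'rV[R]_m _ (nbhs x) _ f (f x))) => e e0.
have C0 : 0 < `|C| * n%:R + 1 by rewrite ltr_pwDr// mulr_ge0.
near=> y; apply: le_trans (norm_le_enorm _) _; apply: le_trans (fC _ _) _.
apply: (@le_trans _ _ ((`|C| * n%:R + 1) * `|x - y|)).
  apply: (@le_trans _ _ (`|C| * enorm (x - y))).
    by rewrite ler_wpM2r ?enorm_ge0// ler_norm.
  apply: (@le_trans _ _ (`|C| * n%:R * `|x - y|)).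
    by rewrite -mulrA ler_wpM2l// enorm_le_norm.
  by rewrite ler_wpM2r// lerDl.
rewrite mulrC -ler_pdivlMr//.
near: y; apply: cvgr_dist_le; first exact: cvg_id.
by rewrite divr_gt0.
Unshelve. all: by end_near. Qed.

Lemma lipschitz_continuousR n (f : 'rV[R]_n -> R) (C : R) :
  (forall x y, `|f x - f y| <= C * enorm (x - y)) -> continuous f.
Proof.
move=> fC x; apply: (iffRL (@cvgrPdist_le R R _ (nbhs x) _ f (f x))) => e e0.
have C0 : 0 < `|C| * n%:R + 1 by rewrite ltr_pwDr// mulr_ge0.
near=> y; apply: le_trans (fC _ _) _.
apply: (@le_trans _ _ ((`|C| * n%:R + 1) * `|x - y|)).
  apply: (@le_trans _ _ (`|C| * enorm (x - y))).
    by rewrite ler_wpM2r ?enorm_ge0// ler_norm.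
  apply: (@le_trans _ _ (`|C| * n%:R * `|x - y|)).
    by rewrite -mulrA ler_wpM2l// enorm_le_norm.
  by rewrite ler_wpM2r// lerDl.
rewrite mulrC -ler_pdivlMr//.
near: y; apply: cvgr_dist_le; first exact: cvg_id.
by rewrite divr_gt0.
Unshelve. all: by end_near. Qed.

Lemma continuous_coord n i : continuous (fun x : 'rV[R]_n => x 0 i).
Proof.
apply: (@lipschitz_continuousR _ _ 1) => x y; rewrite mul1r.
by have := normr_coord (x - y) i; rewrite !mxE.
Qed.

Lemma continuous_enorm n : continuous (@enorm R n).
Proof.
apply: (@lipschitz_continuousR _ _ 1) => x y; rewrite mul1r ler_norml.
by rewrite enormB_ge andbT lerNl opprB -(enormN (x - y)) opprB enormB_ge.
Qed.

Lemma continuous_dot n (y : 'rV[R]_n) : continuous (dot y).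
Proof.
apply: (@lipschitz_continuousR _ _ (enorm y)) => x z.
rewrite (_ : dot y x - _ = dot y (x - z)) ?CauchySchwarz//.
by rewrite dotDr -[- z]scaleN1r dotZr mulN1r.
Qed.

End norms.

(** * Rotations as products of shears *)

Section rotations.
Context {R : realType}.
Local Notation mR := (measurableTypeR R).

(** Invariance of the surface measure is part of the notion, so that it has to be proved only for
    the explicit maps [rotv] and their compositions; these already carry [e1] to every unit
    vector. *)
Definition rotation n (f : 'rV[R]_n -> 'rV[R]_n) :=
  [/\ forall x y, f (x + y) = f x + f y, forall k x, f (k *: x) = k *: f x,
      forall x y, dot (f x) (f y) = dot x y &
      mpres (@sphere_measure R n) (@trv R n \o f \o @rv R n)].

Lemma rotation_comp n (f g : 'rV[R]_n -> 'rV[R]_n) :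
  rotation f -> rotation g -> rotation (f \o g).
Proof.
move=> [fD fZ fd fm] [gD gZ gd gm]; split => /=.
- by move=> x y; rewrite gD fD.
- by move=> k x; rewrite gZ fZ.
- by move=> x y; rewrite fd gd.
rewrite (_ : _ \o _ = (@trv R n \o f \o @rv R n) \o (@trv R n \o g \o @rv R n)).
  exact: mpres_comp.
by apply/funext => v /=; rewrite trvK.
Qed.

Lemma rotationB n (f : 'rV[R]_n -> 'rV[R]_n) : rotation f ->
  forall x y, f (x - y) = f x - f y.
Proof. by move=> [fD fZ _ _] x y; rewrite fD -scaleN1r fZ scaleN1r. Qed.

Lemma rotation_enorm n (f : 'rV[R]_n -> 'rV[R]_n) : rotation f ->
  forall x, enorm (f x) = enorm x.
Proof. by move=> [_ _ fd _] x; rewrite /enorm fd. Qed.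

Lemma rotation_continuous n (f : 'rV[R]_n -> 'rV[R]_n) : rotation f -> continuous f.
Proof.
move=> rf; apply: (@lipschitz_continuous _ _ _ _ 1) => x y.
by rewrite -rotationB// rotation_enorm// mul1r.
Qed.

(** With c = cos theta and |u| = sin theta, the rotation by theta in the plane of [e1] and (0, u):
    it fixes the orthogonal complement of that plane and sends [e1] to (c, u). Dividing by [1 + c]
    avoids normalising [u]. *)
Definition rotv n (c : R) (u : 'rV[R]_n) (x : 'rV[R]_n.+1) : 'rV[R]_n.+1 :=
  let s := \sum_j u 0 j * x 0 (lift ord0 j) in
  \row_i if unlift ord0 i is Some j
    then x 0 i + (x 0 0 - s / (1 + c)) * u 0 j else c * x 0 0 - s.

Lemma rotv0 n c (u : 'rV[R]_n) x :
  rotv c u x 0 0 = c * x 0 0 - \sum_j u 0 j * x 0 (lift ord0 j).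
Proof. by rewrite mxE unlift_none. Qed.

Lemma rotvS n c (u : 'rV[R]_n) x j : rotv c u x 0 (lift ord0 j) =
  x 0 (lift ord0 j) + (x 0 0 - (\sum_j u 0 j * x 0 (lift ord0 j)) / (1 + c)) * u 0 j.
Proof. by rewrite mxE liftK. Qed.

Lemma rotation_rotv n c (u : 'rV[R]_n) : 1 + c != 0 -> dot u u = 1 - c ^+ 2 ->
  rotation (rotv c u).
Proof.
move=> c1 uc.
have rD x y : rotv c u (x + y) = rotv c u x + rotv c u y.
  have sD : \sum_j u 0 j * (x + y) 0 (lift ord0 j) =
    \sum_j u 0 j * x 0 (lift ord0 j) + \sum_j u 0 j * y 0 (lift ord0 j).
    by rewrite -big_split; apply: eq_bigr => j _ /=; rewrite mxE mulrDr.
  apply/rowP => i; rewrite [RHS]mxE; case: (unliftP ord0 i) => [j ->|->].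
    by rewrite !rotvS sD !mxE; ring.
  by rewrite !rotv0 sD !mxE; ring.
have rZ k x : rotv c u (k *: x) = k *: rotv c u x.
  have sZ : \sum_j u 0 j * (k *: x) 0 (lift ord0 j) =
    k * \sum_j u 0 j * x 0 (lift ord0 j).
    by rewrite mulr_sumr; apply: eq_bigr => j _ /=; rewrite mxE; ring.
  apply/rowP => i; rewrite [RHS]mxE; case: (unliftP ord0 i) => [j ->|->].
    by rewrite !rotvS sZ !mxE; ring.
  by rewrite !rotv0 sZ !mxE; ring.
have rd x y : dot (rotv c u x) (rotv c u y) = dot x y.
  rewrite /dot !big_ord_recl.
  under eq_bigr do rewrite !rotvS.
  rewrite !rotv0.
  set s := \sum_j u 0 j * x 0 _; set s' := \sum_j u 0 j * y 0 _.
  set a := x 0 0 - _; set b := y 0 0 - _.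
  transitivity ((c * x 0 0 - s) * (c * y 0 0 - s') +
     (\sum_(i < n) x 0 (lift ord0 i) * y 0 (lift ord0 i) + a * s' + b * s +
      a * b * (1 - c ^+ 2))).
    congr (_ + _); rewrite -uc /s' /s /dot !mulr_sumr -!big_split/=.
    by apply: eq_bigr => i _; ring.
  by rewrite /a /b; field.
split=> //; apply: mpres_sphere => //.
(* A plane rotation is the product of three shears, with slopes -tan (theta/2), sin theta and -tan
   (theta/2). Here [l] gives the first and last of them, as u / (1 + c) is tan (theta/2) times the
   unit vector along u. *)
pose l (v : n.-tuple mR) : mR := - (\sum_j u 0 j * tnth v j) / (1 + c).
have ml : measurable_fun setT l.
  apply: measurable_funM => //; apply: measurableT_comp => //.
  apply: measurable_sum => j; apply: measurable_funM => //.
  exact: measurable_tnth.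
rewrite (_ : _ \o _ = (@cons_pair R n \o (fun p => (p.1 + l p.2 : mR, p.2)) \o @uncons R n)
  \o ((@cons_pair R n \o
   (fun p => (p.1, tadd [tuple p.1 * u 0 i : mR | i < n] p.2)) \o @uncons R n) \o
   (@cons_pair R n \o (fun p => (p.1 + l p.2 : mR, p.2)) \o @uncons R n))).
  apply: mpres_comp (mpres_shear1 ml).
  by apply: mpres_comp (mpres_shear1 ml) (mpres_shear2 _).
apply/funext => v; apply: eq_from_tnth => i.
rewrite /comp tnth_mktuple !cons_pairK.
have E : \sum_j u 0 j * rv v 0 (lift ord0 j) = \sum_j u 0 j * tnth (uncons v).2 j.
  by apply: eq_bigr => j _; rewrite mxE uncons2E.
case: (unliftP ord0 i) => [j ->|->].
  rewrite rotvS cons_pair_lift !tnth_mktuple E !mxE.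
  by rewrite uncons2E /= /l -mulNr.
rewrite rotv0 cons_pair0 E !mxE.
rewrite /l /=; set s := \sum_j _; set x0 := thead v.
under eq_bigr do rewrite !tnth_mktuple.
rewrite (_ : \sum_(j < n) _ = s + (x0 + - s / (1 + c)) * (1 - c ^+ 2)).
  by rewrite (_ : tnth v ord0 = x0)//; field.
rewrite -uc /s /dot mulr_sumr -big_split/=; apply: eq_bigr => j _.
by ring.
Qed.

End rotations.

Section average.
Context {R : realType} {n : nat}.
Local Notation mR := (measurableTypeR R).
Local Notation d := n.+2.
Local Notation V := 'rV[R]_d.
Local Notation e1 := (unit_e1 R d).
Local Notation sig := (@sphere_measure R d).

Lemma dot_e1 (x : V) : dot e1 x = x 0 0.
Proof.
rewrite /dot (bigD1 0)//= mxE/= mul1r big1 ?addr0// => i i0.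
by rewrite mxE (_ : (i == 0 :> nat) = false) ?mul0r//; apply/negbTE.
Qed.

Lemma dot_e1e1 : dot e1 e1 = 1.
Proof. by rewrite dot_e1 mxE. Qed.

Lemma rotation_exists (w : V) : dot w w = 1 -> exists2 f, rotation f & f e1 = w.
Proof.
move=> w1; pose u : 'rV[R]_n.+1 := \row_j w 0 (lift ord0 j).
have e1S j : e1 0 (lift ord0 j) = 0 by rewrite mxE.
have e10 : e1 0 0 = 1 by rewrite mxE.
have uE : dot u u = 1 - w 0 0 ^+ 2.
  rewrite -w1 /dot [in RHS]big_ord_recl -expr2 addrC addKr.
  by apply: eq_bigr => j _; rewrite !mxE.
(* For [w = - e1] the half-angle tangent is infinite; a quarter turn in a coordinate plane, applied
   twice, is used instead. *)
have [c1|c1] := eqVneq (1 + w 0 0) 0.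
  pose u' : 'rV[R]_n.+1 := delta_mx 0 0.
  have ru : rotation (rotv 0 u').
    apply: rotation_rotv; first by rewrite addr0 oner_eq0.
    rewrite expr0n subr0 /dot (bigD1 0)//= mxE eqxx mulr1 big1 ?addr0// => i i0.
    by rewrite mxE (negbTE i0) mulr0.
  exists (rotv 0 u' \o rotv 0 u'); first exact: rotation_comp.
  have fe j : rotv 0 u' e1 0 (lift ord0 j) = u' 0 j.
    rewrite rotvS e10 e1S big1 ?mul0r ?subr0 ?mul1r ?add0r// => i _.
    by rewrite e1S mulr0.
  have fe0 : rotv 0 u' e1 0 0 = 0.
    by rewrite rotv0 mul0r sub0r big1 ?oppr0// => i _; rewrite e1S mulr0.
  have sE : \sum_j u' 0 j * rotv 0 u' e1 0 (lift ord0 j) = 1.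
    rewrite (bigD1 0)//= fe mxE eqxx mulr1 big1 ?addr0// => i i0.
    by rewrite mxE (negbTE i0) mul0r.
  have w0 : w 0 0 = -1 by apply/eqP; rewrite -subr_eq0 opprK addrC c1.
  have u0 : u = 0 by apply: dot_eq0; rewrite uE w0 sqrrN expr1n subrr.
  apply/rowP => i; case: (unliftP ord0 i) => [j ->|->] /=.
    have -> : w 0 (lift ord0 j) = u 0 j by rewrite mxE.
    by rewrite rotvS sE fe fe0 u0 [RHS]mxE addr0 divr1; ring.
  by rewrite rotv0 sE fe0 w0; ring.
exists (rotv (w 0 0) u); first exact: rotation_rotv.
have s0 : \sum_j u 0 j * e1 0 (lift ord0 j) = 0.
  by rewrite big1// => i _; rewrite e1S mulr0.
apply/rowP => i; case: (unliftP ord0 i) => [j ->|->].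
  by rewrite rotvS s0 e1S e10 mul0r subr0 mul1r add0r mxE.
by rewrite rotv0 s0 e10; lra.
Qed.

Lemma lebesgue_ball_gt0 : (0 < @lebesgue_tuple R d (@punctured_ball R d))%E.
Proof.
have dp : (0 : R) < d%:R by rewrite ltr0n.
(* The cube with coordinates in [a, 2a] lies in the unit ball because its points have coordinate sum
   at most 1. *)
pose a : R := (2 * d%:R)^-1.
have a0 : 0 < a by rewrite invr_gt0 mulr_gt0.
have : (0 < @lebesgue_tuple R d (tcube a (2 * a)))%E.
  rewrite lebesgue_tcube; last by lra.
  by rewrite lte_fin exprn_gt0//; lra.
move=> /lt_le_trans; apply; apply: le_measure; rewrite ?inE.
- exact: measurable_tcube.
- exact: measurable_punctured_ball.
move=> v /= va.
have n0 : 0 < enorm (rv v).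
  apply: lt_le_trans (normr_coord (rv v) 0); rewrite mxE.
  by have /andP[h _] := va 0; apply: lt_le_trans a0 (le_trans h (ler_norm _)).
apply/andP; split => //; apply: le_trans (enorm_le_sum _) _.
apply: (@le_trans _ _ (\sum_(i < d) 2 * a)).
  apply: ler_sum => i _; rewrite mxE; have /andP[h1 h2] := va i.
  by rewrite ger0_norm// (le_trans (ltW a0)).
rewrite sumr_const card_ord -[leLHS]mulr_natl mulrA [_ * 2]mulrC /a mulfV//.
Qed.

Lemma lebesgue_ball_lty : (@lebesgue_tuple R d (@punctured_ball R d) < +oo)%E.
Proof.
apply: (@le_lt_trans _ _ (@lebesgue_tuple R d (tcube (-1) 1))).
  apply: le_measure; rewrite ?inE.
  - exact: measurable_punctured_ball.
  - exact: measurable_tcube.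
  move=> v /= /andP[_ h] i; rewrite -ler_norml.
  by have := normr_coord (rv v) i; rewrite mxE => /le_trans; apply.
by rewrite lebesgue_tcube ?ltry//; lra.
Qed.

Definition ball_volume : R := fine (@lebesgue_tuple R d (@punctured_ball R d)).

Lemma ball_volume_gt0 : 0 < ball_volume.
Proof. by rewrite fine_gt0// lebesgue_ball_gt0 lebesgue_ball_lty. Qed.

Lemma sphere_setT : sig setT = 1%E.
Proof.
rewrite /sphere_measure /mscale/= /cone_volume /pushforward /mrestr preimage_setT setTI.
rewrite -[X in (_ * X)%E]fineK; last first.
  by rewrite ge0_fin_numE// lebesgue_ball_lty.
by rewrite -EFinM mulVf// gt_eqF// ball_volume_gt0.
Qed.

(** The measure lives on all tuples, so integrands that agree on unit vectors are compared through
    this almost-everywhere statement. It holds because [direction] has norm 1 on the punctured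
    ball. *)
Lemma ae_sphere : {ae sig, forall v, dot (rv v) (rv v) = 1}.
Proof.
exists [set v | enorm (rv v) != 1]; split.
- rewrite (_ : mkset _ = setT `&` (fun v => enorm (rv v) : mR) @^-1` (~` [set 1])).
    by apply: measurable_enorm => //; apply: measurableC; exact: measurable_set1.
  by rewrite setTI; apply/seteqP; split => v /= /eqP.
- rewrite /sphere_measure /mscale/= /cone_volume /pushforward /mrestr.
  rewrite (_ : _ `&` _ = set0) ?measure0 ?mule0// -subset0 => v [/= + /andP[v0 _]].
  rewrite directionE trvK enormZ ger0_norm ?invr_ge0 ?enorm_ge0//.
  by rewrite mulVf ?eqxx// (gt_eqF v0).
move=> v /= vn; apply/negP => /eqP ev; apply: vn.
by rewrite -enorm_sqr ev expr1n.
Qed.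

Lemma measurable_rv (g : V -> R) : continuous g ->
  measurable_fun setT (fun v : d.-tuple mR => g (rv v) : mR).
Proof.
move=> cg; apply: measurable_continuous_comp => // j.
by under eq_fun do rewrite mxE; exact: measurable_tnth.
Qed.

Lemma sphere_bounded (g : V -> R) : continuous g ->
  exists2 M, 0 <= M & forall w, dot w w = 1 -> `|g w| <= M.
Proof.
move=> cg; pose K := [set v : V | forall i, v ord0 i \in `[(-1), 1]].
have cK : compact K.
  by apply: (@rV_compact R d (fun=> `[-1, 1]%classic)) => _; exact: segment_compact.
have := compact_bounded (continuous_compact (continuous_subspaceT cg) cK).
move=> [M [_ HM]]; exists `|M + 1| => // w w1.
apply: le_trans (ler_norm _); apply: HM; first by rewrite ltrDl.
exists w => //= i; rewrite in_itv/= -ler_norml.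
by have := normr_coord w i; rewrite /enorm w1 sqrtr1.
Qed.

End average.

(** * Continuity of composite expressions *)

Section continuity_rules.
Context {R : realType} {X : topologicalType}.
Implicit Types (f g : X -> R).

Lemma cst_cont (c : R) : continuous (fun _ : X => c).
Proof. by move=> x; exact: cvg_cst. Qed.

Lemma add_cont f g : continuous f -> continuous g -> continuous (fun x => f x + g x).
Proof. by move=> cf cg x; apply: cvgD; [exact: cf|exact: cg]. Qed.

Lemma opp_cont f : continuous f -> continuous (fun x => - f x).
Proof. by move=> cf x; apply: cvgN; exact: cf. Qed.

Lemma mul_cont f g : continuous f -> continuous g -> continuous (fun x => f x * g x).
Proof. by move=> cf cg x; apply: cvgM; [exact: cf|exact: cg]. Qed.

Lemma exp_cont f k : continuous f -> continuous (fun x => f x ^+ k).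
Proof.
move=> cf; elim: k => [|k IH]; first exact: cst_cont.
by under eq_fun do rewrite exprS; exact: mul_cont.
Qed.

Lemma comp_cont (h : R -> R) f : continuous h -> continuous f ->
  continuous (fun x => h (f x)).
Proof. by move=> ch cf x; apply: continuous_comp; [exact: cf|exact: ch]. Qed.

Lemma sqrt_cont f : continuous f -> continuous (fun x => Num.sqrt (f x)).
Proof. by apply: comp_cont; exact: sqrt_continuous. Qed.

Lemma expR_cont f : continuous f -> continuous (fun x => expR (f x)).
Proof. by apply: comp_cont; exact: continuous_expR. Qed.

Lemma cos_cont f : continuous f -> continuous (fun x => cos (f x)).
Proof. by apply: comp_cont; exact: continuous_cos. Qed.

Lemma sin_cont f : continuous f -> continuous (fun x => sin (f x)).
Proof. by apply: comp_cont; exact: continuous_sin. Qed.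

Lemma norm_cont f : continuous f -> continuous (fun x => `|f x|).
Proof. by apply: comp_cont; exact: norm_continuous. Qed.

Lemma max_cont f g : continuous f -> continuous g ->
  continuous (fun x => Num.max (f x) (g x)).
Proof. by move=> cf cg x; apply: continuous_max; [exact: cf|exact: cg]. Qed.

Lemma min_cont f g : continuous f -> continuous g ->
  continuous (fun x => Num.min (f x) (g x)).
Proof. by move=> cf cg x; apply: continuous_min; [exact: cf|exact: cg]. Qed.

Lemma inv_cont f : (forall x, f x != 0) -> continuous f ->
  continuous (fun x => (f x)^-1).
Proof. by move=> f0 cf x; apply: cvgV => //; exact: cf. Qed.

Lemma sum_cont I (s : seq I) (F : I -> X -> R) : (forall i, continuous (F i)) ->
  continuous (fun x => \sum_(i <- s) F i x).
Proof.
move=> cF; elim: s => [|i s IH].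
  by under eq_fun do rewrite big_nil; exact: cst_cont.
by under eq_fun do rewrite big_cons; exact: add_cont.
Qed.

End continuity_rules.

Section vector_continuity_rules.
Context {R : realType} {X : topologicalType} {n : nat}.
Implicit Types (f g : X -> 'rV[R]_n).

Lemma cstv_cont (c : 'rV[R]_n) : continuous (fun _ : X => c).
Proof. by move=> x; exact: cvg_cst. Qed.

Lemma addv_cont f g : continuous f -> continuous g -> continuous (fun x => f x + g x).
Proof. by move=> cf cg x; apply: cvgD; [exact: cf|exact: cg]. Qed.

Lemma oppv_cont f : continuous f -> continuous (fun x => - f x).
Proof. by move=> cf x; apply: cvgN; exact: cf. Qed.

Lemma scale_cont (k : X -> R) f : continuous k -> continuous f ->
  continuous (fun x => k x *: f x).
Proof. by move=> ck cf x; apply: cvgZ; [exact: ck|exact: cf]. Qed.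

Lemma compv_cont {Y : topologicalType} (h : 'rV[R]_n -> Y) f :
  continuous h -> continuous f -> continuous (fun x => h (f x)).
Proof. by move=> ch cf x; apply: continuous_comp; [exact: cf|exact: ch]. Qed.

Lemma enorm_cont f : continuous f -> continuous (fun x => enorm (f x)).
Proof. by apply: compv_cont; exact: continuous_enorm. Qed.

Lemma coord_cont f i : continuous f -> continuous (fun x => f x 0 i).
Proof. by apply: (@compv_cont _ (fun v => v 0 i)); exact: continuous_coord. Qed.

Lemma dot_cont f g : continuous f -> continuous g ->
  continuous (fun x => dot (f x) (g x)).
Proof.
move=> cf cg; apply: sum_cont => i.
by apply: mul_cont; exact: coord_cont.
Qed.

Lemma row_cont f : (forall i, continuous (fun x => f x 0 i)) -> continuous f.
Proof.
move=> cf x; apply/cvg_ballP => e e0.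
have : \forall y \near x, forall i, ball (f x 0 i) e (f y 0 i).
  by apply: filter_forall => i; exact: (cvg_ball (cf i x) e0).
by apply: filterS => y h; split => // i j; rewrite ord1.
Qed.

End vector_continuity_rules.

Lemma fst_cont {A B : topologicalType} : continuous (fun p : A * B => p.1).
Proof. by move=> p; exact: cvg_fst. Qed.
Lemma snd_cont {A B : topologicalType} : continuous (fun p : A * B => p.2).
Proof. by move=> p; exact: cvg_snd. Qed.
Lemma fst_comp {X A B : topologicalType} (f : X -> A * B) :
  continuous f -> continuous (fun x => (f x).1).
Proof. by move=> cf x; apply: continuous_comp; [exact: cf|exact: fst_cont]. Qed.
Lemma snd_comp {X A B : topologicalType} (f : X -> A * B) :
  continuous f -> continuous (fun x => (f x).2).
Proof. by move=> cf x; apply: continuous_comp; [exact: cf|exact: snd_cont]. Qed.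
Lemma id_cont {A : topologicalType} : continuous (fun x : A => x).
Proof. by move=> x; exact: cvg_id. Qed.

Lemma pair_comp {X A B Y : topologicalType} (h : A * B -> Y) (f : X -> A) (g : X -> B) :
  continuous h -> continuous f -> continuous g -> continuous (fun x => h (f x, g x)).
Proof.
move=> ch cf cg x; apply: (@continuous_comp _ _ _ (fun x => (f x, g x)) h).
  exact: (cvg_pair (cf x) (cg x)).
exact: ch.
Qed.

Ltac cont_vec :=
  lazymatch goal with
  | |- forall y, @continuous_at _ _ y ?f =>
    lazymatch f with
    | (fun x => _ + _) => apply: addv_cont
    | (fun x => - _) => apply: oppv_cont
    | (fun x => _ *: _) => apply: scale_cont
    | (fun x => fst _) => apply: fst_comp
    | (fun x => snd _) => apply: snd_comp
    | _ => exact: cstv_cont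
    end
  end.

Ltac cont_scal :=
  lazymatch goal with
  | |- forall y, @continuous_at _ _ y ?f =>
    lazymatch f with
    | (fun x => _ + _) => apply: add_cont
    | (fun x => - _) => apply: opp_cont
    | (fun x => _ * _) => apply: mul_cont
    | (fun x => _ ^+ _) => apply: exp_cont
    | (fun x => `| _ |) => apply: norm_cont
    | (fun x => Num.sqrt _) => apply: sqrt_cont
    | (fun x => expR _) => apply: expR_cont
    | (fun x => cos _) => apply: cos_cont
    | (fun x => sin _) => apply: sin_cont
    | (fun x => Order.max _ _) => apply: max_cont
    | (fun x => Order.min _ _) => apply: min_cont
    | (fun x => enorm _) => apply: enorm_cont
    | (fun x => dot _ _) => apply: dot_cont
    | (fun x => fun_of_matrix _ _ _) => apply: coord_cont
    | (fun x => fst _) => apply: fst_comp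
    | (fun x => snd _) => apply: snd_comp
    | _ => exact: cst_cont
    end
  end.

Ltac cont_step :=
  lazymatch goal with
  | |- forall y, @continuous_at _ _ y ?f =>
    lazymatch f with
    | (fun x => x) => exact: id_cont
    | (fun x => fst x) => exact: fst_cont
    | (fun x => snd x) => exact: snd_cont
    | fst => exact: fst_cont
    | snd => exact: snd_cont
    | dot _ => exact: continuous_dot
    | @GRing.scale _ _ _ => exact: scaler_continuous
    | @GRing.mul _ _ => exact: mulrl_continuous
    | @enorm _ _ => exact: continuous_enorm
    | expR => exact: continuous_expR
    | cos => exact: continuous_cos
    | sin => exact: continuous_sin
    | _ => lazymatch type of f with
      | _ -> ?B => let B' := eval hnf in B in
        lazymatch B' with
        | matrix _ _ _ => cont_vec
        | _ => cont_scal
        end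
      end
    end
  end.

Ltac cont := repeat first [ assumption | cont_step ].

(** * Spherical averages *)

Section average.
Context {R : realType} {n : nat}.
Local Notation mR := (measurableTypeR R).
Local Notation d := n.+2.
Local Notation V := 'rV[R]_d.
Local Notation e1 := (unit_e1 R d).
Local Notation sig := (@sphere_measure R d).
Implicit Types (g h : V -> R).

Lemma sphere_fin_num_fun : fin_num_fun sig.
Proof.
move=> A mA; rewrite ge0_fin_numE//; apply: (@le_lt_trans _ _ (sig setT)).
  by apply: le_measure; rewrite ?inE//.
by rewrite sphere_setT ltry.
Qed.

HB.instance Definition _ := Measure_isFinite.Build _ _ _ sig sphere_fin_num_fun.

Definition avg g : R := \int[sig]_v g (rv v).

(** The identity on unit vectors, with values in a cube. Composing with it makes a continuous
    integrand bounded on all tuples without changing its average, which is how integrability and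
    Fubini are obtained. *)
Definition clip (x : V) : V := \row_i Num.max (-1) (Num.min 1 (x 0 i)).

Lemma clip_coord x i : `|clip x 0 i| <= 1.
Proof. by rewrite mxE ler_norml le_max lexx/= ge_max ge_min lexx/=; lra. Qed.

Lemma clip_id x : dot x x = 1 -> clip x = x.
Proof.
move=> x1; apply/rowP => i; rewrite mxE.
have := normr_coord x i; rewrite /enorm x1 sqrtr1 ler_norml => /andP[h1 h2].
by rewrite min_r// max_r.
Qed.

Lemma clip_continuous : continuous clip.
Proof.
apply: row_cont => i; rewrite (_ : (fun _ => _) =
  (fun x : V => Num.max (-1) (Num.min 1 (x 0 i)))); last by apply/funext => x; rewrite mxE.
by cont.
Qed.

Lemma avg_integrable_aux g : continuous g -> (exists M, forall x, `|g x| <= M) ->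
  sig.-integrable setT (EFin \o (fun v => g (rv v))).
Proof.
move=> cg [M gM]; apply: measurable_bounded_integrable => //.
- by rewrite -[X in (X < _)%E]/(sig setT) sphere_setT ltry.
- exact: measurable_rv.
- exists M; split; first exact: num_real.
  by move=> y My x _; apply: le_trans (gM _) (ltW My).
Qed.

Lemma continuous_clip g : continuous g -> continuous (g \o clip).
Proof. by move=> cg x; apply: continuous_comp; [exact: clip_continuous|exact: cg]. Qed.

Lemma clip_bounded g : continuous g -> exists M, forall x, `|(g \o clip) x| <= M.
Proof.
move=> cg; pose K := [set v : V | forall i, v ord0 i \in `[(-1), 1]].
have cK : compact K.
  by apply: (@rV_compact R d (fun=> `[-1, 1]%classic)) => _; exact: segment_compact.
have := compact_bounded (continuous_compact (continuous_subspaceT cg) cK).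
move=> [M [_ HM]]; exists (M + 1) => x; apply: HM; first by rewrite ltrDl.
by exists (clip x) => //= i; rewrite in_itv/= -ler_norml clip_coord.
Qed.

Lemma ae_clip g : continuous g ->
  ae_eq sig setT (EFin \o (fun v => g (rv v))) (EFin \o (fun v => (g \o clip) (rv v))).
Proof.
move=> cg; apply: filterS (@ae_sphere R n) => v v1 _ /=.
by rewrite clip_id.
Qed.

Lemma avg_integrable g : continuous g ->
  sig.-integrable setT (EFin \o (fun v => g (rv v))).
Proof.
move=> cg; have cgc := continuous_clip cg.
have /integrableP[mc ic] := avg_integrable_aux cgc (clip_bounded cg).
have mg : measurable_fun setT (EFin \o (fun v => g (rv v))).
  by apply/measurable_EFinP; exact: measurable_rv.
apply/integrableP; split => //; apply: le_lt_trans ic.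
rewrite le_eqVlt; apply/orP; left; apply/eqP; apply: ae_eq_integral => //.
- exact: measurableT_comp.
- exact: measurableT_comp.
- by apply: filterS (ae_clip cg) => v h vT; rewrite /comp; congr (abse _); exact: h.
Qed.

Lemma avg_clip g : continuous g -> avg g = avg (g \o clip).
Proof.
move=> cg; rewrite /avg /Rintegral; congr fine; apply: ae_eq_integral => //.
- by apply/measurable_EFinP; exact: measurable_rv.
- by apply/measurable_EFinP; apply: measurable_rv; exact: continuous_clip.
- exact: ae_clip.
Qed.

Lemma avgD g h : continuous g -> continuous h ->
  avg (fun w => g w + h w) = avg g + avg h.
Proof. by move=> cg ch; apply: RintegralD => //; exact: avg_integrable. Qed.

Lemma avgB g h : continuous g -> continuous h ->
  avg (fun w => g w - h w) = avg g - avg h.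
Proof. by move=> cg ch; apply: RintegralB => //; exact: avg_integrable. Qed.

Lemma avgZ k g : continuous g -> avg (fun w => k * g w) = k * avg g.
Proof. by move=> cg; apply: RintegralZl => //; exact: avg_integrable. Qed.

Lemma avg_cst k : avg (fun=> k) = k.
Proof.
by rewrite /avg Rintegral_cst// -[X in fine X]/(sig setT) sphere_setT mulr1.
Qed.

Lemma avgN g : continuous g -> avg (fun w => - g w) = - avg g.
Proof.
move=> cg; rewrite -mulN1r -avgZ//; congr avg; apply/funext => w.
by rewrite mulN1r.
Qed.

Lemma avg_eq g h : (forall w, dot w w = 1 -> g w = h w) ->
  continuous g -> continuous h -> avg g = avg h.
Proof.
move=> gh cg ch; rewrite /avg /Rintegral; congr fine; apply: ae_eq_integral => //.
- by apply/measurable_EFinP; exact: measurable_rv.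
- by apply/measurable_EFinP; exact: measurable_rv.
- by apply: filterS (@ae_sphere R n) => v v1 _ /=; rewrite gh.
Qed.

Lemma avg_ge0 g : (forall w, dot w w = 1 -> 0 <= g w) -> continuous g -> 0 <= avg g.
Proof.
move=> g0 cg; rewrite (@avg_eq _ (fun w => `|g w|)) //; last by cont.
  by apply: Rintegral_ge0 => v _; exact: normr_ge0.
by move=> w w1; rewrite ger0_norm// g0.
Qed.

Lemma avg_le g h : (forall w, dot w w = 1 -> g w <= h w) ->
  continuous g -> continuous h -> avg g <= avg h.
Proof.
move=> gh cg ch; rewrite -subr_ge0 -avgB//; apply: avg_ge0; last by cont.
by move=> w w1; rewrite subr_ge0 gh.
Qed.

Lemma avg_norm g : continuous g -> `|avg g| <= avg (fun w => `|g w|).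
Proof.
move=> cg; rewrite ler_norml; apply/andP; split; last first.
  by apply: avg_le => //; [move=> w _; exact: ler_norm|cont].
rewrite -avgN; last by cont.
by apply: avg_le => //; [move=> w _; rewrite lerNl -normrN ler_norm|cont; cont].
Qed.

Lemma avg_bound g M : (forall w, dot w w = 1 -> `|g w| <= M) -> continuous g ->
  `|avg g| <= M.
Proof.
move=> gM cg; apply: le_trans (avg_norm cg) _; rewrite -[leRHS]avg_cst.
by apply: avg_le => //; cont.
Qed.

Lemma avg_sum I (s : seq I) (F : I -> V -> R) : (forall i, continuous (F i)) ->
  avg (fun w => \sum_(i <- s) F i w) = \sum_(i <- s) avg (F i).
Proof.
move=> cF; elim: s => [|i s IH].
  by under eq_fun do rewrite big_nil; rewrite avg_cst big_nil.
under eq_fun do rewrite big_cons; rewrite avgD// ?IH ?big_cons//.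
exact: sum_cont.
Qed.

Lemma avg_rot (f : V -> V) g : rotation f -> continuous g -> avg (g \o f) = avg g.
Proof.
move=> rf cg; have [_ _ _ [mf fE]] := rf.
have cgf : continuous (g \o f).
  by move=> x; apply: continuous_comp; [exact: rotation_continuous|exact: cg].
have mg : measurable_fun setT (EFin \o (fun v => g (rv v))).
  by apply/measurable_EFinP; exact: measurable_rv.
set F := (@trv R d \o f \o @rv R d) in mf fE *.
have FE : (EFin \o (fun v => g (rv v))) \o F = EFin \o (fun v => (g \o f) (rv v)).
  by apply/funext => v /=; rewrite trvK.
have ig : sig.-integrable (F @^-1` setT) ((EFin \o (fun v => g (rv v))) \o F).
  by rewrite preimage_setT FE; exact: avg_integrable.
have := integral_pushforward mf mg ig measurableT.
rewrite preimage_setT FE => E.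
rewrite /avg /Rintegral; congr fine; rewrite -[LHS]E.
by apply: eq_measure_integral => A mA _; rewrite -[RHS]fE.
Qed.

Lemma avg_dot w (k : R -> R) : dot w w = 1 -> continuous k ->
  avg (fun x => k (dot w x)) = avg (fun x => k (x 0 0)).
Proof.
move=> w1 ck; have [f rf <-] := rotation_exists w1.
rewrite -[LHS](avg_rot rf); last by apply: (comp_cont ck); cont.
congr avg; apply/funext => x /=; have [_ _ fd _] := rf.
by rewrite fd dot_e1.
Qed.

(** [X] is an arbitrary topological space, so the argument is not by sequences: compactness of a
    cube containing the sphere gives a neighborhood of x on which [E y] is uniformly close to
    [E x]. *)
Lemma avg_continuous {X : topologicalType} (E : X -> V -> R) :
  continuous (fun p : X * V => E p.1 p.2) -> continuous (fun x => avg (E x)).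
Proof.
move=> cE x; apply: (iffRL (@cvgrPdist_le R R _ (nbhs x) _ _ _)) => e e0.
have cEx y : continuous (E y).
  have cy : continuous (fun _ : V => y) by exact: cst_continuous.
  exact: (pair_comp cE cy (@id_cont V)).
pose K := [set v : V | forall i, v ord0 i \in `[(-1), 1]].
have cK : compact K.
  by apply: (@rV_compact R d (fun=> `[-1, 1]%classic)) => _; exact: segment_compact.
have /compact_near_coveringP/(_ _ (nbhs x)
  (fun y w => `|E x w - E y w| <= e) _) := cK.
have step w : K w -> \forall w' \near w & y \near x, `|E x w' - E y w'| <= e.
  move=> _; have cpt : continuous (fun p : V * X => E x p.1 - E p.2 p.1).
    apply: add_cont; first exact: (compv_cont (cEx x) fst_cont).
    by apply: opp_cont; exact: (pair_comp cE snd_cont fst_cont).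
  have /(_ e e0) := iffLR (@cvgrPdist_le R R _ (nbhs (w, x)) (nbhs_filter _) _ _) (cpt (w, x)).
  by rewrite /= subrr; under eq_near do rewrite sub0r normrN.
move=> /(_ step); apply: filterS => y H.
rewrite -avgB//; apply: avg_bound; last by cont; exact: cEx.
move=> w w1; apply: H => i; rewrite /= in_itv/= -ler_norml.
by have := normr_coord w i; rewrite /enorm w1 sqrtr1.
Qed.

Lemma avg_swap (g : V * V -> R) : continuous g ->
  avg (fun v => avg (fun w => g (v, w))) = avg (fun w => avg (fun v => g (v, w))).
Proof.
move=> cg.
have cV (v : V) : continuous (fun _ : V => v) by exact: cst_continuous.
have cpair (a b : V * V -> V) : continuous a -> continuous b ->
    continuous (fun p => g (a p, b p)) by exact: pair_comp.
have cg1 v : continuous (fun w => g (v, w)).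
  exact: (pair_comp cg (cV v) (@id_cont V)).
have cg2 w : continuous (fun v => g (v, w)).
  exact: (pair_comp cg (@id_cont V) (cV w)).
have ccl1 : continuous (fun p : V * V => clip p.1).
  by move=> p; apply: continuous_comp; [exact: fst_cont|exact: clip_continuous].
have ccl2 : continuous (fun p : V * V => clip p.2).
  by move=> p; apply: continuous_comp; [exact: snd_cont|exact: clip_continuous].
pose G (p : V * V) := g (clip p.1, clip p.2).
have cG : continuous G by exact: (cpair _ _ ccl1 ccl2).
have lhs : avg (fun v => avg (fun w => g (v, w))) = avg (fun v => avg (fun w => G (v, w))).
  rewrite avg_clip; last by apply: avg_continuous; exact: cpair fst_cont snd_cont.
  congr avg; apply/funext => v /=; rewrite avg_clip//.
have rhs : avg (fun w => avg (fun v => g (v, w))) = avg (fun w => avg (fun v => G (v, w))).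
  rewrite avg_clip; last by apply: avg_continuous; exact: cpair snd_cont fst_cont.
  congr avg; apply/funext => v /=; rewrite avg_clip//.
rewrite {}lhs {}rhs.
have [M HM] : exists M, forall p, `|G p| <= M.
  pose K := [set v : V | forall i, v ord0 i \in `[(-1), 1]].
  have cK : compact K.
    by apply: (@rV_compact R d (fun=> `[-1, 1]%classic)) => _; exact: segment_compact.
  have := compact_bounded (continuous_compact (continuous_subspaceT cg) (compact_setX cK cK)).
  move=> [M [_ HM]]; exists (M + 1) => x; apply: HM; first by rewrite ltrDl.
  by exists (clip x.1, clip x.2) => //=; split => i; rewrite /= in_itv/= -ler_norml clip_coord.
have mG : measurable_fun setT (fun p : d.-tuple mR * d.-tuple mR => G (rv p.1, rv p.2) : mR).
  apply: measurable_continuous_comp2 => // j; under eq_fun do rewrite mxE.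
    exact: (measurableT_comp (measurable_tnth j) measurable_fst).
  exact: (measurableT_comp (measurable_tnth j) measurable_snd).
have cG1 v : continuous (fun w => G (v, w)).
  exact: (pair_comp cG (cV v) (@id_cont V)).
have cG2 w : continuous (fun v => G (v, w)).
  exact: (pair_comp cG (@id_cont V) (cV w)).
have iG : (sig \x sig)%E.-integrable setT (EFin \o (fun p => G (rv p.1, rv p.2))).
  apply: measurable_bounded_integrable => //.
  - rewrite -setXTT [X in (X < _)%E]product_measure1E//.
    by rewrite -[X in (X * _)%E]/(sig setT) -[X in (_ * X)%E]/(sig setT) sphere_setT mule1 ltry.
  - exists M; split; first exact: num_real.
    by move=> y My x _; apply: le_trans (HM _) (ltW My).
have E1 v : (avg (fun w => G (v, w)))%:E = (\int[sig]_w (G (v, rv w))%:E)%E.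
  by rewrite /avg fineK//; apply: integrable_fin_num => //; exact: (avg_integrable (cG1 v)).
have E2 w : (avg (fun v => G (v, w)))%:E = (\int[sig]_v (G (rv v, w))%:E)%E.
  by rewrite /avg fineK//; apply: integrable_fin_num => //; exact: (avg_integrable (cG2 w)).
rewrite [LHS]/avg [RHS]/avg /Rintegral; apply: (f_equal fine).
under eq_integral do rewrite E1.
under [RHS]eq_integral do rewrite E2.
exact: (Fubini iG).
Qed.

End average.

(** * One-variable calculus *)

Section derivative_rules.
Context {R : realType}.

(** A quadratic bound on the remainder survives averaging over the sphere; this makes it the
    criterion for differentiating under the integral sign. *)
Lemma is_derive_quad {V : normedModType R} (f : V -> R) (x v : V) (D C eta : R) :
  0 < eta ->
  (forall h : R, `|h| <= eta -> `|f (x + h *: v) - f x - h * D| <= C * h ^+ 2) ->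
  is_derive x v f D.
Proof.
move=> eta0 H.
have L : h^-1 *: ((f \o shift x) (h *: v) - f x) @[h --> 0^'] --> D.
  apply: (iffRL (@cvgrPdist_le R R^o _ (0^') _ _ _)) => e e0.
  have Ce : 0 < e / (`|C| + 1) by rewrite divr_gt0// ltr_wpDl.
  near=> h.
  have h0 : h != 0 by near: h; exact: nbhs_dnbhs_neq.
  have hp : 0 < `|h| by rewrite normr_gt0.
  have heta : `|h| <= eta.
    near: h; apply: dnbhs0_le => //.
  have he : `|h| <= e / (`|C| + 1).
    near: h; apply: dnbhs0_le => //.
  rewrite -normrN opprB /= [h *: v + x]addrC.
  have -> : h^-1 *: (f (x + h *: v) - f x) - D = h^-1 * (f (x + h *: v) - f x - h * D).
    by rewrite /GRing.scale/= [RHS]mulrBr mulKf.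
  rewrite normrM normfV ler_pdivrMl//; apply: le_trans (H h heta) _.
  rewrite -[h ^+ 2]real_normK ?num_real// expr2 mulrA mulrC ler_wpM2l//.
  apply: (@le_trans _ _ ((`|C| + 1) * `|h|)).
    by rewrite ler_wpM2r// (le_trans (ler_norm _))// lerDl.
  by rewrite mulrC -ler_pdivlMr// ltr_wpDl.
apply: DeriveDef; first by apply/cvg_ex; exists D.
by rewrite /derive; apply: cvg_lim.
Unshelve. all: by end_near. Qed.

Lemma derC (c x : R) : is_derive x 1 (fun=> c) 0.
Proof. exact: is_derive_cst. Qed.

Lemma derI (x : R) : is_derive x 1 (fun y => y) 1.
Proof. exact: is_derive_id. Qed.

Lemma derD (f g : R -> R) (x a b : R) : is_derive x 1 f a -> is_derive x 1 g b ->
  is_derive x 1 (fun y => f y + g y) (a + b).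
Proof. by move=> ? ?; exact: is_deriveD. Qed.

Lemma derN (f : R -> R) (x a : R) : is_derive x 1 f a ->
  is_derive x 1 (fun y => - f y) (- a).
Proof. by move=> ?; exact: is_deriveN. Qed.

Lemma derM (f g : R -> R) (x a b : R) : is_derive x 1 f a -> is_derive x 1 g b ->
  is_derive x 1 (fun y => f y * g y) (a * g x + f x * b).
Proof.
move=> fa gb; have H : is_derive x 1 (f * g) (f x *: b + g x *: a) by exact: is_deriveM.
by apply: is_derive_eq H _; rewrite /GRing.scale/= addrC [g x * a]mulrC.
Qed.

Lemma derX (f : R -> R) (x a : R) k : is_derive x 1 f a ->
  is_derive x 1 (fun y => f y ^+ k.+1) (k.+1%:R * f x ^+ k * a).
Proof.
move=> fa; elim: k => [|k IH].
  by rewrite expr0 mulr1 mul1r; under eq_fun do rewrite expr1.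
under eq_fun do rewrite exprS.
have H := derM fa IH; apply: is_derive_eq H _.
by rewrite !exprS (_ : k.+2%:R = k.+1%:R + 1 :> R) ?natr1//; set z := k.+1%:R; ring.
Qed.

Lemma der_comp (f g : R -> R) (x a b : R) : is_derive (g x) 1 f a ->
  is_derive x 1 g b -> is_derive x 1 (fun y => f (g y)) (a * b).
Proof. by move=> ? ?; exact: is_derive1_comp. Qed.

Lemma derV (f : R -> R) (x a : R) : f x != 0 -> is_derive x 1 f a ->
  is_derive x 1 (fun y => (f y)^-1) (- a / f x ^+ 2).
Proof.
move=> fx fa; have H : is_derive x 1 (fun y => (f y)^-1) (- (f x) ^- 2 *: a).
  exact: is_deriveV.
by apply: is_derive_eq H _; rewrite /GRing.scale/= !mulNr mulrC.
Qed.

Lemma der_sqrt (f : R -> R) (x a : R) : 0 < f x -> is_derive x 1 f a ->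
  is_derive x 1 (fun y => Num.sqrt (f y)) (a / (2 * Num.sqrt (f x))).
Proof.
move=> fx fa; have H := der_comp (is_derive1_sqrt fx) fa.
by apply: is_derive_eq H _; rewrite mulrC.
Qed.

Lemma der_continuous (f : R -> R) (x a : R) : is_derive x 1 f a ->
  {for x, continuous f}.
Proof.
by move=> [fa _]; apply/differentiable_continuous; rewrite -derivable1_diffP.
Qed.

Lemma mean_value (f df : R -> R) (a b : R) : a < b ->
  (forall x, a <= x <= b -> is_derive x 1 f (df x)) ->
  exists2 c, a < c < b & f b - f a = df c * (b - a).
Proof.
move=> ab H; have [||c] := @MVT R f df a b ab.
- by move=> x; rewrite in_itv/= => /andP[h1 h2]; apply: H; rewrite !ltW.
- apply: derivable_within_continuous => x; rewrite in_itv/= => h.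
  by have [] := H x h.
by rewrite in_itv/= => h E; exists c.
Qed.

Lemma derivative_bound (f df : R -> R) (a b C : R) : a <= b ->
  (forall x, a <= x <= b -> is_derive x 1 f (df x)) ->
  (forall x, a <= x <= b -> `|df x| <= C) -> `|f b - f a| <= C * (b - a).
Proof.
rewrite le_eqVlt => /predU1P[->|ab] H HC; first by rewrite !subrr normr0 mulr0.
have [c /andP[h1 h2] ->] := mean_value ab H.
have ba : 0 <= b - a by rewrite subr_ge0 ltW.
rewrite normrM (ger0_norm ba); apply: ler_wpM2r => //.
by apply: HC; rewrite !ltW.
Qed.

Lemma derivative_ge0 (f df : R -> R) (a b : R) : a <= b ->
  (forall x, a <= x <= b -> is_derive x 1 f (df x)) ->
  (forall x, a <= x <= b -> 0 <= df x) -> f a <= f b.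
Proof.
rewrite le_eqVlt => /predU1P[->//|ab] H HC.
have [c /andP[h1 h2] E] := mean_value ab H.
by rewrite -subr_ge0 E mulr_ge0 ?subr_ge0 ?(ltW ab)//; apply: HC; rewrite !ltW.
Qed.

Lemma derivative_gt0 (f df : R -> R) (a b : R) : a < b ->
  (forall x, a <= x <= b -> is_derive x 1 f (df x)) ->
  (forall x, a <= x <= b -> 0 < df x) -> f a < f b.
Proof.
move=> ab H HC; have [c /andP[h1 h2] E] := mean_value ab H.
by rewrite -subr_gt0 E mulr_gt0 ?subr_gt0//; apply: HC; rewrite !ltW.
Qed.

End derivative_rules.

(** * Integrals over intervals and substitution *)

Section interval_integral.
Context {R : realType}.
Local Notation mu := (@lebesgue_measure R).
Implicit Types (f g k : R -> R) (a b : R).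

Definition intv a b f : R := \int[mu]_(x in `[a, b]) f x.

Lemma intv_integrable a b f : continuous f -> mu.-integrable `[a, b] (EFin \o f).
Proof.
move=> cf; apply: continuous_compact_integrable; first exact: segment_compact.
exact: continuous_subspaceT.
Qed.

Lemma intv_ge0 a b f : (forall x, a <= x <= b -> 0 <= f x) -> 0 <= intv a b f.
Proof. by move=> f0; apply: Rintegral_ge0 => x /=; rewrite in_itv/=; exact: f0. Qed.

Lemma intv_le a b f g : continuous f -> continuous g ->
  (forall x, a <= x <= b -> f x <= g x) -> intv a b f <= intv a b g.
Proof.
move=> cf cg fg; apply: le_Rintegral => //; exact: intv_integrable.
Qed.

Lemma intvZ a b c f : continuous f -> intv a b (fun x => c * f x) = c * intv a b f.
Proof. by move=> cf; apply: RintegralZl => //; exact: intv_integrable. Qed.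

Lemma intvD a b f g : continuous f -> continuous g ->
  intv a b (fun x => f x + g x) = intv a b f + intv a b g.
Proof. by move=> cf cg; apply: RintegralD => //; exact: intv_integrable. Qed.

Lemma intv_cst a b c : a <= b -> intv a b (fun=> c) = c * (b - a).
Proof.
move=> ab; rewrite /intv Rintegral_cst//= lebesgue_measure_itv/= lte_fin.
by case: ltgtP ab => // ->; rewrite subrr.
Qed.

Lemma intv_sub a b a' b' f : continuous f -> (forall x, 0 <= f x) ->
  a' <= a -> b <= b' -> intv a b f <= intv a' b' f.
Proof.
move=> cf f0 aa bb; rewrite /intv /Rintegral fine_le//.
- by apply: integrable_fin_num => //; exact: intv_integrable.
- by apply: integrable_fin_num => //; exact: intv_integrable.
apply: ge0_subset_integral => //.
- by have /integrableP[] := @intv_integrable a' b' f cf.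
- by move=> x _; rewrite lee_fin.
- by move=> x /=; rewrite !in_itv/= => /andP[h1 h2]; rewrite (le_trans aa)// (le_trans h2).
Qed.

Lemma intv_subst (F dF k : R -> R) a b : a < b ->
  (forall x, a <= x <= b -> is_derive x 1 F (dF x)) ->
  (forall x, a <= x <= b -> 0 < dF x) ->
  continuous F -> continuous dF -> continuous k ->
  intv (F a) (F b) k = intv a b (fun x => k (F x) * dF x).
Proof.
move=> ab FdF dF0 cF cdF ck.
have F'E x : a <= x <= b -> derive1 F x = dF x.
  by move=> /FdF [_ <-]; rewrite derive1E.
have near_ab x : x \in `]a, b[ -> \forall y \near x, derive1 F y = dF y.
  move=> xab; near=> y; apply: F'E.
  have : y \in `]a, b[ by near: y; exact: near_in_itvoo.
  by rewrite in_itv/= => /andP[h1 h2]; rewrite !ltW.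
have cdF' x : x \in `]a, b[ -> {for x, continuous (derive1 F)}.
  move=> xab; rewrite /prop_for /continuous_at.
  rewrite F'E; last by move: xab; rewrite in_itv/= => /andP[? ?]; rewrite !ltW.
  apply: cvg_trans (cdF x); apply: near_eq_cvg.
  by have := near_ab x xab; apply: filterS => y ->.
have E : (\int[mu]_(x in `[F a, F b]) (k x)%:E =
    \int[mu]_(x in `[a, b]) (((k \o F) * derive1 F) x)%:E)%E.
  apply: integration_by_substitution_increasing; first exact: ltW.
  - move=> x y; rewrite !in_itv/= => /andP[h1 h2] /andP[h3 h4] xy.
    apply: (derivative_gt0 (df := dF)) => // z /andP[z1 z2].
      by apply: FdF; rewrite (le_trans h1)// (le_trans z2).
    by apply: dF0; rewrite (le_trans h1)// (le_trans z2).
  - by move=> x xab; apply: cdF'.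
  - apply/cvg_ex; exists (dF a).
    apply: cvg_trans (cvg_at_right_filter (cdF a)); apply: near_eq_cvg.
    near=> y; apply/esym/F'E; apply/andP; split; near: y; first exact: nbhs_right_ge.
    by apply: nbhs_right_le.
  - apply/cvg_ex; exists (dF b).
    apply: cvg_trans (cvg_at_left_filter (cdF b)); apply: near_eq_cvg.
    near=> y; apply/esym/F'E; apply/andP; split; near: y; last exact: nbhs_left_le.
    by apply: nbhs_left_ge.
  - split.
    + move=> x; rewrite in_itv/= => /andP[h1 h2].
      by have [] : is_derive x 1 F (dF x) by apply: FdF; rewrite !ltW.
    + exact: (cvg_at_right_filter (cF a)).
    + exact: (cvg_at_left_filter (cF b)).
  - exact: continuous_subspaceT.
rewrite /intv /Rintegral E; congr fine; apply: eq_integral => x.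
by rewrite inE/= in_itv/= => xab; rewrite /GRing.mul/= F'E.
Unshelve. all: by end_near. Qed.

Lemma intv_subst_ge (F dF k : R -> R) a b C : a < b ->
  (forall x, a <= x <= b -> is_derive x 1 F (dF x)) ->
  (forall x, a <= x <= b -> 0 < dF x <= C) ->
  continuous F -> continuous dF -> continuous k -> (forall x, 0 <= k x) ->
  intv (F a) (F b) k <= C * intv a b (fun x => k (F x)).
Proof.
move=> ab FdF dFC cF cdF ck k0.
have ckF : continuous (fun x => k (F x)) by exact: comp_cont.
rewrite (intv_subst ab FdF)//; last by move=> x /dFC/andP[].
rewrite -intvZ//; apply: intv_le; first by cont.
  by cont.
move=> x xab; rewrite mulrC ler_wpM2r//.
by have /andP[] := dFC x xab.
Qed.

Lemma intv_subst_le (F dF k : R -> R) a b C : a < b ->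
  (forall x, a <= x <= b -> is_derive x 1 F (dF x)) ->
  (forall x, a <= x <= b -> 0 < dF x /\ 1 <= C * dF x) ->
  continuous F -> continuous dF -> continuous k -> (forall x, 0 <= k x) ->
  intv a b (fun x => k (F x)) <= C * intv (F a) (F b) k.
Proof.
move=> ab FdF dFC cF cdF ck k0.
have ckF : continuous (fun x => k (F x)) by exact: comp_cont.
rewrite (intv_subst ab FdF)//; last by move=> x /dFC[].
have cG : continuous (fun x => k (F x) * dF x) by cont.
rewrite -intvZ//; apply: intv_le => //; first by cont.
move=> x xab; rewrite mulrCA ler_peMr//.
by have [] := dFC x xab.
Qed.

End interval_integral.

Lemma le_integral_mrestr d (T : measurableType d) (R : realType)
    (m : {measure set T -> \bar R}) (D E : set T) (mD : measurable D) (f : T -> \bar R) :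
  measurable E -> E `<=` D -> measurable_fun setT f -> (forall x, 0 <= f x)%E ->
  (\int[m]_(x in E) f x <= \int[mrestr m mD]_x f x)%E.
Proof.
move=> mE ED mf f0.
have -> : (\int[m]_(x in E) f x = \int[mrestr m mD]_(x in E) f x)%E.
  apply: eq_measure_integral => A mA AE; rewrite /mrestr; congr (m _).
  by apply/esym/setIidPl; exact: subset_trans ED.
exact: ge0_subset_integral.
Qed.

Lemma ge0_integral_lebesgue_cons (R : realType) n
    (m : {sigma_finite_measure set (n.-tuple (measurableTypeR R)) -> \bar R})
    (E : set (n.+1.-tuple (measurableTypeR R))) f :
  measurable E -> measurable_fun setT f -> (forall x, 0 <= f x)%E ->
  (\int[lebesgue_cons m]_(v in E) f v =
   \int[@lebesgue_measure R \x m]_(p in @cons_pair R n @^-1` E) f (cons_pair p))%E.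
Proof.
move=> mE mf f0; rewrite /lebesgue_cons.
rewrite [LHS](ge0_integral_pushforward (@measurable_cons_pair R n) _ mE)//.
exact: measurable_funTS.
Qed.

(** * Density of the first coordinate on the sphere *)

Section density.
Context {R : realType} {n : nat}.
Local Notation mR := (measurableTypeR R).
Local Notation d := n.+2.
Local Notation V := 'rV[R]_d.
Local Notation sig := (@sphere_measure R d).
Local Notation mu := (@lebesgue_measure R).

(* The first coordinate of (x, y) / |(x, y)| as a function of x, with b = |y|. *)
Lemma intv_projection_ge (k : R -> R) (a b : R) : continuous k -> (forall x, 0 <= k x) ->
  0 < a -> a <= b <= 2^-1 ->
  a * intv (- (7 / 10)) (7 / 10) k <=
  intv (- 2^-1) 2^-1 (fun x => k (x / Num.sqrt (x ^+ 2 + b ^+ 2))).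
Proof.
move=> ck k0 a0 /andP[ab b2]; have b0 : 0 < b by exact: lt_le_trans ab.
have s0 x : 0 < x ^+ 2 + b ^+ 2 by rewrite ltr_wpDl ?sqr_ge0// exprn_gt0.
have r0 x : 0 < Num.sqrt (x ^+ 2 + b ^+ 2) by rewrite sqrtr_gt0.
pose F x := x / Num.sqrt (x ^+ 2 + b ^+ 2).
pose dF x := b ^+ 2 / Num.sqrt (x ^+ 2 + b ^+ 2) ^+ 3.
have FdF (x : R) : is_derive x 1 F (dF x).
  have H1 := derD (derX 1 (derI x)) (derC (b ^+ 2) x).
  have H2 := @der_sqrt R (fun y => y ^+ 2 + b ^+ 2) x _ (s0 x) H1.
  have H3 := @derV R (fun y => Num.sqrt (y ^+ 2 + b ^+ 2)) x _ (lt0r_neq0 (r0 x)) H2.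
  have H := derM (derI x) H3.
  apply: is_derive_eq H _; rewrite /dF.
  set r := Num.sqrt (x ^+ 2 + b ^+ 2).
  have rr : r ^+ 2 = x ^+ 2 + b ^+ 2 by rewrite /r sqr_sqrtr ?ltW.
  have rn : r != 0 by apply: lt0r_neq0; exact: r0.
  have -> : b ^+ 2 = r ^+ 2 - x ^+ 2 by rewrite rr; ring.
  by field.
have cS : continuous (fun x : R => Num.sqrt (x ^+ 2 + b ^+ 2)) by cont.
have cF : continuous F.
  by apply: mul_cont; [exact: id_cont|apply: inv_cont => // x; exact: lt0r_neq0].
have cdF : continuous dF.
  apply: mul_cont; first exact: cst_cont.
  apply: inv_cont => [x|]; first by rewrite expf_neq0 ?lt0r_neq0.
  by cont.
have dFC x : 0 < dF x <= b^-1.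
  rewrite divr_gt0 ?exprn_gt0//= ler_pdivrMr ?exprn_gt0// -ler_pdivrMl ?invr_gt0//.
  rewrite invrK -exprS ler_pXn2r ?nnegrE ?(ltW b0)//.
  rewrite -[leLHS](ger0_norm (ltW b0)) -sqrtr_sqr ler_wsqrtr//.
  by rewrite lerDr sqr_ge0.
have := @intv_subst_ge R F dF k (- 2^-1) 2^-1 b^-1 _ (fun x _ => FdF x)
  (fun x _ => dFC x) cF cdF ck k0.
have hl : - 2^-1 < 2^-1 :> R by lra.
move=> /(_ hl) H.
rewrite mulrC -ler_pdivlMr//.
apply: (@le_trans _ _ (intv (F (- 2^-1)) (F 2^-1) k)); last first.
  apply: le_trans H _; rewrite mulrC ler_wpM2l//; last by rewrite lef_pV2.
  by apply: intv_ge0 => x _.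
(* This is where 7/10 comes from: as b <= 1/2, the value F (1/2) is at least 1 / sqrt 2. *)
have F2 : 7 / 10 <= F 2^-1.
  rewrite ler_pdivlMr// -(ler_pXn2r (_ : 0 < 2)%N) ?nnegrE ?mulr_ge0 ?invr_ge0 ?sqrtr_ge0//.
  rewrite exprMn sqr_sqrtr ?ltW//.
  have : b ^+ 2 <= 2^-1 ^+ 2 by rewrite ler_pXn2r ?nnegrE ?invr_ge0// ltW.
  by nra.
apply: intv_sub => //.
have -> // : F (- 2^-1) = - F 2^-1 by rewrite /F sqrrN mulNr.
by rewrite lerN2.
Qed.

(** The law of the first coordinate has a density bounded below away from the poles. The bound is
    read off a cylinder in the ball, [-1/2, 1/2] times a cube [Q] of the other coordinates that
    avoids 0: on each fiber x |-> x / |(x, y)| is a change of variables with bounded derivative. *)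
Lemma avg_coord_ge : exists2 c : R, 0 < c & forall k : R -> R,
  continuous k -> (forall x, 0 <= k x) ->
  c * intv (- (7 / 10)) (7 / 10) k <= avg (fun w : V => k (w 0 0)).
Proof.
(* Points of [Q] then have norm between a and (n+1) * 2a = 1/2, as [intv_projection_ge] requires. *)
pose a : R := (4 * n.+1%:R)^-1.
have a0 : 0 < a by rewrite invr_gt0 mulr_gt0 ?ltr0n.
pose Q : set (n.+1.-tuple mR) := tcube a (2 * a).
have mQ : measurable Q by exact: measurable_tcube.
have bQ y : Q y -> a <= enorm (rv y) <= 2^-1.
  move=> Qy; apply/andP; split.
    have /andP[h _] := Qy 0; apply: le_trans (normr_coord (rv y) 0).
    by rewrite mxE (le_trans h)// ler_norm.
  apply: le_trans (enorm_le_sum _) _.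
  apply: (@le_trans _ _ (\sum_(i < n.+1) 2 * a)).
    apply: ler_sum => i _; rewrite mxE; have /andP[h1 h2] := Qy i.
    by rewrite ger0_norm// (le_trans (ltW a0)).
  rewrite sumr_const card_ord -[leLHS]mulr_natl /a invfM.
  have : n.+1%:R != 0 :> R by rewrite pnatr_eq0.
  move=> nz; rewrite (_ : _ * _ = 2^-1 :> R)//.
  set m := n.+1%:R in nz *; by field.
pose vol := @ball_volume R n.
have vol0 : 0 < vol by exact: ball_volume_gt0.
pose muQ := (2 * a - a) ^+ n.+1.
exists (vol^-1 * (a * muQ)).
  rewrite mulr_gt0 ?invr_gt0// mulr_gt0// exprn_gt0// (_ : _ - _ = a) //; ring.
move=> k ck k0; set J := intv _ _ k.
have ckw : continuous (fun w : V => k (w 0 0)) by apply: (comp_cont ck); cont.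
pose f0 (v : d.-tuple mR) := (k ((rv v) 0 0))%:E.
have mf0 : measurable_fun setT f0 by apply/measurable_EFinP; exact: (measurable_rv ckw).
have avgE : (avg (fun w : V => k (w 0 0)))%:E = (\int[sig]_v f0 v)%E.
  by rewrite /avg fineK//; apply: integrable_fin_num => //; exact: (avg_integrable ckw).
rewrite -lee_fin avgE.
have f00 v : (0 <= f0 v)%E by rewrite lee_fin.
rewrite [leRHS](ge0_integral_mscale _ _ _ mf0)//.
rewrite -mulrA EFinM; apply: lee_wpmul2l.
  by rewrite lee_fin invr_ge0 ltW.
rewrite [leRHS](ge0_integral_pushforward (@measurable_direction R d) _ measurableT mf0)//.
pose E : set (d.-tuple mR) := @uncons R n.+1 @^-1` (`[- 2^-1, 2^-1]%classic `*` Q).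
have mE : measurable E.
  rewrite -[X in measurable X]setTI; apply: measurable_uncons => //.
  by apply: measurableX => //; exact: measurable_itv.
have dotE (x : mR) y : dot (rv (cons_pair (x, y))) (rv (cons_pair (x, y))) =
    x ^+ 2 + enorm (rv y) ^+ 2.
  rewrite enorm_sqr /dot big_ord_recl !mxE cons_pair0 -expr2; congr (_ + _).
  by apply: eq_bigr => i _; rewrite !mxE cons_pair_lift.
have subE : E `<=` @punctured_ball R d.
  move=> v Ev; rewrite -(unconsK v); have : (`[- 2^-1, 2^-1]%classic `*` Q) (uncons v) := Ev.
  case: (uncons v) => x y [/=]; rewrite in_itv/= => /andP[x1 x2] Qy; rewrite /punctured_ball/= /enorm dotE.
  have /andP[y1 y2] := bQ y Qy.
  have y0 : 0 < enorm (rv y) by exact: lt_le_trans y1.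
  rewrite sqrtr_gt0 ltr_wpDl ?sqr_ge0 ?exprn_gt0//=.
  rewrite -[leRHS]sqrtr1 ler_wsqrtr//.
  have : enorm (rv y) ^+ 2 <= 2^-1 ^+ 2 by rewrite ler_pXn2r ?nnegrE ?enorm_ge0 ?invr_ge0.
  by nra.
have mfd : measurable_fun setT (f0 \o @direction R d).
  by apply: measurableT_comp => //; exact: measurable_direction.
apply: (@le_trans _ _ (\int[@lebesgue_tuple R d]_(v in E) (f0 \o @direction R d) v)%E); last first.
  by apply: le_integral_mrestr => // v; exact: f00.
pose h (p : mR * n.+1.-tuple mR) := (f0 \o @direction R d) (cons_pair p).
have mh : measurable_fun setT h.
  by apply: measurableT_comp => //; exact: measurable_cons_pair.
pose IQ : set (mR * n.+1.-tuple mR) := `[- 2^-1, 2^-1]%classic `*` Q.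
have -> : (\int[@lebesgue_tuple R d]_(v in E) (f0 \o @direction R d) v =
   \int[mu \x @lebesgue_tuple R n.+1]_(p in IQ) h p)%E.
  have cE : @cons_pair R n.+1 @^-1` E = IQ.
    by apply/seteqP; split => p; rewrite /E /preimage /mkset cons_pairK.
  rewrite -cE; apply: ge0_integral_lebesgue_cons => // v; exact: f00.
have mIQ : measurable IQ.
  by apply: measurableX => //; exact: measurable_itv.
rewrite integral_mkcond fubini_tonelli2; last 2 first.
- by apply/(measurable_restrictT _ _).1 => //; exact: measurable_funTS.
- by apply: erestrict_ge0 => p _; exact: f00.
pose G (y : n.+1.-tuple mR) := fubini_G mu (h \_ IQ) y.
rewrite -/G.
have mG : measurable_fun setT G.
  apply: measurable_fun_fubini_tonelli_G.
    by apply/(measurable_restrictT _ _).1 => //; exact: measurable_funTS.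
  by apply: erestrict_ge0 => p _; exact: f00.
apply: (@le_trans _ _ (\int[@lebesgue_tuple R n.+1]_(y in Q) G y)%E); last first.
  apply: ge0_subset_integral => //; move=> y _; apply: integral_ge0 => x _.
  by apply: erestrict_ge0 => p _; exact: f00.
apply: (@le_trans _ _ (\int[@lebesgue_tuple R n.+1]_(y in Q) (a * J)%:E)%E).
  have LQ : @lebesgue_tuple R n.+1 Q = muQ%:E by apply: lebesgue_tcube; lra.
  rewrite integral_cst// [X in (_ * X)%E](_ : _ = muQ%:E); last exact: LQ.
  by rewrite -EFinM lee_fin /muQ -mulrA (mulrC _ J) mulrA.
apply: ge0_le_integral => //.
- move=> y _; rewrite lee_fin; apply: mulr_ge0; first exact: ltW.
  by rewrite /J; apply: intv_ge0.
- exact: measurable_funTS.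
move=> y Qy; rewrite /G /fubini_G.
have kE x : (h \_ IQ) (x, y) =
   ((fun x => (k (x / Num.sqrt (x ^+ 2 + enorm (rv y) ^+ 2)))%:E) \_ `[- 2^-1, 2^-1]%classic) x.
  rewrite /patch; have -> : ((x, y) \in IQ) = (x \in `[- 2^-1, 2^-1]%classic).
    by apply/idP/idP; rewrite !inE; [case|move=> xI; split].
  case: ifP => [_|//]; rewrite /h /f0 /comp directionE trvK mxE [X in X^-1]/enorm dotE.
  by rewrite mxE cons_pair0 mulrC.
under eq_integral do rewrite kE.
rewrite -integral_mkcond.
have cF : continuous (fun x : R => k (x / Num.sqrt (x ^+ 2 + enorm (rv y) ^+ 2))).
  have /andP[y1 _] := bQ y Qy; apply: (comp_cont ck).
  apply: mul_cont; first exact: id_cont.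
  apply: inv_cont; last by cont.
  move=> x; apply: lt0r_neq0; rewrite sqrtr_gt0 ltr_wpDl ?sqr_ge0 ?exprn_gt0//.
  exact: lt_le_trans y1.
pose I2 : set mR := `[- 2^-1, 2^-1]%classic; rewrite -/I2.
have -> : (\int[mu]_(x in I2) (k (x / Num.sqrt (x ^+ 2 + enorm (rv y) ^+ 2)))%:E =
  (intv (- 2^-1)%R 2^-1%R (fun x => k (x / Num.sqrt (x ^+ 2 + enorm (rv y) ^+ 2))))%:E)%E.
  by rewrite /intv fineK//; apply: integrable_fin_num => //; exact: intv_integrable.
by rewrite lee_fin; apply: intv_projection_ge => //; exact: bQ.
Qed.

End density.

Section parametric_interval_integral.
Context {R : realType} {n : nat}.
Local Notation V := 'rV[R]_n.+2.
Local Notation sig := (@sphere_measure R n.+2).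
Local Notation mR := (measurableTypeR R).
Local Notation mu := (@lebesgue_measure R).

Lemma intv_continuous {X : topologicalType} (E : X -> R -> R) (a b : R) :
  continuous (fun p : X * R => E p.1 p.2) -> continuous (fun x => intv a b (E x)).
Proof.
move=> cE x; apply: (iffRL (@cvgrPdist_le R R _ (nbhs x) _ _ _)) => e e0.
have [ab|ba] := leP a b; last first.
  apply: nearW => y; rewrite /intv set_itv_ge ?bnd_simp -?ltNge//.
  by rewrite !Rintegral_set0 subrr normr0 ltW.
have cEx y : continuous (E y).
  have cy : continuous (fun _ : R => y) by exact: cst_continuous.
  exact: (pair_comp cE cy (@id_cont R)).
pose e' := e / (b - a + 1).
have ba0 : 0 < b - a + 1 by rewrite ltr_wpDl// subr_ge0.
have e'0 : 0 < e' by rewrite divr_gt0.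
have /compact_near_coveringP/(_ _ (nbhs x)
  (fun y w => `|E x w - E y w| <= e') _) := @segment_compact R a b.
have step w : `[a, b]%classic w -> \forall w' \near w & y \near x, `|E x w' - E y w'| <= e'.
  move=> _; have cpt : continuous (fun p : R * X => E x p.1 - E p.2 p.1).
    apply: add_cont; first by apply: comp_cont; [exact: cEx|exact: fst_cont].
    by apply: opp_cont; exact: (pair_comp cE snd_cont fst_cont).
  have /(_ e' e'0) := iffLR (@cvgrPdist_le R R _ (nbhs (w, x)) (nbhs_filter _) _ _) (cpt (w, x)).
  by rewrite /= subrr; under eq_near do rewrite sub0r normrN.
move=> /(_ step); apply: filterS => y H.
have -> : intv a b (E x) - intv a b (E y) = intv a b (fun r => E x r - E y r).
  rewrite -mulN1r -intvZ// -intvD//; last by cont; exact: cEx.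
  by congr intv; apply/funext => r; rewrite mulN1r.
apply: (@le_trans _ _ (intv a b (fun=> e'))).
  rewrite ler_norml; apply/andP; split.
    rewrite -mulN1r -intvZ//; last by cont.
    apply: intv_le; [by cont|by cont; exact: cEx|].
    move=> r rab; rewrite mulN1r.
    by have := H r; rewrite /= in_itv/= => /(_ rab); rewrite ler_norml => /andP[].
  apply: intv_le; [by cont; exact: cEx|by cont|].
  move=> r rab.
  by have := H r; rewrite /= in_itv/= => /(_ rab); rewrite ler_norml => /andP[].
rewrite intv_cst// /e' -mulrA ger_pMr// mulrC ler_pdivrMr// mul1r lerDl//.
Qed.

(** Fubini, once clipping the sphere variable has made the integrand bounded. The scalar variable is
    viewed as a vector of length 1 so that measurability follows from
    [measurable_continuous_comp2]. *)
Lemma intv_avg_swap (g : R * V -> R) (a b : R) : continuous g ->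
  intv a b (fun x => avg (fun w => g (x, w))) =
  avg (fun w => intv a b (fun x => g (x, w))).
Proof.
move=> cg.
have cRV (v : V) : continuous (fun _ : R => v) by exact: cst_continuous.
have cVR (x : R) : continuous (fun _ : V => x) by exact: cst_continuous.
have ccl : continuous (fun p : R * V => clip p.2).
  by move=> p; apply: continuous_comp; [exact: snd_cont|exact: clip_continuous].
pose G (p : R * V) := g (p.1, clip p.2).
have cG : continuous G by exact: (pair_comp cg fst_cont ccl).
have cg1 x : continuous (fun w => g (x, w)) by exact: (pair_comp cg (cVR x) (@id_cont V)).
have cG1 x : continuous (fun w => G (x, w)) by exact: (pair_comp cG (cVR x) (@id_cont V)).
have cG2 w : continuous (fun x => G (x, w)) by exact: (pair_comp cG (@id_cont R) (cRV w)).
have lhs : intv a b (fun x => avg (fun w => g (x, w))) =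
    intv a b (fun x => avg (fun w => G (x, w))).
  by congr intv; apply/funext => x; rewrite avg_clip.
have rhs : avg (fun w => intv a b (fun x => g (x, w))) =
    avg (fun w => intv a b (fun x => G (x, w))).
  by apply: avg_clip; apply: intv_continuous; exact: (pair_comp cg snd_cont fst_cont).
rewrite {}lhs {}rhs.
have [M HM] : exists M, forall p, p.1 \in `[a, b] -> `|G p| <= M.
  pose K := [set v : V | forall i, v ord0 i \in `[(-1), 1]].
  have cK : compact K.
    by apply: (@rV_compact R n.+2 (fun=> `[-1, 1]%classic)) => _; exact: segment_compact.
  have := compact_bounded (continuous_compact (continuous_subspaceT cg)
    (compact_setX (@segment_compact R a b) cK)).
  move=> [M [_ HM]]; exists (M + 1) => x xab; apply: HM; first by rewrite ltrDl.
  by exists (x.1, clip x.2) => //=; split => //= i; rewrite /= in_itv/= -ler_norml clip_coord.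
pose D : set mR := `[a, b]%classic.
have mD : measurable D by exact: measurable_itv.
have mG : measurable_fun setT (fun p : mR * (n.+2).-tuple mR => G (p.1, rv p.2) : mR).
  pose G' (q : 'rV[R]_1 * V) := G (q.1 0 0, q.2).
  have cG' : continuous G'.
    by apply: (pair_comp cG); [cont|cont].
  rewrite (_ : (fun p => _) = (fun p => G' (const_mx p.1, rv p.2))); last first.
    by apply/funext => p; rewrite /G' mxE.
  apply: (measurable_continuous_comp2 cG') => j.
    by under eq_fun do rewrite mxE; exact: measurable_fst.
  under eq_fun do rewrite mxE.
  exact: (measurableT_comp (measurable_tnth j) measurable_snd).
pose H (p : mR * (n.+2).-tuple mR) : \bar R := ((fun p => (G (p.1, rv p.2))%:E) \_ (D `*` setT)) p.
have HE x v : H (x, v) = ((fun x => (G (x, rv v))%:E) \_ D) x.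
  rewrite /H /patch; have -> // : ((x, v) \in D `*` setT) = (x \in D).
  by apply/idP/idP; rewrite !inE; [case|move=> ?; split].
have E1 : (intv a b (fun x => avg (fun w => G (x, w))))%:E = (\int[mu]_x \int[sig]_v H (x, v))%E.
  rewrite /intv fineK; last first.
    apply: integrable_fin_num => //; apply: intv_integrable.
    by apply: avg_continuous; exact: (pair_comp cG fst_cont snd_cont).
  rewrite integral_mkcond; apply: eq_integral => x _.
  under eq_integral do rewrite HE.
  rewrite /patch; case: ifP => xD; last by rewrite integral0.
  by rewrite /avg fineK//; apply: integrable_fin_num => //; exact: (avg_integrable (cG1 x)).
have E2 : (avg (fun w => intv a b (fun x => G (x, w))))%:E = (\int[sig]_v \int[mu]_x H (x, v))%E.
  rewrite /avg fineK; last first.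
    apply: integrable_fin_num => //.
    apply: (@avg_integrable _ _ (fun w => intv a b (fun x => G (x, w)))).
    by apply: intv_continuous; exact: (pair_comp cG snd_cont fst_cont).
  apply: eq_integral => v _; under [RHS]eq_integral do rewrite HE.
  rewrite -integral_mkcond /intv fineK//.
  by apply: integrable_fin_num => //; exact: (intv_integrable _ _ (cG2 (rv v))).
apply: EFin_inj; rewrite E1 E2.
apply: Fubini.
have mDT : measurable (D `*` [set: (n.+2).-tuple mR]) by exact: measurableX.
rewrite (_ : H = (fun p => (G (p.1, rv p.2))%:E) \_ (D `*` setT)); last by apply/funext.
apply/integrable_restrict => //; rewrite setTI.
apply: measurable_bounded_integrable => //.
- suff : ((mu \x sig)%E (D `*` setT) < +oo)%E by [].
  rewrite product_measure1E// -[X in (_ * X)%E]/(sig setT) sphere_setT mule1.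
  rewrite -[X in (X < _)%E]/(mu D) /D lebesgue_measure_itv/=.
  by case: ifP => // _; rewrite -EFinB ltry.
- exact: measurable_funTS.
- exists M; split; first exact: num_real.
  by move=> y My [x v] [xD _] /=; apply: le_trans (HM _ _) (ltW My).
Qed.

End parametric_interval_integral.

Global Opaque avg intv.

Lemma gcomp_cont {A B C : topologicalType} (h : B -> C) (f : A -> B) :
  continuous h -> continuous f -> continuous (fun x => h (f x)).
Proof. by move=> ch cf x; apply: continuous_comp; [exact: cf|exact: ch]. Qed.

(** * Radial spherical means *)

Section spherical_means.
Context {R : realType} (n : nat).
Local Notation V := 'rV[R]_n.+2.
Local Notation e1 := (unit_e1 R n.+2).
Implicit Types (p q : R -> R) (r s t : R).

(* The spherical mean of radius s of the radial function p (enorm x), as a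
   function of the norm r of the base point. *)
Definition sp s p r : R := avg (fun w : V => p (enorm (r *: e1 + s *: w))).

Lemma enorm_e1 : enorm e1 = 1.
Proof. by rewrite /enorm dot_e1e1 sqrtr1. Qed.

Lemma enorm_unit (w : V) : dot w w = 1 -> enorm w = 1.
Proof. by rewrite /enorm => ->; rewrite sqrtr1. Qed.

Lemma enorm_rs_le r s (w : V) : dot w w = 1 -> enorm (r *: e1 + s *: w) <= `|r| + `|s|.
Proof.
move=> w1; apply: le_trans (enormD _ _) _.
by rewrite !enormZ enorm_e1 (enorm_unit w1) !mulr1.
Qed.

Lemma enorm_rs_ge r s (w : V) : dot w w = 1 -> `|r| - `|s| <= enorm (r *: e1 + s *: w).
Proof.
move=> w1; have := enormB_ge (r *: e1) (- (s *: w)).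
by rewrite opprK enormN !enormZ enorm_e1 (enorm_unit w1) !mulr1.
Qed.

Lemma enorm_rs r s (w : V) : dot w w = 1 ->
  enorm (r *: e1 + s *: w) = Num.sqrt (r ^+ 2 + s ^+ 2 + 2 * r * s * w 0 0).
Proof.
move=> w1; congr Num.sqrt.
rewrite dotDl !dotDr !dotZl !dotZr dot_e1e1 w1 (dotC w) dot_e1; ring.
Qed.

Lemma sp_cont2 {X : topologicalType} (f g : X -> R) p : continuous p ->
  continuous f -> continuous g -> continuous (fun x => sp (f x) p (g x)).
Proof.
move=> cp cf cg; apply: avg_continuous; apply: (comp_cont cp).
have c1 : continuous (fun x : X * V => f x.1) by exact: gcomp_cont cf fst_cont.
have c2 : continuous (fun x : X * V => g x.1) by exact: gcomp_cont cg fst_cont.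
by cont.
Qed.

Lemma sp_cont s p : continuous p -> continuous (sp s p).
Proof. by move=> cp; apply: sp_cont2 => //; [exact: cst_cont|exact: id_cont]. Qed.

Lemma sp_arg_cont r s p : continuous p ->
  continuous (fun w : V => p (enorm (r *: e1 + s *: w))).
Proof. by move=> cp; apply: (comp_cont cp); cont. Qed.

(** A rotation carries [e1] to the direction of x, so the mean of a radial function is again radial.
    This is what allows the means to be iterated as operators on functions of the radius. *)
Lemma avg_radial s p (x : V) : continuous p ->
  avg (fun w => p (enorm (x + s *: w))) = sp s p (enorm x).
Proof.
move=> cp; have [x0|x0] := eqVneq (dot x x) 0.
  by rewrite /sp (dot_eq0 x0) enorm0 scale0r.
have ex : 0 < enorm x by rewrite sqrtr_gt0 lt_def x0 dot_ge0.
have [|f rf fe] := @rotation_exists R n ((enorm x)^-1 *: x).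
  by rewrite dotZl dotZr -enorm_sqr mulrA -invfM -expr2 mulVf// expf_neq0// gt_eqF.
rewrite -[LHS](avg_rot rf); last by apply: (comp_cont cp); cont.
apply: (f_equal avg); apply/funext => w /=; congr p; rewrite -[RHS](rotation_enorm rf).
have [fD fZ _ _] := rf; congr enorm.
by rewrite fD !fZ fe scalerA mulfV ?gt_eqF// scale1r.
Qed.

Lemma sp_twice s t p r : continuous p ->
  sp s (sp t p) r = avg (fun w : V => avg (fun v => p (enorm (r *: e1 + s *: w + t *: v)))).
Proof.
move=> cp; apply: (f_equal avg); apply/funext => w.
by rewrite (avg_radial t (r *: e1 + s *: w) cp).
Qed.

Lemma sp_comm s t p r : continuous p -> sp s (sp t p) r = sp t (sp s p) r.
Proof.
move=> cp; rewrite (sp_twice s t r cp) (sp_twice t s r cp).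
have E := @avg_swap _ _ (fun x : V * V => p (enorm (r *: e1 + s *: x.1 + t *: x.2))).
rewrite [LHS]E.
  apply: (f_equal avg); apply/funext => w; apply: (f_equal avg); apply/funext => v.
  by rewrite addrAC.
by apply: (comp_cont cp); cont.
Qed.

Lemma sp_sym s p r : continuous p -> sp s p r = sp r p s.
Proof.
move=> cp; apply: avg_eq; [|exact: sp_arg_cont|exact: sp_arg_cont].
move=> w w1; congr p; rewrite !enorm_rs//; congr Num.sqrt; ring.
Qed.

(* Symmetry and commutativity turn the iterated mean into a mixture of means. *)
Lemma sp_product s t p r : continuous p ->
  sp t (sp s p) r = avg (fun w : V => sp (enorm (t *: e1 + s *: w)) p r).
Proof.
move=> cp; rewrite (sp_sym t r (sp_cont (s := s) cp)) (sp_comm r s t cp).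
by apply: (f_equal avg); apply/funext => w; exact: sp_sym.
Qed.

Lemma sp_add s p q r : continuous p -> continuous q ->
  sp s (fun x => p x + q x) r = sp s p r + sp s q r.
Proof. by move=> cp cq; apply: avgD; exact: sp_arg_cont. Qed.

Lemma sp_sub s p q r : continuous p -> continuous q ->
  sp s (fun x => p x - q x) r = sp s p r - sp s q r.
Proof. by move=> cp cq; apply: avgB; exact: sp_arg_cont. Qed.

Lemma sp_scale s c p r : continuous p -> sp s (fun x => c * p x) r = c * sp s p r.
Proof. by move=> cp; apply: avgZ; exact: sp_arg_cont. Qed.

Lemma sp_le s p q r : continuous p -> continuous q ->
  (forall x, 0 <= x <= `|r| + `|s| -> p x <= q x) -> sp s p r <= sp s q r.
Proof.
move=> cp cq pq; apply: avg_le; [|exact: sp_arg_cont|exact: sp_arg_cont].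
by move=> w w1; apply: pq; rewrite enorm_ge0 enorm_rs_le.
Qed.

Lemma sp_eq s p q r : continuous p -> continuous q ->
  (forall x, 0 <= x <= `|r| + `|s| -> p x = q x) -> sp s p r = sp s q r.
Proof.
move=> cp cq pq; apply: avg_eq; [|exact: sp_arg_cont|exact: sp_arg_cont].
by move=> w w1; apply: pq; rewrite enorm_ge0 enorm_rs_le.
Qed.

Lemma sp_ge0 s p r : continuous p -> (forall x, 0 <= x <= `|r| + `|s| -> 0 <= p x) ->
  0 <= sp s p r.
Proof.
move=> cp p0; apply: avg_ge0; last exact: sp_arg_cont.
by move=> w w1; apply: p0; rewrite enorm_ge0 enorm_rs_le.
Qed.

(** The real form of phi_(ia)(r e1); the sign of the exponent is immaterial by the symmetry of the
    sphere, see [phi_iaE]. *)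
Definition Phi a r : R := avg (fun w : V => expR (a * r * w 0 0)).

Lemma Phi_continuous a : continuous (Phi a).
Proof. by apply: avg_continuous; cont. Qed.

Lemma avg_gt0 (g : V -> R) (m : R) : continuous g -> 0 < m ->
  (forall w, dot w w = 1 -> m <= g w) -> 0 < avg g.
Proof.
move=> cg m0 H; apply: lt_le_trans m0 _; rewrite -[leLHS](@avg_cst R n).
by apply: avg_le => //; cont.
Qed.

Lemma coord0_le1 (w : V) : dot w w = 1 -> `|w 0 0| <= 1.
Proof. by move=> w1; have := normr_coord w 0; rewrite (enorm_unit w1). Qed.

Lemma Phi_gt0 a r : 0 < Phi a r.
Proof.
apply: (@avg_gt0 _ (expR (- `|a * r|))); [by cont|exact: expR_gt0|].
move=> w w1; rewrite ler_expR; apply: (@le_trans _ _ (- (`|a * r| * `|w 0 0|))).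
  by rewrite lerN2 ler_piMr// coord0_le1.
by rewrite -normrM lerNl -normrN ler_norm.
Qed.

Lemma Phi_radial a (x : V) : avg (fun w => expR (a * dot x w)) = Phi a (enorm x).
Proof.
have [x0|x0] := eqVneq (dot x x) 0.
  apply: (f_equal avg); apply/funext => w; rewrite (dot_eq0 x0) enorm0 mulr0 mul0r.
  by rewrite -(scale0r x) dotZl mul0r mulr0.
have ex : 0 < enorm x by rewrite sqrtr_gt0 lt_def x0 dot_ge0.
have e1' : dot ((enorm x)^-1 *: x) ((enorm x)^-1 *: x) = 1.
  by rewrite dotZl dotZr -enorm_sqr mulrA -invfM -expr2 mulVf// expf_neq0// gt_eqF.
transitivity (avg (fun w : V => expR (a * enorm x * dot ((enorm x)^-1 *: x) w))).
  apply: (f_equal avg); apply/funext => w; congr expR; rewrite dotZl; field.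
  exact: lt0r_neq0.
by apply: (@avg_dot _ _ _ (fun u => expR (a * enorm x * u))) => //; cont.
Qed.

(** The radial function is an average of the exponentials x |-> [expR (a * dot x v)] over unit
    vectors v, and each of them is an eigenfunction of every spherical mean with the same
    eigenvalue. *)
Lemma sp_Phi a s r : sp s (Phi a) r = Phi a s * Phi a r.
Proof.
transitivity (avg (fun w : V => avg (fun v => expR (a * dot (r *: e1 + s *: w) v)))).
  by apply: (f_equal avg); apply/funext => w; rewrite Phi_radial.
have E := @avg_swap _ _ (fun x : V * V => expR (a * dot (r *: e1 + s *: x.1) x.2)).
rewrite [LHS]E; last by cont.
rewrite /= mulrC -[RHS]mulrC -avgZ; last by cont.
apply: avg_eq; [|by apply: avg_continuous; cont|by cont].
move=> w w1; rewrite mulrC.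
have -> : Phi a s = avg (fun v : V => expR (a * s * dot w v)).
  have ck : continuous (fun u : R => expR (a * s * u)) by cont.
  exact: (esym (avg_dot w1 ck)).
rewrite -avgZ; last by cont.
apply: (f_equal avg); apply/funext => v; rewrite -expRD; congr expR.
by rewrite dotDl !dotZl dot_e1 (dotC v); ring.
Qed.

Lemma Phi0 a : Phi a 0 = 1.
Proof. by rewrite /Phi; under eq_fun do rewrite mulr0 mul0r expR0; rewrite avg_cst. Qed.

End spherical_means.

(** * Lower bounds for products of spherical means *)

Section laziness.
Context {R : realType} (n : nat).
Local Notation V := 'rV[R]_n.+2.
Local Notation e1 := (unit_e1 R n.+2).
Local Notation sp := (@sp R n).
Implicit Types (p q : R -> R) (r s t : R).

(** The smoothing operator K of the overview, before normalisation: means over radii spread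
    uniformly on an interval around t. *)
Definition Kop (a b : R) p r : R := intv a b (fun x => sp x p r).

Lemma Kop_cont a b p : continuous p -> continuous (Kop a b p).
Proof. by move=> cp; apply: intv_continuous; apply: sp_cont2 => //; cont. Qed.

Lemma spr_cont p r : continuous p -> continuous (fun x => sp x p r).
Proof. by move=> cp; apply: sp_cont2 => //; cont. Qed.

Lemma sp_Kop a b s p r : continuous p -> sp s (Kop a b p) r = Kop a b (sp s p) r.
Proof.
move=> cp; rewrite /Kop.
transitivity (avg (fun w : V => intv a b (fun x => sp x p (enorm (r *: e1 + s *: w))))) => //.
rewrite -(@intv_avg_swap _ _ (fun y : R * V => sp y.1 p (enorm (r *: e1 + s *: y.2)))) /=.
  by apply: (f_equal (intv a b)); apply/funext => x; exact: sp_comm.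
by apply: sp_cont2 => //; cont.
Qed.

Lemma Kop_ge0 a b p r : continuous p -> (forall x, 0 <= p x) -> 0 <= Kop a b p r.
Proof. by move=> cp p0; apply: intv_ge0 => x _; apply: sp_ge0. Qed.

Lemma Kop_sub a b a' b' p r : continuous p -> (forall x, 0 <= p x) ->
  a' <= a -> b <= b' -> Kop a b p r <= Kop a' b' p r.
Proof.
move=> cp p0; apply: intv_sub; first exact: spr_cont.
by move=> x; apply: sp_ge0.
Qed.

Lemma Kop_Phi a b c r : Kop a b (Phi n c) r = intv a b (Phi n c) * Phi n c r.
Proof.
rewrite /Kop mulrC -intvZ; last exact: Phi_continuous.
by apply: (f_equal (intv a b)); apply/funext => x; rewrite sp_Phi mulrC.
Qed.

(** The polynomial is the squared norm of t e1 + s w with x = w_0. As x runs through the interval of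
    [avg_coord_ge], this norm covers [9t/10, 11t/10] and stays above both t/2 and s/2. *)
Lemma law_of_cosines_bounds t s : 0 < t -> 9 / 10 * t <= s -> s <= 11 / 10 * t ->
  [/\ forall x, - (7 / 10) <= x -> (t / 2) ^+ 2 <= t ^+ 2 + s ^+ 2 + 2 * t * s * x,
      forall x, - (7 / 10) <= x -> s ^+ 2 <= 4 * (t ^+ 2 + s ^+ 2 + 2 * t * s * x),
      t ^+ 2 + s ^+ 2 + 2 * t * s * - (7 / 10) <= (9 / 10 * t) ^+ 2 &
      (11 / 10 * t) ^+ 2 <= t ^+ 2 + s ^+ 2 + 2 * t * s * (7 / 10)].
Proof.
move=> t0 s1 s2; have ts : 0 <= t * s by rewrite mulr_ge0//; lra.
have h1 : 0 <= (s - 9 / 10 * t) * (11 / 10 * t - s) by rewrite mulr_ge0 ?subr_ge0.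
have h2 : 0 <= t * (11 / 10 * t - s) by rewrite mulr_ge0 ?subr_ge0// ltW.
have h3 : 0 <= t * (s - 9 / 10 * t) by rewrite mulr_ge0 ?subr_ge0// ltW.
have h4 := sqr_ge0 (s - 9 / 10 * t); have h5 := sqr_ge0 t.
have h6 := sqr_ge0 (t - s); have h7 := sqr_ge0 s.
have tsx x : - (7 / 10) <= x -> 0 <= t * s * (x + 7 / 10).
  by move=> x7; rewrite mulr_ge0//; lra.
by split; [move=> x /tsx; lra|move=> x /tsx; lra|lra|lra].
Qed.

Let ab_lt t : 0 < t -> 9 / 10 * t < 11 / 10 * t. Proof. by move=> t0; lra. Qed.

(** By [sp_product] the iterated mean is a mixture of means of radius |t e1 + s w|. The density
    bound for w_0 becomes one for this radius after the substitution [F], whose derivative is at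
    most 2t. *)
Lemma sp_sp_ge t : 0 < t -> exists2 c : R, 0 < c & forall s p r,
  9 / 10 * t <= s <= 11 / 10 * t -> continuous p -> (forall x, 0 <= p x) ->
  c * Kop (9 / 10 * t) (11 / 10 * t) p r <= sp t (sp s p) r.
Proof.
move=> t0; have [c0 c00 H0] := @avg_coord_ge R n.
exists (c0 / (2 * t)); first by rewrite divr_gt0// mulr_gt0.
move=> s p r /andP[s1 s2] cp p0.
have [A1 A2 A3 A4] := law_of_cosines_bounds t0 s1 s2.
rewrite (sp_product n s t r cp); pose h x := sp x p r.
have ch : continuous h by exact: spr_cont.
have h0 x : 0 <= h x by apply: sp_ge0.
pose F u := Num.sqrt (t ^+ 2 + s ^+ 2 + 2 * t * s * u).
have cF : continuous F by rewrite /F; cont.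
have -> : avg (fun w : V => sp (enorm (t *: e1 + s *: w)) p r) = avg (fun w : V => h (F (w 0 0))).
  apply: avg_eq.
  - by move=> w w1; rewrite enorm_rs.
  - by apply: (comp_cont ch); cont.
  - by apply: (comp_cont ch); apply: (comp_cont cF); cont.
apply: le_trans (H0 (fun u => h (F u)) _ _); last 2 first.
- exact: comp_cont.
- by move=> x; exact: h0.
rewrite -mulrA ler_pM2l// [leLHS]mulrC ler_pdivrMr ?mulr_gt0// [leRHS]mulrC.
(* The maximum equals [F u] on the interval of integration and keeps [dF] continuous on the whole
   line. *)
pose dF u := t * s / Num.max (t / 2) (F u).
have s0 : 0 < s by lra.
have F2 u : - (7 / 10) <= u <= 7 / 10 -> 0 < t ^+ 2 + s ^+ 2 + 2 * t * s * u /\ t / 2 <= F u.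
  move=> /andP[u1 u2].
  have H1 := A1 u u1.
  split; first by apply: lt_le_trans H1; rewrite exprn_gt0// divr_gt0.
  have t2 : 0 <= t / 2 by rewrite divr_ge0 ?ltW.
  by rewrite /F -[leLHS](ger0_norm t2) -sqrtr_sqr ler_wsqrtr.
have cdF : continuous dF.
  apply: mul_cont; first exact: cst_cont.
  apply: inv_cont; last by cont.
  by move=> x; apply: lt0r_neq0; rewrite lt_max divr_gt0.
have FdF u : - (7 / 10) <= u <= 7 / 10 -> is_derive (u : R) 1 F (dF u).
  move=> ur; have [f0 fl] := F2 u ur.
  have H1 : is_derive (u : R) 1 (fun u => t ^+ 2 + s ^+ 2 + 2 * t * s * u)
      (0 + (0 * u + 2 * t * s * 1)).
    exact: (derD (derC (t ^+ 2 + s ^+ 2) u) (derM (derC (2 * t * s) u) (derI u))).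
  have H := @der_sqrt R (fun u => t ^+ 2 + s ^+ 2 + 2 * t * s * u) u _ f0 H1.
  apply: is_derive_eq H _; rewrite /dF max_r// /F.
  have : 0 < Num.sqrt (t ^+ 2 + s ^+ 2 + 2 * t * s * u) by rewrite sqrtr_gt0.
  move=> /lt0r_neq0; set z := Num.sqrt _ => z0; by field.
have := @intv_subst_ge R F dF h (- (7 / 10)) (7 / 10) (2 * t) _ FdF _ cF cdF ch h0.
have l1 : - (7 / 10) < 7 / 10 :> R by lra.
move=> /(_ l1) H; rewrite /Kop -[X in intv _ _ X]/h.
apply: le_trans (H _); last first.
  move=> x xr; have [f0 fl] := F2 x xr; rewrite /dF max_r//.
  have fx : 0 < F x by apply: lt_le_trans fl; rewrite divr_gt0.
  rewrite divr_gt0 ?mulr_gt0//= ler_pdivrMr//.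
  have : s ^+ 2 <= 4 * F x ^+ 2.
    rewrite /F sqr_sqrtr; last exact: ltW.
    by have /andP[x1 _] := xr; exact: A2.
  rewrite (_ : 4 * F x ^+ 2 = (2 * F x) ^+ 2); last by ring.
  have Fx2 : 0 <= 2 * F x by rewrite mulr_ge0// ltW.
  have s0' : 0 <= s by exact: ltW.
  rewrite ler_pXn2r ?nnegrE// => hs.
  by rewrite (_ : 2 * t * F x = t * (2 * F x)) ?ler_pM2l//; ring.
have t9 : 0 <= 9 / 10 * t by rewrite mulr_ge0// ltW.
have t11 : 0 <= 11 / 10 * t by rewrite mulr_ge0// ltW.
apply: intv_sub => //.
  by rewrite /F -[leRHS](ger0_norm t9) -sqrtr_sqr ler_wsqrtr.
by rewrite /F -[leLHS](ger0_norm t11) -sqrtr_sqr ler_wsqrtr.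
Qed.

Definition sp3 t p := sp t (sp t (sp t p)).

Lemma sp3_cont t p : continuous p -> continuous (sp3 t p).
Proof. by move=> cp; do 3 apply: sp_cont. Qed.

(** Two factors dominate K by [sp_sp_ge], so three dominate M_t K. Since M_t commutes with K, the
    latter is a mixture of products M_t M_x with x near t, each of which dominates K once more. *)
Lemma sp3_ge t : 0 < t -> exists2 c : R, 0 < c & forall p r,
  continuous p -> (forall x, 0 <= p x) ->
  c * Kop (9 / 10 * t) (11 / 10 * t) p r <= sp3 t p r /\
  c * sp t (Kop (9 / 10 * t) (11 / 10 * t) p) r <= sp3 t p r.
Proof.
move=> t0; have [c c0 H] := sp_sp_ge t0.
pose a := 9 / 10 * t; pose b := 11 / 10 * t.
have ab : a < b by exact: ab_lt.
have tab : a <= t <= b by rewrite /a /b; apply/andP; split; lra.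
have step p r : continuous p -> (forall x, 0 <= p x) ->
    c * sp t (Kop a b p) r <= sp3 t p r.
  move=> cp p0; rewrite -sp_scale; last exact: Kop_cont.
  apply: sp_le; first by apply: mul_cont; [exact: cst_cont|exact: Kop_cont].
    by do 2 apply: sp_cont.
  by move=> x _; exact: H.
exists (Num.min c (c * (c * (b - a)))).
  by rewrite lt_min c0/= !mulr_gt0// subr_gt0.
move=> p r cp p0.
have K0 : 0 <= Kop a b p r by exact: Kop_ge0.
have S0 : 0 <= sp t (Kop a b p) r.
  by apply: sp_ge0 => [|x _]; [exact: Kop_cont|exact: Kop_ge0].
split; last first.
  by apply: le_trans (step p r cp p0); rewrite ler_wpM2r// ge_min lexx.
apply: le_trans (step p r cp p0).
apply: (@le_trans _ _ (c * (c * (b - a)) * Kop a b p r)).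
  by rewrite ler_wpM2r// ge_min lexx orbT.
rewrite -mulrA ler_pM2l// (sp_Kop _ _ t r cp) /Kop.
apply: (@le_trans _ _ (intv a b (fun=> c * Kop a b p r))).
  by rewrite intv_cst ?(ltW ab)// mulrAC.
apply: intv_le; [exact: cst_cont|by apply: spr_cont; exact: sp_cont|].
by move=> x xab; rewrite (sp_comm n x t r cp); exact: H.
Qed.

(* Spreading by a small radius s only widens the interval of radii. *)
Lemma sp_Kop_le t s p r : 0 < t -> 0 < s <= t / 20 -> continuous p ->
  (forall x, 0 <= p x) ->
  sp s (Kop (19 / 20 * t) (21 / 20 * t) p) r <= 3 * Kop (9 / 10 * t) (11 / 10 * t) p r.
Proof.
move=> t0 /andP[s0 st] cp p0.
rewrite (sp_Kop _ _ s r cp) /Kop; set a := 19 / 20 * t; set b := 21 / 20 * t.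
pose h x := sp x p r.
have ch : continuous h by exact: spr_cont.
have h0 x : 0 <= h x by apply: sp_ge0.
have -> : (fun x => sp x (sp s p) r) = (fun x => avg (fun w : V => h (enorm (x *: e1 + s *: w)))).
  by apply/funext => x; exact: sp_product.
rewrite (@intv_avg_swap _ _ (fun y : R * V => h (enorm (y.1 *: e1 + s *: y.2)))) /=; last first.
  by apply: (comp_cont ch); cont.
rewrite -[leRHS](@avg_cst R n); apply: avg_le; last exact: cst_cont; last first.
  by apply: intv_continuous; apply: (comp_cont ch); cont.
move=> w w1; pose u := w 0 0.
have := coord0_le1 w1; rewrite -/u ler_norml => /andP[u1 u2].
pose F x := Num.sqrt (x ^+ 2 + s ^+ 2 + 2 * x * s * u).
have FE x : enorm (x *: e1 + s *: w) = F x by rewrite enorm_rs.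
under [X in intv _ _ X]eq_fun do rewrite FE.
pose dF x := (x + s * u) / Num.max (t / 2) (F x).
have cF : continuous F by rewrite /F; cont.
have Fb x : a <= x <= b -> [/\ 0 < x, x - s <= F x, F x <= x + s & t / 2 <= F x].
  move=> /andP[x1 x2]; have x0 : 0 < x by rewrite /a in x1; lra.
  have h1 := enorm_rs_ge x s w1; have h2 := enorm_rs_le x s w1.
  rewrite FE !gtr0_norm// in h1 h2.
  by split => //; rewrite /a in x1; lra.
have cdF : continuous dF.
  apply: mul_cont; first by cont.
  apply: inv_cont; last by cont.
  by move=> x; apply: lt0r_neq0; rewrite lt_max divr_gt0.
have FdF x : a <= x <= b -> is_derive (x : R) 1 F (dF x).
  move=> xr; have [x0 f1 f2 f3] := Fb x xr.
  have fp : 0 < F x by lra.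
  have H1 : is_derive (x : R) 1 (fun x => x ^+ 2 + s ^+ 2 + 2 * s * u * x)
     (2 * x ^+ 1 * 1 + 0 + (0 * x + 2 * s * u * 1)).
    exact: (derD (derD (derX 1 (derI x)) (derC (s ^+ 2) x)) (derM (derC (2 * s * u) x) (derI x))).
  have FE2 : F = (fun x => Num.sqrt (x ^+ 2 + s ^+ 2 + 2 * s * u * x)).
    by apply/funext => y; congr Num.sqrt; ring.
  have pos : 0 < x ^+ 2 + s ^+ 2 + 2 * s * u * x by move: fp; rewrite FE2 sqrtr_gt0.
  have H := @der_sqrt R (fun x => x ^+ 2 + s ^+ 2 + 2 * s * u * x) x _ pos H1.
  rewrite /dF max_r// FE2; apply: is_derive_eq H _.
  move: fp; rewrite FE2 => /lt0r_neq0; set z := Num.sqrt _ => z0; by field.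
have ab : a < b by rewrite /a /b; lra.
(* The derivative (x + s u) / F x is at least (x - s) / (x + s), far above 1/3, and F moves the
   endpoints by at most s <= t/20. *)
apply: le_trans (@intv_subst_le R F dF h a b 3 ab FdF _ cF cdF ch h0) _.
  move=> x xr; have [x0 f1 f2 f3] := Fb x xr.
  have fp : 0 < F x by lra.
  have /andP[x1 x2] := xr; rewrite /a in x1.
  have su : - s <= s * u by nra.
  rewrite /dF max_r//; split; first by rewrite divr_gt0//; lra.
  by rewrite mulrA ler_pdivlMr// mul1r; lra.
rewrite ler_pM2l//; apply: intv_sub => //.
  by have [|x0 f1 f2 f3] := Fb a; [rewrite lexx ltW|rewrite /a in f1 *; lra].
by have [|x0 f1 f2 f3] := Fb b; [rewrite lexx ltW|rewrite /b in f2 *; lra].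
Qed.

(** The two kinds of radius serve different ends: s = t describes the increments p_(k+1) - p_k, and
    small s feeds the maximum principle near 0. *)
Lemma lazy t s : 0 < t -> (0 < s <= t / 20 \/ s = t) -> exists2 c : R, 0 < c & forall p r,
  continuous p -> (forall x, 0 <= p x) ->
  c * (Kop (19 / 20 * t) (21 / 20 * t) p r + sp s (Kop (19 / 20 * t) (21 / 20 * t) p) r)
    <= sp3 t p r.
Proof.
move=> t0 st; have [c c0 H] := sp3_ge t0; exists (c / 6); first by rewrite divr_gt0.
move=> p r cp p0; pose K := Kop (19 / 20 * t) (21 / 20 * t).
rewrite -/K; pose K' := Kop (9 / 10 * t) (11 / 10 * t).
have KK x : K p x <= K' p x by apply: Kop_sub => //; lra.
have [h1 h2] := H p r cp p0; rewrite -/K' in h1 h2.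
have K0 : 0 <= K p r by exact: Kop_ge0.
have K'0 : 0 <= K' p r by exact: Kop_ge0.
have c1 : c * K p r <= c * K' p r by rewrite ler_pM2l.
have S3 : 0 <= sp3 t p r by apply: le_trans h1; rewrite mulr_ge0 ?(ltW c0).
case: st => [st|->].
  have h3 := sp_Kop_le r t0 st cp p0; rewrite -/K' -/K in h3.
  have c2 : c * sp s (K p) r <= c * (3 * K' p r) by rewrite ler_pM2l.
  move: h1 c2 c1 S3; clear; move: (K p r) (K' p r) (sp s _ r) (sp3 t p r) => x y z w; lra.
have h3 : sp t (K p) r <= sp t (K' p) r.
  by apply: sp_le => [||x _]; [exact: Kop_cont|exact: Kop_cont|exact: KK].
have c2 : c * sp t (K p) r <= c * sp t (K' p) r by rewrite ler_pM2l.
move: h2 c2 h1 c1 S3; clear; move: (K p r) (K' p r) (sp t (K p) r) (sp t (K' p) r) (sp3 t p r) => x y z w v; lra.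
Qed.

End laziness.

(** * Growth of sequences dominated by a positive operator *)

Section binomial_bounds.
Context {R : realType}.

(* Coefficient of X^l in (1 + X)^i (X - 1). *)
Definition diff_coef (i l : nat) : R :=
  (if l is l'.+1 then 'C(i, l')%:R else 0) - 'C(i, l)%:R.

Lemma diff_coefS i l : diff_coef i.+1 l.+1 = diff_coef i l.+1 + diff_coef i l.
Proof.
rewrite /diff_coef; case: l => [|l]; rewrite !binS !natrD ?bin0; ring.
Qed.

(** The difference of neighboring binomial coefficients is ['C(i.+1, l)] times a linear function of
    l, so its l^1 norm is a mean absolute deviation of the binomial law, to be estimated through the
    variance. *)
Lemma diff_coefE i l : i.+1%:R * diff_coef i l = 'C(i.+1, l)%:R * (l%:R *+ 2 - i.+1%:R).
Proof.
rewrite /diff_coef; case: l => [|l].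
  by rewrite !bin0 mul0rn; ring.
have h1 : (i.+1 * 'C(i, l))%:R = (l.+1 * 'C(i.+1, l.+1))%:R :> R.
  by rewrite mul_bin_diag.
have h2 : i.+1%:R * 'C(i, l.+1)%:R = (i.+1%:R - l.+1%:R) * 'C(i.+1, l.+1)%:R :> R.
  rewrite mulrBl -!natrM -h1 !natrM -mulrBr; congr (_ * _).
  by rewrite binS natrD addrK.
by rewrite mulrBr h2 -natrM h1 natrM; ring.
Qed.

Lemma sum_binS N (f : nat -> R) :
  \sum_(l < N.+2) 'C(N.+1, l)%:R * f l = \sum_(l < N.+1) 'C(N, l)%:R * (f l + f l.+1).
Proof.
rewrite big_ord_recl /= bin0 mul1r.
under eq_bigr do rewrite /bump /= add1n binS natrD mulrDl.
rewrite big_split /=.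
under [RHS]eq_bigr do rewrite mulrDr.
rewrite big_split /= addrA; congr (_ + _).
rewrite [in RHS]big_ord_recl /= bin0 mul1r; congr (_ + _).
rewrite big_ord_recr /= bin_small ?mul0r ?addr0//.
Qed.

Lemma sum_bin N : \sum_(l < N.+1) 'C(N, l)%:R = 2 ^+ N :> R.
Proof.
elim: N => [|N IH]; first by rewrite big_ord_recl big_ord0 bin0 addr0.
have := sum_binS N (fun=> 1).
under eq_bigr do rewrite mulr1; move=> ->.
under eq_bigr do rewrite mulrC.
by rewrite -mulr_sumr IH exprS.
Qed.

(** The variance of the symmetric binomial law. *)
Lemma sum_bin_sqr N :
  \sum_(l < N.+1) 'C(N, l)%:R * (l%:R *+ 2 - N%:R) ^+ 2 = N%:R * 2 ^+ N :> R.
Proof.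
elim: N => [|N IH].
  by rewrite big_ord_recl big_ord0 mul0rn subrr expr0n mulr0 addr0 mul0r.
rewrite (sum_binS N (fun l => (l%:R *+ 2 - N.+1%:R) ^+ 2)).
transitivity (\sum_(l < N.+1) (2 * ('C(N, l)%:R * (l%:R *+ 2 - N%:R) ^+ 2) + 2 * 'C(N, l)%:R) : R).
  by apply: eq_bigr => l _; rewrite -!natr1; set u := (l : nat)%:R; ring.
by rewrite big_split -!mulr_sumr /= IH sum_bin exprS -natr1; ring.
Qed.

(* AM-GM with weight tau replaces the Cauchy-Schwarz bound 2^(i+1) / sqrt (i+1). *)
Lemma sum_diff_coef i (tau : R) : 0 < tau ->
  \sum_(l < i.+2) `|diff_coef i l| <= 2 ^+ i * (tau / i.+1%:R + tau^-1).
Proof.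
move=> tau0; have ip : 0 < i.+1%:R :> R by rewrite ltr0n.
rewrite -(ler_pM2l ip) mulr_sumr.
apply: (@le_trans _ _ (\sum_(l < i.+2) (tau / 2 * 'C(i.+1, l)%:R +
    (2 * tau)^-1 * ('C(i.+1, l)%:R * (l%:R *+ 2 - i.+1%:R) ^+ 2)))).
  apply: ler_sum => l _.
  rewrite -{1}(gtr0_norm ip) -normrM diff_coefE normrM ger0_norm//.
  set C := 'C(_, _)%:R; set z := _ - _.
  have C0 : 0 <= C by rewrite ler0n.
  rewrite (_ : _ + _ = C * (tau / 2 + (2 * tau)^-1 * z ^+ 2)); last by ring.
  rewrite ler_wpM2l//.
  have tn : tau != 0 by rewrite gt_eqF.
  have -> : tau / 2 + (2 * tau)^-1 * z ^+ 2 =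
     `|z| + (2 * tau)^-1 * (`|z| - tau) ^+ 2.
    by rewrite -(real_normK (num_real z)); field.
  by rewrite lerDl mulr_ge0 ?sqr_ge0// invr_ge0 mulr_ge0 ?(ltW tau0).
rewrite big_split -!mulr_sumr /= sum_bin sum_bin_sqr.
set N := i.+1%:R in ip *; rewrite exprS; set P := 2 ^+ i.
have Nn : N != 0 by rewrite gt_eqF.
have tn : tau != 0 by rewrite gt_eqF.
rewrite le_eqVlt; apply/orP; left; apply/eqP; field; rewrite tn addrC natr1; exact: Nn.
Qed.

End binomial_bounds.

(** * Positive operators with a common eigenfunction *)

Section positive_operators.
Context {R : realType} (phi : R -> R).
Hypothesis phi_gt0 : forall x, 0 < phi x.
Hypothesis phi_cont : continuous phi.
Implicit Types (p q : R -> R) (O : (R -> R) -> R -> R) (W : R -> R).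

(* A linear operator of range l (the value at r only depends on [0, |r| + l]),
   positive, with eigenfunction phi. *)
Record posop O (lam l : R) : Prop := {
  posop_cont : forall p, continuous p -> continuous (O p);
  posopD : forall p q r, continuous p -> continuous q ->
    O (fun x => p x + q x) r = O p r + O q r;
  posopZ : forall c p r, continuous p -> O (fun x => c * p x) r = c * O p r;
  posop_ge0 : forall p r, continuous p ->
    (forall x, 0 <= x <= `|r| + l -> 0 <= p x) -> 0 <= O p r;
  posop_phi : forall r, O phi r = lam * phi r }.

Lemma posopB O lam l p q r : posop O lam l -> continuous p -> continuous q ->
  O (fun x => p x - q x) r = O p r - O q r.
Proof.
move=> PO cp cq.
rewrite (_ : (fun x => _) = (fun x => p x + (-1) * q x)); last first.
  by apply/funext => x; rewrite mulN1r.
have cq' : continuous (fun x => (-1) * q x) by cont.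
by rewrite (posopD PO r cp cq') (posopZ PO _ _ cq) mulN1r.
Qed.

Lemma posop_le O lam l p q r : posop O lam l -> continuous p -> continuous q ->
  (forall x, 0 <= x <= `|r| + l -> p x <= q x) -> O p r <= O q r.
Proof.
move=> PO cp cq pq; rewrite -subr_ge0 -(posopB r PO cq cp).
have c : continuous (fun x => q x - p x) by cont.
by apply: (posop_ge0 PO c) => x xr; rewrite subr_ge0 pq.
Qed.

Lemma posop_eq O lam l p q r : posop O lam l -> continuous p -> continuous q ->
  (forall x, 0 <= x <= `|r| + l -> p x = q x) -> O p r = O q r.
Proof.
move=> PO cp cq pq; apply/le_anti/andP; split; apply: (posop_le PO) => // x xr;
  by rewrite pq.
Qed.

Lemma posop_widen O lam l l' : l <= l' -> posop O lam l -> posop O lam l'.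
Proof.
move=> ll [h1 h2 h3 h4 h5]; split => // p r cp H; apply: h4 => // x /andP[x0 xl].
by apply: H; rewrite x0 (le_trans xl)// lerD2l.
Qed.

Lemma posop_comp O1 O2 lam1 lam2 l1 l2 : posop O1 lam1 l1 -> posop O2 lam2 l2 ->
  posop (fun p => O1 (O2 p)) (lam1 * lam2) (l1 + l2).
Proof.
move=> P1 P2; split => [p cp|p q r cp cq|c p r cp|p r cp H|r].
- exact: (posop_cont P1 (posop_cont P2 cp)).
- rewrite (_ : O2 _ = (fun x => O2 p x + O2 q x)); last first.
    by apply/funext => x; exact: (posopD P2).
  by apply: (posopD P1); exact: (posop_cont P2).
- rewrite (_ : O2 _ = (fun x => c * O2 p x)); last first.
    by apply/funext => x; exact: (posopZ P2).
  by apply: (posopZ P1); exact: (posop_cont P2).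
- apply: (posop_ge0 P1 (posop_cont P2 cp)) => x /andP[x0 xl].
  apply: (posop_ge0 P2 cp) => z /andP[z0 zl]; apply: H; rewrite z0 (le_trans zl)//.
  by rewrite ger0_norm// addrA lerD2r.
- rewrite (_ : O2 phi = (fun x => lam2 * phi x)); last first.
    by apply/funext => x; exact: (posop_phi P2).
  by rewrite (posopZ P1 _ _ phi_cont) (posop_phi P1) mulrCA mulrA.
Qed.

Lemma posop_scale O c lam l : 0 <= c -> posop O lam l ->
  posop (fun p r => c * O p r) (c * lam) l.
Proof.
move=> c0 PO; split => [p cp|p q r cp cq|k p r cp|p r cp H|r].
- by have := posop_cont PO cp => cO; cont.
- by rewrite (posopD PO)// mulrDr.
- by rewrite (posopZ PO)// mulrCA.
- by rewrite mulr_ge0// (posop_ge0 PO).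
- by rewrite (posop_phi PO) mulrA.
Qed.

Lemma posop_sum O lam l N (c : nat -> R) (f : nat -> R -> R) r : posop O lam l ->
  (forall i, continuous (f i)) ->
  O (fun x => \sum_(i < N) c i * f i x) r = \sum_(i < N) c i * O (f i) r.
Proof.
move=> PO cf; elim: N => [|N IH].
  rewrite big_ord0 (_ : (fun _ => _) = (fun x => 0 * phi x)); last first.
    by apply/funext => x; rewrite big_ord0 mul0r.
  by rewrite (posopZ PO _ _ phi_cont) mul0r.
rewrite (_ : (fun _ => _) = (fun x => (\sum_(i < N) c i * f i x) + c N * f N x)); last first.
  by apply/funext => x; rewrite big_ord_recr.
have c1 : continuous (fun x => \sum_(i < N) c i * f i x).
  by apply: sum_cont => i; have := cf i => cfi; cont.
have c2 : continuous (fun x => c N * f N x) by have := cf N => cfi; cont.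
by rewrite (posopD PO _ c1 c2) IH (posopZ PO) ?big_ord_recr.
Qed.

Definition dominated p W := forall x, `|p x| <= phi x * W `|x|.

Definition weight W := (forall x, 0 <= W x) /\ (forall x y, 0 <= x -> x <= y -> W x <= W y).

Lemma weight_shift W c l : 0 <= c -> 0 <= l -> weight W -> weight (fun x => c * W (x + l)).
Proof.
move=> c0 l0 [W0 W1]; split => [x|x y x0 xy]; first by rewrite mulr_ge0.
by rewrite ler_wpM2l// W1 ?lerD2r// addr_ge0.
Qed.

(** On the range of [O] at r the function p lies between the constant multiples of [phi] by W (|r| +
    l) and its negative; positivity and the eigenvalue equation do the rest. *)
Lemma posop_dominated O lam l p W : 0 <= l -> posop O lam l -> weight W -> continuous p ->
  dominated p W -> dominated (O p) (fun x => lam * W (x + l)).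
Proof.
move=> l0 PO [_ W1] cp pW r; pose c := W (`|r| + l).
have cc : continuous (fun x => c * phi x) by cont.
have H x : 0 <= x <= `|r| + l -> `|p x| <= c * phi x.
  move=> /andP[x0 xr]; apply: le_trans (pW x) _; rewrite mulrC ler_wpM2r ?(ltW (phi_gt0 x))//.
  by rewrite ger0_norm// W1.
have E : phi r * (lam * W (`|r| + l)) = O (fun x => c * phi x) r.
  by rewrite (posopZ PO _ _ phi_cont) (posop_phi PO) -/c; ring.
rewrite E ler_norml; apply/andP; split; last first.
  by apply: (posop_le PO cp cc) => x /H; rewrite ler_norml => /andP[].
have cN : continuous (fun x => - 1 * (c * phi x)) by cont.
rewrite -mulN1r -(posopZ PO (-1) r cc).
by apply: (posop_le PO cN cp) => x /H; rewrite mulN1r ler_norml => /andP[].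
Qed.

Lemma dominated_sum N (c : nat -> R) (f : nat -> R -> R) W : weight W ->
  (forall i, (i < N)%N -> dominated (f i) W) ->
  dominated (fun x => \sum_(i < N) c i * f i x) (fun x => (\sum_(i < N) `|c i|) * W x).
Proof.
move=> [W0 _] fW x; apply: le_trans (ler_norm_sum _ _ _) _.
rewrite mulrCA mulr_suml; apply: ler_sum => i _; rewrite normrM ler_wpM2l// fW//.
Qed.

(** * Decay of B^n (F - 1) when B dominates y K (1 + F) *)

Variables (B K F : (R -> R) -> R -> R) (y t : R) (p W : R -> R).
Hypothesis t0 : 0 < t.
Hypothesis y0 : 0 < y.
Hypothesis y4 : y <= 1 / 4.
Hypothesis PB : posop B 1 (3 * t).
Hypothesis PK : posop K 1 (2 * t).
Hypothesis PF : posop F 1 t.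
Hypothesis PR : posop (fun q r => B q r - y * (K q r + K (F q) r)) (1 - 2 * y) (3 * t).
Hypothesis BF : forall q r, continuous q -> B (F q) r = F (B q) r.
Hypothesis cp : continuous p.
Hypothesis wW : weight W.
Hypothesis pW : dominated p W.

(** This is (1 + F)^i (F - 1) p; [GE] expands it in powers of F with the coefficients
    [diff_coef]. *)
Let G i := iter i (fun g x => g x + F g x) (fun x => F p x - p x).
Let Fl l := iter l F p.

Let cFl l : continuous (Fl l).
Proof. by elim: l => // l IH; exact: (posop_cont PF IH). Qed.

Let cG i : continuous (G i).
Proof.
elim: i => [|i IH]; have cF := fun q => @posop_cont _ _ _ PF q.
  by have cFp := cF _ cp; rewrite /G /=; cont.
by have cFG := cF _ IH; rewrite /G /= -/(G i); cont.
Qed.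

Let GE i x : G i x = \sum_(l < i.+2) diff_coef i l * Fl l x.
Proof.
elim: i x => [|i IH] x.
  by rewrite !big_ord_recl big_ord0 /diff_coef /= /G /=; rewrite bin0 bin1; ring.
rewrite /G /= -/(G i) IH.
rewrite (_ : G i = (fun x => \sum_(l < i.+2) diff_coef i l * Fl l x)); last exact/funext.
rewrite (posop_sum i.+2 (diff_coef i) x PF cFl) [RHS]big_ord_recl.
rewrite [X in _ = _ + X](_ : _ = (\sum_(l < i.+2) diff_coef i l.+1 * Fl l.+1 x) +
    \sum_(l < i.+2) diff_coef i l * Fl l.+1 x); last first.
  rewrite -big_split; apply: eq_bigr => l _.
  by rewrite (_ : (lift ord0 l : nat) = l.+1)// diff_coefS mulrDl.
rewrite addrA; congr (_ + _).
rewrite [in RHS]big_ord_recr /= big_ord_recl /=.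
rewrite {5}/diff_coef !bin_small// subrr mul0r addr0.
by congr (_ + _); rewrite /diff_coef !bin0.
Qed.

Let wshift c l : 0 <= c -> 0 <= l -> weight (fun x => c * W (x + l)).
Proof. by move=> c0 l0; exact: weight_shift. Qed.

Let dom_Fl l : dominated (Fl l) (fun x => W (x + l%:R * t)).
Proof.
elim: l => [|l IH]; first by move=> x; rewrite mul0r addr0; exact: pW.
have w : weight (fun x => W (x + l%:R * t)).
  have lt0 : 0 <= l%:R * t by rewrite mulr_ge0// ltW.
  have [w1 w2] := wshift ler01 lt0.
  by split => [x|x z x0 xz]; [have := w1 x|have := w2 x z x0 xz]; rewrite !mul1r.
move=> x; have := posop_dominated (ltW t0) PF w (@cFl l) IH x.
by rewrite mul1r -addrA -natr1 mulrDl mul1r [t + _]addrC.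
Qed.

Let dom_G i tau : 0 < tau ->
  dominated (G i) (fun x => 2 ^+ i * (tau / i.+1%:R + tau^-1) * W (x + i.+1%:R * t)).
Proof.
move=> tau0 x; have [W0 W1] := wW.
rewrite GE.
have w1 : weight (fun x => W (x + i.+1%:R * t)).
  have lt0 : 0 <= i.+1%:R * t by rewrite mulr_ge0// ltW.
  have [v1 v2] := wshift ler01 lt0.
  by split => [u|u z x0 xz]; [have := v1 u|have := v2 u z x0 xz]; rewrite !mul1r.
have H l : (l < i.+2)%N -> dominated (Fl l) (fun x => W (x + i.+1%:R * t)).
  move=> li u; apply: le_trans (dom_Fl l u) _; rewrite ler_wpM2l ?(ltW (phi_gt0 _))//.
  apply: W1; first by rewrite addr_ge0// mulr_ge0// ltW.
  by rewrite lerD2l ler_wpM2r ?(ltW t0)// ler_nat -ltnS.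
apply: le_trans (@dominated_sum i.+2 (diff_coef i) Fl _ w1 H x) _.
by rewrite ler_wpM2l ?(ltW (phi_gt0 _))// ler_wpM2r// sum_diff_coef.
Qed.

(** This is B^n (1 + F)^i (F - 1) p. The index i records how many lazy factors have been split off
    from the powers of B. *)
Let H_ n i := iter n B (G i).

Let cH n i : continuous (H_ n i).
Proof. by elim: n => [|n IH]; [exact: cG|exact: (posop_cont PB IH)]. Qed.

Let HS n i x : H_ n i x + F (H_ n i) x = H_ n i.+1 x.
Proof.
elim: n x => [|n IH] x //.
rewrite /H_ /= -/(H_ n i) -/(H_ n i.+1) -BF; last exact: cH.
rewrite (_ : H_ n i.+1 = (fun x => H_ n i x + F (H_ n i) x)); last exact/esym/funext.
by rewrite (posopD PB x (@cH n i) (posop_cont PF (@cH n i))).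
Qed.

(* [2^i (tau / z + 1 / tau)] with [z = y n + i + 1] is superharmonic for the
   walk n -> n+1, i -> i+1 (weight y), i -> i (weight 1 - 2 y). *)
Lemma superharmonic (z : R) : 1 <= z -> 2 * y / (z + 1) + (1 - 2 * y) / z <= (z + y)^-1.
Proof.
move=> z1; have z0 : 0 < z by lra.
have zp : 0 < z + 1 by lra.
have zy : 0 < z + y by have := y0; lra.
rewrite addf_div ?gt_eqF// -[leRHS]mul1r ler_pdivrMr ?mulr_gt0//.
rewrite [leRHS]mulrAC ler_pdivlMr// mul1r; have := y0; have := y4; nra.
Qed.

(** Write B as the positive operator of [PR], of mass 1 - 2y, plus y K (1 + F). The first part keeps
    i, the second raises it by one at the cost y, while 2^i doubles: hence the weights 1 - 2y and 2y
    of [superharmonic]. *)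
Lemma growth_aux n i tau : 0 < tau -> dominated (H_ n i) (fun x =>
  2 ^+ i * (tau / (y * n%:R + i.+1%:R) + tau^-1) * W (x + i.+1%:R * t + 3 * t * n%:R)).
Proof.
move=> tau0; have [W0 W1] := wW.
elim: n i => [|n IH] i; first by move=> x; rewrite !mulr0 add0r addr0; exact: dom_G.
pose z := y * n%:R + i.+1%:R.
have i0 : 1 <= i.+1%:R :> R by rewrite ler1n.
have n0 : 0 <= n%:R :> R by rewrite ler0n.
have yn : 0 <= y * n%:R by rewrite mulr_ge0// ltW.
have z1 : 1 <= z by rewrite /z; lra.
have t00 := ltW t0.
have W' N j : weight (fun x => 2 ^+ j * (tau / (y * N%:R + j.+1%:R) + tau^-1) *
    W (x + j.+1%:R * t + 3 * t * N%:R)).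
  have h1 : 0 <= 2 ^+ j * (tau / (y * N%:R + j.+1%:R) + tau^-1).
    by rewrite mulr_ge0 ?exprn_ge0// addr_ge0 ?invr_ge0 ?divr_ge0 ?addr_ge0 ?mulr_ge0 ?(ltW tau0) ?(ltW y0).
  have h2 : 0 <= j.+1%:R * t + 3 * t * N%:R by rewrite addr_ge0 ?mulr_ge0.
  have [v1 v2] := wshift h1 h2; split => [u|u v u0 uv].
    by rewrite -addrA.
  by rewrite -!addrA; exact: v2.
move=> r; pose Wr := W (`|r| + i.+1%:R * t + 3 * t * n.+1%:R).
have E : H_ n.+1 i r = (B (H_ n i) r - y * (K (H_ n i) r + K (F (H_ n i)) r)) + y * K (H_ n i.+1) r.
  rewrite (_ : H_ n i.+1 = (fun x => H_ n i x + F (H_ n i) x)); last exact/esym/funext.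
  rewrite (posopD PK r (@cH n i) (posop_cont PF (@cH n i))).
  by rewrite subrK.
rewrite E; apply: le_trans (ler_normD _ _) _; rewrite normrM (gtr0_norm y0).
have t3 : 0 <= 3 * t by rewrite mulr_ge0.
have t2 : 0 <= 2 * t by rewrite mulr_ge0.
have D1 := posop_dominated t3 PR (W' n i) (@cH n i) (IH i) r.
have D2 := posop_dominated t2 PK (W' n i.+1) (@cH n i.+1) (IH i.+1) r.
apply: le_trans (lerD D1 (ler_wpM2l (ltW y0) D2)) _.
have -> : `|r| + 3 * t + i.+1%:R * t + 3 * t * n%:R = `|r| + i.+1%:R * t + 3 * t * n.+1%:R.
  by rewrite -[n.+1%:R]natr1; ring.
rewrite -/Wr.
set W2 := W (`|r| + 2 * t + _ + _).
have W2r : W2 <= Wr.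
  apply: W1; first by rewrite !addr_ge0 ?mulr_ge0.
  have -> : `|r| + 2 * t + i.+2%:R * t + 3 * t * n%:R = `|r| + i.+1%:R * t + 3 * t * n.+1%:R.
    by rewrite -[n.+1%:R]natr1 -[i.+2%:R]natr1; ring.
  by [].
rewrite mul1r -/z.
have -> : y * n%:R + i.+2%:R = z + 1 by rewrite /z -[i.+2%:R]natr1 addrA.
have -> : y * n.+1%:R + i.+1%:R = z + y by rewrite /z -[n.+1%:R]natr1; ring.
have S := superharmonic z1.
have p0 := phi_gt0 r; have Wr0 : 0 <= Wr by exact: W0.
rewrite exprS; set P : R := 2 ^+ i; have P0 : 0 <= P by rewrite exprn_ge0.
apply: (@le_trans _ _ (phi r * ((1 - 2 * y) * (P * (tau / z + tau^-1) * Wr)) +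
   y * (phi r * (2 * P * (tau / (z + 1) + tau^-1) * Wr)))).
  rewrite lerD2l ler_wpM2l ?(ltW y0)// ler_wpM2l ?(ltW p0)// ler_wpM2l//.
  by rewrite mulr_ge0 ?mulr_ge0// addr_ge0 ?invr_ge0 ?divr_ge0 ?(ltW tau0)//; lra.
rewrite (_ : _ + _ = phi r * P * Wr * (tau * (2 * y / (z + 1) + (1 - 2 * y) / z) + tau^-1)); last by ring.
rewrite (_ : phi r * (P * _ * _) = phi r * P * Wr * (tau * (z + y)^-1 + tau^-1)); last by ring.
rewrite ler_wpM2l ?mulr_ge0 ?(ltW p0)// lerD2r ler_wpM2l ?(ltW tau0)//.
Qed.

(** The case i = 0 of [growth_aux], with the tau that balances tau / (y n + 1) against 1 / tau. *)
Lemma growth n r : `|iter n B (fun x => F p x - p x) r| <=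
  phi r * (2 / Num.sqrt (y * n%:R + 1) * W (`|r| + t + 3 * t * n%:R)).
Proof.
pose tau := Num.sqrt (y * n%:R + 1).
have yn : 0 < y * n%:R + 1 by rewrite ltr_wpDl// mulr_ge0// ltW.
have tau0 : 0 < tau by rewrite sqrtr_gt0.
have := @growth_aux n 0 tau tau0 r; rewrite expr0 !mul1r.
have -> // : tau / (y * n%:R + 1) + tau^-1 = 2 / tau.
rewrite -[y * n%:R + 1](sqr_sqrtr (ltW yn)) -/tau; field.
by rewrite gt_eqF.
Qed.

End positive_operators.

Lemma intv_gt0 {R : realType} (a b : R) (f : R -> R) : a < b -> continuous f ->
  (forall x, a <= x <= b -> 0 < f x) -> 0 < intv a b f.
Proof.
move=> ab cf f0; have [|c cab H] := @EVT_min _ f a b (ltW ab); first exact: continuous_subspaceT.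
rewrite in_itv/= in cab.
apply: (@lt_le_trans _ _ (f c * (b - a))); first by rewrite mulr_gt0 ?f0 ?subr_gt0.
rewrite -(@intv_cst _ a b (f c) (ltW ab)); apply: intv_le => //; first exact: cst_cont.
Qed.

Section positivity.
Context {R : realType} (n : nat).
Local Notation V := 'rV[R]_n.+2.
Local Notation sp := (@sp R n).

Lemma avg_coord_gt0 (k : R -> R) : continuous k -> (forall x, 0 <= k x) ->
  (forall x, - (7 / 10) <= x <= - (6 / 10) -> 0 < k x) -> 0 < avg (fun w : V => k (w 0 0)).
Proof.
move=> ck k0 kp; have [c c0 H] := @avg_coord_ge R n.
apply: lt_le_trans (H k ck k0); rewrite mulr_gt0//.
apply: (@lt_le_trans _ _ (intv (- (7 / 10)) (- (6 / 10)) k)).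
  by apply: intv_gt0 => //; lra.
by apply: intv_sub => //; lra.
Qed.

(** For s < r the sphere of radius s around r e1 enters the open ball of radius r: w_0 <= -6/10
    suffices, and the directions with w_0 in [-7/10, -6/10] have positive measure. This is the
    strong form of the maximum principle used in [rise_neg]. *)
Lemma sp_gt0 s r (h : R -> R) : continuous h -> 0 < s -> s < r ->
  (forall x, 0 <= x <= r + s -> 0 <= h x) -> (forall x, 0 <= x < r -> 0 < h x) ->
  0 < sp s h r.
Proof.
move=> ch s0 sr h0 h1; have r0 : 0 < r by exact: lt_trans sr.
pose k x := Num.max (h (Num.sqrt (r ^+ 2 + s ^+ 2 + 2 * r * s * x))) 0.
have ck : continuous k.
  rewrite /k; apply: max_cont; last by cont.
  by apply: (gcomp_cont ch); apply: sqrt_cont; cont.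
have -> : sp s h r = avg (fun w : V => k (w 0 0)).
  apply: avg_eq => [w w1||]; [|exact: sp_arg_cont|by apply: (gcomp_cont ck); cont].
  rewrite enorm_rs// /k; apply/esym/max_idPl; rewrite -enorm_rs//; apply: h0.
  by rewrite enorm_ge0 (le_trans (enorm_rs_le _ _ w1))// !gtr0_norm.
apply: avg_coord_gt0 => // [x|x /andP[x1 x2]]; first by rewrite /k le_max lexx orbT.
rewrite /k lt_max; apply/orP; left; apply: h1.
have rs0 : 0 < r * s by rewrite mulr_gt0.
rewrite sqrtr_ge0/= -[ltRHS](gtr0_norm r0) -sqrtr_sqr ltr_sqrt ?exprn_gt0//.
by move: rs0; rewrite !expr2; nra.
Qed.

Lemma sp_at0 s (p : R -> R) : continuous p -> 0 <= s -> sp s p 0 = p s.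
Proof.
move=> cp s0; rewrite sp_sym//.
transitivity (avg (fun _ : V => p s)); last exact: avg_cst.
apply: (f_equal avg); apply/funext => w.
by rewrite scale0r addr0 enormZ enorm_e1 mulr1 ger0_norm.
Qed.

End positivity.

Global Opaque sp Phi Kop.

(** * The smoothing estimate for spherical means *)

Section smoothing.
Context {R : realType} (n : nat) (a : R).
Local Notation V := 'rV[R]_n.+2.
Local Notation sp := (@sp R n).
Local Notation sp3 := (@sp3 R n).
Local Notation Kop := (@Kop R n).
Local Notation Phi := (@Phi R n a).
Implicit Types (p q : R -> R) (r s t : R).

Let cPhi : continuous Phi. Proof. exact: Phi_continuous. Qed.

Lemma sp_posop s l : `|s| <= l -> posop Phi (sp s) (Phi s) l.
Proof.
move=> sl; split => [p cp|p q r cp cq|c p r cp|p r cp H|r].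
- exact: sp_cont.
- exact: sp_add.
- exact: sp_scale.
- by apply: sp_ge0 => // x /andP[x0 xr]; apply: H; rewrite x0 (le_trans xr)// lerD2l.
- exact: sp_Phi.
Qed.

Lemma Kop_posop b c : 0 <= b -> b <= c -> posop Phi (Kop b c) (intv b c Phi) c.
Proof.
move=> b0 bc; split => [p cp|p q r cp cq|k p r cp|p r cp H|r].
- exact: Kop_cont.
- have c1 := @spr_cont R n p r cp; have c2 := @spr_cont R n q r cq.
  transitivity (intv b c (fun x => sp x p r + sp x q r)); last exact: (intvD b c c1 c2).
  by apply: (f_equal (intv b c)); apply/funext => x; exact: sp_add.
- transitivity (intv b c (fun x => k * sp x p r)); last exact: (intvZ b c k (@spr_cont R n p r cp)).
  by apply: (f_equal (intv b c)); apply/funext => x; exact: sp_scale.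
- apply: intv_ge0 => x /andP[xb xc]; apply: sp_ge0 => // z /andP[z0 zr].
  apply: H; rewrite z0 (le_trans zr)// lerD2l ger0_norm//; exact: le_trans xb.
- exact: Kop_Phi.
Qed.

Lemma sp3_posop t : 0 <= t -> posop Phi (sp3 t) (Phi t ^+ 3) (3 * t).
Proof.
move=> t0; have P : posop Phi (sp t) (Phi t) t by apply: sp_posop; rewrite ger0_norm.
have := posop_comp cPhi P (posop_comp cPhi P P).
by rewrite !exprS expr0 mulr1 (_ : t + (t + t) = 3 * t) //; ring.
Qed.

Lemma posop_normalize O lam l : 0 < lam -> posop Phi O lam l ->
  posop Phi (fun p r => lam^-1 * O p r) 1 l.
Proof.
move=> l0 PO; have li : 0 <= lam^-1 by rewrite invr_ge0 ltW.
by have := posop_scale li PO; rewrite mulVf ?gt_eqF.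
Qed.

Lemma posop_compl O O' lam lam' l y : posop Phi O lam l -> posop Phi O' lam' l ->
  (forall p r, continuous p -> (forall x, 0 <= p x) -> y * O' p r <= O p r) ->
  posop Phi (fun p r => O p r - y * O' p r) (lam - y * lam') l.
Proof.
move=> PO PO' H; split => [p cp|p q r cp cq|k p r cp|p r cp p0|r].
- have c1 := posop_cont PO cp; have c2 := posop_cont PO' cp; cont.
- rewrite (posopD PO _ cp cq) (posopD PO' _ cp cq); ring.
- rewrite (posopZ PO _ _ cp) (posopZ PO' _ _ cp); ring.
(* Positivity of p is known only on the range of the operators. There p agrees with its positive
   part, which is nonnegative everywhere, as the comparison hypothesis demands. *)
- have cm : continuous (fun x => Num.max (p x) 0) by cont.
  have E O1 lam1 : posop Phi O1 lam1 l -> O1 p r = O1 (fun x => Num.max (p x) 0) r.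
    move=> P1; apply: (posop_eq P1 cp cm) => x xr.
    by apply/esym/max_idPl; exact: p0.
  rewrite (E _ _ PO) (E _ _ PO') subr_ge0; apply: H => // x.
  by rewrite le_max lexx orbT.
- rewrite (posop_phi PO) (posop_phi PO'); ring.
Qed.

Lemma posop_add O O' lam lam' l : posop Phi O lam l -> posop Phi O' lam' l ->
  posop Phi (fun p r => O p r + O' p r) (lam + lam') l.
Proof.
move=> PO PO'; split => [p cp|p q r cp cq|k p r cp|p r cp p0|r].
- have c1 := posop_cont PO cp; have c2 := posop_cont PO' cp; cont.
- rewrite (posopD PO _ cp cq) (posopD PO' _ cp cq); ring.
- rewrite (posopZ PO _ _ cp) (posopZ PO' _ _ cp); ring.
- by rewrite addr_ge0// ?(posop_ge0 PO)// (posop_ge0 PO').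
- rewrite (posop_phi PO) (posop_phi PO'); ring.
Qed.

Lemma sp3_sp t s p r : continuous p -> sp3 t (sp s p) r = sp s (sp3 t p) r.
Proof.
move=> cp; rewrite /sp3 -[RHS]sp_comm; last by do 2 apply: sp_cont.
apply: (f_equal (fun h => sp t h r)); apply/funext => x.
rewrite -[RHS]sp_comm; last by apply: sp_cont.
by apply: (f_equal (fun h => sp t h x)); apply/funext => z; rewrite sp_comm.
Qed.

Lemma smoothing t s : 0 < t -> (0 < s <= t / 20 \/ s = t) -> exists2 y : R, 0 < y &
  forall p W N r, continuous p -> weight W -> dominated Phi p W ->
  `|iter N (fun q x => (Phi t ^+ 3)^-1 * sp3 t q x) (fun x => (Phi s)^-1 * sp s p x - p x) r|
    <= Phi r * (2 / Num.sqrt (y * N%:R + 1) * W (`|r| + t + 3 * t * N%:R)).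
Proof.
move=> t0 st; have [c c0 L] := lazy n t0 st.
have s0 : 0 < s by case: st => [/andP[]//|->].
have sl : s <= t by case: st => [/andP[_ h]|->] //; lra.
pose k1 := 19 / 20 * t; pose k2 := 21 / 20 * t.
have k10 : 0 <= k1 by rewrite /k1; lra.
have k12 : k1 < k2 by rewrite /k1 /k2; lra.
have k2t : k2 <= 2 * t by rewrite /k2; lra.
pose kap := intv k1 k2 Phi.
have kap0 : 0 < kap by apply: intv_gt0 => // x _; exact: Phi_gt0.
have Ps : 0 < Phi s by exact: Phi_gt0.
have Pt : 0 < Phi t ^+ 3 by apply: exprn_gt0; exact: Phi_gt0.
have PF1 : posop Phi (sp s) (Phi s) t by apply: sp_posop; rewrite gtr0_norm.
have PF := posop_normalize Ps PF1.
have PK1 := Kop_posop k10 (ltW k12).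
have PK := posop_widen k2t (posop_normalize kap0 PK1).
have PB := posop_normalize Pt (sp3_posop (ltW t0)).
pose F q x := (Phi s)^-1 * sp s q x; pose K q x := kap^-1 * Kop k1 k2 q x.
pose B q x := (Phi t ^+ 3)^-1 * sp3 t q x.
have D0 : 0 < 1 + (Phi s)^-1 by rewrite addr_gt0 ?invr_gt0.
(* The bound 1/4 is the one [superharmonic] needs; the other is the constant of [lazy] after
   dividing by the eigenvalues of the four operators. *)
pose y := Num.min (1 / 4) (c * kap / (Phi t ^+ 3 * (1 + (Phi s)^-1))).
have Y1 : 0 < c * kap / (Phi t ^+ 3 * (1 + (Phi s)^-1)).
  exact: divr_gt0 (mulr_gt0 c0 kap0) (mulr_gt0 Pt D0).
have y0 : 0 < y by rewrite /y lt_min Y1 divr_gt0.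
have y4 : y <= 1 / 4 by rewrite /y ge_min lexx.
have y5 : y * (Phi t ^+ 3 * (1 + (Phi s)^-1)) <= c * kap.
  by rewrite -(ler_pdivlMr _ _ (mulr_gt0 Pt D0)) /y ge_min lexx orbT.
have KF : posop Phi (fun q r => K q r + K (F q) r) (1 + 1) (3 * t).
  have t3 : 2 * t <= 3 * t by rewrite ler_wpM2r ?(ltW t0)// ler_nat.
  apply: posop_add; first exact: (posop_widen t3 PK).
  have := posop_comp cPhi PK PF; rewrite mulr1.
  by rewrite (_ : 2 * t + t = 3 * t) //; ring.
have PR : posop Phi (fun q r => B q r - y * (K q r + K (F q) r)) (1 - 2 * y) (3 * t).
  have -> : 1 - 2 * y = 1 - y * (1 + 1) by ring.
  apply: (posop_compl PB KF) => q r cq q0.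
  have L1 := L q r cq q0; rewrite (@sp_Kop R n _ _ s q r cq) -/k1 -/k2 in L1.
  have KFE : K (F q) r = (Phi s)^-1 * K (sp s q) r.
    rewrite /K /F (posopZ PK1 _ _ (sp_cont (s := s) cq)) mulrCA; reflexivity.
  have X0 : 0 <= Kop k1 k2 q r by apply: Kop_ge0.
  have Y0 : 0 <= Kop k1 k2 (sp s q) r.
    by apply: Kop_ge0 => [|x]; [exact: sp_cont|apply: sp_ge0].
  rewrite KFE /K; move: L1 X0 Y0.
  move: (Kop k1 k2 q r) (Kop k1 k2 (sp s q) r) (sp3 t q r) => X Y Z L1 X0 Y0.
  have e1 : 0 <= (Phi s)^-1 by rewrite invr_ge0 ltW.
  apply: (@le_trans _ _ (y * (kap^-1 * ((1 + (Phi s)^-1) * (X + Y))))).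
    rewrite ler_wpM2l ?(ltW y0)// mulrCA -mulrDr ler_wpM2l ?invr_ge0 ?(ltW kap0)//.
    move: e1; clear -X0 Y0; move: ((Phi s)^-1) => z z0; nra.
  rewrite mulrCA ler_pdivrMl// [leRHS]mulrCA ler_pdivlMl//.
  apply: (@le_trans _ _ (c * kap * (X + Y))).
    by rewrite mulrA mulrA ler_wpM2r ?addr_ge0// [_ * y]mulrC -mulrA mulrC mulrC.
  by rewrite mulrAC mulrC ler_wpM2l ?(ltW kap0).
have BF q r : continuous q -> B (F q) r = F (B q) r.
  move=> cq; have c1 : continuous (sp s q) by exact: sp_cont.
  have c2 : continuous (sp3 t q) by exact: sp3_cont.
  rewrite /B /F (posopZ (sp3_posop (ltW t0)) _ _ c1) (posopZ PF1 _ _ c2).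
  by rewrite sp3_sp// mulrCA.
exists y => // p W N r cp wW pW.
have := @growth _ Phi (@Phi_gt0 R n a) cPhi B K F y t p W t0 y0 y4 PB PK PF PR BF cp wW pW N r.
exact.
Qed.

End smoothing.

Lemma growth_arith {R : realDomainType} (b y u M t : R) : 0 < b -> b <= 1 -> b <= y -> 0 <= u ->
  0 < t -> u <= M -> M <= u + 1 ->
  b * (1 + u) <= y * M + 1 /\ 1 + (u + t + 3 * t * M) <= (1 + 4 * t) * (1 + u).
Proof. by move=> *; split; nra. Qed.

(** * Sequences of radial means *)

Section mean_sequences.
Context {R : realType} (n : nat) (a t : R).
Local Notation sp := (@sp R n).
Local Notation sp3 := (@sp3 R n).
Local Notation Phi := (@Phi R n a).
Implicit Types (p : int -> R -> R) (r s : R).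

Let cPhi : continuous Phi. Proof. exact: Phi_continuous. Qed.

Let spZ s (c : R) (q : R -> R) r (cq : continuous q) : sp s (fun x => c * q x) r = c * sp s q r :=
  @sp_scale R n s c q r cq.

Let spC s r (q : R -> R) (cq : continuous q) : sp t (sp s q) r = sp s (sp t q) r :=
  @sp_comm R n t s q r cq.

Let P0 r : 0 < Phi r := @Phi_gt0 R n a r.

Let Phi_neq0 r : Phi r != 0. Proof. by rewrite gt_eqF// Phi_gt0. Qed.

(** The growth relative to [Phi] is counted in half powers of 1 + |r|, because one application of
    the smoothing estimate gains exactly one factor sqrt (1 + |r|). *)
Record mean_seq (alpha : R) (m : nat) p : Prop := {
  mean_cont : forall k, continuous (p k);
  mean_eq : forall k r, sp t (p k) r = alpha * p (k + 1) r;
  mean_bound : exists2 C, 0 <= C & forall k r,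
    `|p k r| <= Phi r * (C * Num.sqrt (1 + `|r|) ^+ m) }.

(** The operator M_s / Phi(s) - 1, which annihilates the multiples of [Phi]. *)
Definition excess s (q : R -> R) r := (Phi s)^-1 * sp s q r - q r.

Lemma excess_cont s q : continuous q -> continuous (excess s q).
Proof. by move=> cq; have c1 := @sp_cont R n s q cq; rewrite /excess; cont. Qed.

Lemma sp_excess s r q : continuous q -> sp t (excess s q) r = excess s (sp t q) r.
Proof.
move=> cq; have c1 := @sp_cont R n s q cq.
have c2 : continuous (fun x => (Phi s)^-1 * sp s q x) by cont.
by rewrite /excess (@sp_sub R n t _ _ r c2 cq) (spZ t _ r c1) (spC s r cq).
Qed.

Lemma weight_sqrt C m : 0 <= C -> weight (fun x : R => C * Num.sqrt (1 + x) ^+ m).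
Proof.
move=> C0; split => [x|x y x0 xy]; first by rewrite mulr_ge0// exprn_ge0.
by rewrite ler_wpM2l// lerXn2r ?nnegrE ?sqrtr_ge0// ler_wsqrtr// lerD2l.
Qed.

Lemma mean_iter p N k : (forall k, continuous (p k)) ->
  (forall k r, sp t (p k) r = Phi t * p (k + 1) r) ->
  iter N (fun q x => (Phi t ^+ 3)^-1 * sp3 t q x) (p k) = p (k + (3 * N)%:Z).
Proof.
move=> cp H; elim: N => [|N IH]; first by rewrite muln0 addr0.
have E c j : sp t (fun y => c * p j y) = (fun y => c * Phi t * p (j + 1) y).
  by apply/funext => y; rewrite (spZ t c y (cp j)) H mulrA.
have E1 j : sp t (p j) = (fun y => Phi t * p (j + 1) y) by apply/funext => y; exact: H.
rewrite iterS IH; apply/funext => x; rewrite /sp3 E1 E E.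
rewrite (_ : k + (3 * N)%:Z + 1 + 1 + 1 = k + (3 * N.+1)%:Z); last by lia.
by move: (Phi_neq0 t) (p _ x); move: (Phi t) => P PN z; field; exact: PN.
Qed.

Lemma excess_seq m p s : 0 < t -> (0 < s <= t / 20 \/ s = t) -> mean_seq (Phi t) m p ->
  (forall k, continuous (excess s (p k))) /\
  (forall k r, sp t (excess s (p k)) r = Phi t * excess s (p (k + 1)) r).
Proof.
move=> t0 st [cp H _]; split => [k|k r]; first exact: excess_cont.
rewrite (sp_excess s r (cp k)).
rewrite (_ : sp t (p k) = (fun y => Phi t * p (k + 1) y)); last exact/funext/H.
rewrite /excess (spZ s _ r (cp (k + 1))); move: (sp s _ r) (p _ r) => u v; ring.
Qed.

Lemma excess_bound m p s C : 0 < t -> (0 < s <= t / 20 \/ s = t) -> mean_seq (Phi t) m p ->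
  0 <= C -> (forall k r, `|p k r| <= Phi r * (C * Num.sqrt (1 + `|r|) ^+ m)) ->
  exists2 y, 0 < y & forall N k r, `|excess s (p k) r| <= Phi r * (2 / Num.sqrt (y * N%:R + 1) *
    (C * Num.sqrt (1 + (`|r| + t + 3 * t * N%:R)) ^+ m)).
Proof.
move=> t0 st ms C0 HC; have [y y0 H] := smoothing n a t0 st; exists y => // N k r.
have [c1 m1] := excess_seq t0 st ms.
have [cp _ _] := ms.
(* Here the sequence has to be doubly infinite: p_k is the N-th image of p_(k-3N) for every N, and
   the bound on p_(k-3N) is the same for all N. *)
have := H _ _ N r (cp (k - (3 * N)%:Z)) (weight_sqrt m C0) (HC _).
rewrite -/(excess s (p (k - (3 * N)%:Z))).
by rewrite (mean_iter N (k - (3 * N)%:Z) c1 m1) subrK.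
Qed.

(** Take N just above |r|. The factor 1 / sqrt (y N + 1) is then of order 1 / sqrt (1 + |r|),
    whereas the enlarged radius |r| + t + 3 t N is still of order 1 + |r|. *)
Lemma excess_mean_seq m p s : 0 < t -> (0 < s <= t / 20 \/ s = t) ->
  mean_seq (Phi t) m.+1 p -> mean_seq (Phi t) m (fun k => excess s (p k)).
Proof.
move=> t0 st ms; have [c1 m1] := excess_seq t0 st ms; split => //.
have [C C0 HC] := mean_bound ms.
have [y y0 H] := excess_bound t0 st ms C0 HC.
pose b := Num.min y 1; have b0 : 0 < b by rewrite /b lt_min y0 ltr01.
have by1 : b <= y by rewrite /b ge_min lexx.
have b1 : b <= 1 by rewrite /b ge_min lexx orbT.
have sb : 0 < Num.sqrt b by rewrite sqrtr_gt0.
pose C' := 2 / Num.sqrt b * C * Num.sqrt (1 + 4 * t) ^+ m.+1.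
exists C'; first by rewrite /C' !mulr_ge0 ?invr_ge0 ?sqrtr_ge0 ?exprn_ge0.
move=> k r; pose N := (Num.truncn `|r|).+1.
have /andP[N1 N2] := truncn_itv (normr_ge0 r).
have NN : N%:R <= `|r| + 1 by rewrite /N -natr1 lerD2r.
have NN' : `|r| <= N%:R by exact: ltW.
have r0 := normr_ge0 r.
apply: le_trans (H N k r) _; rewrite ler_wpM2l ?(ltW (P0 _))//.
have S0 : 0 < Num.sqrt (1 + `|r|) by rewrite sqrtr_gt0; lra.
have E1 : Num.sqrt b * Num.sqrt (1 + `|r|) <= Num.sqrt (y * N%:R + 1).
  by rewrite -sqrtrM ?(ltW b0)// ler_wsqrtr// (growth_arith b0 b1 by1 r0 t0 NN' NN).1.
have E2 : Num.sqrt (1 + (`|r| + t + 3 * t * N%:R)) <= Num.sqrt (1 + 4 * t) * Num.sqrt (1 + `|r|).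
  rewrite -sqrtrM; last by lra.
  by rewrite ler_wsqrtr// (growth_arith b0 b1 by1 r0 t0 NN' NN).2.
set X := Num.sqrt (y * _ + 1) in E1 *; set Y := Num.sqrt (1 + (_ + _)) in E2 *.
set S := Num.sqrt (1 + `|r|) in S0 E1 E2 *.
set U := Num.sqrt (1 + 4 * t) in E2 *.
have Y0 : 0 <= Y by exact: sqrtr_ge0.
have X0 : 0 < X by apply: lt_le_trans E1; exact: mulr_gt0.
apply: (@le_trans _ _ (2 / (Num.sqrt b * S) * (C * (U * S) ^+ m.+1))).
  apply: ler_pM.
  - by rewrite divr_ge0// ltW.
  - by rewrite mulr_ge0// exprn_ge0.
  - by rewrite ler_wpM2l// lef_pV2 ?posrE// mulr_gt0.
  - by rewrite ler_wpM2l// lerXn2r ?nnegrE// mulr_ge0 ?sqrtr_ge0// ltW.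
rewrite /C' -/U exprMn [S ^+ m.+1]exprS le_eqVlt; apply/orP; left; apply/eqP.
by field; rewrite !gt_eqF.
Qed.

(** For m = 0 the weight is constant, so N may go to infinity with r fixed. *)
Lemma excess_bounded0 p s : 0 < t -> (0 < s <= t / 20 \/ s = t) ->
  mean_seq (Phi t) 0 p -> forall k r, excess s (p k) r = 0.
Proof.
move=> t0 st ms k r; apply/eqP; rewrite -normr_le0 leNgt; apply/negP => e0.
have [C C0 HC] := mean_bound ms.
have [y y0 H] := excess_bound t0 st ms C0 HC.
set e := `|_| in e0; pose X := Phi r * (2 * C) / e.
have X0 : 0 <= X by rewrite /X divr_ge0 ?mulr_ge0 ?(ltW (P0 r)) ?(ltW e0).
pose N := (Num.truncn (X ^+ 2 / y)).+1.
have /andP[_ N2] := truncn_itv (divr_ge0 (sqr_ge0 X) (ltW y0)).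
have XN : X ^+ 2 < y * N%:R + 1.
  by move: N2; rewrite -/N ltr_pdivrMr// mulrC => N2; lra.
have XS : X < Num.sqrt (y * N%:R + 1).
  by rewrite -[X]ger0_norm// -sqrtr_sqr ltr_sqrt//; apply: le_lt_trans XN; exact: sqr_ge0.
have S0 : 0 < Num.sqrt (y * N%:R + 1) by exact: le_lt_trans XS.
have := H N k r; rewrite -/e expr0 mulr1.
rewrite (_ : _ * _ = Phi r * (2 * C) / Num.sqrt (y * N%:R + 1)); last by ring.
rewrite ler_pdivlMr// leNgt => /negP; apply.
by rewrite [ltRHS]mulrC -ltr_pdivrMr.
Qed.

Definition rise (q : R -> R) r := q r / Phi r - q 0.

Lemma rise_cont q : continuous q -> continuous (rise q).
Proof.
move=> cq; have := inv_cont Phi_neq0 cPhi => ci; rewrite /rise; cont.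
Qed.

Lemma excess0 s q : continuous q -> 0 <= s -> excess s q 0 = rise q s.
Proof. by move=> cq s0; rewrite /excess (@sp_at0 R n s q cq s0) mulrC. Qed.

Lemma rise_neg q : 0 < t -> continuous q -> rise q t = 0 ->
  (forall s r, 0 < s <= t / 20 -> 0 <= r <= t -> excess s q r = Phi r * rise q s) ->
  forall r, 0 <= r <= t -> 0 < rise q r ->
  exists2 e, 0 < e & forall s, 0 < s < e -> rise q s < 0.
Proof.
move=> t0 cq gt H r0 r0t g0.
have ckP k : continuous (fun x => k * Phi x) by cont.
have ck k : continuous (fun x => k * Phi x - q x) by cont.
pose g := rise q.
have cg : continuous g by exact: rise_cont.
have [|c ct gmax] := @EVT_max _ g 0 t (ltW t0); first exact: continuous_subspaceT.
have mu0 : 0 < g c by apply: lt_le_trans g0 _; apply: gmax; rewrite in_itv.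
pose A : set R := `[0, t]%classic `&` g @^-1` [set g c].
have cA : compact A.
  apply: (subclosed_compact _ (segment_compact (a := 0) (b := t))); last by move=> x [].
  apply: closedI; first exact: interval_closed.
  by apply: preimage_closed => [x _|]; [exact: cg|exact: closed_eq].
(* The smallest argmax: to its left [g] is strictly below its maximum, which is the strict
   positivity that [sp_gt0] asks of [h]. *)
have [||rs rsA rmin] := @compact_EVT_min _ _ (fun x : R => x) A _ cA.
- by exists c; split => //=.
- by apply: continuous_subspaceT => x; exact: cvg_id.
move: rsA; rewrite inE => -[]; rewrite /= in_itv/= => /andP[rs0 rst] gE.
have gN0 : g 0 = 0 by rewrite /g /rise Phi0 divr1 subrr.
have rsp : 0 < rs.
  by rewrite lt_def rs0 andbT; apply/eqP => E; move: mu0; rewrite -gE E gN0 ltxx.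
have rstp : rs < t.
  by rewrite lt_def rst andbT; apply/eqP => E; move: mu0; rewrite -gE -E /g gt ltxx.
(* s < rs is the condition of [sp_gt0], s < t - rs keeps the sphere inside [0, t], where the maximum
   is known, and s < t/20 gives access to the hypothesis on the excess. *)
exists (Num.min rs (Num.min (t - rs) (t / 20))).
  by rewrite !lt_min rsp subr_gt0 rstp divr_gt0.
move=> s /andP[s0]; rewrite !lt_min => /and3P[s1 s2 s3].
pose h x := (q 0 + g c) * Phi x - q x.
have ch : continuous h by exact: ck.
have hE x : h x = Phi x * (g c - g x).
  rewrite /h (_ : g x = q x / Phi x - q 0); last by [].
  have Q (u v w z : R) : z != 0 -> (v + u) * z - w = z * (u - (w / z - v)) by move=> z0; field.
  exact: Q (Phi_neq0 x).
have rst' : rs + s <= t by rewrite addrC -lerBrDr ltW.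
have hs : 0 < sp s h rs.
  apply: (@sp_gt0 R n s rs h ch s0 s1) => x /andP[x0 xr].
    rewrite hE; apply: mulr_ge0 (ltW (P0 x)) _; rewrite subr_ge0; apply: gmax.
    by rewrite in_itv/= x0 (le_trans xr rst').
  have xt : 0 <= x <= t by rewrite x0 (ltW (lt_trans xr rstp)).
  rewrite hE; apply: mulr_gt0 (P0 x) _; rewrite subr_gt0 lt_neqAle; apply/andP; split.
    apply/negP => /eqP E; have : rs <= x by apply: rmin; rewrite inE; split; rewrite /= ?in_itv.
    by rewrite leNgt xr.
  by apply: gmax; rewrite in_itv.
have cqP : continuous (fun x => (q 0 + g c) * Phi x) by exact: ckP.
move: hs; rewrite /h (@sp_sub R n s _ _ rs cqP cq) (spZ s _ rs cPhi) sp_Phi.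
have := H s rs; rewrite /excess => /(_ _ _)/[!s0]/= => HH.
have {}HH := HH (ltW s3) (introT andP (conj rs0 rst)).
have qE : q rs = Phi rs * (q 0 + g c).
  by rewrite -gE /g /rise; field; exact: Phi_neq0.
have spE : sp s q rs = Phi s * (q rs + Phi rs * rise q s).
  by rewrite -HH; field; exact: Phi_neq0.
rewrite spE qE; have p1 := P0 s; have p2 := P0 rs.
rewrite (_ : _ - _ = (Phi s * Phi rs) * (- rise q s)); last by ring.
by rewrite pmulr_rgt0 ?mulr_gt0// oppr_gt0.
Qed.

Lemma rise_opp q : rise (fun x => - q x) =1 (fun x => - rise q x).
Proof. by move=> x; rewrite /rise; ring. Qed.

Lemma excess_opp s q r : continuous q -> excess s (fun x => - q x) r = - excess s q r.
Proof.
move=> cq; rewrite /excess (_ : (fun x => - q x) = (fun x => -1 * q x)).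
  rewrite (spZ s _ r cq); move: (sp s _ r) (q r) => u v; ring.
by apply/funext => x; rewrite mulN1r.
Qed.

(* At its smallest argmax a positive maximum of [rise q] forces [rise q < 0]
   near 0, while a negative value forces [rise q > 0] near 0. *)
Lemma rise_flat q : 0 < t -> continuous q -> rise q t = 0 ->
  (forall s r, 0 < s <= t / 20 -> 0 <= r <= t -> excess s q r = Phi r * rise q s) ->
  forall r, 0 <= r <= t -> rise q r = 0.
Proof.
move=> t0; have half (x : R) : 0 < x -> x / 2 < x.
  by move=> x0; rewrite ltr_pdivrMr// ltr_pMr// ltr1n.
have aux q' : continuous q' -> rise q' t = 0 ->
    (forall s r, 0 < s <= t / 20 -> 0 <= r <= t -> excess s q' r = Phi r * rise q' s) ->
    forall r, 0 <= r <= t -> ~ (0 < rise q' r).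
  move=> cq gt H r rt g0; have [e e0 He] := rise_neg t0 cq gt H rt g0.
  pose s := Num.min e t / 2.
  have m0 : 0 < Num.min e t by rewrite lt_min e0 t0.
  have s0 : 0 < s by rewrite divr_gt0.
  have sm : s < Num.min e t by exact: half.
  move: (sm); rewrite lt_min => /andP[se st].
  have gs : rise q' s < 0 by apply: He; rewrite s0.
  have cN : continuous (fun x => - q' x) by cont.
  have [||||e' e'0 He'] := @rise_neg (fun x => - q' x) t0 cN _ _ s.
  - by rewrite rise_opp gt oppr0.
  - by move=> s' r' h1 h2; rewrite excess_opp// H// rise_opp mulrN.
  - by rewrite (ltW s0) (ltW st).
  - by rewrite rise_opp oppr_gt0.
  pose u := Num.min e e' / 2.
  have v0 : 0 < Num.min e e' by rewrite lt_min e0 e'0.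
  have u0 : 0 < u by rewrite divr_gt0.
  have : u < Num.min e e' by exact: half.
  rewrite lt_min => /andP[ue ue'].
  have h1 : rise q' u < 0 by apply: He; rewrite u0.
  have : rise (fun x => - q' x) u < 0 by apply: He'; rewrite u0.
  by rewrite rise_opp oppr_lt0 ltNge (ltW h1).
move=> cq gt H r rt; apply/eqP; rewrite eq_le; apply/andP; split.
  by rewrite leNgt; apply/negP; exact: (aux q).
rewrite leNgt; apply/negP => g0; have cN : continuous (fun x => - q x) by cont.
apply: (aux (fun x => - q x) cN _ _ r rt).
- by rewrite rise_opp gt oppr0.
- by move=> s' r' h1 h2; rewrite excess_opp// H// rise_opp mulrN.
- by rewrite rise_opp oppr_gt0.
Qed.

(** Flatness of the excess at s = t makes p_k(0) an arithmetic progression in k with increment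
    [rise (p k) t]. Uniform boundedness at 0 forces this increment to vanish, and then [rise_flat],
    fed with small s, applies. *)
Lemma mean_seq_flat_step m p : 0 < t -> mean_seq (Phi t) m p ->
  (forall s k r, (0 < s <= t / 20 \/ s = t) -> 0 <= r <= t ->
    excess s (p k) r = Phi r * excess s (p k) 0) ->
  forall k r, 0 <= r <= t -> p k r = Phi r * p k 0.
Proof.
move=> t0 ms H k r rt; have [cp _ _] := ms.
have tt : 0 <= t <= t by rewrite (ltW t0) lexx.
have ext k' r' : excess t (p k') r' = p (k' + 1) r' - p k' r'.
  by rewrite /excess (mean_eq ms) (mulKf (Phi_neq0 t)).
have S1 k' : p (k' + 1) 0 = p k' t / Phi t.
  have := mean_eq ms k' 0; rewrite (@sp_at0 R n t _ (cp k') (ltW t0)) => ->.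
  by rewrite mulrAC mulfV ?mul1r.
(* For s = t the excess is p_(k+1) - p_k, so its flatness transports [rise] at t from k to k + 1. *)
have S2 k' : rise (p (k' + 1)) t = rise (p k') t.
  have := H t k' t (or_intror erefl) tt; rewrite !ext /rise => E.
  have -> : p (k' + 1) t = p k' t + Phi t * (p (k' + 1) 0 - p k' 0).
    by rewrite -E; ring.
  by field; exact: Phi_neq0.
pose g := rise (p k) t.
have S3 N : rise (p (k + N%:Z)) t = g.
  elim: N => [|N IH]; first by rewrite addr0.
  by rewrite (_ : k + N.+1%:Z = k + N%:Z + 1) ?S2//; lia.
have S4 N : p (k + N%:Z) 0 = p k 0 + N%:R * g.
  elim: N => [|N IH]; first by rewrite addr0 mul0r addr0.
  rewrite (_ : k + N.+1%:Z = k + N%:Z + 1); last by lia.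
  have := S3 N; rewrite /rise -S1 -natr1 => /eqP; rewrite subr_eq => /eqP ->.
  by rewrite IH; ring.
have [C C0 HC] := mean_bound ms.
have g0 : g = 0.
  apply/eqP; rewrite -normr_le0 leNgt; apply/negP => gp.
  pose X := 2 * C / `|g|.
  have X0 : 0 <= X by rewrite /X divr_ge0// mulr_ge0.
  have /andP[_ N2] := truncn_itv X0.
  have B N : `|p (k + N%:Z) 0| <= C.
    apply: le_trans (HC _ _) _.
    by rewrite Phi0 mul1r normr0 addr0 sqrtr1 expr1n mulr1.
  move: N2; rewrite ltr_pdivrMr// ltNge => /negP; apply.
  rewrite -[leLHS](ger0_norm (mulr_ge0 (ler0n _ _) (ltW gp))) normrM normr_id -normrM.
  rewrite (_ : _ * g = p (k + (Num.truncn X).+1%:Z) 0 - p k 0); last by rewrite S4; ring.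
  apply: le_trans (ler_normB _ _) _.
  have := B (Num.truncn X).+1; have := B 0%N; rewrite addr0.
  move: (`|p k 0|) (`| p _ 0|) => x y; lra.
have F := @rise_flat (p k) t0 (cp k) g0 _ r rt.
have : rise (p k) r = 0.
  apply: F => s r' st r't; have s0 : 0 <= s by case/andP: st => /ltW.
  by rewrite -(excess0 (cp k) s0) (H s k r')//; left.
rewrite /rise => /eqP; rewrite subr_eq0 => /eqP <-.
by rewrite mulrC divfK.
Qed.

(** Induction on the growth exponent: the excesses have one half power less and are flat by
    induction; at exponent 0 they vanish. *)
Lemma mean_seq_flat m p : 0 < t -> mean_seq (Phi t) m p ->
  forall k r, 0 <= r <= t -> p k r = Phi r * p k 0.
Proof.
move=> t0; elim: m p => [|m IH] p ms; apply: (mean_seq_flat_step t0 ms) => s k r st rt.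
  by rewrite !(excess_bounded0 t0 st ms) mulr0.
exact: (IH _ (excess_mean_seq t0 st ms)).
Qed.

Lemma mean_seq_large alpha m p : 0 < t -> Phi t < alpha -> mean_seq alpha m p -> p 0 0 = 0.
Proof.
move=> t0 al [cp H [C C0 HC]].
have Pt := P0 t.
have al0 : 0 < alpha by exact: lt_trans al.
(* The normalised mean contracts the weight by [be] < 1 at each step. Going back N steps costs only
   polynomial growth in N, so the value at 0 vanishes. *)
pose be := Phi t / alpha.
have be0 : 0 < be by rewrite divr_gt0.
have be1 : be < 1 by rewrite ltr_pdivrMr// mul1r.
pose Wf x : R := C * Num.sqrt (1 + x) ^+ m.
have PS : posop Phi (fun q x => alpha^-1 * sp t q x) be t.
  have := @posop_scale _ Phi _ alpha^-1 _ _ (ltW _) (sp_posop n a (s := t) (l := t) _).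
  rewrite [_^-1 * _]mulrC; apply; first by rewrite invr_gt0.
  by rewrite gtr0_norm.
have tN N : 0 <= N%:R * t by rewrite mulr_ge0// ltW.
have wW N : weight (fun x => be ^+ N * Wf (x + N%:R * t)).
  by apply: weight_shift => //; [rewrite exprn_ge0 ?(ltW be0)|exact: weight_sqrt].
have D N k : dominated Phi (p k) (fun x => be ^+ N * Wf (x + N%:R * t)).
  elim: N k => [|N IH] k; first by move=> x; rewrite expr0 mul1r mul0r addr0; exact: HC.
  have E : p k = (fun x => alpha^-1 * sp t (p (k - 1)) x).
    by apply/funext => x; rewrite H subrK (mulKf (negbT (gt_eqF al0))).
  have := posop_dominated P0 cPhi (ltW t0) PS (wW N) (cp (k - 1)) (IH (k - 1)).
  rewrite -E => DD x; have := DD x.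
  by rewrite [be * (be ^+ N * _)]mulrA -exprS -addrA -[N.+1%:R]natr1 mulrDl mul1r [t + _]addrC.
have B N : `|p 0 0| <= C * (be ^+ N * (1 + N%:R * t) ^+ m).
  apply: le_trans (D N 0 0) _; rewrite Phi0 mul1r normr0 add0r /Wf mulrCA.
  have h1 : 1 <= 1 + N%:R * t by rewrite lerDl.
  have h0 : 0 <= 1 + N%:R * t by exact: le_trans h1.
  rewrite ler_wpM2l// ler_wpM2l ?exprn_ge0 ?(ltW be0)//.
  rewrite lerXn2r ?nnegrE ?sqrtr_ge0// -[leRHS](ger0_norm h0) -sqrtr_sqr ler_wsqrtr//.
  by rewrite expr2 ler_peMr.
(* Half of the geometric decay absorbs the polynomial factor; [eps] below is chosen so that exp (eps
   N)^m <= b^(-N), and the other half still tends to 0. *)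
pose b := Num.sqrt be.
have b0 : 0 < b by rewrite sqrtr_gt0.
have b1 : b < 1 by rewrite -[ltRHS]sqrtr1 ltr_sqrt.
pose eps := - ln b / m.+1%:R.
have lnb : ln b < 0 by apply: ln_lt0; rewrite b0.
have eps0 : 0 < eps by rewrite divr_gt0// oppr_gt0.
pose K := 1 + t / eps.
have te0 : 0 < t / eps by rewrite divr_gt0.
have K0 : 0 <= K by rewrite /K; lra.
have B2 N : `|p 0 0| <= C * K ^+ m * b ^+ N.
  have x0 : 0 <= eps * N%:R by rewrite mulr_ge0// ltW.
  have h : 1 + N%:R * t <= K * expR (eps * N%:R).
    apply: (@le_trans _ _ (K * (1 + eps * N%:R))); last first.
      by rewrite ler_wpM2l// expR_ge1Dx.
    rewrite /K mulrDr mulr1 mulrDl mul1r mulrA divfK ?gt_eqF// [t * _]mulrC.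
    rewrite [eps^-1 * t]mulrC [N%:R * t]mulrC.
    by move: te0 x0; move: (t / eps) (eps * _) (t * _) => u v w; lra.
  have h' : expR (eps * N%:R) ^+ m <= (b ^+ N)^-1.
    rewrite -expRM_natl.
    have -> : (b ^+ N)^-1 = expR (m.+1%:R * (eps * N%:R)).
      rewrite /eps -{1}(@lnK _ b) ?posrE// -expRM_natl -expRN; congr expR.
      by field; rewrite addrC natr1 pnatr_eq0.
    by rewrite ler_expR ler_wpM2r// ler_nat.
  apply: le_trans (B N) _; rewrite -mulrA ler_wpM2l//.
  have -> : be = b ^+ 2 by rewrite sqr_sqrtr// ltW.
  apply: (@le_trans _ _ ((b ^+ 2) ^+ N * (K ^+ m * (b ^+ N)^-1))).
    rewrite ler_wpM2l ?exprn_ge0 ?(ltW b0)//.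
    apply: (@le_trans _ _ ((K * expR (eps * N%:R)) ^+ m)).
      have hN : 0 <= 1 + N%:R * t by rewrite addr_ge0.
      by apply: lerXn2r; rewrite ?nnegrE//; exact: le_trans h.
    by rewrite exprMn ler_wpM2l// exprn_ge0.
  rewrite -exprM mulnC exprM expr2 mulrCA -mulrA divff ?mulr1//.
  by rewrite expf_neq0// gt_eqF.
apply/eqP; rewrite -normr_le0; apply/ler_addgt0Pl => e e0; rewrite addr0.
have bn : `|b| < 1 by rewrite gtr0_norm.
have := cvg_geometric (C * K ^+ m) bn => /cvgrPdist_lt/(_ e e0)[N _ /(_ N (leqnn N))].
rewrite sub0r normrN /geometric /= => h; apply: le_trans (B2 N) _.
by apply: le_trans (ler_norm _) _; exact: ltW.
Qed.

End mean_sequences.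

(** * Smooth functions with exponential decay *)

Section partial_derivatives.
Context {R : realType} {d : nat}.
Local Notation V := 'rV[R]_d.
Local Notation E j := (delta_mx 0 j : V).
Implicit Types (u v : V -> R) (x y w : V).

Definition pd j u : V -> R := fun x => 'D_(E j) u x.

Definition pds s u : V -> R := foldr pd u s.

Definition smoothR u := forall s,
  continuous (pds s u) /\ forall x j, derivable (pds s u) x (E j).

Lemma pds_cat s1 s2 u : pds (s1 ++ s2) u = pds s1 (pds s2 u).
Proof. by rewrite /pds foldr_cat. Qed.

Lemma smoothR_pds s u : smoothR u -> smoothR (pds s u).
Proof. by move=> su s'; rewrite -pds_cat; exact: su. Qed.

Lemma line_derive u y w (s : R) : derivable u (y + s *: w) w ->
  is_derive (s : R) 1 (fun h => u (y + h *: w)) ('D_w u (y + s *: w)).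
Proof.
move=> du; have E : (fun h : R => h^-1 *: (u (y + (h *: 1 + s) *: w) - u (y + s *: w))) =
    (fun h : R => h^-1 *: (u (h *: w + (y + s *: w)) - u (y + s *: w))).
  apply/funext => h; congr (_ *: (u _ - _)).
  by rewrite scalerDl /GRing.scale/= mulr1 addrCA.
by split; rewrite /derivable /derive /= E.
Qed.

Lemma pd_line u y j (s : R) : smoothR u ->
  is_derive (s : R) 1 (fun h => u (y + h *: E j)) (pd j u (y + s *: E j)).
Proof. by move=> su; apply: line_derive; have [_] := su [::]; exact. Qed.

Lemma increment_bound u (D : R) y j (h C : R) : smoothR u ->
  (forall s : R, `|s| <= `|h| -> `|pd j u (y + s *: E j) - D| <= C) ->
  `|u (y + h *: E j) - u y - h * D| <= C * `|h|.
Proof.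
move=> su H; pose f (s : R) := u (y + s *: E j) - s * D.
have df s : is_derive (s : R) 1 f (pd j u (y + s *: E j) - D).
  apply: is_derive_eq (derD (pd_line y j s su) (derN (derM (derI s) (derC D s)))) _.
  by rewrite mulr0 addr0 mul1r.
have -> : u (y + h *: E j) - u y - h * D = f h - f 0.
  by rewrite /f scale0r addr0 mul0r subr0; ring.
have [h0|h0] := leP 0 h.
  have := @derivative_bound _ f _ 0 h C h0 (fun s _ => df s); rewrite subr0 (ger0_norm h0).
  by apply=> s /andP[s0 sh]; apply: H; rewrite !ger0_norm.
have := @derivative_bound _ f _ h 0 C (ltW h0) (fun s _ => df s).
rewrite sub0r (ltr0_norm h0) distrC.
by apply=> s /andP[s0 sh]; apply: H; rewrite !ler0_norm ?lerN2// ltW.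
Qed.

(** The mean value theorem applied once in each direction. The second difference is symmetric in i
    and j while the right-hand side is not, whence the symmetry of second derivatives in
    [pd_comm]. *)
Lemma mixed_difference u x i j (h : R) : smoothR u -> 0 < h ->
  exists y, `|y - x| <= 2 * h /\
   u (x + h *: E i + h *: E j) - u (x + h *: E i) - u (x + h *: E j) + u x =
   h ^+ 2 * pd j (pd i u) y.
Proof.
move=> su h0.
have su1 : smoothR (pd i u) := smoothR_pds [:: i] su.
have [|c /andP[c0 ch]] := @mean_value _ (fun s : R => u (x + h *: E j + s *: E i) - u (x + s *: E i))
   (fun s => pd i u (x + h *: E j + s *: E i) - pd i u (x + s *: E i)) 0 h h0.
  by move=> s _; apply: derD; [exact: pd_line|apply: derN; exact: pd_line].
rewrite !scale0r !addr0 subr0 => E1.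
have [|b /andP[b0 bh]] := @mean_value _ (fun s : R => pd i u (x + c *: E i + s *: E j))
   (fun s => pd j (pd i u) (x + c *: E i + s *: E j)) 0 h h0.
  by move=> s _; exact: pd_line.
rewrite scale0r addr0 subr0 => E2.
exists (x + c *: E i + b *: E j); split.
  have nE k : `|E k| <= 1.
    apply: le_trans (norm_le_enorm _) _; rewrite /enorm (_ : dot _ _ = 1) ?sqrtr1//.
    rewrite /dot (bigD1 k)//= !mxE !eqxx mulr1 big1 ?addr0// => i0 ik.
    by rewrite !mxE (negbTE ik) andbF mulr0.
  rewrite (_ : _ - x = c *: E i + b *: E j); last first.
    by rewrite addrAC [x + _]addrC addrK.
  apply: le_trans (ler_normD _ _) _.
  rewrite !normrZ (gtr0_norm c0) (gtr0_norm b0) mulrDl mul1r; apply: lerD.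
    by rewrite -[leRHS]mulr1 ler_pM// ltW.
  by rewrite -[leRHS]mulr1 ler_pM// ltW.
rewrite expr2 -mulrA [h * pd _ _ _]mulrC -E2 (addrAC x (c *: _)) mulrC -E1.
by rewrite [x + h *: E i + _]addrAC; ring.
Qed.

Lemma nearby_values_eq (f g : V -> R) x : {for x, continuous f} -> {for x, continuous g} ->
  (forall h : R, 0 < h -> exists y1 y2, [/\ `|y1 - x| <= 2 * h, `|y2 - x| <= 2 * h & f y1 = g y2]) ->
  f x = g x.
Proof.
move=> cf cg H; apply/eqP; rewrite -subr_eq0 -normr_le0.
apply/ler_addgt0Pl => e e0; rewrite addr0.
have e2 : 0 < e / 2 by rewrite divr_gt0.
have := iffLR (@cvgrPdist_le R R _ (nbhs x) (nbhs_filter x) _ _) cf _ e2.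
move=> /nbhs_normP[d1 /= d10 H1].
have := iffLR (@cvgrPdist_le R R _ (nbhs x) (nbhs_filter x) _ _) cg _ e2.
move=> /nbhs_normP[d2 /= d20 H2].
have [h h0 /andP[hm1 hm2]] : exists2 h : R, 0 < h & (2 * h < d1) && (2 * h < d2).
  have m0 : 0 < Num.min d1 d2 by rewrite lt_min d10 d20.
  exists (Num.min d1 d2 / 3); first by rewrite divr_gt0.
  rewrite -lt_min.
  by rewrite mulrCA -[ltRHS]mulr1 ltr_pM2l// ltr_pdivrMr// mul1r ltr_nat.
have [y1 [y2 [y1x y2x E]]] := H h h0.
have G1 : `|f x - f y1| <= e / 2.
  by apply: H1; rewrite /ball_ /= distrC; exact: le_lt_trans y1x hm1.
have G2 : `|g x - g y2| <= e / 2.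
  by apply: H2; rewrite /ball_ /= distrC; exact: le_lt_trans y2x hm2.
rewrite (splitr e) (_ : _ - _ = (f x - f y1) - (g x - g y2)); last by rewrite E; ring.
by apply: le_trans (ler_normB _ _) _; exact: lerD.
Qed.

Lemma pd_comm u i j : smoothR u -> pd i (pd j u) = pd j (pd i u).
Proof.
move=> su; apply/funext => x.
apply: nearby_values_eq; [exact: (su [:: i; j]).1|exact: (su [:: j; i]).1|].
move=> h h0; have [y1 [y1x D1]] := mixed_difference x i j su h0.
have [y2 [y2x D2]] := mixed_difference x j i su h0.
exists y2, y1; split; [exact: y2x|exact: y1x|].
apply: (mulfI (x := h ^+ 2)); first by rewrite expf_neq0// gt_eqF.
apply: etrans (esym D2) (etrans _ D1); rewrite [x + h *: E j + h *: E i]addrAC.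
by congr (_ + _); exact: addrAC.
Qed.

Lemma pds_rem u s j : smoothR u -> j \in s -> pds s u = pds (j :: rem j s) u.
Proof.
elim: s => // i s IH su; rewrite inE /=; case: eqVneq => [->//|ij /= js].
by rewrite (IH su js); exact: pd_comm (smoothR_pds _ su).
Qed.

Lemma pds_perm u s1 s2 : smoothR u -> perm_eq s1 s2 -> pds s1 u = pds s2 u.
Proof.
elim: s1 s2 => [|j s IH] s2 su; first by rewrite perm_sym => /perm_nilP ->.
move=> p; have js2 : j \in s2 by rewrite -(perm_mem p) mem_head.
rewrite (pds_rem su js2) /=; congr pd; apply: IH => //.
by have := p; rewrite (permPr (perm_to_rem js2)) perm_cons.
Qed.

(** The order of differentiation that [multi_partial] realises. Any sequence of directions can be
    permuted into one of this form, so sequences and multi-indices give the same seminorm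
    conditions. *)
Definition mseq (alpha : 'I_d -> nat) : seq 'I_d :=
  flatten [seq nseq (alpha j) j | j <- enum 'I_d].

Lemma perm_mseq s : perm_eq s (mseq (fun j => count_mem j s)).
Proof.
apply/allP => j _ /=; apply/eqP; rewrite /mseq count_flatten -map_comp sumnE big_map big_enum /=.
rewrite (bigD1 j)//= count_nseq /= eqxx mul1n big1 ?addn0// => i ij.
by rewrite count_nseq /= (negbTE ij) mul0n.
Qed.

Lemma foldr_mseq (T : Type) (F : 'I_d -> T -> T) (alpha : 'I_d -> nat) (f : T) :
  foldr (fun j g => iter (alpha j) (F j) g) f (enum 'I_d) = foldr F f (mseq alpha).
Proof.
rewrite /mseq; elim: (enum 'I_d) => //= j l ->; rewrite foldr_cat.
by elim: (alpha j) => //= k ->.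
Qed.

Lemma lipschitz_list (g : V -> R) (B : R) x w (h : R) (l : seq 'I_d) : smoothR g ->
  (forall j y, `|pd j g y| <= B) ->
  `|g (x + h *: \sum_(j <- l) w 0 j *: E j) - g x| <= `|h| * (\sum_(j <- l) `|w 0 j|) * B.
Proof.
move=> sg HB; elim: l => [|j l IH].
  by rewrite !big_nil scaler0 addr0 subrr normr0 mulr0 mul0r.
rewrite !big_cons; set y := x + _ in IH.
rewrite [x + _](_ : _ = y + (h * w 0 j) *: E j); last by rewrite /y scalerDr scalerA [RHS]addrAC addrA.
have := @increment_bound g 0 y j (h * w 0 j) B sg.
rewrite mulr0 subr0 => /(_ _)I1.
rewrite -(subrKA (g y)); apply: le_trans (ler_normD _ _) _.
rewrite mulrDr mulrDl; apply: lerD => //.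
rewrite -normrM [leRHS]mulrC; apply: I1 => s _.
by rewrite subr0.
Qed.

(** Only partial derivatives are at hand, so the point is moved one coordinate at a time; the drift
    of each partial derivative along the way is controlled by [lipschitz_list]. *)
Lemma quadratic_list (g : V -> R) (B : R) x w (h : R) (l : seq 'I_d) : smoothR g ->
  (forall i j y, `|pd i (pd j g) y| <= B) ->
  `|g (x + h *: \sum_(j <- l) w 0 j *: E j) - g x - h * \sum_(j <- l) w 0 j * pd j g x| <=
   h ^+ 2 * (\sum_(j <- l) `|w 0 j|) ^+ 2 * B.
Proof.
move=> sg HB; elim: l => [|j l IH].
  by rewrite !big_nil scaler0 addr0 subrr mulr0 subr0 normr0 expr0n /= mulr0 mul0r.
have B0 : 0 <= B by apply: le_trans (HB j j x); exact: normr_ge0.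
rewrite !big_cons.
have sp := smoothR_pds [:: j] sg.
have L := @lipschitz_list (pd j g) B x w h l sp (fun i => HB i j).
set y := x + _ in IH L *; set S := \sum_(_ <- _) `|_| in IH L *.
have S0 : 0 <= S by apply: sumr_ge0.
set c := h * w 0 j.
rewrite [x + _](_ : _ = y + c *: E j); last by rewrite /y scalerDr scalerA [RHS]addrAC addrA.
have I1 : `|g (y + c *: E j) - g y - c * pd j g y| <= B * `|c| * `|c|.
  apply: increment_bound => // s sc.
  have := @increment_bound (pd j g) 0 y j s B sp; rewrite mulr0 subr0 => /(_ _)I2.
  apply: le_trans (I2 _) _; first by move=> s' _; rewrite subr0.
  by rewrite ler_wpM2l.
have I3 : `|c * (pd j g y - pd j g x)| <= `|c| * (`|h| * S * B).
  by rewrite normrM ler_wpM2l.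
rewrite (_ : _ - _ = (g (y + c *: E j) - g y - c * pd j g y) + c * (pd j g y - pd j g x) +
  (g y - g x - h * \sum_(i <- l) w 0 i * pd i g x)); last by rewrite /c; ring.
apply: le_trans (ler_normD _ _) _.
apply: (@le_trans _ _ (B * `|c| * `|c| + `|c| * (`|h| * S * B) + h ^+ 2 * S ^+ 2 * B)).
  by apply: lerD => //; apply: le_trans (ler_normD _ _) _; exact: lerD.
have -> : `|c| = `|h| * `|w 0 j| by rewrite /c normrM.
rewrite -(real_normK (num_real h)); move: (normr_ge0 h) (normr_ge0 (w 0 j)) S0 B0.
clear; move: (`|h|) (`|w 0 j|) => k v k0 v0 S0 B0.
rewrite -subr_ge0 (_ : _ - _ = k ^+ 2 * v * S * B); last by ring.
by rewrite !mulr_ge0// exprn_ge0.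
Qed.

Lemma row_sum_E w : \sum_(j <- enum 'I_d) w 0 j *: E j = w.
Proof. by rewrite big_enum /= [RHS]row_sum_delta. Qed.

Lemma pd_quad (g : V -> R) (B : R) x j (h : R) : smoothR g -> (forall i j y, `|pd i (pd j g) y| <= B) ->
  `|g (x + h *: E j) - g x - h * pd j g x| <= B * h ^+ 2.
Proof.
move=> sg HB; have sp := smoothR_pds [:: j] sg.
have B0 : 0 <= B by apply: le_trans (HB j j x); exact: normr_ge0.
rewrite -(real_normK (num_real h)) expr2 mulrA; apply: increment_bound => // s sc.
have := @increment_bound (pd j g) 0 x j s B sp; rewrite mulr0 subr0 => /(_ _)I2.
apply: le_trans (I2 _) _; first by move=> s' _; rewrite subr0.
by rewrite ler_wpM2l.
Qed.

Lemma chain_rule (g : V -> R) (B : R) x w (s : R) : smoothR g -> (forall i j y, `|pd i (pd j g) y| <= B) ->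
  is_derive (s : R) 1 (fun h => g (x + h *: w)) (\sum_j w 0 j * pd j g (x + s *: w)).
Proof.
move=> sg HB; apply: (@is_derive_quad _ _ _ s 1 _ ((\sum_(j <- enum 'I_d) `|w 0 j|) ^+ 2 * B) 1) => // h _.
have := @quadratic_list g B (x + s *: w) w h (enum 'I_d) sg HB.
rewrite row_sum_E big_enum /= [_ * _ * B]mulrAC -mulrA [h ^+ 2 * _]mulrC.
by rewrite scalerDl addrA [h *: 1]mulr1 [B * _]mulrC.
Qed.

End partial_derivatives.

(** * The real-valued class S^a and its spherical averages *)

Section schwartz_class.
Context {R : realType} {n : nat} (a : R).
Hypothesis a0 : 0 <= a.
Local Notation V := 'rV[R]_n.+2.
Local Notation E j := (delta_mx 0 j : V).
Local Notation Phi := (@Phi R n a).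
Implicit Types (u v g : V -> R) (x y w : V) (m : nat).

Definition expweight m x : R := expR (a * enorm x) * (1 + enorm x) ^+ m.

Local Notation wt := expweight.

Definition wbound m u (B : R) := forall x, wt m x * `|u x| <= B.

(** The real-valued functions of S^a, with derivatives indexed by sequences of directions; [SaP]
    relates this to [Sa]. *)
Definition SR u := smoothR u /\ forall s m, exists B, wbound m (pds s u) B.

Lemma enorm1_ge1 x : 1 <= 1 + enorm x.
Proof. by rewrite lerDl enorm_ge0. Qed.

Lemma enorm1_gt0 x : 0 < 1 + enorm x.
Proof. exact: lt_le_trans ltr01 (enorm1_ge1 x). Qed.

Lemma wt_gt0 m x : 0 < wt m x.
Proof. by rewrite mulr_gt0 ?expR_gt0// exprn_gt0// enorm1_gt0. Qed.

Lemma wt_ge1 m x : 1 <= wt m x.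
Proof.
rewrite -[leLHS]mulr1 ler_pM// ?exprn_ege1 ?enorm1_ge1//.
by rewrite -expR0 ler_expR mulr_ge0// enorm_ge0.
Qed.

Lemma wbound_ge0 m u B : wbound m u B -> 0 <= B.
Proof. by move=> /(_ 0); apply: le_trans; rewrite mulr_ge0// ltW// wt_gt0. Qed.

Lemma wbound_norm m u B x : wbound m u B -> `|u x| <= B.
Proof.
move=> H; apply: le_trans (H x); rewrite -[leLHS]mul1r ler_wpM2r//; exact: wt_ge1.
Qed.

Lemma wbound_le m u B B' : B <= B' -> wbound m u B -> wbound m u B'.
Proof. by move=> BB H x; exact: le_trans (H x) BB. Qed.

Lemma wbound_exponent m m' u B : (m <= m')%N -> wbound m' u B -> wbound m u B.
Proof.
move=> mm H x; apply: le_trans (H x); rewrite ler_wpM2r// ler_wpM2l ?expR_ge0//.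
by rewrite ler_weXn2l// enorm1_ge1.
Qed.

Lemma wboundD m u v B C : wbound m u B -> wbound m v C ->
  wbound m (fun x => u x + v x) (B + C).
Proof.
move=> H1 H2 x; apply: le_trans (lerD (H1 x) (H2 x)).
by rewrite -mulrDr ler_wpM2l ?ler_normD// ltW// wt_gt0.
Qed.

Lemma wboundZ m u B c : wbound m u B -> wbound m (fun x => c * u x) (`|c| * B).
Proof. by move=> H x; rewrite normrM mulrCA ler_wpM2l. Qed.

Lemma wboundN m u B : wbound m u B -> wbound m (fun x => - u x) B.
Proof. by move=> H x; rewrite normrN. Qed.

Lemma SR_pds s u : SR u -> SR (pds s u).
Proof. by move=> [su H]; split=> [|s' m]; [exact: smoothR_pds|rewrite -pds_cat]. Qed.

Lemma SR_continuous u : SR u -> continuous u.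
Proof. by move=> [/(_ [::])[cu _] _]. Qed.

Lemma SR_pds_cont s u : SR u -> continuous (pds s u).
Proof. by move=> [/(_ s)[cu _] _]. Qed.

(** There are finitely many sequences of a given length, so bounds picked for each of them can be
    added up. *)
Lemma wbound_pds_all u (L : nat) m : SR u ->
  exists B, forall s, (size s <= L)%N -> wbound m (pds s u) B.
Proof.
move=> [su Hu]; elim: L => [|L [B IH]].
  by have [B HB] := Hu [::] m; exists B => -[].
pose P (l : L.+1.-tuple 'I_n.+2) := sval (cid (Hu l m)).
have B0 : 0 <= B by exact: wbound_ge0 (IH [::] isT).
have P0 l : 0 <= P l by rewrite /P; case: cid => C /= /wbound_ge0.
exists (B + \sum_l P l) => s; rewrite leq_eqVlt => /orP[/eqP ss|ss].
  have HP : wbound m (pds s u) (P (tcast ss (in_tuple s))).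
    by rewrite /P; case: cid => C /=; rewrite val_tcast.
  apply: wbound_le HP; rewrite (bigD1 (tcast ss (in_tuple s)))//= addrCA lerDl.
  by rewrite addr_ge0// sumr_ge0.
by apply: wbound_le (IH s ss); rewrite lerDl sumr_ge0.
Qed.

Lemma pd_lin c u v j : smoothR u -> smoothR v ->
  pd j (fun x => c * u x + v x) = (fun x => c * pd j u x + pd j v x).
Proof.
move=> su sv; apply/funext => x; rewrite /pd.
have [_ /(_ x j)du] := su [::]; have [_ /(_ x j)dv] := sv [::].
have E1 : 'D_(E j) (c \*: u \+ v) x = c *: 'D_(E j) u x + 'D_(E j) v x.
  have D : derivable (c \*: u) x (E j) by exact: derivableZ.
  by rewrite (deriveD D dv) (deriveZ _ du).
exact: E1.
Qed.

Lemma pds_lin c u v s : smoothR u -> smoothR v ->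
  pds s (fun x => c * u x + v x) = (fun x => c * pds s u x + pds s v x).
Proof.
move=> su sv; elim: s => //= j s IH.
by rewrite IH (pd_lin c j (smoothR_pds s su) (smoothR_pds s sv)).
Qed.

Lemma smoothR_lin c u v : smoothR u -> smoothR v -> smoothR (fun x => c * u x + v x).
Proof.
move=> su sv s; rewrite pds_lin//; have [cu du] := su s; have [cv dv] := sv s; split.
  by cont.
move=> x j; apply: (@derivableD _ _ _ (fun x => c * pds s u x) (pds s v)); last exact: dv.
have D : derivable (c \*: pds s u) x (E j) by exact: derivableZ.
exact: D.
Qed.

Lemma SR_lin c u v : SR u -> SR v -> SR (fun x => c * u x + v x).
Proof.
move=> [su Hu] [sv Hv]; split; first exact: smoothR_lin.
move=> s m; rewrite pds_lin//; have [B HB] := Hu s m; have [C HC] := Hv s m.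
by exists (`|c| * B + C); apply: wboundD => //; exact: wboundZ.
Qed.

Lemma pds0 s : pds s (fun _ : V => 0 : R) = (fun=> 0).
Proof.
elim: s => //= j s ->; apply/funext => x; rewrite /pd.
exact: derive_cst.
Qed.

Lemma SR0 : SR (fun=> 0).
Proof.
split=> [s|s m]; rewrite pds0.
  split=> [|x j]; first by cont.
  exact: derivable_cst.
by exists 0 => x; rewrite normr0 mulr0.
Qed.

Definition Mr (r : R) u x : R := avg (fun w => u (x - r *: w)).

Lemma Mr_arg_cont r u x : continuous u -> continuous (fun w : V => u (x - r *: w)).
Proof. by move=> cu; apply: (gcomp_cont cu); cont. Qed.

Lemma Mr_cont r u : continuous u -> continuous (Mr r u).
Proof. by move=> cu; apply: avg_continuous; apply: (gcomp_cont cu); cont. Qed.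

Lemma Mr_cont_r x u : continuous u -> continuous (fun r => Mr r u x).
Proof. by move=> cu; apply: avg_continuous; apply: (gcomp_cont cu); cont. Qed.

(** The quadratic remainder of u is bounded uniformly in the base point, hence so is its average. *)
Lemma pd_Mr r u j : SR u -> forall x, is_derive x (E j) (Mr r u) (Mr r (pd j u) x).
Proof.
move=> Su x; have [su _] := Su.
have [B HB] := @wbound_pds_all u 2 0 Su.
have HB' i k y : `|pd i (pd k u) y| <= B by apply: wbound_norm (HB [:: i; k] isT).
apply: (@is_derive_quad _ _ _ x _ _ B 1) => // h _.
have cu := SR_continuous Su; have cp := SR_continuous (SR_pds [:: j] Su).
have h1 := @Mr_arg_cont r u (x + h *: E j) cu; have h2 := @Mr_arg_cont r u x cu.
have h3 := @Mr_arg_cont r (pd j u) x cp.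
have h4 : continuous (fun w : V => h * pd j u (x - r *: w)) by cont.
have h5 : continuous (fun w : V => u (x + h *: E j - r *: w) - u (x - r *: w)) by cont.
have h6 : continuous (fun w : V => u (x + h *: E j - r *: w) - u (x - r *: w) - h * pd j u (x - r *: w)).
  by cont.
rewrite /Mr -(avgB h1 h2) -(avgZ h h3) -(avgB h5 h4).
apply: (avg_bound _ h6) => w _.
rewrite (_ : x + h *: E j - r *: w = x - r *: w + h *: E j); last exact: addrAC.
exact: (pd_quad (x - r *: w) j h su HB').
Qed.

Lemma pds_Mr r u s : SR u -> pds s (Mr r u) = Mr r (pds s u).
Proof.
move=> Su; elim: s => //= j s ->; apply/funext => x.
by have [_] := pd_Mr r j (SR_pds s Su) x.
Qed.

Lemma enorm1_shift x w (r : R) : dot w w = 1 -> 1 + enorm x <= (1 + enorm (x - r *: w)) * (1 + `|r|).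
Proof.
move=> w1; have h : enorm x <= enorm (x - r *: w) + `|r|.
  have := enormD (x - r *: w) (r *: w); rewrite subrK enormZ (enorm_unit w1) mulr1; exact.
have := enorm_ge0 (x - r *: w); have := normr_ge0 r.
move: h; move: (enorm _) (enorm _) (`|r|) => p q s; nra.
Qed.

(** The exponential rate must come out as [Phi] and not as exp (a r), or the comparison with |A|
    would be lost. With e = x / |x| and y = x - r w, one has |x| <= |y| + r (w . e), and averaging
    exp (a r (w . e)) over w gives [Phi] exactly; only the polynomial weight is estimated
    crudely. *)
Lemma wbound_Mr r u m B : continuous u -> wbound m u B ->
  wbound m (Mr r u) ((1 + `|r|) ^+ m * Phi `|r| * B).
Proof.
move=> cu H x; have B0 := wbound_ge0 H.
have h1 := @Mr_arg_cont r u x cu.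
rewrite -[wt m x](gtr0_norm (wt_gt0 m x)) -normrM.
rewrite /Mr -(avgZ (wt m x) h1).
have h2 : continuous (fun w : V => wt m x * u (x - r *: w)) by cont.
apply: le_trans (avg_norm h2) _.
have [e e1 eE] : exists2 e : V, dot e e = 1 & enorm x = dot x e.
  have [x0|x0] := eqVneq (dot x x) 0.
    exists (unit_e1 R n.+2); first exact: dot_e1e1.
    by rewrite (dot_eq0 x0) enorm0 /dot big1// => i _; rewrite mxE mul0r.
  have ex : 0 < enorm x by rewrite sqrtr_gt0 lt_def x0 dot_ge0.
  exists ((enorm x)^-1 *: x).
    by rewrite dotZl dotZr -enorm_sqr; field; rewrite gt_eqF.
  by rewrite dotZr -enorm_sqr; field; rewrite gt_eqF.
have h3 : continuous (fun w : V => `|wt m x * u (x - r *: w)|) by cont.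
have h4 : continuous (fun w : V => expR (a * dot (r *: e) w)) by cont.
have h5 : continuous (fun w : V => (1 + `|r|) ^+ m * B * expR (a * dot (r *: e) w)) by cont.
apply: (@le_trans _ _ (avg (fun w : V => (1 + `|r|) ^+ m * B * expR (a * dot (r *: e) w)))); last first.
  rewrite (avgZ _ h4) Phi_radial enormZ (enorm_unit e1) mulr1.
  by rewrite mulrAC.
apply: (avg_le _ h3 h5) => w w1; rewrite normrM (gtr0_norm (wt_gt0 m x)).
set y := x - r *: w.
have k1 : (1 + enorm x) ^+ m <= (1 + enorm y) ^+ m * (1 + `|r|) ^+ m.
  rewrite -exprMn lerXn2r ?nnegrE ?mulr_ge0 ?addr_ge0 ?enorm_ge0//.
  exact: enorm1_shift.
have k2 : expR (a * enorm x) <= expR (a * enorm y) * expR (a * dot (r *: e) w).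
  rewrite -expRD ler_expR -mulrDr ler_wpM2l// eE.
  have -> : x = y + r *: w by rewrite /y subrK.
  rewrite dotDl dotZl dotZl [dot w e]dotC lerD2r.
  have := CauchySchwarz y e; rewrite (enorm_unit e1) mulr1; apply: le_trans.
  exact: ler_norm.
apply: (@le_trans _ _ ((expR (a * enorm y) * expR (a * dot (r *: e) w)) *
   ((1 + enorm y) ^+ m * (1 + `|r|) ^+ m) * `|u y|)).
  by rewrite ler_wpM2r// ler_pM ?expR_ge0// exprn_ge0// addr_ge0// enorm_ge0.
rewrite (_ : _ * `|u y| = (1 + `|r|) ^+ m * expR (a * dot (r *: e) w) * (wt m y * `|u y|)).
  rewrite [leRHS]mulrAC ler_wpM2l// mulr_ge0 ?expR_ge0// exprn_ge0// addr_ge0.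
by rewrite /wt; ring.
Qed.

Lemma SR_Mr r u : SR u -> SR (Mr r u).
Proof.
move=> Su; split=> [s|s m]; rewrite pds_Mr//.
  split; first by apply: Mr_cont; exact: SR_pds_cont.
  by move=> x j; have [] := pd_Mr r j (SR_pds s Su) x.
have [_ /(_ s m)[B HB]] := Su.
by exists ((1 + `|r|) ^+ m * Phi `|r| * B); apply: wbound_Mr => //; exact: SR_pds_cont.
Qed.

End schwartz_class.

Transparent avg.

(** * From functionals to radial means *)

Section cap_positivity.
Context {R : realType} {n : nat}.
Local Notation mR := (measurableTypeR R).
Local Notation d := n.+2.
Local Notation V := 'rV[R]_d.
Local Notation sig := (@sphere_measure R d).

Let diag : V := (Num.sqrt d%:R)^-1 *: const_mx 1.

Let D0 : 0 < d%:R :> R. Proof. by rewrite ltr0n. Qed.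

Let S0 : 0 < Num.sqrt d%:R :> R. Proof. by rewrite sqrtr_gt0. Qed.

Let SS : Num.sqrt d%:R * Num.sqrt d%:R = d%:R :> R.
Proof. by rewrite -expr2 sqr_sqrtr// ltW. Qed.

Let dot_diag (x : V) : dot diag x = (Num.sqrt d%:R)^-1 * \sum_i x 0 i.
Proof.
rewrite dotZl; congr (_ * _); apply: eq_bigr => i _.
by rewrite mxE mul1r.
Qed.

Let diag1 : dot diag diag = 1.
Proof.
rewrite dot_diag; under eq_bigr do rewrite !mxE mulr1.
by rewrite sumr_const card_ord -[X in _ * X]mulr_natl mulrCA -invfM SS mulfV// gt_eqF.
Qed.

(** Every cap around the pole has positive measure; [avg_coord_ge] stops short of it. The pole is
    rotated to the diagonal direction, near which lie all points with nearly equal coordinates, that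
    is, a whole cube. *)
Lemma avg_cap_gt0 (K : R -> R) : continuous K -> (forall x, 0 <= K x) -> 0 < K 1 ->
  0 < avg (fun w : V => K (w 0 0)).
Proof.
move=> cK K0 K1; rewrite -(avg_dot diag1 cK).
have K2 : 0 < K 1 / 2 by rewrite divr_gt0.
have := iffLR (@cvgrPdist_le R R _ (nbhs (1 : R)) (nbhs_filter (1 : R)) _ _) (cK 1) _ K2.
move=> /nbhs_normP[e0 /= e00 He].
pose e := Num.min e0 1 / 2.
have m0 : 0 < Num.min e0 1 by rewrite lt_min e00 ltr01.
have ep : 0 < e by rewrite divr_gt0.
have em : e < Num.min e0 1 by rewrite /e ltr_pdivrMr// ltr_pMr// ltr1n.
have [ee0 e1] : e < e0 /\ e < 1 by move: em; rewrite lt_min => /andP[].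
have KE x : 1 - e <= x <= 1 -> K 1 / 2 <= K x.
  move=> /andP[x1 x2]; have := He x; rewrite /ball_ /= => /(_ _)h.
  have : `|K 1 - K x| <= K 1 / 2.
    by apply: h; rewrite ger0_norm ?subr_ge0//; lra.
  by rewrite ler_norml => /andP[_]; lra.
(* b = 1/d keeps the cube in the unit ball, and the ratio a / b = 1 - e bounds from below the cosine
   of the angle with the diagonal. *)
pose b : R := d%:R^-1; pose a := (1 - e) * b.
have b0 : 0 < b by rewrite invr_gt0.
have a0 : 0 < a by rewrite mulr_gt0// subr_gt0.
have ab : a <= b by rewrite /a ler_piMl ?(ltW b0)//; lra.
pose Q : set (d.-tuple mR) := tcube a b.
have mQ : measurable Q by exact: measurable_tcube.
have cdot : continuous (fun w : V => K (dot diag w)) by apply: (comp_cont cK); cont.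
pose f0 (v : d.-tuple mR) := (K (dot diag (rv v)))%:E.
have mf0 : measurable_fun setT f0 by apply/measurable_EFinP; exact: (measurable_rv cdot).
have avgE : (avg (fun w : V => K (dot diag w)))%:E = (\int[sig]_v f0 v)%E.
  by rewrite /avg fineK//; apply: integrable_fin_num => //; exact: (avg_integrable cdot).
rewrite -lte_fin avgE.
have f00 v : (0 <= f0 v)%E by rewrite lee_fin.
pose vol := @ball_volume R n.
have vol0 : 0 < vol by exact: ball_volume_gt0.
rewrite [ltRHS](ge0_integral_mscale _ _ _ mf0)//.
apply: mule_gt0; first by rewrite lte_fin invr_gt0.
rewrite [ltRHS](ge0_integral_pushforward (@measurable_direction R d) _ measurableT mf0)//.
have Qv v : Q v -> 0 < enorm (rv v) <= 1 /\ 1 - e <= dot diag ((enorm (rv v))^-1 *: rv v) <= 1.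
  move=> Qv; have vb i : a <= tnth v i <= b by exact: Qv.
  have s1 : d%:R * a <= \sum_i (rv v) 0 i.
    rewrite (_ : d%:R * a = \sum_(i < d) a); last by rewrite sumr_const card_ord mulr_natl.
    by apply: ler_sum => i _; rewrite mxE; have /andP[] := vb i.
  have s2 : enorm (rv v) <= Num.sqrt d%:R * b.
    rewrite -[leRHS](ger0_norm (ltW (mulr_gt0 S0 b0))) -sqrtr_sqr ler_wsqrtr//.
    rewrite expr2 mulrACA SS (_ : _ * (b * b) = \sum_(i < d) b * b); last first.
      by rewrite sumr_const card_ord mulr_natl.
    apply: ler_sum => i _; rewrite mxE; have /andP[h1 h2] := vb i.
    by rewrite ler_pM// (le_trans (ltW a0)).
  have s3 : enorm (rv v) <= \sum_(i < d) (rv v) 0 i.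
    apply: le_trans (enorm_le_sum _) _; apply: ler_sum => i _; rewrite mxE ger0_norm//.
    by have /andP[h1 _] := vb i; rewrite (le_trans (ltW a0)).
  have s4 : \sum_(i < d) (rv v) 0 i <= 1.
    rewrite -(mulfV (lt0r_neq0 D0)) -/b (_ : d%:R * b = \sum_(i < d) b); last first.
      by rewrite sumr_const card_ord mulr_natl.
    by apply: ler_sum => i _; rewrite mxE; have /andP[] := vb i.
  have s5 : 0 < enorm (rv v).
    apply: lt_le_trans (normr_coord (rv v) 0); rewrite mxE normr_gt0 gt_eqF//.
    by have /andP[h1 _] := vb 0; exact: lt_le_trans h1.
  split; first by rewrite s5 (le_trans s3).
  apply/andP; split; last first.
    apply: le_trans (ler_norm _) _; apply: le_trans (CauchySchwarz _ _) _.
    by rewrite (enorm_unit diag1) mul1r enormZ ger0_norm ?invr_ge0 ?(ltW s5)// mulVf ?gt_eqF.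
  rewrite dotZr dot_diag.
  have -> : (enorm (rv v))^-1 * ((Num.sqrt d%:R)^-1 * \sum_i (rv v) 0 i) =
     (\sum_i (rv v) 0 i) / (Num.sqrt d%:R * enorm (rv v)).
    by rewrite mulrA -invfM mulrC [enorm _ * _]mulrC.
  rewrite ler_pdivlMr ?mulr_gt0//; apply: le_trans s1; rewrite /a [leRHS]mulrCA.
  rewrite ler_wpM2l ?subr_ge0 ?(ltW e1)//.
  by apply: le_trans (ler_wpM2l (ltW S0) s2) _; rewrite mulrA SS.
have subE : Q `<=` @punctured_ball R d by move=> v /Qv[].
have mfd : measurable_fun setT (f0 \o @direction R d).
  by apply: measurableT_comp => //; exact: measurable_direction.
apply: (@lt_le_trans _ _ (\int[@lebesgue_tuple R d]_(v in Q) (f0 \o @direction R d) v)%E); last first.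
  by apply: le_integral_mrestr => // v; exact: f00.
apply: (@lt_le_trans _ _ (\int[@lebesgue_tuple R d]_(v in Q) (K 1 / 2)%:E)%E).
  have LQ : @lebesgue_tuple R d Q = ((b - a) ^+ d)%:E by exact: lebesgue_tcube.
  rewrite integral_cst// [X in (_ * X)%E](_ : _ = ((b - a) ^+ d)%:E); last exact: LQ.
  rewrite -EFinM lte_fin mulr_gt0// exprn_gt0// /a.
  by rewrite (_ : _ - _ = e * b) ?mulr_gt0//; ring.
apply: ge0_le_integral => //.
- by move=> v _; rewrite lee_fin ltW.
- exact: measurable_funTS.
move=> v /Qv[_ h]; rewrite /f0 /comp directionE trvK lee_fin.
exact: KE.
Qed.

End cap_positivity.

Global Opaque avg.

(** * The law of a sum of two independent points on spheres *)

Section product_formula.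
Context {R : realType} {n : nat}.
Local Notation V := 'rV[R]_n.+2.
Local Notation e1 := (unit_e1 R n.+2).
Implicit Types (h : V -> R) (u v w Y : V) (r t : R).

Definition dbl r t h : R := avg (fun v : V => avg (fun w => h (r *: v + t *: w))).

Let dbl_inner r t h v : continuous h -> continuous (fun w : V => h (r *: v + t *: w)).
Proof. by move=> ch; apply: (gcomp_cont ch); cont. Qed.

Let dbl_outer r t h : continuous h -> continuous (fun v : V => avg (fun w => h (r *: v + t *: w))).
Proof. by move=> ch; apply: avg_continuous; apply: (gcomp_cont ch); cont. Qed.

Lemma dbl_bound r t h (M : R) : continuous h -> (forall Y, `|h Y| <= M) -> `|dbl r t h| <= M.
Proof.
move=> ch H; rewrite /dbl; apply: (avg_bound _ (@dbl_outer r t h ch)) => v _.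
by apply: (avg_bound _ (@dbl_inner r t h v ch)) => w _.
Qed.

Lemma dblB r t h h' : continuous h -> continuous h' ->
  dbl r t (fun Y => h Y - h' Y) = dbl r t h - dbl r t h'.
Proof.
move=> ch ch'; rewrite /dbl -(avgB (@dbl_outer r t h ch) (@dbl_outer r t h' ch')).
apply: (f_equal avg); apply/funext => v.
exact: (avgB (@dbl_inner r t h v ch) (@dbl_inner r t h' v ch')).
Qed.

Lemma dbl_rot r t h (f : V -> V) : rotation f -> continuous h -> dbl r t (h \o f) = dbl r t h.
Proof.
move=> rf ch; have [fD fZ _ _] := rf.
rewrite /dbl -(avg_rot rf (@dbl_outer r t h ch)); apply: (f_equal avg); apply/funext => v /=.
rewrite -(avg_rot rf (@dbl_inner r t h (f v) ch)); apply: (f_equal avg); apply/funext => w /=.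
by rewrite fD !fZ.
Qed.

Lemma dbl_radial r t (k : R -> R) : 0 <= r -> continuous k ->
  dbl r t (fun Y => k (enorm Y)) = @sp R n t k r.
Proof.
move=> r0 ck.
have ck' : continuous (fun Y : V => k (enorm Y)) by apply: (comp_cont ck); cont.
transitivity (avg (fun _ : V => @sp R n t k r)); last exact: avg_cst.
rewrite /dbl; apply: (avg_eq _ (@dbl_outer r t _ ck')); last by cont.
move=> v v1; have -> := avg_radial t (r *: v) ck.
by rewrite enormZ (enorm_unit v1) mulr1 ger0_norm.
Qed.

Lemma dbl_swap r t (g : V * V -> R) : continuous g ->
  dbl r t (fun Y => avg (fun u => g (u, Y))) = avg (fun u => dbl r t (fun Y => g (u, Y))).
Proof.
move=> cg.
have c1 : continuous (fun p : V * V => avg (fun w => g (p.1, r *: p.2 + t *: w))).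
  by apply: avg_continuous; apply: (pair_comp cg); cont.
transitivity (avg (fun v : V => avg (fun u : V => avg (fun w => g (u, r *: v + t *: w))))).
  apply: (f_equal avg); apply/funext => v.
  have c2 : continuous (fun p : V * V => g (p.2, r *: v + t *: p.1)).
    by apply: (pair_comp cg); cont.
  exact: (avg_swap c2).
have c3 : continuous (fun p : V * V => avg (fun w => g (p.2, r *: p.1 + t *: w))).
  by apply: avg_continuous; apply: (pair_comp cg); cont.
exact: (avg_swap c3).
Qed.

Section kernel.
Variables (delta : R).
Hypothesis delta0 : 0 < delta.

(* For |u| = 1 the kernel concentrates Y in the direction u, at scale delta. *)
Let ker u Y := Num.max (delta - enorm (enorm Y *: u - Y)) 0.

Let kap (rho : R) : R := avg (fun u => ker u (rho *: e1)).

Let ker_cont2 : continuous (fun p : V * V => ker p.1 p.2).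
Proof. rewrite /ker; cont. Qed.

Let ker_rot (f : V -> V) u Y : rotation f -> ker (f u) (f Y) = ker u Y.
Proof.
move=> rf; have [fD fZ _ _] := rf.
by rewrite /ker (rotation_enorm rf) -fZ -(rotationB rf) (rotation_enorm rf).
Qed.

Let ker_cont Y : continuous (fun u => ker u Y).
Proof. rewrite /ker; cont. Qed.

Let kap_cont : continuous kap.
Proof. rewrite /kap /ker; apply: avg_continuous; cont. Qed.

Let kapE Y : avg (fun u => ker u Y) = kap (enorm Y).
Proof.
have [Y0|Y0] := eqVneq (dot Y Y) 0.
  by rewrite (dot_eq0 Y0) /kap enorm0 scale0r.
have eY : 0 < enorm Y by rewrite sqrtr_gt0 lt_def Y0 dot_ge0.
have [|f rf fE] := @rotation_exists R n ((enorm Y)^-1 *: Y).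
  by rewrite dotZl dotZr -enorm_sqr; field; rewrite gt_eqF.
have [_ fZ _ _] := rf.
have YE : Y = f (enorm Y *: e1) by rewrite fZ fE scalerA mulfV ?gt_eqF// scale1r.
rewrite -(avg_rot rf (@ker_cont Y)) /kap; apply: (f_equal avg); apply/funext => u /=.
by rewrite {1}YE ker_rot.
Qed.

Let kap_gt0 (rho : R) : 0 <= rho -> 0 < kap rho.
Proof.
move=> r0; pose K x := Num.max (delta - rho * Num.sqrt (2 - 2 * x)) 0.
have cK : continuous K by rewrite /K; cont.
have -> : kap rho = avg (fun u : V => K (u 0 0)).
  apply: avg_eq => [u u1||]; [|exact: ker_cont|by apply: (comp_cont cK); cont].
  rewrite /ker /K enormZ enorm_e1 mulr1 ger0_norm// -scalerBr enormZ ger0_norm//.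
  congr (Num.max (_ - _ * Num.sqrt _) _).
  rewrite dotDl !dotDr -scaleN1r !dotZl !dotZr u1 dot_e1e1 dot_e1 dotC dot_e1; ring.
apply: avg_cap_gt0 => // [x|]; first by rewrite le_max lexx orbT.
by rewrite /K mulr1 subrr sqrtr0 mulr0 subr0 lt_max delta0.
Qed.

Let kap_neq0 Y : kap (enorm Y) != 0.
Proof. by rewrite gt_eqF// kap_gt0// enorm_ge0. Qed.

(** The average of h over the sphere through Y with the normalised kernel as density: close to h for
    small delta, and integrable exactly by rotation invariance. *)
Let smear h Y := avg (fun u => h (enorm Y *: u) * ker u Y / kap (enorm Y)).

Let smear_cont2 h : continuous h ->
  continuous (fun p : V * V => h (enorm p.2 *: p.1) * ker p.1 p.2 / kap (enorm p.2)).
Proof.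
move=> ch; apply: mul_cont; last first.
  by apply: inv_cont => [p|]; [exact: kap_neq0|apply: (comp_cont kap_cont); cont].
by apply: mul_cont; [apply: (gcomp_cont ch); cont|exact: ker_cont2].
Qed.

Let ker_avg1 Y : avg (fun u => (kap (enorm Y))^-1 * ker u Y) = 1.
Proof. by rewrite (avgZ _ (@ker_cont Y)) kapE mulVf. Qed.

(** The kernel vanishes unless |Y| u is within delta of Y, and its normalised average is 1. *)
Let smear_close h (L : R) : continuous h -> 0 <= L ->
  (forall x y, `|h x - h y| <= L * enorm (x - y)) ->
  forall Y, `|smear h Y - h Y| <= L * delta.
Proof.
move=> ch L0 hL Y; pose c := (kap (enorm Y))^-1.
have c0 : 0 < c by rewrite invr_gt0 kap_gt0// enorm_ge0.
have k1 : continuous (fun u : V => c * ker u Y) by have := @ker_cont Y => kc; cont.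
have k2 : continuous (fun u : V => h Y * (c * ker u Y)) by cont.
have k3 : continuous (fun u : V => h (enorm Y *: u) * ker u Y / kap (enorm Y)).
  have h1 : continuous (fun u : V => h (enorm Y *: u)) by apply: (gcomp_cont ch); cont.
  have := @ker_cont Y => kc; cont.
have k4 : continuous (fun u : V => h (enorm Y *: u) * ker u Y / kap (enorm Y) - h Y * (c * ker u Y)).
  by cont.
have k5 : continuous (fun u : V => L * delta * (c * ker u Y)) by cont.
have -> : h Y = avg (fun u => h Y * (c * ker u Y)) by rewrite (avgZ _ k1) ker_avg1 mulr1.
rewrite /smear -(avgB k3 k2); apply: le_trans (avg_norm k4) _.
rewrite -[leRHS]mulr1 -(ker_avg1 Y) -(avgZ _ k1).
apply: (avg_le _ _ k5) => [u u1|]; last by cont.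
rewrite (_ : _ - _ = (c * ker u Y) * (h (enorm Y *: u) - h Y)); last by rewrite /c; ring.
have kk : 0 <= ker u Y by rewrite /ker le_max lexx orbT.
rewrite normrM ger0_norm ?mulr_ge0 ?(ltW c0)// mulrC.
have [ed|ed] := leP delta (enorm (enorm Y *: u - Y)).
  have -> : ker u Y = 0 by apply/max_idPr; rewrite subr_le0.
  by rewrite !mulr0.
rewrite ler_wpM2r ?mulr_ge0 ?(ltW c0)//; apply: le_trans (hL _ _) _.
by rewrite ler_wpM2l// ltW.
Qed.

(** The direction u in the argument of h and the direction u' in the kernel decouple: the law of r v
    + t w is rotation invariant, so the integral does not depend on u', which may be averaged out;
    the kernel then contributes 1. *)
Let dbl_smear r t h : 0 <= r -> continuous h ->
  dbl r t (smear h) = @sp R n t (fun rho => avg (fun u => h (rho *: u))) r.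
Proof.
move=> r0 ch.
have cs := smear_cont2 ch.
rewrite /smear (dbl_swap r t cs) /=.
pose h' rho := avg (fun u : V => h (rho *: u)).
have ch' : continuous h' by apply: avg_continuous; apply: (gcomp_cont ch); cont.
rewrite -(dbl_radial t r0 ch').
have ch2 : continuous (fun p : V * V => h (enorm p.2 *: p.1)) by apply: (gcomp_cont ch); cont.
rewrite (dbl_swap r t ch2) /=.
have cF u : continuous (fun p : V * V => h (enorm p.2 *: u) * ker p.1 p.2 / kap (enorm p.2)).
  apply: mul_cont; last first.
    by apply: inv_cont => [p|]; [exact: kap_neq0|apply: (comp_cont kap_cont); cont].
  by apply: mul_cont; [apply: (gcomp_cont ch); cont|exact: ker_cont2].
have cF1 u u' : continuous (fun Y : V => h (enorm Y *: u) * ker u' Y / kap (enorm Y)).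
  have c0 : continuous (fun _ : V => u') by cont.
  exact: (pair_comp (cF u) c0 id_cont).
have cdbl (g : V * V -> R) : continuous g -> continuous (fun u : V => dbl r t (fun Y => g (u, Y))).
  move=> cg; apply: avg_continuous; apply: avg_continuous.
  by apply: (pair_comp cg); cont.
apply: avg_eq => [u u1||]; [|exact: (cdbl _ cs)|exact: (cdbl _ ch2)].
have inv u' : dot u' u' = 1 -> dbl r t (fun Y => h (enorm Y *: u) * ker u' Y / kap (enorm Y)) =
    dbl r t (fun Y => h (enorm Y *: u) * ker e1 Y / kap (enorm Y)).
  move=> u'1; have [f rf fE] := rotation_exists u'1.
  rewrite -(dbl_rot r t rf (@cF1 u u')); apply: (f_equal (dbl r t)); apply/funext => Y /=.
  by rewrite (rotation_enorm rf) -fE (ker_rot _ _ rf).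
transitivity (avg (fun u' : V => dbl r t (fun Y => h (enorm Y *: u) * ker u' Y / kap (enorm Y)))).
  rewrite (inv u u1) -[LHS](@avg_cst R n).
  apply: avg_eq => [u' u'1||]; [by rewrite inv|by cont|exact: (cdbl _ (cF u))].
rewrite -(dbl_swap r t (cF u)); apply: (f_equal (dbl r t)); apply/funext => Y.
have kc := @ker_cont Y.
transitivity (avg (fun u' : V => h (enorm Y *: u) * ((kap (enorm Y))^-1 * ker u' Y))).
  by apply: (f_equal avg); apply/funext => u' /=; ring.
rewrite avgZ; last by cont.
by rewrite ker_avg1 mulr1.
Qed.

Lemma dbl_sp_close r t h (L : R) : 0 <= r -> continuous h -> 0 <= L ->
  (forall x y, `|h x - h y| <= L * enorm (x - y)) ->
  `|@sp R n t (fun rho => avg (fun u => h (rho *: u))) r - dbl r t h| <= L * delta.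
Proof.
move=> r0 ch L0 hL.
have cs : continuous (smear h).
  by apply: avg_continuous; exact: (pair_comp (smear_cont2 ch) snd_cont fst_cont).
rewrite -(dbl_smear t r0 ch) -(dblB r t cs ch).
by apply: dbl_bound; [cont|exact: smear_close].
Qed.

End kernel.

(** Given its norm, r v + t w is uniformly distributed on the sphere. The disintegration is made
    without Haar measure: it is exact for the smeared function, and the Lipschitz bound lets the
    scale delta tend to 0. *)
Lemma product_formula r t h (L : R) : 0 <= r -> continuous h -> 0 <= L ->
  (forall x y, `|h x - h y| <= L * enorm (x - y)) ->
  dbl r t h = @sp R n t (fun rho => avg (fun u => h (rho *: u))) r.
Proof.
move=> r0 ch L0 hL; apply/esym/eqP; rewrite -subr_eq0 -normr_le0.
apply/ler_addgt0Pl => e e0; rewrite addr0.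
have L1 : 0 < L + 1 by rewrite ltr_wpDl.
have d0 : 0 < e / (L + 1) by rewrite divr_gt0.
apply: le_trans (dbl_sp_close d0 t r0 ch L0 hL) _.
by rewrite mulrCA ler_piMr ?(ltW e0)// ler_pdivrMr// mul1r lerDl.
Qed.

End product_formula.

Transparent sp.

Lemma sp_avg {R : realType} n s (p : R -> R) r :
  @sp R n s p r = avg (fun w : 'rV[R]_n.+2 => p (enorm (r *: unit_e1 R n.+2 + s *: w))).
Proof. by []. Qed.

Lemma sp_norm {R : realType} n s (p : R -> R) r : continuous p -> @sp R n s p r = @sp R n s p `|r|.
Proof.
move=> cp; have := @avg_radial R n s p (r *: unit_e1 R n.+2) cp.
by rewrite enormZ enorm_e1 mulr1 => <-.
Qed.

Global Opaque sp.

Lemma sum_cst {R : realType} N (c : R) : \sum_(j < N) c = N%:R * c.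
Proof. by rewrite sumr_const card_ord mulr_natl. Qed.

(** * Quadrature with coefficients independent of the integrand *)

Section quadrature.
Context {R : realType} {n : nat}.
Local Notation V := 'rV[R]_n.+2.
Implicit Types (f : R -> R) (c : nat -> R) (delta : R).

(* With [c i = clamp i] this is the piecewise linear interpolation of f at the
   nodes [i * delta]. *)
Definition interp c delta N f : R :=
  f 0 + \sum_(i < N) c i * (f (i.+1%:R * delta) - f (i%:R * delta)).

Definition clamp delta (i : nat) (x : R) : R := Num.min 1 (Num.max 0 (x / delta - i%:R)).

Lemma clamp_cont delta i : continuous (clamp delta i).
Proof. rewrite /clamp; cont. Qed.

Lemma interp_close delta N f K : 0 < delta -> 0 <= K ->
  (forall x y, 0 <= x <= N%:R * delta -> 0 <= y <= N%:R * delta -> `|f x - f y| <= K * `|x - y|) ->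
  forall x, 0 <= x <= N%:R * delta ->
  `|f x - interp (fun i => clamp delta i x) delta N f| <= 2 * K * delta.
Proof.
move=> d0 K0; have dn : delta != 0 by rewrite gt_eqF.
elim: N => [|N IH] H x /andP[x0 xN].
  have -> : x = 0 by apply/le_anti; rewrite x0 andbT; move: xN; rewrite mul0r.
  by rewrite /interp big_ord0 addr0 subrr normr0 !mulr_ge0// ltW.
have NN : N%:R * delta <= N.+1%:R * delta by rewrite ler_wpM2r ?(ltW d0)// ler_nat.
have N0 : 0 <= N%:R * delta by rewrite mulr_ge0// ltW.
rewrite /interp big_ord_recr /= addrA.
rewrite -[f 0 + \sum_(i < N) _]/(interp (fun i => clamp delta i x) delta N f).
have [xN'|xN'] := leP x (N%:R * delta).
  have -> : clamp delta N x = 0.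
    rewrite /clamp; have -> : Num.max 0 (x / delta - N%:R) = 0.
      by apply/max_idPl; rewrite subr_le0 ler_pdivrMr.
    by apply/min_idPr; exact: ler01.
  rewrite mul0r addr0; apply: IH; last by rewrite x0.
  by move=> y z /andP[y0 y1] /andP[z0 z1]; apply: H; rewrite ?y0 ?z0 ?(le_trans y1) ?(le_trans z1).
have -> : interp (fun i => clamp delta i x) delta N f = f (N%:R * delta).
  rewrite /interp (eq_bigr (fun i : 'I_N => f (i.+1%:R * delta) - f (i%:R * delta))).
    rewrite -(big_mkord xpredT (fun i => f (i.+1%:R * delta) - f (i%:R * delta))).
    rewrite (@telescope_sumr _ 0%N N (fun i => f (i%:R * delta))) ?leq0n//.
    by rewrite mul0r addrC subrK.
  move=> i _; have h : 1 <= x / delta - i%:R.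
    rewrite lerBrDl ler_pdivlMr//; apply: le_trans (ltW xN').
    by rewrite ler_wpM2r ?(ltW d0)// natr1 ler_nat.
  rewrite /clamp (_ : Num.max 0 _ = x / delta - i%:R); last first.
    by apply/max_idPr; exact: le_trans h.
  by rewrite (_ : Num.min 1 _ = 1) ?mul1r//; apply/min_idPl.
have c0 : 0 <= clamp delta N x <= 1.
  by rewrite /clamp le_min ler01 le_max lexx /= ge_min lexx.
set c := clamp _ _ _ in c0 *; case/andP: c0 => c0 c1.
have hN : 0 <= N%:R * delta <= N.+1%:R * delta by rewrite N0 NN.
have hN1 : 0 <= N.+1%:R * delta <= N.+1%:R * delta by rewrite lexx (le_trans N0).
have hx : 0 <= x <= N.+1%:R * delta by rewrite x0.
have h1 := H x (N%:R * delta) hx hN.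
have h2 := H (N.+1%:R * delta) (N%:R * delta) hN1 hN.
have l1 : `|x - N%:R * delta| <= delta.
  rewrite ger0_norm ?subr_ge0 ?(ltW xN')//; move: xN; rewrite -natr1 mulrDl mul1r; lra.
have l2 : `|N.+1%:R * delta - N%:R * delta| = delta.
  by rewrite -natr1 mulrDl mul1r addrAC subrr add0r gtr0_norm.
rewrite opprD addrA; apply: le_trans (ler_normB _ _) _.
rewrite -mulrA mulrDl mul1r; apply: lerD.
  by apply: le_trans h1 _; rewrite ler_wpM2l.
rewrite normrM (ger0_norm c0) -[leRHS]mul1r; apply: ler_pM => //.
by move: h2; rewrite l2.
Qed.

(** The point is the order of quantifiers: the coefficients depend on [rho] and N only. One rule
    therefore serves rho |-> [Mr rho u x] for all x and rho |-> [L (Mr rho u)] at once. *)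
Lemma quadrature (rho : V -> R) (b : R) N : continuous rho -> 0 < b -> (0 < N)%N ->
  (forall w, dot w w = 1 -> 0 <= rho w <= b) -> exists c, forall f K, continuous f -> 0 <= K ->
  (forall x y, 0 <= x <= b -> 0 <= y <= b -> `|f x - f y| <= K * `|x - y|) ->
  `|avg (fun w => f (rho w)) - interp c (b / N%:R) N f| <= 2 * K * (b / N%:R).
Proof.
move=> crho b0 N0 rb; pose delta := b / N%:R.
have N0' : 0 < N%:R :> R by rewrite ltr0n.
have d0 : 0 < delta by rewrite divr_gt0.
have Nd : N%:R * delta = b by rewrite /delta mulrCA divff ?mulr1// gt_eqF.
exists (fun i => avg (fun w => clamp delta i (rho w))) => f K cf K0 H.
have cc i : continuous (fun w => clamp delta i (rho w)).
  by apply: (gcomp_cont (@clamp_cont delta i)).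
have cfr : continuous (fun w => f (rho w)) by exact: (gcomp_cont cf).
pose D i := f (i.+1%:R * delta) - f (i%:R * delta).
have cs : continuous (fun w => \sum_(i < N) D i * clamp delta i (rho w)).
  by apply: sum_cont => i; have := cc i => cci; cont.
have ci : continuous (fun w => f 0 + \sum_(i < N) D i * clamp delta i (rho w)) by cont.
have E : avg (fun w => f 0 + \sum_(i < N) D i * clamp delta i (rho w)) =
    interp (fun i => avg (fun w => clamp delta i (rho w))) delta N f.
  have c0 : continuous (fun _ : V => f 0) by cont.
  rewrite (avgD c0 cs) avg_cst /interp; congr (_ + _).
  rewrite (@avg_sum R n 'I_N _ (fun i w => D i * clamp delta i (rho w))); last first.
    by move=> i; have := cc i => cci; cont.
  by apply: eq_bigr => i _; rewrite (avgZ _ (cc i)) mulrC.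
rewrite -/delta -E -(avgB cfr ci).
have cB : continuous (fun w => f (rho w) - (f 0 + \sum_(i < N) D i * clamp delta i (rho w))) by cont.
apply: (avg_bound _ cB) => w w1.
have -> : f 0 + \sum_(i < N) D i * clamp delta i (rho w) = interp (fun i => clamp delta i (rho w)) delta N f.
  by rewrite /interp; congr (_ + _); apply: eq_bigr => i _; rewrite mulrC.
by apply: interp_close => //; rewrite Nd//; exact: rb.
Qed.

End quadrature.

(** * Functionals applied to spherical averages *)

Section functionals.
Context {R : realType} {n : nat} (a : R).
Hypothesis a0 : 0 <= a.
Local Notation V := 'rV[R]_n.+2.
Local Notation E j := (delta_mx 0 j : V).
Local Notation e1 := (unit_e1 R n.+2).
Local Notation Phi := (@Phi R n a).
Local Notation SR := (@SR R n a).
Local Notation wt := (@expweight R n a).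
Local Notation wbound := (@wbound R n a).
Implicit Types (u v : V -> R) (x y w : V) (m : nat) (L : (V -> R) -> R).

Lemma Phi_norm r : Phi `|r| = Phi r.
Proof.
have := Phi_radial a (r *: e1); rewrite enormZ enorm_e1 mulr1 => <-.
apply: (f_equal avg); apply/funext => w.
by rewrite dotZl dot_e1 mulrA.
Qed.

Lemma wt_shift m x w (h b : R) : dot w w = 1 -> `|h| <= b ->
  wt m x <= wt m (x - h *: w) * (expR (a * b) * (1 + b) ^+ m).
Proof.
move=> w1 hb; have b0 : 0 <= b by exact: le_trans hb.
have h1 : enorm x <= enorm (x - h *: w) + b.
  have := enormD (x - h *: w) (h *: w); rewrite subrK enormZ (enorm_unit w1) mulr1.
  by move/le_trans; apply; rewrite lerD2l.
have h2 : 1 + enorm x <= (1 + enorm (x - h *: w)) * (1 + b).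
  by move: h1 (enorm_ge0 (x - h *: w)) b0; move: (enorm _) (enorm _) => p q; nra.
rewrite /wt mulrACA -exprMn; apply: ler_pM => //.
- by rewrite exprn_ge0// addr_ge0 ?enorm_ge0.
- by rewrite -expRD ler_expR -mulrDr ler_wpM2l.
- by rewrite lerXn2r ?nnegrE ?mulr_ge0 ?addr_ge0 ?enorm_ge0.
Qed.

(** The sum of the bounds on the partial derivatives times the cost, in the weight, of moving the
    base point by at most b. *)
Definition lip_cst m (b B : R) : R := n.+2%:R * B * (expR (a * b) * (1 + b) ^+ m).

Lemma line_lipschitz u m (B b : R) x w (r1 r2 : R) : SR u -> (forall j, wbound m (pd j u) B) ->
  dot w w = 1 -> `|r1| <= b -> `|r2| <= b ->
  wt m x * `|u (x - r1 *: w) - u (x - r2 *: w)| <= `|r1 - r2| * lip_cst m b B.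
Proof.
move=> Su HB w1; wlog : r1 r2 / r1 <= r2.
  move=> H h1 h2; have [r12|r21] := leP r1 r2; first exact: H.
  by rewrite distrC [`|r1 - _|]distrC; apply: H => //; exact: ltW.
move=> r12 h1 h2; have [su _] := Su.
have [C HC] := @wbound_pds_all R n a u 2 0 Su.
have HC' i k y : `|pd i (pd k u) y| <= C by apply: (wbound_norm a0) (HC [:: i; k] isT).
pose f (h : R) := u (x + h *: (- w)).
have fE h : u (x - h *: w) = f h by rewrite /f scalerN.
have df (h : R) : is_derive (h : R) 1 f (\sum_j (- w) 0 j * pd j u (x + h *: (- w))).
  exact: (chain_rule x (- w) h su HC').
have W0 := wt_gt0 a m x.
have B0 : 0 <= B by exact: wbound_ge0 (HB 0).
pose K := lip_cst m b B / wt m x.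
have dfb h : r1 <= h <= r2 -> `|\sum_j (- w) 0 j * pd j u (x + h *: (- w))| <= K.
  move=> /andP[k1 k2]; have hb : `|h| <= b.
    rewrite ler_norml; move: h1 h2; rewrite !ler_norml => /andP[p1 _] /andP[_ p2].
    by rewrite (le_trans p1 k1) (le_trans k2 p2).
  rewrite /K ler_pdivlMr// mulrC -[X in X * _](gtr0_norm W0) -normrM mulr_sumr.
  apply: le_trans (ler_norm_sum _ _ _) _.
  rewrite /lip_cst -mulrA -sum_cst.
  apply: ler_sum => j _; rewrite normrM mulrC normrM (gtr0_norm W0).
  have wj : `|(- w) 0 j| <= 1.
    by rewrite mxE normrN; have := normr_coord w j; rewrite (enorm_unit w1).
  have S := wt_shift m x w1 hb.
  have P := HB j (x - h *: w); rewrite scalerN.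
  rewrite mulrAC; apply: (@le_trans _ _ (1 * wt m x * `|pd j u (x - h *: w)|)).
    by rewrite ler_wpM2r// ler_wpM2r ?(ltW W0).
  rewrite mul1r mulrC; apply: (@le_trans _ _ (`|pd j u (x - h *: w)| * (wt m (x - h *: w) * (expR (a * b) * (1 + b) ^+ m)))).
    by rewrite ler_wpM2l.
  rewrite [leLHS]mulrA [X in X * _ <= _]mulrC ler_wpM2r// mulr_ge0 ?expR_ge0// exprn_ge0// addr_ge0//.
  exact: le_trans hb.
have := @derivative_bound _ f _ r1 r2 K r12 (fun h _ => df h) dfb.
rewrite !fE distrC [`|r1 - _|]distrC [`|r2 - r1|]ger0_norm ?subr_ge0// => F.
rewrite -ler_pdivlMl//; apply: le_trans F _.
by rewrite /K le_eqVlt; apply/orP; left; apply/eqP; ring.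
Qed.

Lemma Mr_lipschitz u m (B b r1 r2 : R) : SR u -> (forall j, wbound m (pd j u) B) ->
  `|r1| <= b -> `|r2| <= b ->
  wbound m (fun x => Mr r1 u x - Mr r2 u x) (`|r1 - r2| * lip_cst m b B).
Proof.
move=> Su HB h1 h2 x; have cu := SR_continuous Su.
have k1 := @Mr_arg_cont R n r1 u x cu; have k2 := @Mr_arg_cont R n r2 u x cu.
have W0 := wt_gt0 a m x.
have k3 : continuous (fun w : V => u (x - r1 *: w) - u (x - r2 *: w)) by cont.
have k4 : continuous (fun w : V => wt m x * (u (x - r1 *: w) - u (x - r2 *: w))) by cont.
rewrite /Mr -(avgB k1 k2) -{1}(gtr0_norm W0) -normrM -(avgZ _ k3).
apply: (avg_bound _ k4) => w w1; rewrite normrM (gtr0_norm W0).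
exact: line_lipschitz.
Qed.

Lemma SR_lipschitz u : SR u -> exists2 K, 0 <= K & forall x y, `|u x - u y| <= K * enorm (x - y).
Proof.
move=> Su; have [su _] := Su; have [B HB] := @wbound_pds_all R n a u 1 0 Su.
have HB' j y : `|pd j u y| <= B by apply: (wbound_norm a0) (HB [:: j] isT).
have B0 : 0 <= B by exact: wbound_ge0 (HB [::] isT).
exists (n.+2%:R * B) => [|x y]; first by rewrite mulr_ge0.
have := @lipschitz_list R _ u B y (x - y) 1 (enum 'I_n.+2) su HB'.
rewrite row_sum_E scale1r [y + _]addrC subrK normr1 mul1r => H; apply: le_trans H _.
rewrite mulrAC ler_wpM2r// big_enum /= -sum_cst.
by apply: ler_sum => j _; exact: normr_coord.
Qed.

Lemma Mr_product r t u x : 0 <= r -> SR u ->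
  Mr t (Mr r u) x = @sp R n t (fun rho => Mr rho u x) r.
Proof.
move=> r0 Su; have [K K0 HK] := SR_lipschitz Su; have cu := SR_continuous Su.
pose h y := u (x - y).
have cx : continuous (fun y : V => x - y).
  by apply: addv_cont; [exact: cstv_cont|apply: oppv_cont; exact: id_cont].
have ch : continuous h by exact: (gcomp_cont cu cx).
have hL y z : `|h y - h z| <= K * enorm (y - z).
  apply: le_trans (HK _ _) _; rewrite (_ : x - y - (x - z) = - (y - z)) ?enormN//.
  by rewrite !opprB addrC addrA subrK.
have := @product_formula R n r t h K r0 ch K0 hL.
move=> E0; transitivity (dbl r t h); last exact: E0.
rewrite /dbl /Mr.
have c2 : continuous (fun p : V * V => u (x - t *: p.1 - r *: p.2)) by apply: (gcomp_cont cu); cont.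
rewrite [LHS](avg_swap c2); apply: (f_equal avg); apply/funext => w.
apply: (f_equal avg); apply/funext => v /=.
by rewrite /h opprD addrA addrAC.
Qed.

(** What is retained of a continuous seminorm: one weight exponent, a finite list of derivatives and
    a constant, all to be chosen independently of k. *)
Record bounded_functional L m (A : seq (seq 'I_n.+2)) (C : R) : Prop := {
  bf_lin : forall c u v, SR u -> SR v -> L (fun x => c * u x + v x) = c * L u + L v;
  bf_ge0 : 0 <= C;
  bf_bound : forall u B, SR u -> (forall s, s \in A -> wbound m (pds s u) B) -> `|L u| <= C * B }.

Section one_functional.
Variables (L : (V -> R) -> R) (m : nat) (A : seq (seq 'I_n.+2)) (C : R).
Hypothesis bL : bounded_functional L m A C.

Lemma bf_sub u v : SR u -> SR v -> L (fun x => u x - v x) = L u - L v.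
Proof.
move=> Su Sv; rewrite (_ : (fun x => _) = (fun x => -1 * v x + u x)).
  by rewrite (bf_lin bL) // mulN1r addrC.
by apply/funext => x; rewrite mulN1r addrC.
Qed.

Lemma SR_sub u v : SR u -> SR v -> SR (fun x => u x - v x) /\
  forall s, pds s (fun x => u x - v x) = (fun x => pds s u x - pds s v x).
Proof.
move=> Su Sv; have E : (fun x => u x - v x) = (fun x => -1 * v x + u x).
  by apply/funext => x; rewrite mulN1r addrC.
rewrite E; split; first exact: SR_lin.
move=> s; have [su _] := Su; have [sv _] := Sv; rewrite pds_lin//.
by apply/funext => x; rewrite mulN1r addrC.
Qed.

Lemma seq_wbound u : SR u -> exists2 B, 0 <= B & forall s, s \in A ->
  wbound m (pds s u) B /\ forall j, wbound m (pd j (pds s u)) B.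
Proof.
move=> Su; have [N HN] : exists N, forall s, s \in A -> (size s < N)%N.
  elim: (A) => [|s0 A' [N HN]]; first by exists 0%N.
  exists (maxn (size s0).+1 N) => s; rewrite inE leq_max => /orP[/eqP->|/HN->].
    by rewrite leqnn.
  by rewrite orbT.
have [B HB] := @wbound_pds_all R n a u N m Su.
exists B; first exact: wbound_ge0 (HB [::] isT).
move=> s sA; split=> [|j]; first by apply: HB; rewrite ltnW// HN.
by apply: (HB (j :: s)); exact: HN.
Qed.

Lemma pairing_lipschitz u (b : R) : SR u -> 0 <= b -> exists2 K, 0 <= K &
  (forall r1 r2, `|r1| <= b -> `|r2| <= b -> `|L (Mr r1 u) - L (Mr r2 u)| <= K * `|r1 - r2|) /\
  (forall s r1 r2, s \in A -> `|r1| <= b -> `|r2| <= b ->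
     wbound m (fun x => Mr r1 (pds s u) x - Mr r2 (pds s u) x) (K * `|r1 - r2|)).
Proof.
move=> Su b0; have [B B0 HB] := seq_wbound Su.
have LC0 : 0 <= lip_cst m b B.
  by rewrite /lip_cst !mulr_ge0 ?expR_ge0// exprn_ge0// addr_ge0.
have W s r1 r2 : s \in A -> `|r1| <= b -> `|r2| <= b ->
     wbound m (fun x => Mr r1 (pds s u) x - Mr r2 (pds s u) x) (`|r1 - r2| * lip_cst m b B).
  move=> sA h1 h2; apply: Mr_lipschitz => //; first exact: SR_pds.
  by have [_] := HB s sA.
exists ((C + 1) * lip_cst m b B); first by rewrite mulr_ge0// addr_ge0// (bf_ge0 bL).
split=> [r1 r2 h1 h2|s r1 r2 sA h1 h2]; last first.
  apply: wbound_le (W s r1 r2 sA h1 h2); rewrite mulrC ler_wpM2r//.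
  by rewrite ler_peMl// lerDr (bf_ge0 bL).
rewrite -bf_sub; [|exact: SR_Mr|exact: SR_Mr].
have [S1 S2] := SR_sub (SR_Mr a0 r1 Su) (SR_Mr a0 r2 Su).
apply: le_trans (bf_bound bL S1 (B := `|r1 - r2| * lip_cst m b B) _) _.
  by move=> s sA; rewrite S2 !(pds_Mr a0)//; exact: W.
rewrite mulrCA [leRHS]mulrC ler_wpM2l//; apply: ler_wpM2r => //; rewrite lerDl; exact: ler01.
Qed.

Lemma pairing_cont u : SR u -> continuous (fun r => L (Mr r u)).
Proof.
move=> Su r; have b0 : 0 <= `|r| + 1 by rewrite addr_ge0.
have [K K0 [HK _]] := pairing_lipschitz Su b0.
apply: (iffRL (@cvgrPdist_le R R _ (nbhs r) _ _ _)) => e e0.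
have K1 : 0 < K + 1 by rewrite ltr_wpDl.
apply/nbhs_normP; exists (Num.min 1 (e / (K + 1))) => /=.
  by rewrite lt_min ltr01 divr_gt0.
move=> r'; rewrite /ball_ /= lt_min => /andP[h1 h2].
apply: le_trans (HK r r' _ _) _; first by rewrite lerDl.
  rewrite -[r'](subrK r); apply: le_trans (ler_normD _ _) _.
  by rewrite addrC lerD2l distrC ltW.
apply: (@le_trans _ _ ((K + 1) * `|r - r'|)); first by rewrite ler_wpM2r// lerDl.
by rewrite mulrC -ler_pdivlMr// ltW.
Qed.

Lemma interp_functional c delta N u : SR u ->
  [/\ SR (fun x => interp c delta N (fun r => Mr r u x)),
    forall s, pds s (fun x => interp c delta N (fun r => Mr r u x)) =
      (fun x => interp c delta N (fun r => Mr r (pds s u) x)) &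
    L (fun x => interp c delta N (fun r => Mr r u x)) = interp c delta N (fun r => L (Mr r u))].
Proof.
move=> Su; elim: N => [|N [I1 I2 I3]].
  have E v : (fun x => interp c delta 0 (fun r => Mr r v x)) = Mr 0 v.
    by apply/funext => x; rewrite /interp big_ord0 addr0.
  by rewrite E; split; [exact: SR_Mr|move=> s; rewrite E (pds_Mr a0)|rewrite /interp big_ord0 addr0].
have E v : (fun x => interp c delta N.+1 (fun r => Mr r v x)) =
    (fun x => c N * (Mr (N.+1%:R * delta) v x - Mr (N%:R * delta) v x) +
       interp c delta N (fun r => Mr r v x)).
  by apply/funext => x; rewrite /interp big_ord_recr /= addrA addrC.
have [S1 S2] := SR_sub (SR_Mr a0 (N.+1%:R * delta) Su) (SR_Mr a0 (N%:R * delta) Su).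
rewrite E; split.
- exact: SR_lin.
- move=> s; have [s1 _] := S1; have [s2 _] := I1.
  by rewrite (pds_lin _ _ s1 s2) I2 S2 !(pds_Mr a0)// E.
- rewrite (bf_lin bL)// I3 bf_sub; [|exact: SR_Mr|exact: SR_Mr].
  by rewrite /interp big_ord_recr /= [RHS]addrA [RHS]addrC.
Qed.

(** L cannot be moved under an integral directly. Both sides are within O(1/N) of one finite
    combination of values [L (Mr rho u)]: the right-hand side by quadrature for that function, the
    left one by the same rule at every point x and linearity of L. *)
Lemma pairing_sp u r t : 0 <= r -> 0 < t -> SR u ->
  L (Mr t (Mr r u)) = @sp R n t (fun rho => L (Mr rho u)) r.
Proof.
move=> r0 t0 Su; pose b := r + t; have b0 : 0 < b by rewrite ltr_wpDl.
have [K K0 [HK1 HK2]] := pairing_lipschitz Su (ltW b0).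
pose rho w := enorm (r *: e1 + t *: w).
have crho : continuous rho by rewrite /rho; cont.
have rb w : dot w w = 1 -> 0 <= rho w <= b.
  move=> w1; rewrite enorm_ge0 /rho; apply: le_trans (enorm_rs_le _ _ w1) _.
  by rewrite ger0_norm// gtr0_norm.
have nb (x : R) : 0 <= x <= b -> `|x| <= b by case/andP => x0 xb; rewrite ger0_norm.
have cp := pairing_cont Su.
have SM : SR (Mr t (Mr r u)) by do 2 apply: SR_Mr => //.
apply/eqP; rewrite -subr_eq0 -normr_le0.
have C0 := bf_ge0 bL.
have main N : (0 < N)%N -> `|L (Mr t (Mr r u)) - @sp R n t (fun rho => L (Mr rho u)) r| <=
   (C * (2 * K) + 2 * K) * (b / N%:R).
  move=> N0; have [c Hc] := quadrature crho b0 N0 rb.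
  set delta := b / N%:R in Hc *.
  have [I1 I2 I3] := interp_functional c delta N Su.
  have H1 := Hc (fun rho => L (Mr rho u)) K cp K0 (fun (x y : R) hx hy => HK1 x y (nb x hx) (nb y hy)).
  have [S1 S2] := SR_sub SM I1.
  have H2 : `|L (Mr t (Mr r u)) - interp c delta N (fun r => L (Mr r u))| <= C * (2 * K * delta).
    rewrite -I3 -bf_sub//; apply: (bf_bound bL S1) => s sA x.
    rewrite S2 I2 (pds_Mr a0 t s (SR_Mr a0 r Su)) (pds_Mr a0 r s Su).
    rewrite (Mr_product t x r0 (SR_pds s Su)).
    have W0 := wt_gt0 a m x; rewrite mulrC -ler_pdivlMr//.
    have c1 : continuous (fun rho => Mr rho (pds s u) x).
      by apply: Mr_cont_r; exact: SR_pds_cont Su.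
    have K0' : 0 <= K / wt m x by rewrite divr_ge0// ltW.
    have := Hc (fun rho => Mr rho (pds s u) x) (K / wt m x) c1 K0' _.
    rewrite (_ : 2 * (K / wt m x) * delta = 2 * K * delta / wt m x); last by ring.
    apply=> y z hy hz; rewrite mulrAC ler_pdivlMr// mulrC.
    exact: (HK2 s y z sA (nb y hy) (nb z hz) x).
  rewrite mulrDl -mulrA sp_avg.
  have -> : L (Mr t (Mr r u)) - avg (fun w => L (Mr (rho w) u)) =
     (L (Mr t (Mr r u)) - interp c delta N (fun r => L (Mr r u))) -
     (avg (fun w => L (Mr (rho w) u)) - interp c delta N (fun r => L (Mr r u))).
    by rewrite opprB addrA subrK.
  by apply: le_trans (ler_normB _ _) _; apply: lerD; [exact: H2|exact: H1].
apply/ler_addgt0Pl => e e0; rewrite addr0.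
pose M := (C * (2 * K) + 2 * K) * b.
have M0 : 0 <= M by rewrite !mulr_ge0 ?addr_ge0 ?mulr_ge0// ltW.
have /andP[_ hN] := truncn_itv (divr_ge0 M0 (ltW e0)).
apply: le_trans (main (Num.truncn (M / e)).+1 isT) _.
rewrite mulrA -/M ler_pdivrMr ?ltr0n// mulrC.
by rewrite -ler_pdivrMr// ltW.
Qed.

End one_functional.

(** The exponent is m + m because the weight (1 + |r|)^m is 2m half powers; the absolute value
    extends the pairing to all real radii. *)
Lemma pairing_mean_seq (L : int -> (V -> R) -> R) m A (C : R) (t alpha : R) u :
  0 < t -> (forall k, bounded_functional (L k) m A C) ->
  (forall k v, SR v -> L k (Mr t v) = alpha * L (k + 1) v) -> SR u ->
  mean_seq n a t alpha (m + m) (fun k r => L k (Mr `|r| u)).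
Proof.
move=> t0 bL HL Su.
have ca : continuous (fun r : R => `|r|) by cont.
split.
- by move=> k; exact: (gcomp_cont (pairing_cont (bL k) Su) ca).
- move=> k r; have r0 := normr_ge0 r.
  rewrite -(HL k _ (SR_Mr a0 `|r| Su)) (pairing_sp (bL k) r0 t0 Su).
  have cp := pairing_cont (bL k) Su.
  have cp' : continuous (fun r : R => L k (Mr `|r| u)) by exact: (gcomp_cont cp ca).
  have -> : @sp R n t (fun rho => L k (Mr rho u)) `|r| = @sp R n t (fun r => L k (Mr `|r| u)) `|r|.
    by apply: (@sp_eq R n t _ _ `|r| cp cp') => x /andP[x0 _]; rewrite (ger0_norm x0).
  by rewrite -(sp_norm n t r cp').
- have [B B0 HB] := seq_wbound m A Su.
  exists (C * B); first by rewrite mulr_ge0// (bf_ge0 (bL 0)).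
  move=> k r.
  apply: le_trans (bf_bound (bL k) (SR_Mr a0 `|r| Su) (B := (1 + `|r|) ^+ m * Phi r * B) _) _.
    move=> s sA; rewrite (pds_Mr a0)//.
    have := wbound_Mr a0 `|r| (SR_continuous (SR_pds s Su)) (HB s sA).1.
    by rewrite normr_id Phi_norm.
  rewrite exprD -exprMn -expr2 sqr_sqrtr ?addr_ge0//.
  by rewrite le_eqVlt; apply/orP; left; apply/eqP; ring.
Qed.

End functionals.

Transparent Phi.

Lemma Phi_avg {R : realType} n (a r : R) :
  Phi n a r = avg (fun w : 'rV[R]_n.+2 => expR (a * r * w 0 0)).
Proof. by []. Qed.

Global Opaque Phi.

(** * The Laplacian as a limit of spherical means *)

Section moments.
Context {R : realType} {n : nat}.
Local Notation V := 'rV[R]_n.+2.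
Local Notation E j := (delta_mx 0 j : V).
Local Notation e1 := (unit_e1 R n.+2).

Lemma dot_E i (x : V) : dot (E i) x = x 0 i.
Proof.
rewrite /dot (bigD1 i)//= mxE !eqxx mul1r big1 ?addr0// => j ji.
by rewrite mxE (negbTE ji) andbF mul0r.
Qed.

Lemma dot_EE i : dot (E i) (E i) = 1.
Proof. by rewrite dot_E mxE !eqxx. Qed.

Lemma avg_coord (k : R -> R) i : continuous k -> avg (fun w : V => k (w 0 i)) = avg (fun w : V => k (w 0 0)).
Proof.
move=> ck; rewrite -(avg_dot (dot_EE i) ck); apply: (f_equal avg); apply/funext => w.
by rewrite dot_E.
Qed.

Lemma avg_coord_eq0 i : avg (fun w : V => w 0 i) = 0.
Proof.
have ci : continuous (fun x : R => x) by exact: id_cont.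
rewrite (avg_coord i ci).
have w1 : dot (- e1) (- e1) = 1 by rewrite -scaleN1r dotZl dotZr dot_e1e1; ring.
have := avg_dot w1 ci.
have -> : avg (fun w : V => dot (- e1) w) = avg (fun w : V => - w 0 0).
  by apply: (f_equal avg); apply/funext => w; rewrite -scaleN1r dotZl dot_e1 mulN1r.
rewrite avgN; last by cont.
by move: (avg _) => z h; lra.
Qed.

Lemma avg_sqr_coord i : avg (fun w : V => w 0 i ^+ 2) = n.+2%:R^-1.
Proof.
have ck : continuous (fun x : R => x ^+ 2) by cont.
rewrite (avg_coord i ck); set s := avg _.
have h : \sum_(j < n.+2) avg (fun w : V => w 0 j ^+ 2) = 1.
  rewrite -(@avg_sum R n 'I_n.+2 _ (fun j w => w 0 j ^+ 2)); last by move=> j; cont.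
  rewrite -[RHS](@avg_cst R n); apply: avg_eq => [w w1||]; [|apply: sum_cont => j; cont|by cont].
  by rewrite -w1; apply: eq_bigr => j _; rewrite expr2.
have : n.+2%:R * s = 1.
  rewrite -sum_cst -[RHS]h; apply: eq_bigr => j _; exact/esym/(avg_coord j ck).
move=> E1; apply: (mulfI (x := n.+2%:R)); first by rewrite pnatr_eq0.
by rewrite E1 mulfV// pnatr_eq0.
Qed.

(** Polarisation: the unit vector (E i + E j) / sqrt 2 has the same second moment as a coordinate
    vector. *)
Lemma avg_mixed i j : i != j -> avg (fun w : V => w 0 i * w 0 j) = 0.
Proof.
move=> ij; have ck : continuous (fun x : R => x ^+ 2) by cont.
have s2 : 2^-1 = (Num.sqrt 2)^-1 ^+ 2 :> R by rewrite exprVn sqr_sqrtr.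
have w1 : dot ((Num.sqrt 2)^-1 *: (E i + E j)) ((Num.sqrt 2)^-1 *: (E i + E j)) = 1.
  rewrite dotZl dotZr dotDl !dotDr !dot_EE !dot_E !mxE eqxx /= (negbTE ij) eq_sym (negbTE ij).
  transitivity ((Num.sqrt 2)^-1 * ((Num.sqrt 2)^-1 * (1 + 0 + (0 + 1))) : R) => //.
  by rewrite mulrA -expr2 -s2; field.
have := avg_dot w1 ck; rewrite avg_sqr_coord.
have c1 : continuous (fun w : V => w 0 i * w 0 j) by cont.
have c2 : continuous (fun w : V => w 0 i ^+ 2) by cont.
have c3 : continuous (fun w : V => w 0 j ^+ 2) by cont.
have c4 : continuous (fun w : V => w 0 i ^+ 2 + w 0 j ^+ 2) by cont.
have c5 : continuous (fun w : V => 2^-1 * (w 0 i ^+ 2 + w 0 j ^+ 2)) by cont.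
have -> : avg (fun w : V => dot ((Num.sqrt 2)^-1 *: (E i + E j)) w ^+ 2) =
   avg (fun w : V => 2^-1 * (w 0 i ^+ 2 + w 0 j ^+ 2) + w 0 i * w 0 j).
  apply: (f_equal avg); apply/funext => w; rewrite dotZl dotDl !dot_E exprMn -s2; by field.
rewrite (avgD c5 c1) (avgZ _ c4) (avgD c2 c3) !avg_sqr_coord.
move: (n.+2%:R^-1) (avg _) => p q; lra.
Qed.

End moments.

Section taylor.
Context {R : realType}.

Lemma der_sum I (s : seq I) (f df : I -> R -> R) (x : R) :
  (forall i, is_derive (x : R) 1 (f i) (df i x)) ->
  is_derive (x : R) 1 (fun y => \sum_(i <- s) f i y) (\sum_(i <- s) df i x).
Proof.
move=> H; elim: s => [|i s IH].
  rewrite big_nil (_ : (fun y => _) = (fun=> 0)); first exact: derC.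
  by apply/funext => y; rewrite big_nil.
rewrite big_cons (_ : (fun y => _) = (fun y => f i y + \sum_(j <- s) f j y)).
  exact: derD.
by apply/funext => y; rewrite big_cons.
Qed.

Lemma taylor3 (f f1 f2 f3 : R -> R) (r K : R) : 0 <= r -> 0 <= K ->
  (forall s, is_derive (s : R) 1 f (f1 s)) -> (forall s, is_derive (s : R) 1 f1 (f2 s)) ->
  (forall s, is_derive (s : R) 1 f2 (f3 s)) -> (forall s, 0 <= s <= r -> `|f3 s| <= K) ->
  `|f r - f 0 - r * f1 0 - r ^+ 2 / 2 * f2 0| <= K * r ^+ 3.
Proof.
move=> r0 K0 d1 d2 d3 H.
have B2 s : 0 <= s <= r -> `|f2 s - f2 0| <= K * r.
  move=> /andP[s0 sr]; apply: (@le_trans _ _ (K * (s - 0))).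
    apply: (derivative_bound s0 (fun x _ => d3 x)) => x /andP[x0 xs].
    by apply: H; rewrite x0 (le_trans xs).
  by rewrite subr0 ler_wpM2l.
have B1 s : 0 <= s <= r -> `|f1 s - f1 0 - s * f2 0| <= K * r * r.
  move=> /andP[s0 sr]; pose F x := f1 x - x * f2 0.
  have dF x : is_derive (x : R) 1 F (f2 x - f2 0).
    apply: is_derive_eq (derD (d2 x) (derN (derM (derI x) (derC (f2 0) x)))) _.
    by rewrite mulr0 addr0 mul1r.
  have := @derivative_bound _ F _ 0 s (K * r) s0 (fun x _ => dF x).
  rewrite /F mul0r !subr0 addrAC => /(_ _)G; apply: le_trans (G _) _.
    by move=> x /andP[x0 xs]; apply: B2; rewrite x0 (le_trans xs).
  by rewrite ler_wpM2l// mulr_ge0.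
pose F x := f x - x * f1 0 - x ^+ 2 / 2 * f2 0.
have dF x : is_derive (x : R) 1 F (f1 x - f1 0 - x * f2 0).
  have D := derD (derD (d1 x) (derN (derM (derI x) (derC (f1 0) x))))
     (derN (derM (derM (derX 1 (derI x)) (derC 2^-1 x)) (derC (f2 0) x))).
  by apply: is_derive_eq D _; rewrite expr1; field.
have := @derivative_bound _ F _ 0 r (K * r * r) r0 (fun x _ => dF x) B1.
rewrite /F mul0r expr0n /= !mul0r !subr0.
rewrite (_ : f r - r * f1 0 - r ^+ 2 / 2 * f2 0 - f 0 = f r - f 0 - r * f1 0 - r ^+ 2 / 2 * f2 0); last by ring.
by move/le_trans; apply; rewrite !exprS expr0 mulr1 !mulrA.
Qed.

End taylor.

Section expansions.
Context {R : realType} {n : nat} (a : R).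
Hypothesis a0 : 0 <= a.
Local Notation V := 'rV[R]_n.+2.
Local Notation Phi := (@Phi R n a).
Local Notation SR := (@SR R n a).
Local Notation wt := (@expweight R n a).
Local Notation wbound := (@wbound R n a).
Local Notation D := (n.+2%:R : R).
Implicit Types (u v : V -> R) (x w : V) (m : nat).

(** Here without the minus sign of [laplacian]; [laplacianE] restores it. *)
Definition lap u : V -> R := fun x => \sum_j pd j (pd j u) x.

Lemma avg_linear_form (c : 'I_n.+2 -> R) : avg (fun w : V => \sum_j (- w) 0 j * c j) = 0.
Proof.
have cj j : continuous (fun w : V => (- w) 0 j * c j).
  by apply: mul_cont; [apply: coord_cont; exact: oppv_cont id_cont|cont].
rewrite (avg_sum _ cj) big1// => j _.
have c1 : continuous (fun w : V => w 0 j) by cont.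
have -> : avg (fun w : V => (- w) 0 j * c j) = avg (fun w : V => - c j * w 0 j).
  by apply: (f_equal avg); apply/funext => w; rewrite mxE; ring.
by rewrite (avgZ _ c1) avg_coord_eq0 mulr0.
Qed.

Lemma avg_quadratic_form (c : 'I_n.+2 -> 'I_n.+2 -> R) :
  avg (fun w : V => \sum_j (- w) 0 j * \sum_i (- w) 0 i * c i j) = D^-1 * \sum_j c j j.
Proof.
have cij i j : continuous (fun w : V => c i j * (w 0 i * w 0 j)) by cont.
have cj j : continuous (fun w : V => \sum_i c i j * (w 0 i * w 0 j)).
  by apply: sum_cont => i; exact: cij.
have -> : avg (fun w : V => \sum_j (- w) 0 j * \sum_i (- w) 0 i * c i j) =
    avg (fun w : V => \sum_j \sum_i c i j * (w 0 i * w 0 j)).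
  apply: (f_equal avg); apply/funext => w; apply: eq_bigr => j _; rewrite mulr_sumr.
  by apply: eq_bigr => i _; rewrite !mxE; ring.
rewrite (avg_sum _ cj) mulr_sumr; apply: eq_bigr => j _.
rewrite (avg_sum _ (cij ^~ j)) (bigD1 j)//= big1 => [|i ij].
  have c1 : continuous (fun w : V => w 0 j * w 0 j) by cont.
  rewrite addr0 (avgZ _ c1) mulrC; congr (_ * _).
  by rewrite -(avg_sqr_coord j).
have c1 : continuous (fun w : V => w 0 i * w 0 j) by cont.
by rewrite (avgZ _ c1) avg_mixed// mulr0.
Qed.

(** Taylor's formula along each ray, averaged: the first moments of the sphere vanish and the second
    ones are 1/d times the identity. The third-order remainder is taken at points within distance 1
    of x, where the weight changes by a bounded factor only. *)
Lemma Mr_expansion u m : SR u -> exists2 C, 0 <= C & forall r, 0 <= r <= 1 ->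
  wbound m (fun x => Mr r u x - u x - r ^+ 2 / 2 * (D^-1 * lap u x)) (C * r ^+ 3).
Proof.
move=> Su; have [su _] := Su.
have [B HB] := @wbound_pds_all R n a u 4 m Su.
have B0 : 0 <= B by exact: wbound_ge0 (HB [::] isT).
have HBn s y : (size s <= 4)%N -> `|pds s u y| <= B.
  by move=> s4; apply: (wbound_norm a0) (HB s s4).
pose Ec : R := expR (a * 1) * (1 + 1) ^+ m.
have Ec0 : 0 <= Ec by rewrite mulr_ge0 ?expR_ge0.
exists (D * (D * (D * (B * Ec)))); first by rewrite !mulr_ge0.
move=> r /andP[r0 r1] x; have W0 := wt_gt0 a m x.
rewrite -[wt m x](gtr0_norm W0) -normrM.
pose f w (s : R) := u (x + s *: (- w)).
pose f1 w (s : R) := \sum_j (- w) 0 j * pd j u (x + s *: (- w)).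
pose f2 w (s : R) := \sum_j (- w) 0 j * \sum_i (- w) 0 i * pd i (pd j u) (x + s *: (- w)).
pose f3 w (s : R) := \sum_j (- w) 0 j * \sum_i (- w) 0 i * \sum_k (- w) 0 k * pd k (pd i (pd j u)) (x + s *: (- w)).
have dline l w (s : R) : (size l <= 2)%N ->
    is_derive (s : R) 1 (fun s => pds l u (x + s *: (- w))) (\sum_k (- w) 0 k * pd k (pds l u) (x + s *: (- w))).
  move=> l2; apply: (@chain_rule R _ (pds l u) B) => [|i j y]; first exact: smoothR_pds.
  by apply: (HBn (i :: j :: l)); exact: l2.
have d1 w s : is_derive (s : R) 1 (f w) (f1 w s) by exact: (dline [::]).
have dc (c : R) (g dg : R -> R) (s : R) : is_derive (s : R) 1 g (dg s) -> is_derive (s : R) 1 (fun y => c * g y) (c * dg s).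
  move=> dg'; apply: is_derive_eq (derM (derC c s) dg') _.
  by rewrite mul0r add0r.
have d2 w s : is_derive (s : R) 1 (f1 w) (f2 w s).
  apply: (@der_sum R _ (index_enum _) (fun j s => (- w) 0 j * pd j u (x + s *: (- w)))
    (fun j s => (- w) 0 j * \sum_i (- w) 0 i * pd i (pd j u) (x + s *: (- w)))) => j.
  apply: (dc _ _ (fun s => \sum_i (- w) 0 i * pd i (pd j u) (x + s *: (- w)))).
  exact: (dline [:: j]).
have d3 w s : is_derive (s : R) 1 (f2 w) (f3 w s).
  apply: (@der_sum R _ (index_enum _) (fun j s => (- w) 0 j * \sum_i (- w) 0 i * pd i (pd j u) (x + s *: (- w)))
    (fun j s => (- w) 0 j * \sum_i (- w) 0 i * \sum_k (- w) 0 k * pd k (pd i (pd j u)) (x + s *: (- w)))) => j.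
  apply: (dc _ _ (fun s => \sum_i (- w) 0 i * \sum_k (- w) 0 k * pd k (pd i (pd j u)) (x + s *: (- w)))).
  apply: (@der_sum R _ (index_enum _) (fun i s => (- w) 0 i * pd i (pd j u) (x + s *: (- w)))
    (fun i s => (- w) 0 i * \sum_k (- w) 0 k * pd k (pd i (pd j u)) (x + s *: (- w)))) => i.
  apply: (dc _ _ (fun s => \sum_k (- w) 0 k * pd k (pd i (pd j u)) (x + s *: (- w)))).
  exact: (dline [:: i; j]).
pose K := D * (D * (D * (B * Ec))) / wt m x.
have K0 : 0 <= K by rewrite divr_ge0 ?(ltW W0)// !mulr_ge0.
have sumb w (c : 'I_n.+2 -> R) (M : R) : dot w w = 1 -> (forall j, `|c j| <= M) ->
    `|\sum_j (- w) 0 j * c j| <= D * M.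
  move=> w1 cM; apply: le_trans (ler_norm_sum _ _ _) _; rewrite -sum_cst.
  apply: ler_sum => j _; rewrite normrM -[leRHS]mul1r ler_pM// mxE normrN.
  by have := normr_coord w j; rewrite (enorm_unit w1).
have f3b w : dot w w = 1 -> forall s, 0 <= s <= r -> `|f3 w s| <= K.
  move=> w1 s /andP[s0 sr].
  have s1 : `|s| <= 1 by rewrite ger0_norm// (le_trans sr).
  have -> : K = D * (D * (D * (B * Ec / wt m x))) by rewrite /K; ring.
  rewrite /f3; apply: (sumb _ _ _ w1) => j; apply: (sumb _ _ _ w1) => i; apply: (sumb _ _ _ w1) => k.
  rewrite ler_pdivlMr//; have S := wt_shift a0 m x w1 s1; rewrite -/Ec in S.
  rewrite scalerN; set z := `|_|; have z0 : 0 <= z by exact: normr_ge0.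
  apply: (@le_trans _ _ (z * (wt m (x - s *: w) * Ec))); first by rewrite ler_wpM2l.
  rewrite [leLHS]mulrA ler_wpM2r// mulrC.
  by apply: (HB [:: _; _; _] isT).
have T w : dot w w = 1 -> `|f w r - f w 0 - r * f1 w 0 - r ^+ 2 / 2 * f2 w 0| <= K * r ^+ 3.
  by move=> w1; exact: (taylor3 r0 K0 (d1 w) (d2 w) (d3 w) (f3b w w1)).
have E0 (w : V) : x + 0 *: (- w) = x by rewrite scale0r addr0.
pose q j := pd j u x; pose q2 i j := pd i (pd j u) x.
have f1E w : f1 w 0 = \sum_j (- w) 0 j * q j by apply: eq_bigr => j _; rewrite E0.
have f2E w : f2 w 0 = \sum_j (- w) 0 j * \sum_i (- w) 0 i * q2 i j.
  by rewrite /f2 E0.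
have co j : continuous (fun w : V => (- w) 0 j) by apply: coord_cont; exact: oppv_cont id_cont.
have cu := SR_continuous Su.
have k0 := @Mr_arg_cont R n r u x cu.
have k1 : continuous (fun w : V => \sum_j (- w) 0 j * q j).
  by apply: sum_cont => j; apply: mul_cont (co j) _; cont.
have k2 : continuous (fun w : V => \sum_j (- w) 0 j * \sum_i (- w) 0 i * q2 i j).
  apply: sum_cont => j; apply: mul_cont (co j) _; apply: sum_cont => i.
  by apply: mul_cont (co i) _; cont.
have k3 : continuous (fun w : V => u (x - r *: w) - u x) by cont.
have k4 : continuous (fun w : V => r * \sum_j (- w) 0 j * q j) by cont.
have k5 : continuous (fun w : V => r ^+ 2 / 2 * \sum_j (- w) 0 j * \sum_i (- w) 0 i * q2 i j) by cont.
have k6 : continuous (fun w : V => u (x - r *: w) - u x - r * \sum_j (- w) 0 j * q j) by cont.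
have k7 : continuous (fun w : V => u (x - r *: w) - u x - r * (\sum_j (- w) 0 j * q j) -
   r ^+ 2 / 2 * \sum_j (- w) 0 j * \sum_i (- w) 0 i * q2 i j) by cont.
have kc : continuous (fun _ : V => u x) by cont.
have -> : Mr r u x - u x - r ^+ 2 / 2 * (D^-1 * lap u x) =
   avg (fun w : V => u (x - r *: w) - u x - r * (\sum_j (- w) 0 j * q j) -
   r ^+ 2 / 2 * \sum_j (- w) 0 j * \sum_i (- w) 0 i * q2 i j).
  rewrite (avgB k6 k5) (avgB k3 k4) (avgB k0 kc) (avgZ _ k1) (avgZ _ k2) avg_cst.
  by rewrite avg_linear_form avg_quadratic_form mulr0 subr0.
rewrite -(avgZ _ k7).
have k8 : continuous (fun w : V => wt m x * (u (x - r *: w) - u x - r * (\sum_j (- w) 0 j * q j) -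
   r ^+ 2 / 2 * \sum_j (- w) 0 j * \sum_i (- w) 0 i * q2 i j)) by cont.
apply: (avg_bound _ k8) => w w1; rewrite normrM (gtr0_norm W0).
have := T w w1; rewrite f1E f2E /f E0 scalerN /K => h.
apply: le_trans (ler_wpM2l (ltW W0) h) _.
rewrite le_eqVlt; apply/orP; left; apply/eqP.
by move: (wt m x) W0 => W W0; field; rewrite gt_eqF.
Qed.

Lemma Phi_expansion : exists2 C, 0 <= C & forall r, 0 <= r <= 1 ->
  `|Phi r - 1 - r ^+ 2 / 2 * (D^-1 * a ^+ 2)| <= C * r ^+ 3.
Proof.
exists (a ^+ 3 * expR a); first by rewrite mulr_ge0 ?exprn_ge0 ?expR_ge0.
move=> r /andP[r0 r1].
have c0 : continuous (fun w : V => expR (a * r * w 0 0)) by cont.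
have c1 : continuous (fun w : V => w 0 0) by cont.
have c2 : continuous (fun w : V => w 0 0 ^+ 2) by cont.
have c3 : continuous (fun w : V => (r * a) * w 0 0) by cont.
have c4 : continuous (fun w : V => (r ^+ 2 / 2 * a ^+ 2) * w 0 0 ^+ 2) by cont.
have cc : continuous (fun _ : V => 1 : R) by cont.
have c5 : continuous (fun w : V => expR (a * r * w 0 0) - 1) by cont.
have c6 : continuous (fun w : V => expR (a * r * w 0 0) - 1 - (r * a) * w 0 0) by cont.
have c7 : continuous (fun w : V => expR (a * r * w 0 0) - 1 - (r * a) * w 0 0 - (r ^+ 2 / 2 * a ^+ 2) * w 0 0 ^+ 2) by cont.
have -> : Phi r - 1 - r ^+ 2 / 2 * (D^-1 * a ^+ 2) =
   avg (fun w : V => expR (a * r * w 0 0) - 1 - (r * a) * w 0 0 - (r ^+ 2 / 2 * a ^+ 2) * w 0 0 ^+ 2).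
  rewrite (avgB c6 c4) (avgB c5 c3) (avgB c0 cc) (avgZ _ c1) (avgZ _ c2) avg_cst.
  rewrite avg_coord_eq0 avg_sqr_coord mulr0 subr0 Phi_avg; move: (D^-1) (avg _) => p q; ring.
apply: (avg_bound _ c7) => w w1.
pose b := a * w 0 0.
have bb : `|b| <= a by rewrite /b normrM (ger0_norm a0) ler_piMr// coord0_le1.
have de (s : R) : is_derive (s : R) 1 (fun s => expR (b * s)) (b * expR (b * s)).
  have D1 := derM (derC b s) (derI s).
  apply: is_derive_eq (der_comp (is_derive_expR (b * s)) D1) _.
  by rewrite mul0r add0r mulr1 mulrC.
have dc (c : R) (s : R) : is_derive (s : R) 1 (fun s => c * expR (b * s)) (c * (b * expR (b * s))).
  apply: is_derive_eq (derM (derC c s) (de s)) _.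
  by rewrite mul0r add0r.
have d2 (s : R) : is_derive (s : R) 1 (fun s => b * expR (b * s)) (b ^+ 2 * expR (b * s)).
  by apply: is_derive_eq (dc b s) _; ring.
have d3 (s : R) : is_derive (s : R) 1 (fun s => b ^+ 2 * expR (b * s)) (b ^+ 3 * expR (b * s)).
  by apply: is_derive_eq (dc (b ^+ 2) s) _; ring.
have K0 : 0 <= a ^+ 3 * expR a by rewrite mulr_ge0 ?exprn_ge0 ?expR_ge0.
have := taylor3 r0 K0 de d2 d3 _; rewrite mulr0 expR0 !mulr1 => /(_ _)T.
rewrite (_ : a * r * w 0 0 = b * r); last by rewrite /b; ring.
rewrite (_ : r * a * w 0 0 = r * b); last by rewrite /b; ring.
rewrite (_ : r ^+ 2 / 2 * a ^+ 2 * w 0 0 ^+ 2 = r ^+ 2 / 2 * b ^+ 2); last by rewrite /b; ring.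
apply: T => s /andP[s0 sr]; rewrite normrM normrX (ger0_norm (expR_ge0 _)).
apply: ler_pM; rewrite ?exprn_ge0 ?expR_ge0//; first by rewrite lerXn2r ?nnegrE.
rewrite ler_expR; apply: le_trans (ler_norm _) _; rewrite normrM (ger0_norm s0).
by rewrite -[leRHS]mulr1 ler_pM// (le_trans sr).
Qed.

Lemma SR_lap u : SR u -> SR (lap u).
Proof.
move=> Su; have H (s : seq 'I_n.+2) : SR (fun x => \sum_(j <- s) pd j (pd j u) x).
  elim: s => [|j s IH].
    rewrite (_ : (fun x => _) = (fun=> 0)); first exact: SR0.
    by apply/funext => x; rewrite big_nil.
  rewrite (_ : (fun x => _) = (fun x => 1 * pd j (pd j u) x + \sum_(j <- s) pd j (pd j u) x)).
    by apply: SR_lin => //; exact: (SR_pds [:: j; j] Su).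
  by apply/funext => x; rewrite big_cons mul1r.
exact: H.
Qed.

Lemma pds_lap s u : SR u -> pds s (lap u) = lap (pds s u).
Proof.
move=> Su; have [su _] := Su.
have H (l : seq 'I_n.+2) : smoothR (fun x => \sum_(j <- l) pd j (pd j u) x) /\
    pds s (fun x => \sum_(j <- l) pd j (pd j u) x) = (fun x => \sum_(j <- l) pds s (pd j (pd j u)) x).
  elim: l => [|j l [I1 I2]].
    have E (f : 'I_n.+2 -> V -> R) : (fun x => \sum_(j <- [::]) f j x) = (fun=> 0).
      by apply/funext => x; rewrite big_nil.
    by rewrite E (E (fun j => pds s (pd j (pd j u)))) pds0; split=> //; have [] := SR0 (n := n) a.
  have E (f : 'I_n.+2 -> V -> R) : (fun x => \sum_(i <- j :: l) f i x) =
      (fun x => 1 * f j x + \sum_(i <- l) f i x).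
    by apply/funext => x; rewrite big_cons mul1r.
  have sj : smoothR (pd j (pd j u)) := smoothR_pds [:: j; j] su.
  rewrite E (E (fun i => pds s (pd i (pd i u)))); split; first exact: smoothR_lin.
  by rewrite (pds_lin _ _ sj I1) I2.
have [_ ->] := H (index_enum _); apply/funext => x; apply: eq_bigr => j _.
rewrite -[pd j (pd j u)]/(pds [:: j; j] u) -[pd j (pd j (pds s u))]/(pds [:: j; j] (pds s u)).
by rewrite -!pds_cat (pds_perm su (s2 := [:: j; j] ++ s))// perm_catC.
Qed.

Lemma Mr0 u : Mr 0 u = u.
Proof.
apply/funext => x; rewrite /Mr (_ : (fun w : V => _) = (fun=> u x)) ?avg_cst//.
by apply/funext => w; rewrite scale0r subr0.
Qed.

Variables (L : int -> (V -> R) -> R) (m : nat) (A : seq (seq 'I_n.+2)) (C t : R).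
Hypothesis t0 : 0 < t.
Hypothesis bL : forall k, bounded_functional a (L k) m A C.

Lemma functional_zero alpha : Phi t < alpha ->
  (forall k v, SR v -> L k (Mr t v) = alpha * L (k + 1) v) ->
  forall u, SR u -> L 0 u = 0.
Proof.
move=> al HL u Su; have := mean_seq_large t0 al (pairing_mean_seq a0 t0 bL HL Su).
by rewrite normr0 Mr0.
Qed.

Lemma functional_eigen : (forall k v, SR v -> L k (Mr t v) = Phi t * L (k + 1) v) ->
  forall u, SR u -> L 0 (lap u) = a ^+ 2 * L 0 u.
Proof.
move=> HL u Su.
have F r : 0 <= r <= t -> L 0 (Mr r u) = Phi r * L 0 u.
  move=> rt; have := mean_seq_flat t0 (pairing_mean_seq a0 t0 bL HL Su) 0 rt.
  by rewrite normr0 Mr0 ger0_norm//; case/andP: rt.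
have [C1 C10 H1] : exists2 C1, 0 <= C1 & forall r, 0 <= r <= 1 -> forall s, s \in A ->
    wbound m (fun x => Mr r (pds s u) x - pds s u x - r ^+ 2 / 2 * (D^-1 * lap (pds s u) x)) (C1 * r ^+ 3).
  elim: A => [|s A' [C1 C10 IH]]; first by exists 0.
  have [C2 C20 H2] := Mr_expansion m (SR_pds s Su).
  exists (C1 + C2) => [|r r01 s']; first exact: addr_ge0.
  have r30 : 0 <= r ^+ 3 by rewrite exprn_ge0//; case/andP: r01.
  rewrite inE => /orP[/eqP->|sA].
    by apply: wbound_le (H2 r r01); rewrite ler_wpM2r// lerDr.
  by apply: wbound_le (IH r r01 s' sA); rewrite ler_wpM2r// lerDl.
have [C2 C20 H2] := Phi_expansion.
have C0 := bf_ge0 (bL 0).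
pose X := L 0 (lap u) - a ^+ 2 * L 0 u.
pose M := C * C1 + C2 * `|L 0 u|.
have M0 : 0 <= M by rewrite addr_ge0 ?mulr_ge0.
have Dp : 0 < D by rewrite ltr0n.
(* The r^2 terms of [Mr_expansion] and [Phi_expansion] differ by r^2 / (2d) times the defect X;
   everything else is O(r^3). *)
have K r : 0 <= r <= 1 -> r <= t -> r ^+ 2 / 2 * (D^-1 * `|X|) <= M * r ^+ 3.
  move=> r01 rt; have r0 : 0 <= r by case/andP: r01.
  have Sl := SR_lap Su.
  pose c := r ^+ 2 / 2 * D^-1.
  have c0 : 0 <= c by rewrite mulr_ge0 ?invr_ge0 ?(ltW Dp)// mulr_ge0 ?sqr_ge0.
  have [S1 E1] := SR_sub (SR_Mr a0 r Su) Su.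
  have S2 : SR (fun x => - c * lap u x + (Mr r u x - u x)) by exact: SR_lin.
  have E2 : L 0 (fun x => - c * lap u x + (Mr r u x - u x)) = - c * L 0 (lap u) + (L 0 (Mr r u) - L 0 u).
    rewrite (bf_lin (bL 0) _ Sl S1) (bf_sub (bL 0))//; exact: SR_Mr.
  have B := bf_bound (bL 0) S2 (B := C1 * r ^+ 3) _.
  have {}B : `|- c * L 0 (lap u) + (L 0 (Mr r u) - L 0 u)| <= C * (C1 * r ^+ 3).
    rewrite -E2; apply: B => s sA x.
    have [sl _] := Sl; have [s1 _] := S1; have [su _] := Su.
    rewrite (pds_lin _ _ sl s1) E1 (pds_Mr a0 r s Su).
    rewrite (pds_lap s Su).
    have := H1 r r01 s sA x.
    rewrite (_ : _ - r ^+ 2 / 2 * (D^-1 * lap (pds s u) x) =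
      - c * lap (pds s u) x + (Mr r (pds s u) x - pds s u x)); last by rewrite /c; ring.
    by [].
  have P := H2 r r01; rewrite (F r) ?r0// in B.
  rewrite mulrA -/c -[X in X * _](ger0_norm c0) -normrM.
  have -> : c * X = ((Phi r - 1 - r ^+ 2 / 2 * (D^-1 * a ^+ 2)) * L 0 u) -
     (- c * L 0 (lap u) + (Phi r * L 0 u - L 0 u)) by rewrite /X /c; ring.
  apply: le_trans (ler_normB _ _) _; rewrite normrM /M mulrDl addrC; apply: lerD.
    by apply: le_trans B _; rewrite mulrA.
  by rewrite [leRHS]mulrAC ler_wpM2r.
apply/eqP; rewrite -subr_eq0 -/X -normr_le0; apply/ler_addgt0Pl => e e0; rewrite addr0.
pose r := Num.min (Num.min 1 t) (e / (2 * D * M + 1)).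
have N0 : 0 < 2 * D * M + 1 by rewrite ltr_wpDl ?mulr_ge0 ?(ltW Dp).
have r0 : 0 < r by rewrite /r !lt_min ltr01 t0 divr_gt0.
have r1 : r <= 1 by rewrite /r !ge_min lexx.
have rt : r <= t by rewrite /r !ge_min lexx !orbT.
have re : r * (2 * D * M + 1) <= e by rewrite -ler_pdivlMr// /r ge_min lexx orbT.
have := K r _ rt; rewrite (ltW r0) r1 => /(_ isT)h.
have r2 : 0 < r ^+ 2 by rewrite exprn_gt0.
apply: le_trans re.
rewrite -(ler_pM2l r2) -(ler_pM2l (_ : 0 < 2^-1 * D^-1)); last by rewrite mulr_gt0 ?invr_gt0.
apply: (@le_trans _ _ (M * r ^+ 3)).
  by apply: le_trans h; rewrite le_eqVlt; apply/orP; left; apply/eqP; ring.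
rewrite (_ : 2^-1 / D * (r ^+ 2 * _) = M * r ^+ 3 + 2^-1 / D * r ^+ 3).
  by rewrite lerDl mulr_ge0 ?exprn_ge0 ?(ltW r0)// mulr_ge0 ?invr_ge0 ?(ltW Dp).
by field; rewrite gt_eqF.
Qed.

End expansions.

Import Normc.
Local Open Scope complex_scope.

Transparent avg.

Lemma avgE {R : realType} n (g : 'rV[R]_n.+2 -> R) :
  avg g = \int[@sphere_measure R n.+2]_v g (rv v).
Proof. by []. Qed.

Global Opaque avg.

(** * Complex distributions *)

Section complex_facts.
Context {R : realType}.
Local Notation Re := (@complex.Re R).
Local Notation Im := (@complex.Im R).
Implicit Types (z w : R[i]).

Lemma Re_le_normc z : `|Re z| <= normc z.
Proof.
by case: z => x y /=; rewrite -sqrtr_sqr ler_wsqrtr// lerDl sqr_ge0.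
Qed.

Lemma Im_le_normc z : `|Im z| <= normc z.
Proof.
by case: z => x y /=; rewrite -sqrtr_sqr ler_wsqrtr// lerDr sqr_ge0.
Qed.

Lemma normc_ge0 z : 0 <= normc z.
Proof. by case: z => x y /=; rewrite sqrtr_ge0. Qed.

Lemma normc_le_ReIm z : normc z <= `|Re z| + `|Im z|.
Proof.
case: z => x y /=.
rewrite -[leRHS]ger0_norm ?addr_ge0// -sqrtr_sqr ler_wsqrtr// sqrrD !real_normK ?num_real//.
by rewrite -addrA [_ *+ 2 + _]addrC addrA lerDl mulrn_wge0// mulr_ge0.
Qed.

Lemma normc_real (x : R) : normc x%:C = `|x|.
Proof. by rewrite /= expr0n /= addr0 sqrtr_sqr. Qed.

Lemma normr_normc z : `|z| = (normc z)%:C.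
Proof. by rewrite normc_def; case: z. Qed.

Lemma ReM_real (x : R) z : Re (x%:C * z) = x * Re z.
Proof. by case: z => p q /=; rewrite mul0r subr0. Qed.

Lemma ReD z w : Re (z + w) = Re z + Re w. Proof. by case: z; case: w. Qed.

Lemma complex_eq z w : Re z = Re w -> Im z = Im w -> z = w.
Proof. by case: z => ? ?; case: w => ? ? /= -> ->. Qed.

Lemma Re_Ni z : Re (- 'i * z) = Im z.
Proof. by case: z => p q /=; ring. Qed.

Lemma sum_complex I (s : seq I) (F : I -> R) :
  (\sum_(i <- s) F i)%:C = \sum_(i <- s) (F i)%:C.
Proof. by elim: s => [|i s IH]; rewrite ?big_nil// !big_cons -IH; exact: rmorphD. Qed.

Lemma sum_ReIm I (s : seq I) (P Q : I -> R) :
  \sum_(i <- s) ((P i)%:C + 'i * (Q i)%:C) = (\sum_(i <- s) P i)%:C + 'i * (\sum_(i <- s) Q i)%:C.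
Proof.
rewrite 2!sum_complex; elim: s => [|i s IH]; first by rewrite !big_nil mulr0 addr0.
by rewrite !big_cons IH mulrDr addrACA.
Qed.

Lemma normc_exp z (k : int) : normc z = 1 -> normc (z ^ k) = 1.
Proof.
move=> z1; have H n : normc (z ^+ n) = 1.
  by elim: n => [|n IH]; [rewrite expr0 normc1|rewrite exprS normcM z1 IH mulr1].
by case: k => n; [exact: H|rewrite -[z ^ Negz n]/((z ^+ n.+1)^-1) normcV H invr1].
Qed.

End complex_facts.

Section complexification.
Context {R : realType} {n : nat} (a : R).
Hypothesis a0 : 0 <= a.
Local Notation V := 'rV[R]_n.+2.
Local Notation C := R[i].
Local Notation Re := (@complex.Re R).
Local Notation Im := (@complex.Im R).
Local Notation SR := (@SR R n a).
Local Notation wt := (@expweight R n a).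
Local Notation wbound := (@wbound R n a).
Implicit Types (u v : V -> R) (f g : V -> C).

Lemma Re_foldr_partial s f : (fun x => Re (foldr partial f s x)) = pds s (fun x => Re (f x)).
Proof. by elim: s => //= j s <-. Qed.

Lemma Im_foldr_partial s f : (fun x => Im (foldr partial f s x)) = pds s (fun x => Im (f x)).
Proof. by elim: s => //= j s <-. Qed.

Lemma smoothE f : smooth f <-> smoothR (fun x => Re (f x)) /\ smoothR (fun x => Im (f x)).
Proof.
split=> [H|[H1 H2] s].
  split=> s; have [c1 c2 d] := H s.
    by rewrite -Re_foldr_partial; split=> // x j; have [] := d x j.
  by rewrite -Im_foldr_partial; split=> // x j; have [] := d x j.
have [c1 d1] := H1 s; have [c2 d2] := H2 s; split.
- by rewrite -Re_foldr_partial in c1.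
- by rewrite -Im_foldr_partial in c2.
- move=> x j; split; first by have := d1 x j; rewrite -Re_foldr_partial.
  by have := d2 x j; rewrite -Im_foldr_partial.
Qed.

Lemma multi_partialE (alpha : {ffun 'I_n.+2 -> nat}) f :
  multi_partial alpha f = foldr partial f (mseq alpha).
Proof. exact: foldr_mseq. Qed.

Lemma gamma_leP m (alpha : {ffun 'I_n.+2 -> nat}) f (B : R) :
  (gamma a m alpha f <= B%:E)%E <->
  forall x, wt m x * normc (foldr partial f (mseq alpha) x) <= B.
Proof.
rewrite /gamma multi_partialE; split=> H.
  move=> x; rewrite -lee_fin; apply: le_trans H.
  by apply: ereal_sup_ubound; exists x.
by apply: ge_ereal_sup => _ [x _ <-]; rewrite lee_fin; exact: H.
Qed.

Lemma gamma_lt_pinfty m (alpha : {ffun 'I_n.+2 -> nat}) f : (gamma a m alpha f < +oo)%E ->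
  exists B, forall x, wt m x * normc (foldr partial f (mseq alpha) x) <= B.
Proof.
move=> H; have E : (gamma a m alpha f = (fine (gamma a m alpha f))%:E)%E.
  rewrite fineK// fin_real// H andbT.
  apply: (@lt_le_trans _ _ (wt m 0 * normc (multi_partial alpha f 0))%:E).
    exact: ltNyr.
  by apply: ereal_sup_ubound; exists 0.
by exists (fine (gamma a m alpha f)); apply/gamma_leP; rewrite -E.
Qed.

(** A sequence of derivatives is reordered into the one that realises its multi-index, and the
    modulus is comparable with the real and imaginary parts. *)
Lemma SaP f : Sa a f <-> SR (fun x => Re (f x)) /\ SR (fun x => Im (f x)).
Proof.
split=> [[sf gf]|[[s1 H1] [s2 H2]]].
  have [s1 s2] := (smoothE f).1 sf.
  have B s m : exists B, forall x, wt m x * normc (foldr partial f (mseq (fun j => count_mem j s)) x) <= B.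
    have := gamma_lt_pinfty (gf m [ffun j => count_mem j s]).
    rewrite (_ : mseq _ = mseq (fun j => count_mem j s)) //.
    by rewrite /mseq; congr flatten; apply: eq_map => j; rewrite ffunE.
  split; split=> // s m; have [M HM] := B s m; exists M => x; apply: le_trans (HM x);
    rewrite ler_wpM2l ?(ltW (wt_gt0 _ _ _))//.
    rewrite (pds_perm s1 (perm_mseq s)) -Re_foldr_partial; exact: Re_le_normc.
  rewrite (pds_perm s2 (perm_mseq s)) -Im_foldr_partial; exact: Im_le_normc.
split; first by apply/smoothE.
move=> m alpha; have [B1 HB1] := H1 (mseq alpha) m; have [B2 HB2] := H2 (mseq alpha) m.
apply: (@le_lt_trans _ _ (B1 + B2)%:E); last exact: ltry.
apply/gamma_leP => x; apply: le_trans (lerD (HB1 x) (HB2 x)).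
rewrite -mulrDr ler_wpM2l ?(ltW (wt_gt0 _ _ _))//.
rewrite -Re_foldr_partial -Im_foldr_partial; exact: normc_le_ReIm.
Qed.

Lemma Sa_real u : SR u -> Sa a (fun x => (u x)%:C).
Proof. by move=> Su; apply/SaP; split=> //; exact: SR0. Qed.

Lemma gamma_real_le m (alpha : {ffun 'I_n.+2 -> nat}) u (B : R) :
  wbound m (pds (mseq alpha) u) B -> (gamma a m alpha (fun x => (u x)%:C) <= B%:E)%E.
Proof.
move=> H; apply/gamma_leP => x; apply: le_trans (H x).
rewrite ler_wpM2l ?(ltW (wt_gt0 _ _ _))//; apply: le_trans (normc_le_ReIm _) _.
have := Re_foldr_partial (mseq alpha) (fun x => (u x)%:C) => /(congr1 (@^~ x))/= ->.
have := Im_foldr_partial (mseq alpha) (fun x => (u x)%:C) => /(congr1 (@^~ x))/= ->.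
by rewrite pds0 normr0 addr0.
Qed.

Lemma Sa_lin (c : C) f g : Sa a f -> Sa a g -> Sa a (fun x => c * f x + g x).
Proof.
move=> /SaP[f1 f2] /SaP[g1 g2]; apply/SaP; split.
  rewrite (_ : (fun x => _) = (fun x => Re c * Re (f x) + (- Im c * Im (f x) + Re (g x)))).
    by do 2 apply: SR_lin => //.
  by apply/funext => x; case: c (f x) (g x) => ? ? [? ?] [? ?] /=; ring.
rewrite (_ : (fun x => _) = (fun x => Re c * Im (f x) + (Im c * Re (f x) + Im (g x)))).
  by do 2 apply: SR_lin => //.
by apply/funext => x; case: c (f x) (g x) => ? ? [? ?] [? ?] /=; ring.
Qed.

Lemma Sa_decompose f : f = (fun x => 'i * (Im (f x))%:C + (Re (f x))%:C).
Proof. by apply/funext => x; rewrite [LHS]complexE addrC. Qed.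

(** Continuity at 0 yields finitely many weighted seminorms and a radius e such that gam < 1 on the
    corresponding ball; homogeneity turns this into a bound. *)
Lemma seminorm_bound (gam : (V -> C) -> R) : continuous_seminorm a gam ->
  exists m (A : seq (seq 'I_n.+2)) (K : R), 0 < K /\ forall u B, SR u ->
    (forall s, s \in A -> wbound m (pds s u) B) -> gam (fun x => (u x)%:C) <= K * B.
Proof.
move=> [gD gZ gc]; have S0 : Sa a (fun _ : V => 0) by exact: (Sa_real (@SR0 R n a)).
have g0 : gam (fun=> 0) = 0.
  by have := gZ 0 _ S0; rewrite normc0 !mul0r.
have /(_ [set y | `|0 - y| < 1])[] := gc _ S0.
  by rewrite g0; apply/nbhs_normP; exists 1 => //= y.
move=> [I e] /= e0 HI.
(* The empty sequence joins the list so that the hypothesis on B makes it nonnegative. *)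
exists (\max_(p <- I) p.1)%N, ([::] :: [seq mseq (fun j => p.2 j) | p : nat * {ffun 'I_n.+2 -> nat} <- I]), (2 / e); split; first by rewrite divr_gt0.
move=> u B Su HB; have B0 : 0 <= B := wbound_ge0 (HB [::] (mem_head _ _)).
apply/ler_addgt0Pl => d d0.
(* B may be 0, so the function is rescaled by means of a slightly larger, positive bound. *)
pose B' := B + d * e / 2.
have B'0 : 0 < B' by rewrite ltr_wpDl// divr_gt0// mulr_gt0.
have -> : d + 2 / e * B = 2 * B' / e by rewrite /B'; field; rewrite gt_eqF.
pose c := e / (2 * B').
have c0 : 0 < c by rewrite divr_gt0// mulr_gt0.
have Sc : SR (fun x => c * u x).
  rewrite (_ : (fun x => _) = (fun x => c * u x + 0)); first by apply: SR_lin => //; exact: SR0.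
  by apply/funext => x; rewrite addr0.
have cE : (fun x => (c * u x)%:C) = (fun x => c%:C * (u x)%:C).
  by apply/funext => x; rewrite rmorphM.
have : [set y | `|0 - y| < 1] (gam (fun x => (c * u x)%:C)).
  apply: HI; split; first exact: Sa_real.
  move=> p pI; apply: (@le_lt_trans _ _ (e / 2)%:E); last first.
    by rewrite lte_fin ltr_pdivrMr// ltr_pMr// ltr1n.
  rewrite (_ : (_ \- _)%R = (fun x => (c * u x)%:C)); last by apply/funext => x /=; rewrite subr0.
  apply: gamma_real_le.
  have su : smoothR u by case: Su.
  have W : wbound p.1 (pds (mseq p.2) u) B.
    apply: (wbound_exponent (m' := (\max_(p <- I) p.1)%N)).
      by rewrite (big_rem p)//= leq_maxl.
    by apply: HB; rewrite inE; apply/orP; right; apply/mapP; exists p.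
  have E : pds (mseq p.2) (fun x => c * u x) = (fun x => c * pds (mseq p.2) u x).
    rewrite (_ : (fun x => c * u x) = (fun x => c * u x + 0)); last by apply/funext => x; rewrite addr0.
    have [s0 _] := @SR0 R n a.
    rewrite (pds_lin c (mseq p.2) su s0) pds0.
    by apply/funext => x; rewrite addr0.
  rewrite E; apply: wbound_le (wboundZ c W).
  rewrite (gtr0_norm c0) (_ : e / 2 = c * B'); last by rewrite /c; field; rewrite gt_eqF.
  by rewrite ler_pM2l// lerDl divr_ge0// mulr_ge0// ltW.
rewrite cE gZ; last exact: Sa_real.
rewrite normc_real (gtr0_norm c0) /= sub0r normrN => h.
have := le_lt_trans (ler_norm _) h; rewrite mulrC -ltr_pdivlMr// => /ltW.
by rewrite mul1r /c invf_div.
Qed.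

Lemma spherical_average_real t v : spherical_average t (fun x => (v x)%:C) = (fun x => (Mr t v x)%:C).
Proof.
apply/funext => x; rewrite /spherical_average /sphere_integral; apply: complex_eq => //=.
by have := @avg_cst R n 0; rewrite avgE.
Qed.

Lemma phi_iaE t : phi ('i * a%:C) (t *: unit_e1 R n.+2) = (Phi n a t)%:C.
Proof.
have E (w : V) : 'i * ('i * a%:C) * (dot (t *: unit_e1 R n.+2) w)%:C = (a * - t * w 0 0)%:C.
  by rewrite dotZl dot_e1 mulrA -expr2 sqr_i mulN1r -!rmorphN -!rmorphM /=; congr (_%:C); ring.
rewrite /phi (_ : (fun w => cexp _) = (fun w : V => (expR (a * - t * w 0 0))%:C)); last first.
  by apply/funext => w; rewrite E /cexp /= cos0 mulr1 sin0 mulr0.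
rewrite -(Phi_norm a) -normrN (Phi_norm a) Phi_avg avgE /sphere_integral; apply: complex_eq => //=.
by have := @avg_cst R n 0; rewrite avgE.
Qed.

Section sequence.
Variables (t : R) (A : C) (T : int -> (V -> C) -> C).
Hypothesis t0 : 0 < t.
Hypothesis HT : average_sequence t a A T.
Hypothesis A0 : A != 0.

Let c : C := A / (normc A)%:C.

Let nA0 : 0 < normc A.
Proof.
rewrite lt_def normc_ge0 andbT; apply: contra A0 => /eqP/eq0_normc ->; exact: eqxx.
Qed.

Let nAC : (normc A)%:C != 0 :> C.
Proof. by rewrite (inj_eq (@complexI R) _ 0) gt_eqF. Qed.

Let c1 : normc c = 1.
Proof. by rewrite /c normcM normcV normc_real gtr0_norm// mulfV// gt_eqF. Qed.

Let c_neq0 : c != 0.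
Proof. by apply/eqP => E; have := c1; rewrite E normc0 => /eqP; rewrite eq_sym oner_eq0. Qed.

(** With c the phase of A, the factors c^k turn multiplication by A into multiplication by |A|; the
    free factor z recovers the imaginary part from real parts. *)
Definition real_part (z : C) (k : int) u : R := Re (z * c ^ k * T k (fun x => (u x)%:C)).

Lemma real_part_bounded z : exists m (B : seq (seq 'I_n.+2)) (K : R), forall k,
  bounded_functional a (real_part z k) m B K.
Proof.
have [dT _ [gam [M [cg M0 HM]]]] := HT.
have [m [B [K [K0 HK]]]] := seminorm_bound cg.
exists m, B, (normc z * (M * K)) => k; split.
- move=> k' u v Su Sv; rewrite /real_part; have [lin _] := dT k.
  rewrite (_ : (fun x => _) = (fun x => k'%:C * (u x)%:C + (v x)%:C)); last first.
    by apply/funext => x; rewrite rmorphD rmorphM.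
  rewrite (lin _ _ _ (Sa_real Su) (Sa_real Sv)) mulrDr ReD; congr (_ + _).
  by rewrite mulrCA ReM_real.
- by rewrite !mulr_ge0 ?normc_ge0// ltW.
- move=> u W Su HW; apply: le_trans (Re_le_normc _) _.
  rewrite !normcM (normc_exp k c1) mulr1 -mulrA ler_wpM2l ?normc_ge0//.
  apply: le_trans (HM k _ (Sa_real Su)) _; rewrite -mulrA ler_wpM2l ?(ltW M0)//.
  exact: HK.
Qed.

Lemma real_part_mean z k v : SR v -> real_part z k (Mr t v) = normc A * real_part z (k + 1) v.
Proof.
move=> Sv; have [_ HM _] := HT; have := HM k _ (Sa_real Sv).
rewrite /distr_op spherical_average_real /real_part => ->.
rewrite expfzDr// expr1z -ReM_real; congr Re; rewrite /c.
move: (c ^ k) (T _ _) => p q; move: nAC; move: ((normc A)%:C) => w w0.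
by field.
Qed.

End sequence.

Lemma dual_zero (T : (V -> C) -> C) : dual_Sa a T -> T (fun=> 0) = 0.
Proof.
move=> [lin _]; have S0 : Sa a (fun _ : V => 0) by exact: (Sa_real (@SR0 R n a)).
have := lin 1 _ _ S0 S0; rewrite !mul1r addr0 => /eqP.
by rewrite -subr_eq0 opprD addrA subrr sub0r oppr_eq0 => /eqP.
Qed.

Lemma dual_scale (T : (V -> C) -> C) (k : C) f : dual_Sa a T -> Sa a f ->
  T (fun x => k * f x) = k * T f.
Proof.
move=> dT Sf; have S0 : Sa a (fun _ : V => 0) by exact: (Sa_real (@SR0 R n a)).
rewrite (_ : (fun x => _) = (fun x => k * f x + 0)); last by apply/funext => x; rewrite addr0.
by have [lin _] := dT; rewrite lin// (dual_zero dT) addr0.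
Qed.

Lemma laplacianE f : laplacian f =
  (fun x => 'i * (- (lap (fun x => Im (f x)) x)%:C) + - (lap (fun x => Re (f x)) x)%:C).
Proof.
apply/funext => x; rewrite /laplacian /lap.
have E : \sum_(j < n.+2) partial j (partial j f) x =
    (\sum_j pd j (pd j (fun x => Re (f x))) x)%:C + 'i * (\sum_j pd j (pd j (fun x => Im (f x))) x)%:C.
  pose P j := pd j (pd j (fun x => Re (f x))) x; pose Q j := pd j (pd j (fun x => Im (f x))) x.
  transitivity (\sum_j ((P j)%:C + 'i * (Q j)%:C)); first by apply: eq_bigr => j _; exact: complexE.
  exact: sum_ReIm.
by rewrite E opprD mulrN addrC.
Qed.

(** * Assertions (a) and (b) *)

Section conclusions.
Variables (t : R) (A : C) (T : int -> (V -> C) -> C).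
Hypothesis t0 : 0 < t.
Hypothesis HT : average_sequence t a A T.

Lemma phi_gt0 : 0 < phi ('i * a%:C) (t *: unit_e1 R n.+2).
Proof. by rewrite phi_iaE ltcR Phi_gt0. Qed.

Lemma complex_by_parts (z w : C) : (forall y : C, Re (y * z) = Re (y * w)) -> z = w.
Proof.
move=> H; apply: complex_eq; first by have := H 1; rewrite !mul1r.
by have := H (- 'i); rewrite !Re_Ni.
Qed.

Lemma average_sequence_zero : phi ('i * a%:C) (t *: unit_e1 R n.+2) < `|A| ->
  distr_eq a (T 0) (fun=> 0).
Proof.
move=> HA; have A0 : A != 0 by rewrite -normr_gt0; apply: lt_trans HA; exact: phi_gt0.
move: HA; rewrite phi_iaE normr_normc ltcR => HA.
have dT : dual_Sa a (T 0) by case: HT.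
have Z u : SR u -> T 0 (fun x => (u x)%:C) = 0.
  move=> Su; apply: complex_by_parts => y; rewrite mulr0.
  have [m [B [K bK]]] := real_part_bounded HT A0 y.
  have := functional_zero a0 t0 bK HA (real_part_mean HT A0 y) Su.
  by rewrite /real_part expr0z mulr1.
move=> f /SaP[f1 f2]; have [lin _] := dT.
rewrite (Sa_decompose f) lin; [|exact: Sa_real|exact: Sa_real].
by rewrite !Z// mulr0 addr0.
Qed.

Lemma average_sequence_eigen : `|A| = phi ('i * a%:C) (t *: unit_e1 R n.+2) ->
  distr_eq a (distr_op laplacian (T 0)) (fun f => - a%:C ^+ 2 * T 0 f).
Proof.
move=> HA; have A0 : A != 0 by rewrite -normr_gt0 HA; exact: phi_gt0.
move: HA; rewrite phi_iaE normr_normc => /complexI HA.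
have dT : dual_Sa a (T 0) by case: HT.
have Z u : SR u -> T 0 (fun x => (lap u x)%:C) = a%:C ^+ 2 * T 0 (fun x => (u x)%:C).
  move=> Su; apply: complex_by_parts => y.
  have [m [B [K bK]]] := real_part_bounded HT A0 y.
  have HM k v : SR v -> real_part A T y k (Mr t v) = Phi n a t * real_part A T y (k + 1) v.
    by move=> Sv; rewrite -HA; exact: (real_part_mean HT A0).
  have := functional_eigen a0 t0 bK HM Su.
  rewrite /real_part expr0z mulr1 => ->.
  by rewrite mulrCA -rmorphXn ReM_real.
move=> f /SaP[f1 f2]; have [lin _] := dT.
rewrite /distr_op laplacianE.
have N u : SR u -> Sa a (fun x => - (lap u x)%:C) /\
    T 0 (fun x => - (lap u x)%:C) = - (a%:C ^+ 2 * T 0 (fun x => (u x)%:C)).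
  move=> Su; have E : (fun x => - (lap u x)%:C) = (fun x => (-1 : C) * (lap u x)%:C).
    by apply/funext => x; rewrite mulN1r.
  have Sl := Sa_real (SR_lap Su).
  rewrite E (dual_scale _ dT Sl) Z// mulN1r; split=> //.
  rewrite (_ : (fun x => _) = (fun x => -1 * (lap u x)%:C + 0)).
    by apply: Sa_lin => //; exact: (Sa_real (@SR0 R n a)).
  by apply/funext => x; rewrite addr0.
have [S1 E1] := N _ f1; have [S2 E2] := N _ f2.
have E3 : T 0 f = 'i * T 0 (fun x => (Im (f x))%:C) + T 0 (fun x => (Re (f x))%:C).
  by rewrite {1}(Sa_decompose f); exact: lin (Sa_real f2) (Sa_real f1).
have L := lin 'i _ _ S2 S1.
have Q (i p q w : C) : i * - (w * p) + - (w * q) = - w * (i * p + q) by ring.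
apply: (etrans L); apply: (etrans (f_equal2 (fun p q => 'i * p + q) E2 E1)).
by apply: (etrans _ (f_equal (fun z => - a%:C ^+ 2 * z) (esym E3))); exact: Q.
Qed.

End conclusions.

End complexification.

(** * Exponential plane waves *)

Section product_weight.
Context {R : realType}.
Local Notation mR := (measurableTypeR R).
Local Notation leb := (@lebesgue_tuple R).

(** An integrable majorant in product form, so that its integral is computed one coordinate at a
    time. *)
Definition pweight m (x : 'rV[R]_m) : R := \prod_(i < m) (1 + x 0 i ^+ 2)^-1.

Lemma pweight_gt0 m (x : 'rV[R]_m) : 0 < pweight x.
Proof. by apply: prodr_gt0 => i _; rewrite invr_gt0 ltr_pwDl ?sqr_ge0. Qed.

Lemma measurable_pweight m : measurable_fun setT (fun v : m.-tuple mR => pweight (rv v) : mR).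
Proof.
rewrite /pweight; apply: measurable_prod => i _.
have ci : continuous (fun x : R => (1 + x ^+ 2)^-1).
  apply: inv_cont; last by cont.
  by move=> x; rewrite gt_eqF// ltr_pwDl ?sqr_ge0.
under eq_fun do rewrite mxE.
exact: (measurableT_comp (continuous_measurable_fun ci) (measurable_tnth i)).
Qed.

Lemma integral_oneDsqr_lty : (\int[@lebesgue_measure R]_x ((1 + x ^+ 2)^-1)%:E < +oo)%E.
Proof.
rewrite (@ge0_symfun_integralT R (fun x => (1 + x ^+ 2)^-1)).
- rewrite (_ : [set x : R | 0 <= x] = `[0, +oo[%classic); last first.
    by apply/seteqP; split => x/=; rewrite in_itv/= andbT.
  have := @integral0y_oneDsqr R; rewrite /oneDsqr => ->.
  by rewrite -EFinM ltry.
- by move=> x; rewrite invr_ge0 addr_ge0// sqr_ge0.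
- apply: inv_cont; last by cont.
  by move=> x; rewrite gt_eqF// ltr_pwDl ?sqr_ge0.
- by move=> x /=; rewrite sqrrN.
Qed.

Lemma integral_pweight_lty m : (\int[leb m]_v (pweight (rv v))%:E < +oo)%E.
Proof.
elim: m => [|m IH].
  rewrite [leb 0]/= integral_dirac//; last by apply/measurable_EFinP; exact: measurable_pweight.
  by rewrite diracT mul1e ltry.
have mf : measurable_fun setT (fun v : m.+1.-tuple mR => (pweight (rv v))%:E).
  by apply/measurable_EFinP; exact: measurable_pweight.
have f0 k (v : k.-tuple mR) : (0 <= (pweight (rv v))%:E)%E by rewrite lee_fin ltW ?pweight_gt0.
have := ge0_integral_lebesgue_cons (leb m) measurableT mf (f0 m.+1).
rewrite preimage_setT => E; rewrite [X in (X < _)%E]E.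
have pE (x : mR) y : pweight (rv (cons_pair (x, y))) = (1 + x ^+ 2)^-1 * pweight (rv y).
  rewrite /pweight big_ord_recl mxE cons_pair0; congr (_ * _).
  by apply: eq_bigr => i _; rewrite !mxE cons_pair_lift.
have mf2 : measurable_fun setT (fun p : mR * m.-tuple mR => (pweight (rv (cons_pair p)))%:E).
  exact: (measurableT_comp mf (@measurable_cons_pair R m)).
rewrite fubini_tonelli1//.
rewrite /fubini_F; under eq_integral => x _.
  under eq_integral do rewrite pE EFinM.
  rewrite ge0_integralZl//; [over|by apply/measurable_EFinP; exact: measurable_pweight|].
    by rewrite lee_fin invr_ge0 addr_ge0// sqr_ge0.
set I := (\int[leb m]_v _)%E in IH *.
have I0 : (0 <= I)%E by apply: integral_ge0 => v _; exact: f0.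
have IE : I = (fine I)%:E by rewrite fineK// ge0_fin_numE.
rewrite IE ge0_integralZr//.
- by rewrite -IE lte_mul_pinfty ?integral_oneDsqr_lty// ?ge0_fin_numE// ?integral_ge0//;
   move=> *; rewrite ?integral_oneDsqr_lty// lee_fin invr_ge0 addr_ge0// sqr_ge0.
- apply/measurable_EFinP; apply: continuous_measurable_fun.
  apply: inv_cont; last by cont.
  by move=> x; rewrite gt_eqF// ltr_pwDl ?sqr_ge0.
- by move=> x _; rewrite lee_fin invr_ge0 addr_ge0// sqr_ge0.
- by rewrite lee_fin fine_ge0.
Qed.

End product_weight.

(** * Integration over R^d *)

Section lebesgue_functional.
Context {R : realType} {n : nat}.
Local Notation mR := (measurableTypeR R).
Local Notation d := n.+2.
Local Notation V := 'rV[R]_d.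
Local Notation leb := (@lebesgue_tuple R d).
Local Notation sig := (@sphere_measure R d).
Implicit Types (g h : V -> R) (x w : V).

Definition gint g : R := \int[leb]_v g (rv v).

Definition decay g (B : R) := forall x, `|g x| <= B * pweight x.

Definition gmass : R := fine (\int[leb]_v (pweight (rv v))%:E).

Lemma gmass_ge0 : 0 <= gmass.
Proof. by apply: fine_ge0; apply: integral_ge0 => v _; rewrite lee_fin ltW ?pweight_gt0. Qed.

Lemma pweight_integrable B : leb.-integrable setT (fun v => (B * pweight (rv v))%:E).
Proof.
under eq_fun do rewrite EFinM; apply: integrableZl => //.
apply/integrableP; split; first by apply/measurable_EFinP; exact: measurable_pweight.
under eq_integral do rewrite gee0_abs ?lee_fin ?(ltW (pweight_gt0 _))//.
exact: integral_pweight_lty.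
Qed.

Lemma gint_integrable g B : continuous g -> decay g B -> leb.-integrable setT (fun v => (g (rv v))%:E).
Proof.
move=> cg dg; apply: (le_integrable measurableT _ _ (pweight_integrable B)).
  by apply/measurable_EFinP; exact: (measurable_rv cg).
move=> v _; rewrite !abse_EFin lee_fin; apply: le_trans (dg _) _; exact: ler_norm.
Qed.

Lemma gint_fin g B : continuous g -> decay g B -> (gint g)%:E = (\int[leb]_v (g (rv v))%:E)%E.
Proof.
by move=> cg dg; rewrite /gint fineK//; apply: integrable_fin_num => //; exact: (gint_integrable cg dg).
Qed.

Lemma gintD g h B C : continuous g -> decay g B -> continuous h -> decay h C ->
  gint (fun x => g x + h x) = gint g + gint h.
Proof.
move=> cg dg ch dh; apply: RintegralD => //.
  exact: (gint_integrable cg dg).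
exact: (gint_integrable ch dh).
Qed.

Lemma gintZ g B c : continuous g -> decay g B -> gint (fun x => c * g x) = c * gint g.
Proof. by move=> cg dg; apply: RintegralZl => //; exact: (gint_integrable cg dg). Qed.

Lemma gint_bound g B : continuous g -> decay g B -> `|gint g| <= B * gmass.
Proof.
move=> cg dg; rewrite -lee_fin -abse_EFin (gint_fin cg dg).
apply: le_trans (le_abse_integral _ measurableT _) _.
  by apply/measurable_EFinP; exact: (measurable_rv cg).
apply: (@le_trans _ _ (\int[leb]_v (B * pweight (rv v))%:E)%E).
  apply: ge0_le_integral => //.
  - by apply: measurableT_comp => //; apply/measurable_EFinP; exact: (measurable_rv cg).
  - by have /integrableP[] := pweight_integrable B.
  - by move=> v _; rewrite abse_EFin lee_fin.
have i1 := pweight_integrable 1.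
have -> : (\int[leb]_v (B * pweight (rv v))%:E = B%:E * \int[leb]_v (1 * pweight (rv v))%:E)%E.
  rewrite -integralZl//; apply: eq_integral => v _.
  by rewrite mul1r EFinM.
rewrite EFinM /gmass fineK; first by under eq_integral do rewrite mul1r.
rewrite ge0_fin_numE; first exact: integral_pweight_lty.
by apply: integral_ge0 => v _; rewrite lee_fin ltW ?pweight_gt0.
Qed.

Lemma gint_shift g (c : V) B B' : continuous g -> decay g B ->
  decay (fun x => g (x + c)) B' -> gint (fun x => g (x + c)) = gint g.
Proof.
move=> cg dg dg'.
have cg' : continuous (fun x => g (x + c)) by apply: (gcomp_cont cg); cont.
have [mf fE] := @mpres_tadd R d (trv c).
have mg : measurable_fun setT (fun v => (g (rv v))%:E) by apply/measurable_EFinP; exact: (measurable_rv cg).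
have rE v : rv (tadd (trv c) v) = rv v + c.
  by apply/rowP => i; rewrite !mxE !tnth_mktuple.
have FE : (fun v => (g (rv v))%:E) \o tadd (trv c) = (fun v => (g (rv v + c))%:E).
  by apply/funext => v /=; rewrite rE.
have ig : leb.-integrable (tadd (trv c) @^-1` setT) ((fun v => (g (rv v))%:E) \o tadd (trv c)).
  by rewrite preimage_setT FE; exact: (gint_integrable cg' dg').
have := integral_pushforward mf mg ig measurableT.
rewrite preimage_setT FE => E.
rewrite /gint /Rintegral; apply: (f_equal fine); rewrite -[LHS]E.
by apply: eq_measure_integral => A mA _; rewrite -[RHS]fE.
Qed.

(* Only the values of G on the sphere matter, but the measures live on all
   tuples: clipping makes the bound on G global. *)
Lemma gint_avg_swap (G : V * V -> R) B : continuous G ->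
  (forall x w, (forall i, `|w 0 i| <= 1) -> `|G (x, w)| <= B * pweight x) ->
  (gint (fun x => avg (fun w => G (x, w))))%:E =
  (\int[sig]_v (gint (fun x => G (x, clip (rv v))))%:E)%E.
Proof.
move=> cG HG.
have ccl : continuous (fun p : V * V => clip p.2).
  by move=> p; apply: continuous_comp; [exact: snd_cont|exact: clip_continuous].
pose Gc (p : V * V) := G (p.1, clip p.2).
have cGc : continuous Gc by exact: (pair_comp cG fst_cont ccl).
have HGc x w : `|Gc (x, w)| <= B * pweight x by apply: HG => i; exact: clip_coord.
have cst (v : V) : continuous (fun _ : V => v) by exact: cst_continuous.
have cGx x : continuous (fun w => Gc (x, w)) by exact: (pair_comp cGc (cst x) id_cont).
have cGw w : continuous (fun x => Gc (x, w)) by exact: (pair_comp cGc id_cont (cst w)).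
have cA : continuous (fun x => avg (fun w => Gc (x, w))).
  by apply: avg_continuous; exact: (pair_comp cGc fst_cont snd_cont).
have dA : decay (fun x => avg (fun w => Gc (x, w))) B.
  by move=> x; apply: avg_bound => // w _; exact: HGc.
have AE : (fun x => avg (fun w => G (x, w))) = (fun x => avg (fun w => Gc (x, w))).
  apply/funext => x; rewrite avg_clip; last exact: (pair_comp cG (cst x) id_cont).
  by [].
rewrite AE (gint_fin cA dA).
have mG : measurable_fun setT (fun p : d.-tuple mR * d.-tuple mR => (Gc (rv p.1, rv p.2))%:E).
  apply/measurable_EFinP; apply: measurable_continuous_comp2 => // j; under eq_fun do rewrite mxE.
    exact: (measurableT_comp (measurable_tnth j) measurable_fst).
  exact: (measurableT_comp (measurable_tnth j) measurable_snd).
have iG : (leb \x sig)%E.-integrable setT (fun p => (Gc (rv p.1, rv p.2))%:E).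
  apply/integrable12ltyP => //.
  apply: (@le_lt_trans _ _ (\int[leb]_v (B * pweight (rv v))%:E)%E); last first.
    have /integrableP[_] := pweight_integrable B.
    by apply: le_lt_trans; apply: le_trans (lee_abs _) (le_abse_integral _ _ _) => //;
      have /integrableP[] := pweight_integrable B.
  apply: ge0_le_integral => //.
  - by move=> v _; apply: integral_ge0.
  - apply: (@measurable_fun_fubini_tonelli_F _ _ _ _ _ sig (fun p => `|(Gc (rv p.1, rv p.2))%:E|)%E) => //.
    exact: measurableT_comp.
  - by have /integrableP[] := pweight_integrable B.
  move=> v _; apply: (@le_trans _ _ (\int[sig]_w (B * pweight (rv v))%:E)%E).
    apply: ge0_le_integral => //.
    - by apply: measurableT_comp => //; apply/measurable_EFinP; exact: (measurable_rv (cGx (rv v))).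
    - by move=> w _; rewrite abse_EFin lee_fin; exact: HGc.
  by rewrite integral_cst// [X in (_ * X)%E](_ : _ = 1%E) ?mule1//; exact: sphere_setT.
have E1 x : (avg (fun w => Gc (x, w)))%:E = (\int[sig]_w (Gc (x, rv w))%:E)%E.
  by rewrite avgE fineK//; apply: integrable_fin_num => //; exact: (avg_integrable (cGx x)).
have E2 w : (gint (fun x => Gc (x, w)))%:E = (\int[leb]_v (Gc (rv v, w))%:E)%E.
  by apply: (gint_fin (cGw w)) => x; exact: HGc.
under eq_integral do rewrite E1.
rewrite (_ : (\int[sig]_v _)%E = (\int[sig]_v (\int[leb]_x (Gc (rv x, rv v))%:E))%E).
  exact: (Fubini iG).
by apply: eq_integral => v _; rewrite -E2.
Qed.

Lemma gint_avg_eq (G1 G2 : V * V -> R) B1 B2 : continuous G1 -> continuous G2 ->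
  (forall x w, (forall i, `|w 0 i| <= 1) -> `|G1 (x, w)| <= B1 * pweight x) ->
  (forall x w, (forall i, `|w 0 i| <= 1) -> `|G2 (x, w)| <= B2 * pweight x) ->
  (forall w, (forall i, `|w 0 i| <= 1) -> gint (fun x => G1 (x, w)) = gint (fun x => G2 (x, w))) ->
  gint (fun x => avg (fun w => G1 (x, w))) = gint (fun x => avg (fun w => G2 (x, w))).
Proof.
move=> c1 c2 H1 H2 E; apply: EFin_inj.
rewrite (gint_avg_swap c1 H1) (gint_avg_swap c2 H2); apply: eq_integral => v _.
by rewrite E// => i; exact: clip_coord.
Qed.

End lebesgue_functional.

(** * Pairing with functions of the first coordinate *)

Section kernel_functionals.
Context {R : realType} {n : nat} (a : R).
Hypothesis a0 : 0 <= a.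
Local Notation mR := (measurableTypeR R).
Local Notation d := n.+2.
Local Notation V := 'rV[R]_d.
Local Notation E j := (delta_mx 0 j : V).
Local Notation SR := (@SR R n a).
Local Notation wt := (@expweight R n a).
Local Notation wbound := (@wbound R n a).
Local Notation M := (2 * d)%N.
Implicit Types (h : V -> R) (k : R -> R) (x y w : V) (m : nat) (B K t : R).

Lemma wt_shift_any m x y (b : R) : enorm y <= b ->
  wt m x <= wt m (x - y) * (expR (a * b) * (1 + b) ^+ m).
Proof.
move=> yb; have b0 : 0 <= b by apply: le_trans yb; exact: enorm_ge0.
have h1 : enorm x <= enorm (x - y) + b.
  have := enormD (x - y) y; rewrite subrK.
  by move/le_trans; apply; rewrite lerD2l.
have h2 : 1 + enorm x <= (1 + enorm (x - y)) * (1 + b).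
  by move: h1 (enorm_ge0 (x - y)) b0; move: (enorm _) (enorm _) => p q; nra.
rewrite /expweight mulrACA -exprMn; apply: ler_pM => //.
- by rewrite exprn_ge0// addr_ge0 ?enorm_ge0.
- by rewrite -expRD ler_expR -mulrDr ler_wpM2l.
- by rewrite lerXn2r ?nnegrE ?mulr_ge0 ?addr_ge0 ?enorm_ge0.
Qed.

(** Each of the d factors 1 + x_i^2 is at most (1 + |x|)^2; this is where the exponent 2d comes
    from. *)
Lemma pweight_wt x : expR (a * `|x 0 0|) <= wt M x * pweight x.
Proof.
rewrite /expweight -mulrA -[leLHS]mulr1; apply: ler_pM; rewrite ?expR_ge0//.
  by rewrite ler_expR ler_wpM2l//; exact: normr_coord.
rewrite /pweight exprM -{2}(card_ord d) -prodr_const -big_split /=.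
apply: (@le_trans _ _ (\prod_(i in 'I_d) (1 : R))); first by rewrite big1.
apply: ler_prod => i _; rewrite ler01 /= ler_pdivlMr ?ltr_pwDl ?sqr_ge0// mul1r.
have := normr_coord x i; have := normr_ge0 (x 0 i).
rewrite -(real_normK (num_real (x 0 i))); move: (`|_|) (enorm x) => p q; nra.
Qed.

Definition kbound k K := forall y : R, `|k y| <= K * expR (a * `|y|).

Definition coord_pairing k h : R := gint (fun x => h x * k (x 0 0)).

Lemma coord_pairing_cont k h : continuous k -> continuous h -> continuous (fun x : V => h x * k (x 0 0)).
Proof.
move=> ck ch; have c1 : continuous (fun x : V => k (x 0 0)) by apply: (comp_cont ck); cont.
cont.
Qed.

Lemma kbound_ge0 k K : kbound k K -> 0 <= K.
Proof. by move=> /(_ 0); rewrite normr0 mulr0 expR0 mulr1; apply: le_trans. Qed.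

Lemma coord_pairing_decay k h K B : kbound k K -> wbound M h B -> decay (fun x => h x * k (x 0 0)) (B * K).
Proof.
move=> kK hB x; rewrite normrM.
have K0 := kbound_ge0 kK.
apply: le_trans (ler_wpM2l (normr_ge0 _) (kK (x 0 0))) _.
apply: (@le_trans _ _ (`|h x| * (K * (wt M x * pweight x)))).
  by rewrite ler_wpM2l// ler_wpM2l// pweight_wt.
rewrite [leLHS](_ : _ = K * (wt M x * `|h x|) * pweight x); last by ring.
by rewrite [B * K]mulrC ler_wpM2r ?(ltW (pweight_gt0 _))// ler_wpM2l.
Qed.

Lemma coord_pairing_lin k K c h h' B B' : continuous k -> kbound k K -> continuous h -> wbound M h B ->
  continuous h' -> wbound M h' B' -> coord_pairing k (fun x => c * h x + h' x) = c * coord_pairing k h + coord_pairing k h'.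
Proof.
move=> ck kK ch hB ch' hB'.
have d1 := coord_pairing_decay kK hB; have d2 := coord_pairing_decay kK hB'.
have c1 := coord_pairing_cont ck ch; have c2 := coord_pairing_cont ck ch'.
have c3 : continuous (fun x : V => c * (h x * k (x 0 0))) by cont.
have d3 : decay (fun x : V => c * (h x * k (x 0 0))) (`|c| * (B * K)).
  by move=> x; rewrite normrM -mulrA ler_wpM2l.
rewrite /coord_pairing -(gintZ c c1 d1) -(gintD c3 d3 c2 d2); apply: (f_equal gint); apply/funext => x.
ring.
Qed.

Lemma coord_pairing_kernel_lin k k' K K' c h B : continuous k -> kbound k K -> continuous k' -> kbound k' K' ->
  continuous h -> wbound M h B -> coord_pairing (fun y : R => c * k y + k' y) h = c * coord_pairing k h + coord_pairing k' h.
Proof.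
move=> ck kK ck' kK' ch hB.
have d1 := coord_pairing_decay kK hB; have d2 := coord_pairing_decay kK' hB.
have c1 := coord_pairing_cont ck ch; have c2 := coord_pairing_cont ck' ch.
have c3 : continuous (fun x : V => c * (h x * k (x 0 0))) by cont.
have d3 : decay (fun x : V => c * (h x * k (x 0 0))) (`|c| * (B * K)).
  by move=> x; rewrite normrM -mulrA ler_wpM2l.
rewrite /coord_pairing -(gintZ c c1 d1) -(gintD c3 d3 c2 d2); apply: (f_equal gint); apply/funext => x.
ring.
Qed.

Lemma coord_pairing_bound k K h B : continuous k -> kbound k K -> continuous h -> wbound M h B ->
  `|coord_pairing k h| <= B * K * @gmass R n.
Proof. by move=> ck kK ch hB; apply: gint_bound; [exact: coord_pairing_cont|exact: coord_pairing_decay]. Qed.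

Lemma kbound_shift k K s : kbound k K -> kbound (fun y : R => k (y + s)) (K * expR (a * `|s|)).
Proof.
move=> kK y; apply: le_trans (kK _) _; rewrite -mulrA ler_wpM2l ?(kbound_ge0 kK)//.
by rewrite -expRD ler_expR -mulrDr ler_wpM2l// addrC ler_normD.
Qed.

Lemma wbound_shift m h B y : wbound m h B ->
  wbound m (fun x => h (x - y)) (B * (expR (a * enorm y) * (1 + enorm y) ^+ m)).
Proof.
move=> hB x; have S := wt_shift_any m x (lexx (enorm y)).
apply: le_trans (ler_wpM2r (normr_ge0 _) S) _; rewrite mulrAC.
by rewrite ler_wpM2r ?mulr_ge0 ?expR_ge0// exprn_ge0// addr_ge0// enorm_ge0.
Qed.

Lemma coord_pairing_shift k K h B y : continuous k -> kbound k K -> continuous h -> wbound M h B ->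
  coord_pairing k (fun x => h (x - y)) = coord_pairing (fun z : R => k (z + y 0 0)) h.
Proof.
move=> ck kK ch hB; rewrite /coord_pairing; pose g x := h x * k (x 0 0 + y 0 0).
have cs : continuous (fun z : R => k (z + y 0 0)) by apply: (comp_cont ck); cont.
have cg : continuous g by exact: (coord_pairing_cont cs ch).
have gE : (fun x => g (x + - y)) = (fun x => h (x - y) * k (x 0 0)).
  by apply/funext => x; rewrite /g !mxE subrK.
have dg : decay g _ := coord_pairing_decay (kbound_shift (y 0 0) kK) hB.
have dg' := coord_pairing_decay kK (wbound_shift y hB); rewrite -gE in dg'.
by rewrite -(gint_shift cg dg dg') gE.
Qed.

(** Fubini brings the average outside, and translation invariance moves each shift by t w from h to
    the kernel. *)
Lemma coord_pairing_Mr k K h t : continuous k -> kbound k K -> SR h ->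
  coord_pairing k (Mr t h) = coord_pairing (fun z : R => avg (fun w : V => k (z + t * w 0 0))) h.
Proof.
move=> ck kK Sh; have ch := SR_continuous Sh.
have [B hB] : exists B, wbound M h B by have [_ H] := Sh; exact: (H [::] M).
have B0 := wbound_ge0 hB.
pose G1 (p : V * V) := h (p.1 - t *: p.2) * k (p.1 0 0).
pose G2 (p : V * V) := h p.1 * k (p.1 0 0 + t * p.2 0 0).
have c1 : continuous G1.
  apply: mul_cont; first by apply: (gcomp_cont ch); cont.
  by apply: (gcomp_cont ck); cont.
have c2 : continuous G2.
  apply: mul_cont; first by apply: (gcomp_cont ch); cont.
  by apply: (gcomp_cont ck); cont.
have L : coord_pairing k (Mr t h) = gint (fun x => avg (fun w => G1 (x, w))).
  apply: (f_equal gint); apply/funext => x; rewrite mulrC /Mr -avgZ.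
    by apply: (f_equal avg); apply/funext => w; rewrite mulrC.
  exact: Mr_arg_cont.
have Rr : coord_pairing (fun z : R => avg (fun w : V => k (z + t * w 0 0))) h = gint (fun x => avg (fun w => G2 (x, w))).
  apply: (f_equal gint); apply/funext => x; rewrite -avgZ //.
  by apply: (gcomp_cont ck); cont.
rewrite L Rr.
have eb (w : V) : (forall i, `|w 0 i| <= 1) -> enorm (t *: w) <= `|t| * d%:R.
  move=> wi; rewrite enormZ ler_wpM2l//; apply: le_trans (enorm_le_sum _) _.
  by rewrite -[leRHS]mulr1 -sum_cst; apply: ler_sum => i _; exact: wi.
pose b := `|t| * d%:R.
have b0 : 0 <= b by rewrite mulr_ge0.
apply: (@gint_avg_eq R n G1 G2 (B * (expR (a * b) * (1 + b) ^+ M) * K) (B * (K * expR (a * `|t|)))) => //.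
- move=> x w wi; have S := wt_shift_any M x (eb w wi).
  have W : wbound M (fun x => h (x - t *: w)) (B * (expR (a * b) * (1 + b) ^+ M)).
    move=> z; have Sz := wt_shift_any M z (eb w wi).
    apply: le_trans (ler_wpM2r (normr_ge0 _) Sz) _; rewrite mulrAC.
    by rewrite ler_wpM2r ?hB// mulr_ge0 ?expR_ge0// exprn_ge0// addr_ge0.
  exact: (coord_pairing_decay kK W).
- move=> x w wi; apply: le_trans (coord_pairing_decay (kbound_shift (t * w 0 0) kK) hB x) _.
  rewrite ler_wpM2r ?(ltW (pweight_gt0 _))// ler_wpM2l// ler_wpM2l ?(kbound_ge0 kK)//.
  by rewrite ler_expR ler_wpM2l// normrM ler_piMr.
- move=> w wi; have := coord_pairing_shift (t *: w) ck kK ch hB.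
  by rewrite /coord_pairing !mxE.
Qed.

Lemma shift_remainder m h j B (e : R) : SR h -> wbound m (pd j (pd j h)) B -> 0 <= e <= 1 ->
  wbound m (fun x => h (x + e *: E j) - h x - e * pd j h x) (B * (expR (a * 1) * (1 + 1) ^+ m) * e ^+ 2).
Proof.
move=> Sh hB /andP[e0 e1] x; have [sh _] := Sh; have sp := smoothR_pds [:: j] sh.
have W0 := wt_gt0 a m x; set E1 := _ * (1 + 1) ^+ m.
have E10 : 0 <= E1 by rewrite /E1 mulr_ge0 ?expR_ge0.
pose C := B * E1 / wt m x.
have C0 : 0 <= C by rewrite /C mulr_ge0 ?invr_ge0 ?(ltW W0)// mulr_ge0 ?(wbound_ge0 hB).
have eE : enorm (E j) = 1 by apply: enorm_unit; exact: dot_EE.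
have H1 s : `|s| <= e -> `|pd j (pd j h) (x + s *: E j)| <= C.
  move=> se; rewrite /C ler_pdivlMr//.
  have eb : enorm (- (s *: E j)) <= 1 by rewrite enormN enormZ eE mulr1 (le_trans se).
  have S := wt_shift_any m x eb; rewrite opprK -/E1 in S.
  apply: le_trans (ler_wpM2l (normr_ge0 _) S) _; rewrite mulrA ler_wpM2r// mulrC.
  exact: hB.
have H2 s : `|s| <= e -> `|pd j h (x + s *: E j) - pd j h x| <= C * e.
  move=> se; have := @increment_bound R _ (pd j h) 0 x j s C sp.
  rewrite mulr0 subr0 => /(_ _)I1; apply: le_trans (I1 _) _.
    by move=> s' ss; rewrite subr0; apply: H1; exact: le_trans se.
  by rewrite ler_wpM2l.
have I2 := @increment_bound R _ h (pd j h x) x j e (C * e) sh.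
rewrite (ger0_norm e0) in I2; rewrite mulrC -ler_pdivlMr//.
apply: le_trans (I2 H2) _.
by rewrite /C le_eqVlt; apply/orP; left; apply/eqP; ring.
Qed.

Lemma kernel_remainder k k1 k2 K : (forall y : R, is_derive (y : R) 1 k (k1 y)) ->
  (forall y : R, is_derive (y : R) 1 k1 (k2 y)) -> kbound k2 K -> forall e : R, 0 <= e <= 1 ->
  kbound (fun y : R => k (y - e) - k y + e * k1 y) (K * expR (a * 1) * e ^+ 2).
Proof.
move=> d1 d2 kK e /andP[e0 e1] y; have K0 := kbound_ge0 kK.
have dm (s : R) : is_derive (s : R) 1 (fun s => y - s) (-1).
  by apply: is_derive_eq (derD (derC y s) (derN (derI s))) _; rewrite add0r.
pose f s := k (y - s); pose f1 s := - k1 (y - s).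
have df s : is_derive (s : R) 1 f (f1 s).
  by have := @der_comp R k (fun s : R => y - s) s _ _ (d1 (y - s)) (dm s); rewrite mulrN1.
have df1 s : is_derive (s : R) 1 f1 (k2 (y - s)).
  have := derN (@der_comp R k1 (fun s : R => y - s) s _ _ (d2 (y - s)) (dm s)).
  by rewrite mulrN1 opprK.
pose C := K * expR (a * 1) * expR (a * `|y|).
have C0 : 0 <= C by rewrite !mulr_ge0 ?expR_ge0.
have H2 s : 0 <= s <= e -> `|k2 (y - s)| <= C.
  move=> /andP[s0 se]; apply: le_trans (kK _) _; rewrite /C -mulrA ler_wpM2l//.
  rewrite -expRD ler_expR -mulrDr ler_wpM2l// [leRHS]addrC; apply: le_trans (ler_normB _ _) _.
  by rewrite lerD2l ger0_norm// (le_trans se).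
have H1 s : 0 <= s <= e -> `|f1 s - f1 0| <= C * e.
  move=> /andP[s0 se]; apply: (@le_trans _ _ (C * (s - 0))).
    have D := @derivative_bound R f1 (fun s : R => k2 (y - s)) 0 s C s0 (fun (v : R) _ => df1 v).
    by apply: D => v /andP[v0 vs]; apply: H2; rewrite v0 (le_trans vs).
  by rewrite subr0 ler_wpM2l.
pose F s := f s - s * f1 0.
have dF s : is_derive (s : R) 1 F (f1 s - f1 0).
  apply: is_derive_eq (derD (df s) (derN (derM (derI s) (derC (f1 0) s)))) _.
  by rewrite mulr0 addr0 mul1r.
have := @derivative_bound R F (fun s : R => f1 s - f1 0) 0 e (C * e) e0 (fun (v : R) _ => dF v) H1.
rewrite /F /f /f1 mul0r !subr0 mulrN opprK.
rewrite (_ : k (y - e) + e * k1 y - k y = k (y - e) - k y + e * k1 y); last by ring.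
by move/le_trans; apply; rewrite /C le_eqVlt; apply/orP; left; apply/eqP; ring.
Qed.

Lemma small_eq0 (X C : R) : 0 <= C -> (forall e : R, 0 < e <= 1 -> `|e * X| <= C * e ^+ 2) -> X = 0.
Proof.
move=> C0 H; apply/eqP; rewrite -normr_le0; apply/ler_addgt0Pl => s s0; rewrite addr0.
have C1 : 0 < C + 1 by rewrite ltr_wpDl.
pose e := Num.min 1 (s / (C + 1)).
have e0 : 0 < e by rewrite /e lt_min ltr01 divr_gt0.
have e1 : e <= 1 by rewrite /e ge_min lexx.
have := H e; rewrite e0 e1 => /(_ isT); rewrite normrM (gtr0_norm e0) expr2 mulrCA ler_pM2l// => h.
apply: le_trans h _; apply: (@le_trans _ _ ((C + 1) * e)).
  by rewrite ler_wpM2r ?(ltW e0)// lerDl.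
by rewrite mulrC -ler_pdivlMr// /e ge_min lexx orbT.
Qed.

(** Integration by parts without boundary terms: translation invariance moves a shift by e from h to
    the kernel, both sides are expanded to first order with remainder O(e^2), and [small_eq0]
    compares the coefficients of e. *)
Lemma coord_pairing_pd k k1 k2 K h j : continuous k -> continuous k1 ->
  (forall y : R, is_derive (y : R) 1 k (k1 y)) -> (forall y : R, is_derive (y : R) 1 k1 (k2 y)) ->
  kbound k K -> kbound k1 K -> kbound k2 K -> SR h ->
  coord_pairing k (pd j h) = - ((E j) 0 0 * coord_pairing k1 h).
Proof.
move=> ck ck1 d1 d2 b0 b1 b2 Sh; have [sh Hh] := Sh.
have ch := SR_continuous Sh; have cp := SR_continuous (SR_pds [:: j] Sh).
have [B0 hB0] := Hh [::] M; have [B1 hB1] := Hh [:: j] M; have [B2 hB2] := Hh [:: j; j] M.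
have K0 := kbound_ge0 b0.
set dl := (E j) 0 0; have dlE : dl = 0 \/ dl = 1.
  by rewrite /dl mxE; case: (_ && _); [right|left].
have dl01 : 0 <= dl <= 1 by case: dlE => ->; rewrite ?lexx ?ler01.
pose E1 : R := expR (a * 1) * (1 + 1) ^+ M.
pose C := (B2 * E1 * K + B0 * (K * expR (a * 1))) * @gmass R n.
have B00 := wbound_ge0 hB0; have B20 := wbound_ge0 hB2.
have E10 : 0 <= E1 by rewrite /E1 mulr_ge0 ?expR_ge0.
have C0 : 0 <= C.
  apply: mulr_ge0; last exact: gmass_ge0.
  apply: addr_ge0; first exact: mulr_ge0 (mulr_ge0 B20 E10) K0.
  exact: mulr_ge0 B00 (mulr_ge0 K0 (expR_ge0 _)).
suff: coord_pairing k (pd j h) + dl * coord_pairing k1 h = 0 by move/eqP; rewrite addr_eq0 => /eqP.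
apply: (small_eq0 C0) => e /andP[e0 e1].
have e01 : 0 <= e <= 1 by rewrite (ltW e0).
have ed : 0 <= e * dl <= 1.
  by case/andP: dl01 => l0 l1; rewrite mulr_ge0 ?(ltW e0)//= -[leRHS]mulr1 ler_pM// ltW.
have W1 := shift_remainder Sh hB2 e01; rewrite -/E1 in W1.
have cs : continuous (fun x => h (x + e *: E j)) by apply: (gcomp_cont ch); cont.
have W3 : wbound M (fun x => h (x + e *: E j)) (B0 * (expR (a * enorm (- (e *: E j))) * (1 + enorm (- (e *: E j))) ^+ M)).
  by have := wbound_shift (- (e *: E j)) hB0; under eq_fun do rewrite opprK.
have cr : continuous (fun x => h (x + e *: E j) - h x - e * pd j h x) by cont.
have X1 := coord_pairing_bound ck b0 cr W1.
have cd : continuous (fun x => h (x + e *: E j) - h x) by cont.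
have Wd := wboundD W3 (wboundN hB0).
have Y1 : coord_pairing k (fun x => h (x + e *: E j) - h x - e * pd j h x) =
    coord_pairing k (fun x => h (x + e *: E j)) - coord_pairing k h - e * coord_pairing k (pd j h).
  transitivity (- e * coord_pairing k (pd j h) + coord_pairing k (fun x => h (x + e *: E j) - h x)).
    rewrite -(coord_pairing_lin (- e) ck b0 cp hB1 cd Wd); apply: (f_equal (coord_pairing k)); apply/funext => x /=; ring.
  have -> : coord_pairing k (fun x => h (x + e *: E j) - h x) = -1 * coord_pairing k h + coord_pairing k (fun x => h (x + e *: E j)).
    rewrite -(coord_pairing_lin (-1) ck b0 ch hB0 cs W3); apply: (f_equal (coord_pairing k)); apply/funext => x; ring.
  ring.
have Y2 : coord_pairing k (fun x => h (x + e *: E j)) = coord_pairing (fun z : R => k (z - e * dl)) h.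
  have := coord_pairing_shift (- (e *: E j)) ck b0 ch hB0; rewrite !mxE.
  rewrite (_ : (fun x => h (x - - (e *: E j))) = (fun x => h (x + e *: E j))).
    by move->; rewrite /dl mxE.
  by apply/funext => x; rewrite opprK.
have b3 := kernel_remainder d1 d2 b2 ed.
have ck' : continuous (fun z : R => k (z - e * dl)) by apply: (comp_cont ck); cont.
have bk' : kbound (fun z : R => k (z - e * dl)) _ := kbound_shift (- (e * dl)) b0.
have cr' : continuous (fun y : R => k (y - e * dl) - k y + e * dl * k1 y) by cont.
have X2 := coord_pairing_bound cr' b3 ch hB0.
have Y3 : coord_pairing (fun y : R => k (y - e * dl) - k y + e * dl * k1 y) h =
   coord_pairing (fun z : R => k (z - e * dl)) h - coord_pairing k h + e * dl * coord_pairing k1 h.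
  have ckd : continuous (fun y : R => -1 * k y + k (y - e * dl)) by cont.
  have bkd : kbound (fun y : R => -1 * k y + k (y - e * dl)) (K + K * expR (a * `|- (e * dl)|)).
    move=> y; apply: le_trans (ler_normD _ _) _; rewrite mulrDl; apply: lerD; last exact: bk'.
    by rewrite mulN1r normrN.
  transitivity (e * dl * coord_pairing k1 h + coord_pairing (fun y : R => -1 * k y + k (y - e * dl)) h).
    rewrite -(coord_pairing_kernel_lin (e * dl) ck1 b1 ckd bkd ch hB0); apply: (f_equal (coord_pairing^~ h)); apply/funext => x; ring.
  rewrite (coord_pairing_kernel_lin (-1) ck b0 ck' bk' ch hB0); ring.
rewrite Y1 Y2 in X1; rewrite Y3 in X2.
have -> : e * (coord_pairing k (pd j h) + dl * coord_pairing k1 h) =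
   (coord_pairing (fun z : R => k (z - e * dl)) h - coord_pairing k h + e * dl * coord_pairing k1 h) -
   (coord_pairing (fun z : R => k (z - e * dl)) h - coord_pairing k h - e * coord_pairing k (pd j h)) by ring.
apply: le_trans (ler_normB _ _) _; rewrite addrC.
apply: le_trans (lerD X1 X2) _.
have ee : (e * dl) ^+ 2 <= e ^+ 2.
  by rewrite exprMn ler_piMr ?sqr_ge0//; case: dlE => ->; rewrite ?expr1n ?expr0n.
apply: (@le_trans _ _ (B2 * E1 * e ^+ 2 * K * @gmass R n + B0 * (K * expR (a * 1) * e ^+ 2) * @gmass R n)).
  rewrite lerD2l ler_wpM2r ?gmass_ge0// ler_wpM2l// ler_wpM2l//.
  by rewrite mulr_ge0 ?expR_ge0.
by rewrite /C le_eqVlt; apply/orP; left; apply/eqP; ring.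
Qed.

Lemma coord_pairing_lap k k1 k2 k3 K h : continuous k -> continuous k1 -> continuous k2 ->
  (forall y : R, is_derive (y : R) 1 k (k1 y)) -> (forall y : R, is_derive (y : R) 1 k1 (k2 y)) ->
  (forall y : R, is_derive (y : R) 1 k2 (k3 y)) ->
  kbound k K -> kbound k1 K -> kbound k2 K -> kbound k3 K -> SR h ->
  coord_pairing k (lap h) = coord_pairing k2 h.
Proof.
move=> ck ck1 ck2 d1 d2 d3 b0 b1 b2 b3 Sh.
have H (s : seq 'I_d) : SR (fun x => \sum_(j <- s) pd j (pd j h) x) /\
    coord_pairing k (fun x => \sum_(j <- s) pd j (pd j h) x) = \sum_(j <- s) coord_pairing k (pd j (pd j h)).
  elim: s => [|j s [S1 IH]].
    rewrite big_nil (_ : (fun x => _) = (fun=> 0)); last by apply/funext => x; rewrite big_nil.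
    split; first exact: SR0.
    have c0 : continuous (fun _ : V => 0 : R) by cont.
    have W0 : wbound M (fun=> 0) 0 by move=> x; rewrite normr0 mulr0.
    by have := coord_pairing_bound ck b0 c0 W0; rewrite !mul0r normr_le0 => /eqP.
  have Sj : SR (pd j (pd j h)) := SR_pds [:: j; j] Sh.
  rewrite (_ : (fun x => _) = (fun x => 1 * pd j (pd j h) x + \sum_(j <- s) pd j (pd j h) x)); last first.
    by apply/funext => x; rewrite big_cons mul1r.
  split; first exact: SR_lin.
  have [_ Hj] := Sj; have [Bj hBj] := Hj [::] M.
  have [_ Hs] := S1; have [Bs hBs] := Hs [::] M.
  rewrite (coord_pairing_lin 1 ck b0 (SR_continuous Sj) hBj (SR_continuous S1) hBs) IH big_cons.
  by rewrite mul1r.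
have [_ HE] := H (index_enum _); rewrite /lap HE (bigD1 0)//= big1 => [|j j0].
  have S0 : SR (pd 0 h) := SR_pds [:: 0] Sh.
  rewrite addr0 (coord_pairing_pd 0 ck ck1 d1 d2 b0 b1 b2 S0) (coord_pairing_pd 0 ck1 ck2 d2 d3 b1 b2 b3 Sh).
  by rewrite mxE !eqxx !mul1r opprK.
have Sj : SR (pd j h) := SR_pds [:: j] Sh.
rewrite (coord_pairing_pd j ck ck1 d1 d2 b0 b1 b2 Sj) mxE (_ : (0 == j) = false) ?andbF ?mul0r ?oppr0//.
by rewrite eq_sym; apply/negbTE.
Qed.

End kernel_functionals.

Section gint_positive.
Context {R : realType} {n : nat}.
Local Notation mR := (measurableTypeR R).
Local Notation d := n.+2.
Local Notation V := 'rV[R]_d.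
Local Notation leb := (@lebesgue_tuple R d).

Lemma gint_gt0 (g : V -> R) B : continuous g -> decay g B -> (forall x, 0 <= g x) ->
  0 < g 0 -> 0 < gint g.
Proof.
move=> cg dg g0 gp.
have g2 : 0 < g 0 / 2 by lra.
have := iffLR (@cvgrPdist_le R R _ (nbhs (0 : V)) (nbhs_filter (0 : V)) _ _) (cg 0) _ g2.
move=> /nbhs_ballP[e /= e0 He].
pose b := e / 2; have b0 : 0 < b by rewrite /b; lra.
pose Q : set (d.-tuple mR) := tcube 0 b.
have mQ : measurable Q by exact: measurable_tcube.
have LQ : leb Q = (b ^+ d)%:E by rewrite lebesgue_tcube ?subr0// ltW.
have mg : measurable_fun setT (fun v : d.-tuple mR => (g (rv v))%:E).
  by apply/measurable_EFinP; exact: (measurable_rv cg).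
have H (v : d.-tuple mR) : Q v -> g 0 / 2 <= g (rv v).
  move=> Qv; have B1 : ball (0 : V) e (rv v).
    rewrite -ball_normE /ball_ /= sub0r normrN; apply: (@le_lt_trans _ _ b); last by rewrite /b; lra.
    rewrite /Num.norm/= mx_normrE; apply: bigmax_le => [|[i j] _ /=]; first exact: ltW.
    by rewrite mxE; have /andP[h1 h2] := Qv j; rewrite ger0_norm.
  have := He _ B1 => /=; rewrite ler_norml => /andP[_ h].
  by move: h; move: (g 0) (g (rv v)) => p q h; lra.
rewrite -lte_fin (gint_fin cg dg).
apply: (@lt_le_trans _ _ (\int[leb]_(v in Q) (g 0 / 2)%:E)%E).
  by rewrite integral_cst// [X in (_ * X)%E]LQ -EFinM lte_fin mulr_gt0// exprn_gt0.
apply: (@le_trans _ _ (\int[leb]_(v in Q) (g (rv v))%:E)%E).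
  apply: ge0_le_integral => //.
  - by move=> v _; rewrite lee_fin ltW.
  - exact: measurable_funTS.
by apply: ge0_subset_integral => // v _; rewrite lee_fin.
Qed.

End gint_positive.

Section exponential_kernels.
Context {R : realType} {n : nat} (a : R).
Hypothesis a0 : 0 <= a.
Local Notation d := n.+2.
Local Notation V := 'rV[R]_d.
Local Notation SR := (@SR R n a).
Local Notation coord_pairing := (@coord_pairing R n).
Local Notation kbound := (@kbound R a).

(** Real combinations of the real part (p, q) = (1, 0) and the imaginary part (0, 1) of exp (i (xi +
    i eta) y). The family is closed under derivatives and translations, which thus act linearly on
    (p, q). *)
Definition expwave (xi eta p q y : R) : R := expR (- eta * y) * (p * cos (xi * y) + q * sin (xi * y)).

Lemma expwave_der xi eta p q (y : R) :
  is_derive (y : R) 1 (expwave xi eta p q) (expwave xi eta (xi * q - eta * p) (- (xi * p) - eta * q) y).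
Proof.
have dm (c : R) : is_derive (y : R) 1 (fun y : R => c * y) c.
  by apply: is_derive_eq (derM (derC c y) (derI y)) _; rewrite mul0r add0r mulr1.
have D1 := @der_comp R expR (fun y : R => - eta * y) y _ _ (is_derive_expR _) (dm _).
have D2 := @der_comp R cos (fun y : R => xi * y) y _ _ (is_derive_cos _) (dm _).
have D3 := @der_comp R sin (fun y : R => xi * y) y _ _ (is_derive_sin _) (dm _).
apply: is_derive_eq (derM D1 (derD (derM (derC p y) D2) (derM (derC q y) D3))) _.
by rewrite /expwave; ring.
Qed.

Lemma expwave_cont xi eta p q : continuous (expwave xi eta p q).
Proof. by move=> y; exact: der_continuous (expwave_der xi eta p q y). Qed.

Lemma expwave_bound xi eta p q : `|eta| <= a -> kbound (expwave xi eta p q) (`|p| + `|q|).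
Proof.
move=> ea y; rewrite /expwave normrM mulrC; apply: ler_pM => //.
  apply: le_trans (ler_normD _ _) _; rewrite !normrM.
  apply: lerD; rewrite -[leRHS]mulr1 ler_wpM2l// ler_norml.
    by rewrite cos_geN1 cos_le1.
  by rewrite sin_geN1 sin_le1.
rewrite ger0_norm ?expR_ge0// ler_expR; apply: le_trans (ler_norm _) _.
by rewrite normrM normrN ler_wpM2r.
Qed.

(** The real part of phi_(u + is)(e1); [avg_expsin] is the imaginary part. *)
Definition avg_expcos (u s : R) : R := avg (fun w : V => expR (- s * w 0 0) * cos (u * w 0 0)).
Definition avg_expsin (u s : R) : R := avg (fun w : V => expR (- s * w 0 0) * sin (u * w 0 0)).

Lemma expwave_avg xi eta p q t (z : R) : avg (fun w : V => expwave xi eta p q (z + t * w 0 0)) =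
  expwave xi eta (p * avg_expcos (xi * t) (eta * t) + q * avg_expsin (xi * t) (eta * t))
    (q * avg_expcos (xi * t) (eta * t) - p * avg_expsin (xi * t) (eta * t)) z.
Proof.
set e := expR (- eta * z); set c := cos (xi * z); set s := sin (xi * z).
pose C w : R := expR (- (eta * t) * (w : V) 0 0) * cos (xi * t * w 0 0).
pose S w : R := expR (- (eta * t) * (w : V) 0 0) * sin (xi * t * w 0 0).
have cC : continuous C by rewrite /C; cont.
have cS : continuous S by rewrite /S; cont.
have E : (fun w : V => expwave xi eta p q (z + t * w 0 0)) =
    (fun w => (e * (c * p + s * q)) * C w + (e * (c * q - s * p)) * S w).
  apply/funext => w; rewrite /expwave /C /S.
  have -> : - eta * (z + t * w 0 0) = - eta * z + - (eta * t) * w 0 0 by ring.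
  have -> : xi * (z + t * w 0 0) = xi * z + xi * t * w 0 0 by ring.
  rewrite expRD cosD sinD -/e -/c -/s.
  move: (expR _) (cos (_ * _ * _)) (sin (_ * _ * _)) => A B D; ring.
have c1 : continuous (fun w => (e * (c * p + s * q)) * C w) by apply: mul_cont => //; cont.
have c2 : continuous (fun w => (e * (c * q - s * p)) * S w) by apply: mul_cont => //; cont.
rewrite E (avgD c1 c2) (avgZ _ cC) (avgZ _ cS) -/(avg_expcos _ _) -/(avg_expsin _ _) /expwave -/e -/c -/s.
by move: (avg_expcos _ _) (avg_expsin _ _) => A B; ring.
Qed.

Lemma coord_pairing_expwave xi eta p q h : `|eta| <= a -> SR h ->
  coord_pairing (expwave xi eta p q) h = p * coord_pairing (expwave xi eta 1 0) h + q * coord_pairing (expwave xi eta 0 1) h.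
Proof.
move=> ea Sh; have ch := SR_continuous Sh; have [_ Hh] := Sh; have [B hB] := Hh [::] (2 * d)%N.
have k0 := expwave_bound xi 0 0 ea.
have -> : expwave xi eta p q = (fun y : R => p * expwave xi eta 1 0 y + (fun y : R => q * expwave xi eta 0 1 y + expwave xi eta 0 0 y) y).
  by apply/funext => y; rewrite /expwave; ring.
have c1 : continuous (fun y : R => q * expwave xi eta 0 1 y + expwave xi eta 0 0 y).
  by apply: add_cont; [apply: mul_cont; [cont|]|]; exact: expwave_cont.
have b1 : kbound (fun y : R => q * expwave xi eta 0 1 y + expwave xi eta 0 0 y) (`|0 : R| + `|q|).
  have -> : (fun y : R => q * expwave xi eta 0 1 y + expwave xi eta 0 0 y) = expwave xi eta 0 q.
    by apply/funext => y; rewrite /expwave; ring.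
  exact: (expwave_bound xi 0 q ea).
rewrite (coord_pairing_kernel_lin a0 p (@expwave_cont _ _ _ _) (expwave_bound xi 1 0 ea) c1 b1 ch hB).
rewrite (coord_pairing_kernel_lin a0 q (@expwave_cont _ _ _ _) (expwave_bound xi 0 1 ea) (@expwave_cont _ _ _ _) k0 ch hB).
have -> : coord_pairing (expwave xi eta 0 0) h = 0.
  have := coord_pairing_bound a0 (@expwave_cont xi eta 0 0) k0 ch hB.
  by rewrite normr0 addr0 mulr0 mul0r normr_le0 => /eqP.
by rewrite addr0.
Qed.

Lemma coord_pairing_expwave_Mr xi eta p q t h : `|eta| <= a -> SR h -> coord_pairing (expwave xi eta p q) (Mr t h) =
  (p * avg_expcos (xi * t) (eta * t) + q * avg_expsin (xi * t) (eta * t)) * coord_pairing (expwave xi eta 1 0) h +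
  (q * avg_expcos (xi * t) (eta * t) - p * avg_expsin (xi * t) (eta * t)) * coord_pairing (expwave xi eta 0 1) h.
Proof.
move=> ea Sh; rewrite (coord_pairing_Mr a0 t (@expwave_cont _ _ _ _) (expwave_bound xi p q ea) Sh).
rewrite -(coord_pairing_expwave _ _ _ ea Sh); apply: (f_equal (fun k => coord_pairing k h)); apply/funext => z.
exact: expwave_avg.
Qed.

Lemma coord_pairing_expwave_lap xi eta p q h : `|eta| <= a -> SR h -> coord_pairing (expwave xi eta p q) (lap h) =
  ((eta ^+ 2 - xi ^+ 2) * p - 2 * xi * eta * q) * coord_pairing (expwave xi eta 1 0) h +
  (2 * xi * eta * p + (eta ^+ 2 - xi ^+ 2) * q) * coord_pairing (expwave xi eta 0 1) h.
Proof.
move=> ea Sh.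
pose D p q := xi * q - eta * p; pose D' p q := - (xi * p) - eta * q.
pose p1 := D p q; pose q1 := D' p q; pose p2 := D p1 q1; pose q2 := D' p1 q1.
pose p3 := D p2 q2; pose q3 := D' p2 q2.
pose K := `|p| + `|q| + (`|p1| + `|q1|) + (`|p2| + `|q2|) + (`|p3| + `|q3|).
have bd pp qq : `|pp| + `|qq| <= K -> kbound (expwave xi eta pp qq) K.
  move=> hK y; apply: le_trans (expwave_bound xi pp qq ea y) _.
  by rewrite ler_wpM2r// expR_ge0.
have Q (x1 x2 x3 x4 : R) : 0 <= x1 -> 0 <= x2 -> 0 <= x3 -> 0 <= x4 ->
    [/\ x1 <= x1 + x2 + x3 + x4, x2 <= x1 + x2 + x3 + x4, x3 <= x1 + x2 + x3 + x4 &
        x4 <= x1 + x2 + x3 + x4] by move=> *; split; lra.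
have N (v w : R) : 0 <= `|v| + `|w| by apply: addr_ge0.
have [/bd b0 /bd b1 /bd b2 /bd b3] := Q _ _ _ _ (N p q) (N p1 q1) (N p2 q2) (N p3 q3).
rewrite (coord_pairing_lap a0 (@expwave_cont _ _ _ _) (@expwave_cont _ _ _ _) (@expwave_cont _ _ _ _)
  (expwave_der xi eta p q) (expwave_der xi eta p1 q1) (expwave_der xi eta p2 q2) b0 b1 b2 b3 Sh).
rewrite (coord_pairing_expwave _ _ _ ea Sh) /p2 /q2 /p1 /q1 /D /D'.
by move: (coord_pairing _ _) (coord_pairing _ _) => A1 A2; ring.
Qed.

Lemma coord_pairing_expwave_bound xi eta p q h B : `|eta| <= a -> continuous h -> @wbound R n a (2 * d) h B ->
  `|coord_pairing (expwave xi eta p q) h| <= B * (`|p| + `|q|) * @gmass R n.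
Proof. by move=> ea ch hB; exact: (coord_pairing_bound a0 (@expwave_cont _ _ _ _) (expwave_bound xi p q ea) ch hB). Qed.

End exponential_kernels.

(** * Gaussian test functions *)

Section gaussian_class.
Context {R : realType} {n : nat} (a : R).
Hypothesis a0 : 0 <= a.
Local Notation d := n.+2.
Local Notation V := 'rV[R]_d.
Local Notation E j := (delta_mx 0 j : V).
Local Notation SR := (@SR R n a).
Local Notation wt := (@expweight R n a).
Local Notation wbound := (@wbound R n a).
Variables (xi eta : R).

(** A class closed under partial derivatives, so that membership in [SR] reduces to one decay
    estimate. It contains the test functions on which plane waves do not vanish. *)
Inductive gaussian : (V -> R) -> Prop :=
| gaussian_base p q : gaussian (fun x => expR (- dot x x) * expwave xi eta p q (x 0 0))
| gaussian_coord j u : gaussian u -> gaussian (fun x => x 0 j * u x)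
| gaussian_lin c u v : gaussian u -> gaussian v -> gaussian (fun x => c * u x + v x).

Lemma line_is_derive (u : V -> R) (x w : V) D :
  is_derive (0 : R) 1 (fun h : R => u (x + h *: w)) D -> is_derive x w u D.
Proof.
move=> H; have Q : (fun h : R => h^-1 *: (u (x + (h *: (1 : R) + 0) *: w) - u (x + (0 : R) *: w))) =
    (fun h : R => h^-1 *: (u (h *: w + x) - u x)).
  apply/funext => h; congr (_ *: (u _ - u _)); last by rewrite scale0r addr0.
  by rewrite addr0 /GRing.scale/= mulr1 addrC.
by case: H; rewrite /derivable /derive /= Q => H1 H2; split.
Qed.

Lemma gaussian_cont u : gaussian u -> continuous u.
Proof.
elim=> [p q|j v _ cv|c v w _ cv _ cw].
- apply: mul_cont; first by cont.
  by apply: (comp_cont (@expwave_cont R xi eta p q)); cont.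
- by apply: mul_cont => //; cont.
- by apply: add_cont => //; apply: mul_cont => //; cont.
Qed.

Lemma gaussian_pd u j : gaussian u -> exists v, gaussian v /\ forall x, is_derive x (E j) u (v x).
Proof.
move=> gu; suff [v [gv Hv]] : exists v, gaussian v /\
    forall x, is_derive (0 : R) 1 (fun h : R => u (x + h *: E j)) (v x).
  by exists v; split=> // x; exact: line_is_derive.
elim: gu => [p q|i v gv [v' [gv' Hv]]|c v w gv [v' [gv' Hv]] gw [w' [gw' Hw]]].
- pose dl : R := (E j) 0 0.
  pose p' := dl * (xi * q - eta * p); pose q' := dl * (- (xi * p) - eta * q).
  exists (fun x : V => - 2 * (x 0 j * (expR (- dot x x) * expwave xi eta p q (x 0 0))) +
     expR (- dot x x) * expwave xi eta p' q' (x 0 0)).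
  split; first by apply: gaussian_lin; [apply: gaussian_coord|]; exact: gaussian_base.
  move=> x.
  have dx i : dot (x + i *: E j) (x + i *: E j) = dot x x + 2 * x 0 j * i + i ^+ 2.
    rewrite dotDl !dotDr !dotZl !dotZr dot_EE [dot x (E j)]dotC dot_E; ring.
  have D0 : is_derive (0 : R) 1 (fun h : R => - (dot x x + 2 * x 0 j * h + h ^+ 2)) (- (2 * x 0 j)).
    apply: is_derive_eq (derN (derD (derD (derC (dot x x) 0) (derM (derC (2 * x 0 j) 0) (derI 0))) (derX 1 (derI 0)))) _.
    by ring.
  have D1 := @der_comp R expR (fun h : R => - (dot x x + 2 * x 0 j * h + h ^+ 2)) 0 _ _ (is_derive_expR _) D0.
  have D2 : is_derive (0 : R) 1 (fun h : R => x 0 0 + h * dl) dl.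
    by apply: is_derive_eq (derD (derC (x 0 0) 0) (derM (derI 0) (derC dl 0))) _; ring.
  have D3 := @der_comp R (expwave xi eta p q) (fun h : R => x 0 0 + h * dl) 0 _ _ (expwave_der xi eta p q _) D2.
  have FE : (fun h : R => expR (- dot (x + h *: E j) (x + h *: E j)) * expwave xi eta p q ((x + h *: E j) 0 0)) =
     (fun h : R => expR (- (dot x x + 2 * x 0 j * h + h ^+ 2)) * expwave xi eta p q (x 0 0 + h * dl)).
    by apply/funext => h; rewrite dx !mxE /dl !mxE.
  rewrite FE; apply: is_derive_eq (derM D1 D3) _.
  rewrite !mulr0 mul0r expr0n /= !addr0 /expwave /p' /q'.
  by move: (sin _) (cos _) (expR _) (expR (- dot _ _)) => A B C D; ring.
- exists (fun x : V => (E j) 0 i * v x + x 0 i * v' x); split.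
    by apply: gaussian_lin => //; exact: gaussian_coord.
  move=> x; have D2 : is_derive (0 : R) 1 (fun h : R => x 0 i + h * (E j) 0 i) ((E j) 0 i).
    by apply: is_derive_eq (derD (derC (x 0 i) 0) (derM (derI 0) (derC ((E j) 0 i) 0))) _; ring.
  have FE : (fun h : R => (x + h *: E j) 0 i * v (x + h *: E j)) =
     (fun h : R => (x 0 i + h * (E j) 0 i) * v (x + h *: E j)).
    by apply/funext => h; congr (_ * _); rewrite !mxE.
  rewrite FE; apply: is_derive_eq (derM D2 (Hv x)) _.
  by rewrite scale0r addr0 mul0r addr0.
- exists (fun x : V => c * v' x + w' x); split; first exact: gaussian_lin.
  move=> x; apply: is_derive_eq (derD (derM (derC c 0) (Hv x)) (Hw x)) _.
  by rewrite mul0r add0r.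
Qed.

Lemma gaussian_pds u s : gaussian u -> gaussian (pds s u).
Proof.
move=> gu; elim: s => [//|j s gs] /=; have [v [gv Hv]] := gaussian_pd j gs.
suff -> : pd j (pds s u) = v by [].
by apply/funext => x; rewrite /pd; have [_ ->] := Hv x.
Qed.

Lemma gaussian_wbound u m : gaussian u -> exists B, wbound m u B.
Proof.
move=> gu; elim: gu m => [p q|j v gv IH|c v w gv IHv gw IHw] m.
(* c collects all exponential rates, as (1 + r)^m <= exp (m r); then c r - r^2 <= c^2. *)
- pose K := `|p| + `|q|; pose c := a + m%:R + `|eta|.
  exists (K * expR (c ^+ 2)) => x.
  have kb := @expwave_bound R `|eta| xi eta p q (lexx _) (x 0 0).
  set r := enorm x; have r0 : 0 <= r by exact: enorm_ge0.
  have c0 : 0 <= c by rewrite !addr_ge0.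
  have h1 : (1 + r) ^+ m <= expR (m%:R * r).
    rewrite expRM_natl lerXn2r ?nnegrE ?expR_ge0 ?addr_ge0//; exact: expR_ge1Dx.
  have h2 : `|expwave xi eta p q (x 0 0)| <= K * expR (`|eta| * r).
    apply: le_trans kb _; rewrite ler_wpM2l ?addr_ge0// ler_expR ler_wpM2l//.
    exact: normr_coord.
  rewrite /expweight -/r normrM (ger0_norm (expR_ge0 _)) -enorm_sqr -/r.
  apply: (@le_trans _ _ ((expR (a * r) * expR (m%:R * r)) * (expR (- r ^+ 2) * (K * expR (`|eta| * r))))).
    apply: ler_pM; rewrite ?mulr_ge0 ?expR_ge0// ?exprn_ge0 ?addr_ge0//.
      by rewrite ler_wpM2l ?expR_ge0.
    by rewrite ler_wpM2l ?expR_ge0.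
  rewrite [leLHS](_ : _ = K * (expR (a * r) * expR (m%:R * r) * expR (- r ^+ 2) * expR (`|eta| * r))); last by ring.
  rewrite -!expRD ler_wpM2l ?addr_ge0// ler_expR.
  rewrite (_ : _ + _ = c * r - r ^+ 2); last by rewrite /c; ring.
  by move: (c) => b; have := sqr_ge0 (b - r); have := sqr_ge0 b; nra.
- have [B hB] := IH m.+1; exists B => x; apply: le_trans (hB x).
  rewrite /expweight exprS normrM.
  have h : `|x 0 j| <= 1 + enorm x by apply: le_trans (normr_coord x j) _; rewrite lerDr.
  rewrite [leRHS](_ : _ = (1 + enorm x) * (expR (a * enorm x) * (1 + enorm x) ^+ m * `|v x|)); last by ring.
  rewrite [leLHS](_ : _ = `|x 0 j| * (expR (a * enorm x) * (1 + enorm x) ^+ m * `|v x|)); last by ring.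
  by rewrite ler_wpM2r// !mulr_ge0 ?expR_ge0// exprn_ge0// addr_ge0 ?enorm_ge0.
- have [B hB] := IHv m; have [C hC] := IHw m; exists (`|c| * B + C).
  exact: wboundD (wboundZ c hB) hC.
Qed.

Lemma gaussian_SR u : gaussian u -> SR u.
Proof.
move=> gu; split=> [s|s m]; last by apply: gaussian_wbound; exact: gaussian_pds.
split; first by apply: gaussian_cont; exact: gaussian_pds.
by move=> x j; have [v [_ Hv]] := gaussian_pd j (gaussian_pds s gu); have [] := Hv x.
Qed.

End gaussian_class.

(** The test function carries the opposite rate -eta, so that the exponentials cancel and the
    integrand is a Gaussian times a squared cosine. *)
Lemma coord_pairing_expwave_gt0 {R : realType} n (a xi eta : R) : 0 <= a -> `|eta| <= a ->
  exists2 h, @SR R n a h & 0 < coord_pairing (expwave xi eta 1 0) h.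
Proof.
move=> a0 ea; pose h (x : 'rV[R]_n.+2) := expR (- dot x x) * expwave xi (- eta) 1 0 (x 0 0).
have Sh : SR a h by apply: (@gaussian_SR R n a a0 xi (- eta)); exact: gaussian_base.
exists h => //; have ch := SR_continuous Sh; have [_ Hh] := Sh.
have [B hB] := Hh [::] (2 * n.+2)%N.
have hE (x : 'rV[R]_n.+2) : h x * expwave xi eta 1 0 (x 0 0) = expR (- dot x x) * cos (xi * x 0 0) ^+ 2.
  rewrite /h /expwave opprK; have := expRxMexpNx_1 (eta * x 0 0).
  rewrite !mulNr; move: (sin _) (cos _) (expR _) (expR (- (eta * _))) (expR (eta * _)) => F D C B' A AB.
  transitivity (A * B' * (C * D ^+ 2)); first by ring.
  by rewrite AB mul1r.
apply: (gint_gt0 (coord_pairing_cont (@expwave_cont R xi eta 1 0) ch) (coord_pairing_decay a0 (expwave_bound xi 1 0 ea) hB)).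
  by move=> x; rewrite hE mulr_ge0 ?expR_ge0// sqr_ge0.
by rewrite hE mxE mulr0 cos0 expr1n mulr1 expR_gt0.
Qed.

Section real_calculus.
Context {R : realType}.

Lemma increment_le (f f1 : R -> R) (x h C : R) : (forall s : R, is_derive (s : R) 1 f (f1 s)) ->
  (forall s : R, `|s - x| <= `|h| -> `|f1 s| <= C) -> `|f (x + h) - f x| <= C * `|h|.
Proof.
move=> df H; have [h0|h0] := leP 0 h.
  have xh : x <= x + h by lra.
  have D := @derivative_bound R f f1 x (x + h) C xh (fun v _ => df v).
  rewrite (_ : x + h - x = h) in D; last by ring.
  rewrite (ger0_norm h0); apply: D => v /andP[v1 v2]; apply: H.
  by rewrite !ger0_norm//; lra.
have xh : x + h <= x by lra.
have D := @derivative_bound R f f1 (x + h) x C xh (fun v _ => df v).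
rewrite (_ : x - (x + h) = - h) in D; last by ring.
rewrite (ltr0_norm h0) distrC; apply: D => v /andP[v1 v2]; apply: H.
by rewrite (ltr0_norm h0) ler0_norm; lra.
Qed.

Lemma taylor2 (f f1 f2 : R -> R) (x h C : R) : (forall s : R, is_derive (s : R) 1 f (f1 s)) ->
  (forall s : R, is_derive (s : R) 1 f1 (f2 s)) ->
  (forall s : R, `|s - x| <= `|h| -> `|f2 s| <= C) -> `|f (x + h) - f x - h * f1 x| <= C * h ^+ 2.
Proof.
move=> d1 d2 H; pose g (s : R) := f s - s * f1 x.
have dg (s : R) : is_derive (s : R) 1 g (f1 s - f1 x).
  apply: is_derive_eq (derD (d1 s) (derN (derM (derI s) (derC (f1 x) s)))) _.
  by rewrite mulr0 addr0 mul1r.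
have := @increment_le g (fun s => f1 s - f1 x) x h (C * `|h|) dg.
rewrite /g (_ : f (x + h) - (x + h) * f1 x - (f x - x * f1 x) = f (x + h) - f x - h * f1 x); last by ring.
rewrite -mulrA -expr2 real_normK ?num_real//; apply=> s sx.
have C0 : 0 <= C by apply: le_trans (normr_ge0 (f2 s)) (H s sx).
have := @increment_le f1 f2 x (s - x) C d2; rewrite (_ : x + (s - x) = s) => [I|]; last by ring.
apply: le_trans (I _) _; last by rewrite ler_wpM2l.
by move=> v vx; apply: H; exact: le_trans sx.
Qed.

Lemma ivt (f : R -> R) (x y v : R) : continuous f -> x <= y -> f x <= v <= f y ->
  exists2 c, x <= c <= y & f c = v.
Proof.
move=> cf xy /andP[h1 h2]; have [|c] := @IVT R f x y v xy (continuous_subspaceT cf).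
  by rewrite ge_min le_max h1 h2 orbT.
by rewrite in_itv/=; exists c.
Qed.

Lemma first_crossing (f : R -> R) (b v : R) : continuous f -> 0 <= b -> v < f 0 -> f b <= v ->
  exists z, [/\ 0 < z, f z = v & forall s, 0 <= s < z -> v < f s].
Proof.
move=> cf b0 f0 fb; pose S : set R := [set s | 0 <= s /\ f s <= v].
have Sb : S b by [].
have lS : has_inf S by split; [exists b|exists 0 => s []].
have z0 : 0 <= inf S by apply: lb_le_inf; [exists b|move=> s []].
have lt s : 0 <= s < inf S -> v < f s.
  move=> /andP[s0 sz]; rewrite ltNge; apply/negP => fs.
  by have := ge_inf (lS.2) (conj s0 fs : S s); rewrite leNgt sz.
have cvS (e : R) : 0 < e -> exists2 D, 0 < D & forall s, `|inf S - s| < D -> `|f (inf S) - f s| <= e.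
  move=> e0; have := iffLR (@cvgrPdist_le R R _ (nbhs (inf S : R)) (nbhs_filter _) _ _) (cf (inf S)) _ e0.
  move=> /nbhs_ballP[D /= D0 HD]; exists D => // s hs; exact: (HD s hs).
have le1 : f (inf S) <= v.
  apply/ler_addgt0Pl => e e0; have [D D0 HD] := cvS e e0.
  have [s [s0 fs] sS] := inf_adherent D0 lS.
  have sz : inf S <= s by apply: ge_inf => //; exact: lS.2.
  have := HD s; rewrite ler0_norm ?subr_le0// opprB => /(_ _)H.
  have : `|f (inf S) - f s| <= e by apply: H; lra.
  rewrite ler_norml => /andP[_ h]; lra.
have zp : 0 < inf S.
  rewrite lt_neqAle z0 andbT; apply/eqP => E.
  by move: le1; rewrite -E leNgt f0.
exists (inf S); split => //; apply/eqP; rewrite eq_le le1 /=.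
apply/ler_addgt0Pl => e e0; have [D D0 HD] := cvS e e0.
pose s := Num.max 0 (inf S - D / 2).
have s0 : 0 <= s by rewrite /s le_max lexx.
have sz : s < inf S by rewrite /s gt_max zp /=; lra.
have sD : inf S - D / 2 <= s by rewrite /s le_max lexx orbT.
have vs : v < f s by apply: lt; rewrite s0.
have := HD s; rewrite ger0_norm ?subr_ge0 ?(ltW sz)// => /(_ _)H.
have : `|f (inf S) - f s| <= e by apply: H; lra.
rewrite ler_norml => /andP[h _]; lra.
Qed.

Lemma normM_le (x y p q : R) : `|x| <= p -> `|y| <= q -> `|x * y| <= p * q.
Proof. by move=> h1 h2; rewrite normrM ler_pM. Qed.

Lemma normD_le (x y p q : R) : `|x| <= p -> `|y| <= q -> `|x + y| <= p + q.
Proof. by move=> h1 h2; apply: le_trans (ler_normD _ _) (lerD h1 h2). Qed.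

Lemma norm_cos (x : R) : `|cos x| <= 1.
Proof. by rewrite ler_norml cos_geN1 cos_le1. Qed.

Lemma norm_sin (x : R) : `|sin x| <= 1.
Proof. by rewrite ler_norml sin_geN1 sin_le1. Qed.

End real_calculus.

(** * The spherical Bessel function *)

Section spherical_bessel.
Context {R : realType} {n : nat}.
Local Notation d := n.+2.
Local Notation V := 'rV[R]_d.
Local Notation E j := (delta_mx 0 j : V).
Local Notation avg_expcos := (@avg_expcos R n).
Local Notation avg_expsin := (@avg_expsin R n).

Lemma coord_le1 (w : V) i : dot w w = 1 -> `|w 0 i| <= 1.
Proof. by move=> /enorm_unit <-; exact: normr_coord. Qed.

Lemma avg_der (F F1 F2 : R -> V -> R) (C r : R) :
  (forall w (s : R), is_derive (s : R) 1 (F^~ w) (F1 s w)) ->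
  (forall w (s : R), is_derive (s : R) 1 (F1^~ w) (F2 s w)) ->
  (forall w (s : R), dot w w = 1 -> `|F2 s w| <= C) ->
  (forall s : R, continuous (F s)) -> (forall s : R, continuous (F1 s)) ->
  is_derive (r : R) 1 (fun s => avg (F s)) (avg (F1 r)).
Proof.
move=> d1 d2 HC c0 c1; apply: (@is_derive_quad R R _ r 1 _ C 1) => // h _.
rewrite /GRing.scale/= mulr1.
have ch : continuous (fun w => h * F1 r w) by apply: mul_cont => //; cont.
have cs : continuous (fun w => F (r + h) w - F r w) by apply: add_cont => //; apply: opp_cont.
have -> : avg (F (r + h)) - avg (F r) - h * avg (F1 r) = avg (fun w => F (r + h) w - F r w - h * F1 r w).
  by rewrite (avgB cs ch) (avgB (c0 _) (c0 _)) (avgZ _ (c1 _)).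
apply: avg_bound; last by apply: add_cont => //; apply: opp_cont.
move=> w w1; apply: (@taylor2 R (F^~ w) (F1^~ w) (F2^~ w)) => // s _; exact: HC.
Qed.

(** phi_r(e1) for real r, a normalised Bessel function; [bes1] and [bes2] are its derivatives, taken
    under the integral. *)
Definition bes (r : R) : R := avg (fun w : V => cos (r * w 0 0)).
Definition bes1 (r : R) : R := avg (fun w : V => - (w 0 0 * sin (r * w 0 0))).
Definition bes2 (r : R) : R := avg (fun w : V => - (w 0 0 ^+ 2 * cos (r * w 0 0))).

Lemma der_mulr (c s : R) : is_derive (s : R) 1 (fun s : R => s * c) c.
Proof. by apply: is_derive_eq (derM (derI s) (derC c s)) _; rewrite mulr0 addr0 mul1r. Qed.

Lemma der_cosM (c s : R) : is_derive (s : R) 1 (fun s : R => cos (s * c)) (- (c * sin (s * c))).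
Proof.
have D := @der_comp R cos (fun s : R => s * c) s _ _ (is_derive_cos _) (der_mulr c s).
by apply: is_derive_eq D _; rewrite mulNr mulrC.
Qed.

Lemma der_sinM (c s : R) : is_derive (s : R) 1 (fun s : R => sin (s * c)) (c * cos (s * c)).
Proof.
have D := @der_comp R sin (fun s : R => s * c) s _ _ (is_derive_sin _) (der_mulr c s).
by apply: is_derive_eq D _; rewrite mulrC.
Qed.

Lemma bes_der (r : R) : is_derive (r : R) 1 bes (bes1 r).
Proof.
apply: (@avg_der (fun r w => cos (r * w 0 0)) (fun r w => - (w 0 0 * sin (r * w 0 0)))
  (fun r w => - (w 0 0 * (w 0 0 * cos (r * w 0 0)))) (1 * (1 * 1))).
- by move=> w s; exact: der_cosM.
- move=> w s; apply: is_derive_eq (derN (derM (derC (w 0 0) s) (der_sinM (w 0 0) s))) _.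
  by rewrite mul0r add0r.
- move=> w s w1; rewrite normrN; apply: normM_le; first exact: coord_le1.
  apply: normM_le; [exact: coord_le1|exact: norm_cos].
- by move=> s; cont.
- by move=> s; cont.
Qed.

Lemma bes1_der (r : R) : is_derive (r : R) 1 bes1 (bes2 r).
Proof.
apply: (@avg_der (fun r w => - (w 0 0 * sin (r * w 0 0))) (fun r w => - (w 0 0 ^+ 2 * cos (r * w 0 0)))
  (fun r w => w 0 0 ^+ 2 * (w 0 0 * sin (r * w 0 0))) (1 * 1 * (1 * 1))).
- move=> w s; apply: is_derive_eq (derN (derM (derC (w 0 0) s) (der_sinM (w 0 0) s))) _.
  by rewrite mul0r add0r mulrA.
- move=> w s; apply: is_derive_eq (derN (derM (derC (w 0 0 ^+ 2) s) (der_cosM (w 0 0) s))) _.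
  by rewrite mul0r add0r mulrN opprK.
- move=> w s w1; apply: normM_le.
    by rewrite expr2; apply: normM_le; exact: coord_le1.
  apply: normM_le; [exact: coord_le1|exact: norm_sin].
- by move=> s; cont.
- by move=> s; cont.
Qed.

(* The second derivative at [th = 0] of the constant function
   [th |-> avg (cos (r (cos th w_0 + sin th w_j)))]. *)
Lemma avg_rotated_cos (r : R) (j : 'I_d) : 0 < r -> j != 0 ->
  r * avg (fun w : V => w 0 j ^+ 2 * cos (r * w 0 0)) = - bes1 r.
Proof.
move=> r0 j0.
pose A (th : R) (w : V) : R := cos th * w 0 0 + sin th * w 0 j.
pose B (th : R) (w : V) : R := - sin th * w 0 0 + cos th * w 0 j.
have dA w (s : R) : is_derive (s : R) 1 (A^~ w) (B s w).
  apply: is_derive_eq (derD (derM (is_derive_cos s) (derC (w 0 0) s)) (derM (is_derive_sin s) (derC (w 0 j) s))) _.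
  by rewrite !mulr0 !addr0.
have dB w (s : R) : is_derive (s : R) 1 (B^~ w) (- A s w).
  apply: is_derive_eq (derD (derM (derN (is_derive_sin s)) (derC (w 0 0) s)) (derM (is_derive_cos s) (derC (w 0 j) s))) _.
  by rewrite !mulr0 !addr0 /A; ring.
have cA s : continuous (A s) by rewrite /A; cont.
have cB s : continuous (B s) by rewrite /B; cont.
have crA s : continuous (fun w => r * A s w) by apply: mul_cont => //; cont.
have dc w (s : R) : is_derive (s : R) 1 (fun s => cos (r * A s w)) (- sin (r * A s w) * (r * B s w)).
  have D0 : is_derive (s : R) 1 (fun s => r * A s w) (r * B s w).
    by apply: is_derive_eq (derM (derC r s) (dA w s)) _; rewrite mul0r add0r.
  exact: (@der_comp R cos (fun s => r * A s w) s _ _ (is_derive_cos _) D0).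
have dsn w (s : R) : is_derive (s : R) 1 (fun s => sin (r * A s w)) (cos (r * A s w) * (r * B s w)).
  have D0 : is_derive (s : R) 1 (fun s => r * A s w) (r * B s w).
    by apply: is_derive_eq (derM (derC r s) (dA w s)) _; rewrite mul0r add0r.
  exact: (@der_comp R sin (fun s => r * A s w) s _ _ (is_derive_sin _) D0).
pose F (s : R) (w : V) := cos (r * A s w).
pose F1 (s : R) (w : V) := - sin (r * A s w) * (r * B s w).
pose F2 (s : R) (w : V) := - (cos (r * A s w) * (r * B s w)) * (r * B s w) + - sin (r * A s w) * (r * - A s w).
pose F3 (s : R) (w : V) := sin (r * A s w) * (r * B s w) * (r * B s w) * (r * B s w) +
   3 * (cos (r * A s w) * (r * A s w) * (r * B s w)) + sin (r * A s w) * (r * B s w).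
have dF1 w (s : R) : is_derive (s : R) 1 (F1^~ w) (F2 s w).
  have D := derM (derN (dsn w s)) (derM (derC r s) (dB w s)).
  by apply: is_derive_eq D _; rewrite /F2; ring.
have dF2 w (s : R) : is_derive (s : R) 1 (F2^~ w) (F3 s w).
  have D1 := derM (derC r s) (dB w s); have D2 := derM (derC r s) (derN (dA w s)).
  have D := derD (derM (derN (derM (dc w s) D1)) D1) (derM (derN (dsn w s)) D2).
  by apply: is_derive_eq D _; rewrite /F3; ring.
have bc (p q : R) (w : V) i : `|p| <= 1 -> `|q| <= 1 -> dot w w = 1 ->
    `|p * w 0 0 + q * w 0 i| <= 1 * 1 + 1 * 1.
  by move=> hp hq w1; apply: normD_le; apply: normM_le => //; exact: coord_le1.
pose K : R := r * (1 * 1 + 1 * 1).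
have bA w (s : R) : dot w w = 1 -> `|r * A s w| <= K.
  by move=> w1; apply: normM_le; [rewrite gtr0_norm|exact: (bc _ _ w j (norm_cos s) (norm_sin s))].
have bB w (s : R) : dot w w = 1 -> `|r * B s w| <= K.
  move=> w1; apply: normM_le; [by rewrite gtr0_norm|apply: bc => //; last exact: norm_cos].
  by rewrite normrN; exact: norm_sin.
have H2 w (s : R) : dot w w = 1 -> `|F2 s w| <= 1 * K * K + 1 * K.
  move=> w1; apply: normD_le; apply: normM_le; rewrite ?normrN; try exact: bB; try exact: norm_sin.
    by apply: normM_le; [exact: norm_cos|exact: bB].
  by rewrite mulrN normrN; exact: bA.
have H3 w (s : R) : dot w w = 1 -> `|F3 s w| <= 1 * K * K * K + 3 * (1 * K * K) + 1 * K.
  move=> w1; have S := norm_sin (r * A s w); have C := norm_cos (r * A s w).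
  have bb := bB w s w1; have ba := bA w s w1.
  have n3 : `|3 : R| <= 3 by rewrite ger0_norm.
  apply: normD_le; last exact: normM_le.
  apply: normD_le; first by do 3 apply: normM_le => //.
  by apply: normM_le => //; do 2 apply: normM_le => //.
have cF s : continuous (F s) by apply: (comp_cont (@continuous_cos R)); exact: crA.
have csA s : continuous (fun w => sin (r * A s w)) by apply: (comp_cont (@continuous_sin R)); exact: crA.
have crB s : continuous (fun w => r * B s w) by apply: mul_cont => //; cont.
have cF1 s : continuous (F1 s) by apply: mul_cont; [apply: opp_cont|]; [exact: csA|exact: crB].
have cF2 s : continuous (F2 s).
  apply: add_cont.
    by apply: mul_cont; [apply: opp_cont; apply: mul_cont; [exact: cF|]|]; exact: crB.
  apply: mul_cont; first by apply: opp_cont; exact: csA.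
  by apply: mul_cont; [cont|apply: opp_cont; exact: cA].
have AF s : is_derive (s : R) 1 (fun s => avg (F s)) (avg (F1 s)) := avg_der s dc dF1 H2 cF cF1.
have AF1 s : is_derive (s : R) 1 (fun s => avg (F1 s)) (avg (F2 s)) := avg_der s dF1 dF2 H3 cF1 cF2.
have Fc : (fun s => avg (F s)) = (fun=> bes r).
  apply/funext => s.
  have w1 : dot (cos s *: E 0 + sin s *: E j) (cos s *: E 0 + sin s *: E j) = 1.
    rewrite dotDl !dotDr !dotZl !dotZr !dot_EE !dot_E !mxE (negbTE j0) [0 == j]eq_sym (negbTE j0).
    by rewrite !andbF !mulr0 addr0 add0r !mulr1 -!expr2 cos2Dsin2.
  have ck : continuous (fun x : R => cos (r * x)) by cont.
  rewrite /bes -(avg_dot w1 ck); apply: (f_equal avg); apply/funext => w.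
  by rewrite /F /A dotDl !dotZl !dot_E.
have F1c : (fun s => avg (F1 s)) = (fun=> 0).
  apply/funext => s; have [_ <-] := AF s; rewrite Fc.
  by have [_ ->] := derC (bes r) s.
have F20 : avg (F2 0) = 0.
  have [_ <-] := AF1 0; rewrite F1c.
  by have [_ ->] := derC (0 : R) 0.
have c1 : continuous (fun w : V => w 0 j ^+ 2 * cos (r * w 0 0)) by cont.
have c2 : continuous (fun w : V => - (w 0 0 * sin (r * w 0 0))) by cont.
have c3 : continuous (fun w : V => - r ^+ 2 * (w 0 j ^+ 2 * cos (r * w 0 0))) by cont.
have c4 : continuous (fun w : V => - r * - (w 0 0 * sin (r * w 0 0))) by cont.
have E2 : F2 0 = (fun w : V => - r ^+ 2 * (w 0 j ^+ 2 * cos (r * w 0 0)) + - r * - (w 0 0 * sin (r * w 0 0))).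
  apply/funext => w; rewrite /F2 /A /B cos0 sin0 oppr0 !mul0r !mul1r add0r addr0.
  by move: (cos _) (sin _) => p q; ring.
move: F20; rewrite E2 (avgD c3 c4) (avgZ _ c1) (avgZ _ c2) -/(bes1 r).
move: (avg _) (bes1 r) => p q h.
have h' : r * (r * p + q) = 0 by rewrite -[RHS]oppr0 -h; ring.
by move/eqP: h'; rewrite mulf_eq0 gt_eqF//= addr_eq0 => /eqP.
Qed.

(** The radial Helmholtz equation in dimension d, with d - 1 = n + 1: the factor 1 - w_0^2 is the
    sum of the other squared coordinates, and [avg_rotated_cos] evaluates each of them. *)
Lemma bes_ode (r : R) : 0 < r -> r * (bes2 r + bes r) = - (n.+1%:R * bes1 r).
Proof.
move=> r0; have c0 : continuous (fun w : V => - (w 0 0 ^+ 2 * cos (r * w 0 0))) by cont.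
have c1 : continuous (fun w : V => cos (r * w 0 0)) by cont.
have cj (j : 'I_n.+1) : continuous (fun w : V => w 0 (lift ord0 j) ^+ 2 * cos (r * w 0 0)) by cont.
rewrite /bes2 /bes -(avgD c0 c1).
have -> : avg (fun w : V => - (w 0 0 ^+ 2 * cos (r * w 0 0)) + cos (r * w 0 0)) =
    avg (fun w : V => \sum_(j < n.+1) w 0 (lift ord0 j) ^+ 2 * cos (r * w 0 0)).
  apply: avg_eq; [|by apply: add_cont|by apply: sum_cont => j; exact: cj].
  move=> w; rewrite /dot big_ord_recl -mulr_suml -expr2 => w1.
  have -> : \sum_(j < n.+1) w 0 (lift ord0 j) ^+ 2 = 1 - w 0 0 ^+ 2.
    by rewrite -w1 addrC addKr; apply: eq_bigr => j _; rewrite expr2.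
  ring.
rewrite (avg_sum _ cj) mulr_sumr -[RHS]mulrN -sum_cst; apply: eq_bigr => j _.
exact: avg_rotated_cos.
Qed.

Lemma bes_cont : continuous bes.
Proof. by move=> r; exact: der_continuous (bes_der r). Qed.

Lemma bes0 : bes 0 = 1.
Proof.
rewrite /bes -[RHS](@avg_cst R n 1); apply: (f_equal avg); apply/funext => w.
by rewrite mul0r cos0.
Qed.

(** The equation in divergence form: the flux has derivative r^(n+1) bes r, so it increases as long
    as [bes] is positive, which makes [bes] strictly decreasing there. *)
Definition flux (r : R) : R := r ^+ n.+1 * - bes1 r.

Lemma flux_der (r : R) : 0 <= r -> is_derive (r : R) 1 flux (r ^+ n.+1 * bes r).
Proof.
move=> r0; apply: is_derive_eq (derM (derX n (derI r)) (derN (bes1_der r))) _.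
rewrite mulr1; move: r0; rewrite le_eqVlt => /predU1P[<-|r0].
  rewrite !expr0n /= !mul0r addr0; case: n => [|m].
    by rewrite /bes1 (_ : (fun w => _) = (fun=> 0)) ?avg_cst ?oppr0 ?mulr0//;
      apply/funext => w; rewrite mul0r sin0 mulr0 oppr0.
  by rewrite (_ : (m.+1 == 0%N)%:R = 0 :> R)// mulr0 mul0r.
have O := bes_ode r0; rewrite exprS.
move: (bes2 r) (bes1 r) (bes r) (r ^+ n) (n.+1%:R : R) O => p q b X N O.
have -> : r * X * b = X * (r * (p + b)) - r * X * p by ring.
rewrite O; ring.
Qed.

Lemma flux_gt0 (r : R) : 0 < r -> (forall s, 0 <= s <= r -> 0 < bes s) -> 0 < flux r.
Proof.
move=> r0 H; have f0 : flux 0 = 0 by rewrite /flux expr0n /= mul0r.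
have r2 : 0 <= r / 2 by lra.
have h1 : flux 0 <= flux (r / 2).
  apply: (derivative_ge0 (df := fun s => s ^+ n.+1 * bes s) r2).
    by move=> s /andP[s0 _]; exact: flux_der.
  move=> s /andP[s0 s1]; apply: mulr_ge0; first exact: exprn_ge0.
  by apply: ltW; apply: H; rewrite s0 /=; lra.
rewrite f0 in h1; apply: le_lt_trans h1 _.
apply: (derivative_gt0 (df := fun s => s ^+ n.+1 * bes s)); first by lra.
  by move=> s /andP[s0 _]; apply: flux_der; lra.
move=> s /andP[s0 s1]; apply: mulr_gt0; first by apply: exprn_gt0; lra.
by apply: H; apply/andP; split; lra.
Qed.

Lemma flux_le (r s : R) : 0 < r <= s -> (forall x, 0 <= x <= s -> 0 < bes x) -> flux r <= flux s.
Proof.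
move=> /andP[r0 rs] H.
apply: (derivative_ge0 (df := fun s => s ^+ n.+1 * bes s) rs).
  by move=> x /andP[x0 _]; apply: flux_der; lra.
move=> x /andP[x0 x1]; apply: mulr_ge0; first by apply: exprn_ge0; lra.
by apply: ltW; apply: H; apply/andP; split; lra.
Qed.

(* On a zero-free interval [v = bes1 / bes] satisfies
   [v' = -1 - (n+1)/r v - v^2 <= - (1 + v^2) / 2], so [atan v] drops too fast. *)
Lemma bes_zero (r : R) : n.+1%:R <= r -> exists z, r <= z <= r + (2 * pi + 1) /\ bes z = 0.
Proof.
move=> nr; have N0 : 0 < n.+1%:R :> R by rewrite ltr0n.
have pp : 0 < pi :> R by exact: pi_gt0.
apply: contrapT => H.
have b0 z : r <= z <= r + (2 * pi + 1) -> bes z != 0.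
  by move=> hz; apply/eqP => bz; apply: H; exists z.
pose v (s : R) := bes1 s * (bes s)^-1.
pose dv (s : R) := bes2 s * (bes s)^-1 + bes1 s * (- bes1 s / bes s ^+ 2).
have Dv s : r <= s <= r + (2 * pi + 1) -> is_derive (s : R) 1 v (dv s).
  by move=> hs; exact: derM (bes1_der s) (derV (b0 s hs) (bes_der s)).
have dvle s : r <= s <= r + (2 * pi + 1) -> dv s <= - ((1 + v s ^+ 2) / 2).
  move=> hs; have hb := b0 s hs; have /andP[s1 s2] := hs.
  have s0 : 0 < s by apply: lt_le_trans N0 (le_trans nr s1).
  have sn : s != 0 by exact: lt0r_neq0.
  have O := bes_ode s0; have Ns : n.+1%:R <= s by apply: le_trans nr s1.
  pose N : R := n.+1%:R / s.
  have N1 : 0 <= N <= 1 by rewrite /N divr_ge0 ?(ltW N0) ?(ltW s0)//= ler_pdivrMr// mul1r.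
  have E : dv s = - 1 - N * v s - v s ^+ 2.
    rewrite /dv /v /N; have -> : bes2 s = - bes s - n.+1%:R * bes1 s / s.
      apply: (mulfI (lt0r_neq0 s0)); rewrite -[LHS](addrK (s * bes s)) -mulrDr O.
      by field.
    by field; rewrite sn hb.
  rewrite {}E; move: (v s) N1 => x /andP[]; move: N => M h1 h2.
  have h3 : - (M * x) <= `|x|.
    apply: le_trans (ler_norm _) _; rewrite normrN normrM ger0_norm//.
    by rewrite -[leRHS]mul1r ler_wpM2r.
  have h4 : `|x| ^+ 2 = x ^+ 2 by rewrite real_normK ?num_real.
  have := sqr_ge0 (`|x| - 1); rewrite sqrrB h4 expr1n mulr1 => h5.
  by move: (x ^+ 2) h5 => y h5; lra.
(* W is nondecreasing, although atan varies by less than pi while s / 2 grows by pi + 1/2 over the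
   interval: hence its length 2 pi + 1. The hypothesis n + 1 <= r is what bounds the coefficient (n
   + 1) / s by 1. *)
pose W (s : R) := - atan (v s) - s * 2^-1.
have DW s : r <= s <= r + (2 * pi + 1) ->
    is_derive (s : R) 1 W (- ((1 + v s ^+ 2)^-1 * dv s) - 2^-1).
  move=> hs; have D := @der_comp R atan v s _ _ (is_derive1_atan _) (Dv s hs).
  exact: derD (derN D) (derN (der_mulr 2^-1 s)).
have le : r <= r + (2 * pi + 1) by lra.
have := derivative_ge0 le DW; rewrite /W => /(_ _)G.
have : - atan (v r) - r * 2^-1 <= - atan (v (r + (2 * pi + 1))) - (r + (2 * pi + 1)) * 2^-1.
  apply: G => s hs; have h := dvle s hs.
  have q0 : 0 < 1 + v s ^+ 2 by rewrite ltr_pwDl// sqr_ge0.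
  rewrite subr_ge0 -mulrN -ler_pdivrMl ?invr_gt0// invrK.
  by move: h; move: (1 + _) (dv s) => x y h; lra.
have := atan_ltpi2 (v r); have := atan_gtNpi2 (v (r + (2 * pi + 1))).
by move: (atan _) (atan _) => x y; lra.
Qed.

Lemma bes_two_zeros : exists z1 z2, [/\ 0 < z1, z1 < z2, bes z1 = 0 & bes z2 = 0].
Proof.
have N0 : 0 < n.+1%:R :> R by rewrite ltr0n.
have pp : 0 < pi :> R by exact: pi_gt0.
have [z1 [/andP[h1 h2] b1]] := @bes_zero n.+1%:R (lexx _).
have [|z2 [/andP[h3 h4] b2]] := @bes_zero (n.+1%:R + (2 * pi + 2)); first by lra.
by exists z1, z2; split => //; lra.
Qed.

End spherical_bessel.

(** * Nonreal points of prescribed modulus *)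

Section level_points.
Context {R : realType} {n : nat}.
Local Notation d := n.+2.
Local Notation V := 'rV[R]_d.
Local Notation E j := (delta_mx 0 j : V).
Local Notation avg_expcos := (@avg_expcos R n).
Local Notation avg_expsin := (@avg_expsin R n).
Local Notation bes := (@bes R n).
Local Notation bes1 := (@bes1 R n).
Local Notation flux := (@flux R n).

Lemma avg_reflect (k : R -> R) : continuous k ->
  avg (fun w : V => k (- w 0 0)) = avg (fun w : V => k (w 0 0)).
Proof.
move=> ck; have w1 : dot (- E 0) (- E 0) = 1.
  by rewrite -scaleN1r dotZl dotZr dot_EE mulr1 mulrNN mulr1.
rewrite -(avg_dot w1 ck); apply: (f_equal avg); apply/funext => w.
by rewrite -[- E 0]scaleN1r dotZl dot_E mulN1r.
Qed.

Lemma dist_le (x y v : R) : `|x - y| <= x - v -> v <= y.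
Proof. by rewrite ler_norml => /andP[_]; rewrite lerD2l lerN2. Qed.

Lemma dist_ge (x y v : R) : `|x - y| <= v - x -> y <= v.
Proof. by rewrite distrC => /(le_trans (ler_norm _)); rewrite lerD2r. Qed.

Lemma small_slope (x y e c s : R) : 0 < s -> 0 < c -> 0 < e -> s <= c / (2 * e) ->
  x - s * y <= e * s ^+ 2 -> y <= - c -> x < 0.
Proof.
move=> s0 c0 e0; rewrite ler_pdivlMr ?mulr_gt0// => sc h yc.
have h1 : s * y <= s * - c by rewrite ler_pM2l.
have h2 : s * (s * (2 * e)) <= s * c by rewrite ler_pM2l.
have h3 : 0 < s * c by rewrite mulr_gt0.
move: h h1 h2 h3; rewrite (_ : s * (s * (2 * e)) = 2 * (e * s ^+ 2)); last by ring.
by rewrite mulrN; move: (s * y) (e * s ^+ 2) (s * c) => p q r; clear; lra.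
Qed.

Lemma avg_expcos_s0 (u : R) : avg_expcos u 0 = bes u.
Proof. by apply: (f_equal avg); apply/funext => w; rewrite oppr0 mul0r expR0 mul1r. Qed.

Lemma avg_expsin_s0 (u : R) : avg_expsin u 0 = 0.
Proof.
have ck : continuous (fun x : R => sin (u * x)) by cont.
have cN : continuous (fun w : V => sin (u * w 0 0)) by cont.
have E1 : avg_expsin u 0 = avg (fun w : V => sin (u * w 0 0)).
  by apply: (f_equal avg); apply/funext => w; rewrite oppr0 mul0r expR0 mul1r.
have : avg (fun w : V => - sin (u * w 0 0)) = avg (fun w : V => sin (u * w 0 0)).
  rewrite -(avg_reflect ck); apply: (f_equal avg); apply/funext => w.
  by rewrite mulrN sinN.
rewrite (avgN cN) -E1; move: (avg_expsin u 0) => x; lra.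
Qed.

Lemma avg_expcos_u0 (s : R) : avg_expcos 0 s = Phi n s 1.
Proof.
have ck : continuous (fun x : R => expR (s * 1 * x)) by cont.
rewrite Phi_avg -(avg_reflect ck); apply: (f_equal avg); apply/funext => w.
by rewrite mul0r cos0 !mulr1 mulrN mulNr.
Qed.

Lemma avg_expsin_u0 (s : R) : avg_expsin 0 s = 0.
Proof.
rewrite -[RHS](@avg_cst R n 0); apply: (f_equal avg); apply/funext => w.
by rewrite mul0r sin0 mulr0.
Qed.

(** The squared modulus of phi_(u + is)(e1). *)
Definition modsq (u s : R) : R := avg_expcos u s ^+ 2 + avg_expsin u s ^+ 2.

Lemma modsq_cont_u (s : R) : continuous (fun u : R => modsq u s).
Proof.
have c1 : continuous (fun u => avg_expcos u s).
  apply: (@avg_continuous R n R (fun (u : R) (w : V) => expR (- s * w 0 0) * cos (u * w 0 0))).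
  by cont.
have c2 : continuous (fun u => avg_expsin u s).
  apply: (@avg_continuous R n R (fun (u : R) (w : V) => expR (- s * w 0 0) * sin (u * w 0 0))).
  by cont.
by apply: add_cont; exact: exp_cont.
Qed.

Lemma modsq_cont_s (u : R) : continuous (fun s : R => modsq u s).
Proof.
have c1 : continuous (fun s => avg_expcos u s).
  apply: (@avg_continuous R n R (fun (s : R) (w : V) => expR (- s * w 0 0) * cos (u * w 0 0))).
  by cont.
have c2 : continuous (fun s => avg_expsin u s).
  apply: (@avg_continuous R n R (fun (s : R) (w : V) => expR (- s * w 0 0) * sin (u * w 0 0))).
  by cont.
by apply: add_cont; exact: exp_cont.
Qed.

Lemma modsq_s0 (u : R) : modsq u 0 = bes u ^+ 2.
Proof. by rewrite /modsq avg_expcos_s0 avg_expsin_s0 expr0n addr0. Qed.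

Lemma modsq_u0 (s : R) : modsq 0 s = Phi n s 1 ^+ 2.
Proof. by rewrite /modsq avg_expcos_u0 avg_expsin_u0 expr0n addr0. Qed.

(** Pairing w with -w replaces the integrand by -sinh (s x) sin (u x) with x = w_0, which is
    nonpositive on [-1, 1] as u < pi. Clamping by [cl] extends this sign to the whole line, as
    [avg_cap_gt0] requires. *)
Lemma avg_expsin_lt0 (u s : R) : 0 < s -> 0 < u < pi -> avg_expsin u s < 0.
Proof.
move=> s0 /andP[u0 up].
pose cl (x : R) : R := Num.max (-1) (Num.min 1 x).
have ccl : continuous cl by apply: max_cont; [cont|apply: min_cont; cont].
pose k (x : R) : R := expR (- s * x) * sin (u * x).
have ck : continuous k by rewrite /k; cont.
pose K (x : R) : R := (expR (s * x) - expR (- s * x)) * sin (u * x).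
have cK : continuous K by rewrite /K; cont.
have K0 (x : R) : 0 <= x <= 1 -> 0 <= K x.
  move=> /andP[x0 x1]; apply: mulr_ge0; first by rewrite subr_ge0 ler_expR ler_wpM2r//; lra.
  apply: sin_ge0_pi; rewrite mulr_ge0 ?(ltW u0)//=; apply: le_trans (ltW up).
  by rewrite -[leRHS]mulr1 ler_wpM2l// ltW.
have Kx (x : R) : -1 <= x <= 1 -> 0 <= K x.
  move=> /andP[x0 x1]; have [h|h] := leP 0 x; first by apply: K0; rewrite h.
  have -> : K x = K (- x) by rewrite /K !mulrN !mulNr opprK sinN; ring.
  by apply: K0; apply/andP; split; lra.
have cl1 (x : R) : -1 <= cl x <= 1.
  by rewrite /cl le_max lexx /= ge_max ge_min lexx andbT; lra.
have clE (x : R) : -1 <= x <= 1 -> cl x = x.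
  by move=> /andP[x0 x1]; rewrite /cl min_r// max_r.
have P : 0 < avg (fun w : V => K (cl (w 0 0))).
  apply: (@avg_cap_gt0 R n (fun x => K (cl x))).
  - exact: (comp_cont cK ccl).
  - by move=> x; apply: Kx; exact: cl1.
  - rewrite clE; last by apply/andP; split; lra.
    rewrite /K !mulr1 mulr_gt0//; first by rewrite subr_gt0 ltr_expR; lra.
    by apply: sin_gt0_pi; rewrite u0.
have cKw : continuous (fun w : V => K (w 0 0)) by apply: (comp_cont cK); cont.
have cw : continuous (fun w : V => w 0 0) by cont.
have E1 : avg (fun w : V => K (cl (w 0 0))) = avg (fun w : V => K (w 0 0)).
  apply: avg_eq => //; last by apply: (comp_cont cK); apply: (comp_cont ccl).
  by move=> w /(@coord_le1 R n w 0); rewrite ler_norml => h; rewrite clE.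
rewrite E1 in P.
have ckw : continuous (fun w : V => k (w 0 0)) by apply: (comp_cont ck); cont.
have ckN : continuous (fun w : V => - k (- w 0 0)).
  by apply: opp_cont; apply: (comp_cont ck); apply: opp_cont; cont.
have ckN' : continuous (fun w : V => k (- w 0 0)) by apply: (comp_cont ck); apply: opp_cont; cont.
have E2 : (fun w : V => K (w 0 0)) = (fun w : V => - k (- w 0 0) - k (w 0 0)).
  apply/funext => w; rewrite /K /k !mulrN !mulNr opprK sinN; ring.
move: P; rewrite E2 (avgB ckN ckw) (avgN ckN') (avg_reflect ck) -/(avg_expsin u s).
by move: (avg_expsin u s) => x; lra.
Qed.

(** [bes1 u] is the derivative of the imaginary part at s = 0, so for small s the imaginary part
    inherits the sign of [bes1]. *)
Lemma avg_expsin_taylor (u s : R) : 0 <= s <= 1 -> `|avg_expsin u s - s * bes1 u| <= expR 1 * s ^+ 2.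
Proof.
move=> /andP[s0 s1].
have c1 : continuous (fun w : V => sin (u * w 0 0)) by cont.
have c2 : continuous (fun w : V => - (w 0 0 * sin (u * w 0 0))) by cont.
have c3 : continuous (fun w : V => s * - (w 0 0 * sin (u * w 0 0))) by cont.
have c4 : continuous (fun w : V => expR (- s * w 0 0) * sin (u * w 0 0)) by cont.
have c5 : continuous (fun w : V => sin (u * w 0 0) + s * - (w 0 0 * sin (u * w 0 0))) by cont.
have E0 : avg (fun w : V => sin (u * w 0 0)) = 0.
  rewrite -[RHS](avg_expsin_s0 u); apply: (f_equal avg); apply/funext => w.
  by rewrite oppr0 mul0r expR0 mul1r.
have -> : avg_expsin u s - s * bes1 u = avg (fun w : V => expR (- s * w 0 0) * sin (u * w 0 0) -
    (sin (u * w 0 0) + s * - (w 0 0 * sin (u * w 0 0)))).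
  by rewrite (avgB c4 c5) (avgD c1 c3) (avgZ _ c2) E0 add0r.
apply: avg_bound; last by apply: add_cont => //; apply: opp_cont.
move=> w w1; have hw := @coord_le1 R n w 0 w1; move: (w 0 0) hw => x hx.
have T := @taylor2 R expR expR expR 0 (- s * x) (expR 1) (@is_derive_expR R) (@is_derive_expR R).
have sx : `|- s * x| <= 1.
  by rewrite normrM normrN (ger0_norm s0) -[leRHS]mulr1 ler_pM.
have /T : forall y : R, `|y - 0| <= `|- s * x| -> `|expR y| <= expR 1.
  move=> y; rewrite subr0 => hy; rewrite ger0_norm ?expR_ge0// ler_expR.
  by apply: le_trans (ler_norm _) (le_trans hy sx).
rewrite add0r expR0 mulr1 => T1.
have -> : expR (- s * x) * sin (u * x) - (sin (u * x) + s * - (x * sin (u * x))) =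
   (expR (- s * x) - 1 - - s * x) * sin (u * x) by ring.
rewrite -[leRHS]mulr1; apply: normM_le; last exact: norm_sin.
apply: le_trans T1 _; rewrite ler_wpM2l ?expR_ge0// exprMn sqrrN ler_piMr ?sqr_ge0//.
by rewrite -real_normK ?num_real// expr_le1.
Qed.

Lemma bes_gt0_near0 : exists2 u0 : R, 0 < u0 & forall u, 0 <= u <= u0 -> 0 < bes u.
Proof.
have := iffLR (@cvgrPdist_le R R _ (nbhs (0 : R)) (nbhs_filter _) _ _) (@bes_cont R n 0) 2^-1 _.
have h2 : 0 < 2^-1 :> R by lra.
move=> /(_ h2)/nbhs_ballP[D /= D0 HD]; exists (D / 2); first by lra.
move=> u /andP[u0 uD]; have : `|bes 0 - bes u| <= 2^-1.
  by apply: HD; rewrite /ball /= sub0r normrN ger0_norm//; lra.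
by rewrite bes0 ler_norml => /andP[_]; lra.
Qed.

(** For al >= 1, u is fixed small and s varies: at s = 0 the modulus is bes u < 1, at s = tau it is
    still at least al by continuity in u. Keeping u below pi makes the imaginary part nonzero. *)
Lemma level_above1 (tau al : R) : 0 < tau -> 1 <= al < Phi n tau 1 ->
  exists u s, [/\ 0 < u, 0 < s <= tau, modsq u s = al ^+ 2 & avg_expsin u s != 0].
Proof.
move=> t0 /andP[al1 alP].
have [u0 u0p bpos] := bes_gt0_near0.
have e0 : 0 < modsq 0 tau - al ^+ 2.
  rewrite modsq_u0 subr_gt0; move: (Phi n tau 1) alP => p alp.
  by rewrite ltrXn2r//; lra.
have := iffLR (@cvgrPdist_le R R _ (nbhs (0 : R)) (nbhs_filter _) _ _) (@modsq_cont_u tau 0) _ e0.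
move=> /nbhs_ballP[D /= D0 HD].
have pp : 0 < pi :> R by exact: pi_gt0.
pose u := Num.min u0 (Num.min (D / 2) (pi / 2)).
have up : 0 < u by rewrite /u !lt_min u0p /=; apply/andP; split; lra.
have uu0 : u <= u0 by rewrite /u ge_min lexx.
have uD : u <= D / 2 by rewrite /u !ge_min lexx orbT.
have upi : u <= pi / 2 by rewrite /u !ge_min lexx !orbT.
have h1 : al ^+ 2 <= modsq u tau.
  apply: (@dist_le (modsq 0 tau)).
  by apply: HD; rewrite /ball /= sub0r normrN ger0_norm//; lra.
have b1 : 0 < bes u by apply: bpos; rewrite (ltW up).
have b2 : bes u < 1.
  have [c /andP[c0 cu]] := mean_value up (fun s _ => @bes_der R n s).
  rewrite subr0 (@bes0 R n) => E.
  have : 0 < flux c.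
    by apply: flux_gt0 => // s /andP[s0 sc]; apply: bpos; apply/andP; split; lra.
  rewrite /flux pmulr_rgt0 ?exprn_gt0// oppr_gt0 => b.
  have : bes1 c * u < 0 by rewrite pmulr_llt0.
  by rewrite -E; lra.
have h0 : modsq u 0 < al ^+ 2.
  rewrite modsq_s0; apply: (@lt_le_trans _ _ 1); last by rewrite exprn_ege1.
  by rewrite expr_lt1// ltW.
have [|s /andP[s0 st] E] := ivt (@modsq_cont_s u) (ltW t0) (v := al ^+ 2).
  by rewrite (ltW h0).
have sp : 0 < s.
  rewrite lt_neqAle s0 andbT; apply/eqP => E0.
  by move: h0; rewrite E0 E ltxx.
exists u, s; split => //; first by rewrite sp.
have pu : u < pi by apply: le_lt_trans upi _; rewrite ltr_pdivrMr// ltr_pMr ?ltr1n.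
by rewrite lt_eqF// avg_expsin_lt0// up pu.
Qed.

(** For al < 1, s is fixed small and u varies between first crossings u1 < u2 of the levels (al +
    1)/2 and al/2, which bracket al. There [bes] is positive with slope at most -c < 0, and a small
    s keeps both the bracketing and the sign of the imaginary part. *)
Lemma level_below1 (tau al : R) : 0 < tau -> 0 < al < 1 ->
  exists u s, [/\ 0 < u, 0 < s <= tau, modsq u s = al ^+ 2 & avg_expsin u s != 0].
Proof.
move=> t0 /andP[al0 al1].
have [z [_ [z0 _ bz _]]] := @bes_two_zeros R n.
have v0 : al / 2 < bes 0 by rewrite bes0; lra.
have vz : bes z <= al / 2 by rewrite bz; lra.
have [u2 [u20 bu2 H2]] := first_crossing (@bes_cont R n) (ltW z0) v0 vz.
have w0 : (al + 1) / 2 < bes 0 by rewrite bes0; lra.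
have wz : bes u2 <= (al + 1) / 2 by rewrite bu2; lra.
have [u1 [u10 bu1 H1]] := first_crossing (@bes_cont R n) (ltW u20) w0 wz.
have u12 : u1 < u2.
  rewrite ltNge; apply/negP => h; move: h; rewrite le_eqVlt => /predU1P[h|h].
    by move: bu1; rewrite -h bu2; lra.
  have : (al + 1) / 2 < bes u2 by apply: H1; rewrite (ltW u20).
  by rewrite bu2; lra.
have pos x : 0 <= x <= u2 -> 0 < bes x.
  move=> /andP[x0]; rewrite le_eqVlt => /predU1P[->|xu]; first by rewrite bu2; lra.
  have : al / 2 < bes x by apply: H2; rewrite x0.
  lra.
have f1 : 0 < flux u1.
  by apply: flux_gt0 => // x /andP[x0 x1]; apply: pos; apply/andP; split; lra.
(* The flux increases on [u1, u2], so -bes1 x is at least flux u1 divided by the largest value of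
   x^(n+1). *)
pose c := flux u1 / u2 ^+ n.+1.
have U0 : 0 < u2 ^+ n.+1 by apply: exprn_gt0.
have c0 : 0 < c by rewrite /c divr_gt0.
have bc x : u1 <= x <= u2 -> bes1 x <= - c.
  move=> /andP[x1 x2]; rewrite lerNr /c ler_pdivrMr//.
  have x0 : 0 < x by lra.
  have F : flux u1 <= flux x.
    by apply: flux_le; rewrite ?u10// => y /andP[y0 yx]; apply: pos; apply/andP; split; lra.
  have F0 : 0 < flux x by lra.
  apply: le_trans F _; rewrite /flux mulrC; apply: ler_wpM2l.
    by move: F0; rewrite /flux pmulr_rgt0 ?exprn_gt0// => /ltW.
  by rewrite lerXn2r ?nnegrE ?(ltW x0) ?(ltW u20).
have e1 : 0 < modsq u1 0 - al ^+ 2.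
  by rewrite modsq_s0 subr_gt0 ltrXn2r ?nnegrE ?bu1//; lra.
have e2 : 0 < al ^+ 2 - modsq u2 0.
  by rewrite modsq_s0 subr_gt0 ltrXn2r ?nnegrE ?bu2//; lra.
have := iffLR (@cvgrPdist_le R R _ (nbhs (0 : R)) (nbhs_filter _) _ _) (@modsq_cont_s u1 0) _ e1.
move=> /nbhs_ballP[D1 /= D10 HD1].
have := iffLR (@cvgrPdist_le R R _ (nbhs (0 : R)) (nbhs_filter _) _ _) (@modsq_cont_s u2 0) _ e2.
move=> /nbhs_ballP[D2 /= D20 HD2].
have x0 : 0 < expR 1 :> R by exact: expR_gt0.
pose s := Num.min (Num.min tau 1) (Num.min (Num.min (D1 / 2) (D2 / 2)) (c / (2 * expR 1))).
have s0 : 0 < s.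
  by rewrite /s !lt_min t0 ltr01 !divr_gt0// mulr_gt0.
have st : s <= tau by rewrite /s !ge_min lexx.
have s1 : s <= 1 by rewrite /s !ge_min lexx !orbT.
have sD1 : s <= D1 / 2 by rewrite /s !ge_min lexx !orbT.
have sD2 : s <= D2 / 2 by rewrite /s !ge_min lexx !orbT.
have sc : s <= c / (2 * expR 1) by rewrite /s !ge_min lexx !orbT.
have g1 : al ^+ 2 <= modsq u1 s.
  apply: (@dist_le (modsq u1 0)); apply: HD1.
  by rewrite /ball /= sub0r normrN gtr0_norm// (le_lt_trans sD1)// ltr_pdivrMr// ltr_pMr ?ltr1n.
have g2 : modsq u2 s <= al ^+ 2.
  apply: (@dist_ge (modsq u2 0)); apply: HD2.
  by rewrite /ball /= sub0r normrN gtr0_norm// (le_lt_trans sD2)// ltr_pdivrMr// ltr_pMr ?ltr1n.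
have [|u /andP[uu1 uu2] E] := ivt (opp_cont (@modsq_cont_u s)) (ltW u12) (v := - al ^+ 2).
  by rewrite !lerN2 g1 g2.
have up : 0 < u := lt_le_trans u10 uu1.
exists u, s; split; [exact: up|by rewrite s0 st|exact: oppr_inj|].
rewrite lt_eqF//; have s01 : 0 <= s <= 1 by rewrite (ltW s0).
have := avg_expsin_taylor u s01; rewrite ler_norml => /andP[_ h].
have uu : u1 <= u <= u2 by rewrite uu1.
exact: (small_slope s0 c0 x0 sc h (bc u uu)).
Qed.

Lemma level_point (tau al : R) : 0 < tau -> 0 < al < Phi n tau 1 ->
  exists u s, [/\ 0 < u, 0 < s <= tau, modsq u s = al ^+ 2 & avg_expsin u s != 0].
Proof.
move=> t0 /andP[a0 aP]; have [h|h] := ltP al 1; first by apply: level_below1; rewrite // a0.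
by apply: level_above1; rewrite // h.
Qed.

End level_points.


(** * Counterexamples *)

Section sup_seminorm.
Context {R : realType} {n : nat} (a : R).
Hypothesis a0 : 0 <= a.
Local Notation d := n.+2.
Local Notation V := 'rV[R]_d.
Local Notation C := R[i].
Local Notation Re := (@complex.Re R).
Local Notation Im := (@complex.Im R).
Local Notation SR := (@SR R n a).
Local Notation wt := (@expweight R n a).
Implicit Types (f g : V -> C).

(** The exponent 2d is that of [pweight_wt], so this single seminorm controls the integrals against
    all plane waves with |eta| <= a. *)
Definition supnorm f : R := fine (gamma a (2 * d) [ffun=> 0%N] f).

Lemma multi_partial0 f : multi_partial [ffun=> 0%N] f = f.
Proof. by rewrite /multi_partial; elim: (enum _) => //= j s ->; rewrite ffunE. Qed.

Lemma supnormE f : Sa a f -> (gamma a (2 * d) [ffun=> 0%N] f = (supnorm f)%:E)%E.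
Proof.
move=> [_ /(_ (2 * d)%N [ffun=> 0%N])H]; rewrite /supnorm fineK// fin_real// H andbT.
apply: (@lt_le_trans _ _ (wt (2 * d) 0 * normc (multi_partial [ffun=> 0%N] f 0))%:E).
  exact: ltNyr.
by apply: ereal_sup_ubound; exists 0.
Qed.

Lemma supnorm_leP f B : Sa a f -> supnorm f <= B <-> forall x, wt (2 * d) x * normc (f x) <= B.
Proof.
move=> Sf; have := gamma_leP a (2 * d) [ffun=> 0%N] f B.
by rewrite -multi_partialE multi_partial0 (supnormE Sf) lee_fin.
Qed.

Lemma supnorm_ge f x : Sa a f -> wt (2 * d) x * normc (f x) <= supnorm f.
Proof. by move=> Sf; apply: (supnorm_leP _ Sf).1. Qed.

Lemma supnorm_ge0 f : Sa a f -> 0 <= supnorm f.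
Proof.
move=> Sf; apply: le_trans (supnorm_ge 0 Sf).
by rewrite mulr_ge0 ?normc_ge0// ltW// wt_gt0.
Qed.

Lemma Sa_add f g : Sa a f -> Sa a g -> Sa a (f \+ g).
Proof.
move=> Sf Sg; rewrite (_ : _ \+ _ = (fun x => 1 * f x + g x)); first exact: Sa_lin.
by apply/funext => x; rewrite mul1r.
Qed.

Lemma Sa0 : Sa a (fun _ : V => 0 : C).
Proof. exact: (Sa_real (@SR0 R n a)). Qed.

Lemma Sa_scale c f : Sa a f -> Sa a (fun x => c * f x).
Proof.
move=> Sf; rewrite (_ : (fun x => _) = (fun x => c * f x + (fun=> 0) x)).
  by apply: Sa_lin => //; exact: Sa0.
by apply/funext => x; rewrite addr0.
Qed.

Lemma Sa_diff f g : Sa a f -> Sa a g -> Sa a (f \- g).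
Proof.
move=> Sf Sg; rewrite (_ : _ \- _ = (fun x => -1 * g x + f x)); first exact: Sa_lin.
by apply/funext => x; rewrite mulN1r addrC.
Qed.

Lemma supnorm_add f g : Sa a f -> Sa a g -> supnorm (f \+ g) <= supnorm f + supnorm g.
Proof.
move=> Sf Sg; apply/(supnorm_leP _ (Sa_add Sf Sg)) => x.
apply: le_trans (lerD (supnorm_ge x Sf) (supnorm_ge x Sg)); rewrite -mulrDr.
by rewrite ler_wpM2l ?(ltW (wt_gt0 _ _ _))// le_normcD.
Qed.

Lemma supnorm_scale c f : Sa a f -> supnorm (fun x => c * f x) = normc c * supnorm f.
Proof.
have le k g : Sa a g -> supnorm (fun x => k * g x) <= normc k * supnorm g.
  move=> Sg; apply/(supnorm_leP _ (Sa_scale k Sg)) => x.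
  by rewrite normcM mulrCA ler_wpM2l ?normc_ge0// supnorm_ge.
move=> Sf; apply/eqP; rewrite eq_le le//=.
have [->|c0] := eqVneq c 0.
  by rewrite normc0 mul0r supnorm_ge0//; exact: Sa_scale.
have cp : 0 < normc c.
  by rewrite lt_neqAle normc_ge0 andbT; apply/eqP => /esym/eq0_normc/eqP; rewrite (negbTE c0).
have := le c^-1 _ (Sa_scale c Sf).
rewrite (_ : (fun x => c^-1 * (c * f x)) = f); last by apply/funext => x; rewrite mulKf.
by rewrite normcV mulrC ler_pdivlMr// mulrC.
Qed.

Lemma supnorm_sub f g : Sa a f -> Sa a g -> `|supnorm f - supnorm g| <= supnorm (g \- f).
Proof.
move=> Sf Sg; have S1 := Sa_diff Sg Sf; have S2 := Sa_diff Sf Sg.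
have h1 := supnorm_add Sf S1; have h2 := supnorm_add Sg S2.
have e1 : f \+ (g \- f) = g by apply/funext => x /=; rewrite addrC subrK.
have e2 : g \+ (f \- g) = f by apply/funext => x /=; rewrite addrC subrK.
have e3 : supnorm (f \- g) = supnorm (g \- f).
  rewrite (_ : f \- g = (fun x => -1 * (g \- f) x)).
    by rewrite supnorm_scale// normcN normc1 mul1r.
  by apply/funext => x /=; rewrite mulN1r opprB.
rewrite e1 in h1; rewrite e2 e3 in h2; rewrite ler_norml.
by move: (supnorm f) (supnorm g) (supnorm _) h1 h2 => p q r; lra.
Qed.

Lemma supnorm_seminorm : continuous_seminorm a supnorm.
Proof.
split=> [f g|c f|f Sf]; [exact: supnorm_add|exact: supnorm_scale|].
move=> A /nbhs_ballP[e /= e0 HA].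
exists ([:: (2 * d, [ffun=> 0])%N], e) => //= g [Sg H]; apply: HA.
rewrite /ball /=; apply: le_lt_trans (supnorm_sub Sf Sg) _.
by have := H _ (mem_head _ _); rewrite /= (supnormE (Sa_diff Sg Sf)) lte_fin.
Qed.

Lemma bounded_dual (T : (V -> C) -> C) K : 0 <= K ->
  (forall c f g, Sa a f -> Sa a g -> T (fun x => c * f x + g x) = c * T f + T g) ->
  (forall f, Sa a f -> normc (T f) <= K * supnorm f) -> dual_Sa a T.
Proof.
move=> K0 lin HK; split=> // f Sf e e0.
have K1 : 0 < K + 1 by rewrite ltr_wpDl.
exists ([:: (2 * d, [ffun=> 0])%N], e / (K + 1)) => /=; first by rewrite divr_gt0.
move=> g [Sg H]; have S1 := Sa_diff Sg Sf.
have -> : T g - T f = T (g \- f).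
  have -> : g \- f = (fun x => -1 * f x + g x).
    by apply/funext => x; rewrite mulN1r addrC.
  by rewrite lin// mulN1r addrC.
apply: le_lt_trans (HK _ S1) _.
have := H _ (mem_head _ _); rewrite /= (supnormE S1) lte_fin ltr_pdivlMr// mulrC.
apply: le_lt_trans; rewrite ler_wpM2r ?supnorm_ge0//; lra.
Qed.

End sup_seminorm.

Section plane_waves.
Context {R : realType} {n : nat} (a : R).
Hypothesis a0 : 0 <= a.
Local Notation d := n.+2.
Local Notation V := 'rV[R]_d.
Local Notation C := R[i].
Local Notation Re := (@complex.Re R).
Local Notation Im := (@complex.Im R).
Local Notation SR := (@SR R n a).
Local Notation wt := (@expweight R n a).
Local Notation wbound := (@wbound R n a).
Local Notation coord_pairing := (@coord_pairing R n).
Local Notation avg_expcos := (@avg_expcos R n).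
Local Notation avg_expsin := (@avg_expsin R n).
Implicit Types (f g : V -> C).

Lemma Re_average t f : (fun x => Re (spherical_average t f x)) = Mr t (fun x => Re (f x)).
Proof. by apply/funext => x; rewrite /Mr avgE. Qed.

Lemma Im_average t f : (fun x => Im (spherical_average t f x)) = Mr t (fun x => Im (f x)).
Proof. by apply/funext => x; rewrite /Mr avgE. Qed.

Lemma Sa_average t f : Sa a f -> Sa a (spherical_average t f).
Proof.
move=> /SaP[f1 f2]; apply/SaP; rewrite Re_average Im_average; split.
  exact: (SR_Mr a0 t f1).
exact: (SR_Mr a0 t f2).
Qed.

Lemma Re_laplacian f : (fun x => Re (laplacian f x)) = (fun x => -1 * lap (fun x => Re (f x)) x + 0).
Proof.
have Q (p q : R) : Re ('i * (- p%:C) + - q%:C) = -1 * q + 0 by rewrite /=; ring.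
by rewrite laplacianE; apply/funext => x; exact: Q.
Qed.

Lemma Im_laplacian f : (fun x => Im (laplacian f x)) = (fun x => -1 * lap (fun x => Im (f x)) x + 0).
Proof.
have Q (p q : R) : Im ('i * (- p%:C) + - q%:C) = -1 * p + 0 by rewrite /=; ring.
by rewrite laplacianE; apply/funext => x; exact: Q.
Qed.

Lemma Sa_laplacian f : Sa a f -> Sa a (laplacian f).
Proof.
move=> /SaP[f1 f2]; apply/SaP; rewrite Re_laplacian Im_laplacian; split.
  by apply: SR_lin; [exact: SR_lap|exact: SR0].
by apply: SR_lin; [exact: SR_lap|exact: SR0].
Qed.

Variables (xi eta : R).
Hypothesis ea : `|eta| <= a.
Local Notation Jc := (coord_pairing (expwave xi eta 1 0)).
Local Notation Js := (coord_pairing (expwave xi eta 0 1)).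

(* Integration against [e^(i (xi + i eta) x_0)]. *)
Definition planewave f : C :=
  (Jc (fun x => Re (f x)) - Js (fun x => Im (f x))) +i*
  (Js (fun x => Re (f x)) + Jc (fun x => Im (f x))).

Lemma coord_pairing_SR_lin p q (c : R) (h h' : V -> R) : SR h -> SR h' ->
  coord_pairing (expwave xi eta p q) (fun x => c * h x + h' x) = c * coord_pairing (expwave xi eta p q) h + coord_pairing (expwave xi eta p q) h'.
Proof.
move=> S1 S2; have [_ /(_ [::] (2 * d)%N)[B hB]] := S1; have [_ /(_ [::] (2 * d)%N)[B' hB']] := S2.
exact: (coord_pairing_lin a0 c (@expwave_cont R xi eta p q) (expwave_bound xi p q ea) (SR_continuous S1) hB (SR_continuous S2) hB').
Qed.

Lemma planewave_lin c f g : Sa a f -> Sa a g ->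
  planewave (fun x => c * f x + g x) = c * planewave f + planewave g.
Proof.
move=> /SaP[f1 f2] /SaP[g1 g2].
have Q1 (k z w : C) : Re (k * z + w) = Re k * Re z + (- Im k * Im z + Re w).
  by case: k z w => ? ? [? ?] [? ?] /=; ring.
have Q2 (k z w : C) : Im (k * z + w) = Re k * Im z + (Im k * Re z + Im w).
  by case: k z w => ? ? [? ?] [? ?] /=; ring.
have E1 : (fun x => Re (c * f x + g x)) =
    (fun x => Re c * Re (f x) + (fun x => - Im c * Im (f x) + Re (g x)) x).
  by apply/funext => x; exact: Q1.
have E2 : (fun x => Im (c * f x + g x)) =
    (fun x => Re c * Im (f x) + (fun x => Im c * Re (f x) + Im (g x)) x).
  by apply/funext => x; exact: Q2.
have S1 : SR (fun x => - Im c * Im (f x) + Re (g x)) by apply: SR_lin.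
have S2 : SR (fun x => Im c * Re (f x) + Im (g x)) by apply: SR_lin.
rewrite /planewave E1 E2 !(coord_pairing_SR_lin _ _ _ f1 S1) !(coord_pairing_SR_lin _ _ _ f2 S2).
rewrite !(coord_pairing_SR_lin _ _ _ f2 g1) !(coord_pairing_SR_lin _ _ _ f1 g2).
by case: c {E1 E2 S1 S2} => p q; apply: complex_eq => /=; ring.
Qed.

Lemma planewave_bound f : Sa a f -> normc (planewave f) <= 4 * @gmass R n * supnorm a f.
Proof.
move=> Sf; have /SaP[f1 f2] := Sf; apply: le_trans (normc_le_ReIm _) _.
have W1 : wbound (2 * d) (fun x => Re (f x)) (supnorm a f).
  move=> x; apply: le_trans (supnorm_ge x Sf).
  by rewrite ler_wpM2l ?(ltW (wt_gt0 _ _ _))// Re_le_normc.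
have W2 : wbound (2 * d) (fun x => Im (f x)) (supnorm a f).
  move=> x; apply: le_trans (supnorm_ge x Sf).
  by rewrite ler_wpM2l ?(ltW (wt_gt0 _ _ _))// Im_le_normc.
have b1 := coord_pairing_expwave_bound a0 xi 1 0 ea (SR_continuous f1) W1.
have b2 := coord_pairing_expwave_bound a0 xi 0 1 ea (SR_continuous f1) W1.
have b3 := coord_pairing_expwave_bound a0 xi 1 0 ea (SR_continuous f2) W2.
have b4 := coord_pairing_expwave_bound a0 xi 0 1 ea (SR_continuous f2) W2.
rewrite normr0 normr1 addr0 mulr1 in b1; rewrite normr0 normr1 add0r mulr1 in b2.
rewrite normr0 normr1 addr0 mulr1 in b3; rewrite normr0 normr1 add0r mulr1 in b4.
apply: le_trans (lerD (ler_normB _ _) (ler_normD _ _)) _.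
apply: le_trans (lerD (lerD b1 b4) (lerD b2 b3)) _.
by rewrite le_eqVlt; apply/orP; left; apply/eqP; ring.
Qed.

Lemma planewave_average t f : Sa a f -> planewave (spherical_average t f) =
  (avg_expcos (xi * t) (eta * t) +i* avg_expsin (xi * t) (eta * t)) * planewave f.
Proof.
move=> /SaP[f1 f2]; rewrite /planewave Re_average Im_average.
rewrite (coord_pairing_expwave_Mr a0 xi 1 0 t ea f1) (coord_pairing_expwave_Mr a0 xi 0 1 t ea f1).
rewrite (coord_pairing_expwave_Mr a0 xi 1 0 t ea f2) (coord_pairing_expwave_Mr a0 xi 0 1 t ea f2).
by apply: complex_eq => /=; ring.
Qed.

Lemma planewave_laplacian f : Sa a f -> planewave (laplacian f) =
  ((xi ^+ 2 - eta ^+ 2) +i* (2 * xi * eta)) * planewave f.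
Proof.
move=> /SaP[f1 f2]; have S0 := @SR0 R n a.
have J0 p q : coord_pairing (expwave xi eta p q) (fun=> 0) = 0.
  have := coord_pairing_SR_lin p q 1 S0 S0; rewrite (_ : (fun x => _) = (fun=> 0)); last first.
    by apply/funext => x; rewrite mulr0 addr0.
  by move: (coord_pairing _ _) => x; rewrite mul1r => h; apply: (addrI x); rewrite -h addr0.
have L p q h : SR h -> coord_pairing (expwave xi eta p q) (fun x => -1 * lap h x + 0) =
    - (((eta ^+ 2 - xi ^+ 2) * p - 2 * xi * eta * q) * Jc h +
    (2 * xi * eta * p + (eta ^+ 2 - xi ^+ 2) * q) * Js h).
  move=> Sh; have := coord_pairing_SR_lin p q (-1) (SR_lap Sh) S0.
  by rewrite J0 addr0 mulN1r (coord_pairing_expwave_lap a0 xi p q ea Sh).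
rewrite /planewave Re_laplacian Im_laplacian.
apply: (etrans (f_equal2 (fun p q : R => p +i* q)
  (f_equal2 (fun p q : R => p - q) (L 1 0 _ f1) (L 0 1 _ f2))
  (f_equal2 (fun p q : R => p + q) (L 0 1 _ f1) (L 1 0 _ f2)))).
move: (Jc _) (Js _) (Jc _) (Js _) => p q p' q'.
by apply: complex_eq => /=; ring.
Qed.

Lemma planewave_neq0 : exists2 f, Sa a f & planewave f != 0.
Proof.
have [h Sh Jh] := coord_pairing_expwave_gt0 n xi a0 ea; exists (fun x => (h x)%:C); first exact: Sa_real.
have J0 : Js (fun=> 0) = 0.
  have S0 := @SR0 R n a; have := coord_pairing_SR_lin 0 1 1 S0 S0; rewrite (_ : (fun x => _) = (fun=> 0)); last first.
    by apply/funext => x; rewrite mulr0 addr0.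
  by move: (coord_pairing _ _) => x; rewrite mul1r => e; apply: (addrI x); rewrite -e addr0.
apply/eqP => /(congr1 (@complex.Re R)); rewrite /= J0 subr0 => e.
by move: Jh; rewrite e ltxx.
Qed.

End plane_waves.

Section two_eigenvalues.
Context {R : realType} {n : nat} (a : R).
Local Notation V := 'rV[R]_n.+2.
Local Notation C := R[i].

(** Eigenvectors for distinct eigenvalues are independent: the relation [K] at f and at L f
    eliminates I2, which forces mu = l1, and then [K] itself forces mu = l2. *)
Lemma sum_not_eigen (L : (V -> C) -> V -> C) (I1 I2 T : (V -> C) -> C) (l1 l2 : C) :
  (forall f, Sa a f -> Sa a (L f)) ->
  (forall f, Sa a f -> I1 (L f) = l1 * I1 f) -> (forall f, Sa a f -> I2 (L f) = l2 * I2 f) ->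
  (exists2 f, Sa a f & I1 f != 0) -> (exists2 f, Sa a f & I2 f != 0) -> l1 != l2 ->
  (forall f, T f = I1 f + I2 f) -> ~ eigendistribution a L T.
Proof.
move=> SL H1 H2 [f1 S1 n1] [f2 S2 n2] l12 TE [mu Hmu].
have K f : Sa a f -> (l1 - mu) * I1 f + (l2 - mu) * I2 f = 0.
  move=> Sf; have := Hmu f Sf; rewrite /distr_op !TE H1// H2// => /eqP.
  rewrite -subr_eq0 => /eqP h; rewrite -[RHS]h; ring.
have K1 f : Sa a f -> (l1 - l2) * (l1 - mu) * I1 f = 0.
  move=> Sf; have h1 := K f Sf; have := K _ (SL f Sf); rewrite H1// H2// => h2.
  rewrite -[RHS](subr0 0) -{1}h2 -(mulr0 l2) -h1; ring.
have /eqP := K1 f1 S1; rewrite !mulf_eq0 (negbTE n1) orbF subr_eq0 (negbTE l12) /= subr_eq0 => /eqP E.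
have /eqP := K f2 S2; rewrite E subrr mul0r add0r mulf_eq0 (negbTE n2) orbF subr_eq0 => /eqP E2.
by move: l12; rewrite E E2 eqxx.
Qed.

Hypothesis a0 : 0 <= a.

(** Coefficients of modulus at most 1 make the bound by [supnorm] uniform in k; the eigenvalue of
    M_t on each wave is absorbed by its own recurrence. *)
Lemma two_wave_sequence (t x1 y1 x2 y2 : R) (A : C) (c1 c2 : int -> C) :
  `|y1| <= a -> `|y2| <= a ->
  (forall k, normc (c1 k) <= 1) -> (forall k, normc (c2 k) <= 1) ->
  (forall k, c1 k * (@avg_expcos R n (x1 * t) (y1 * t) +i* @avg_expsin R n (x1 * t) (y1 * t)) = A * c1 (k + 1)) ->
  (forall k, c2 k * (@avg_expcos R n (x2 * t) (y2 * t) +i* @avg_expsin R n (x2 * t) (y2 * t)) = A * c2 (k + 1)) ->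
  average_sequence t a A (fun k (f : V -> C) => c1 k * planewave x1 y1 f + c2 k * planewave x2 y2 f).
Proof.
move=> h1 h2 n1 n2 e1 e2.
have g0 := @gmass_ge0 R n.
have bd k (f : V -> C) : Sa a f ->
    normc (c1 k * planewave x1 y1 f + c2 k * planewave x2 y2 f) <= (8 * @gmass R n + 1) * supnorm a f.
  move=> Sf; have b1 := planewave_bound a0 x1 h1 Sf; have b2 := planewave_bound a0 x2 h2 Sf.
  apply: le_trans (le_normcD _ _) _; rewrite !normcM.
  apply: (@le_trans _ _ (1 * (4 * @gmass R n * supnorm a f) + 1 * (4 * @gmass R n * supnorm a f))).
    by apply: lerD; apply: ler_pM; rewrite ?normc_ge0 ?n1 ?n2 ?b1 ?b2.
  by have := supnorm_ge0 Sf; move: (supnorm a f) (gmass) => p q p0; lra.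
split.
- move=> k; have K0 : 0 <= 8 * @gmass R n + 1 by rewrite addr_ge0// mulr_ge0.
  pose T1 (f : V -> C) := c1 k * planewave x1 y1 f + c2 k * planewave x2 y2 f.
  have lin c f g : Sa a f -> Sa a g -> T1 (fun x => c * f x + g x) = c * T1 f + T1 g.
    move=> Sf Sg; rewrite /T1 (planewave_lin a0 x1 h1 c Sf Sg) (planewave_lin a0 x2 h2 c Sf Sg).
    by move: (planewave x1 y1 f) (planewave x1 y1 g) (planewave x2 y2 f) (planewave x2 y2 g) => p q r s; ring.
  exact: (@bounded_dual R n a T1 _ K0 lin (bd k)).
- move=> k f Sf; rewrite /distr_op (planewave_average a0 x1 h1 t Sf) (planewave_average a0 x2 h2 t Sf).
  by rewrite !mulrA e1 e2 -!mulrA -mulrDr.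
- exists (supnorm a), (8 * @gmass R n + 1); split=> //; first exact: supnorm_seminorm.
  by rewrite ltr_wpDl// mulr_ge0.
Qed.

End two_eigenvalues.


Section counterexamples.
Context {R : realType} {n : nat} (t a : R).
Hypotheses (t0 : 0 < t) (a0 : 0 < a).
Local Notation V := 'rV[R]_n.+2.
Local Notation C := R[i].
Local Notation avg_expcos := (@avg_expcos R n).
Local Notation avg_expsin := (@avg_expsin R n).

Lemma avg_expcosN (u s : R) : avg_expcos (- u) s = avg_expcos u s.
Proof. by apply: (f_equal avg); apply/funext => w; rewrite [- u * _]mulNr cosN. Qed.

Lemma avg_expsinN (u s : R) : avg_expsin (- u) s = - avg_expsin u s.
Proof.
have c1 : continuous (fun w : V => expR (- s * w 0 0) * sin (u * w 0 0)) by cont.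
rewrite -(avgN c1); apply: (f_equal avg); apply/funext => w.
by rewrite [- u * _]mulNr sinN mulrN.
Qed.

Lemma zero_average_sequence : exists T : int -> (V -> C) -> C,
  average_sequence t a 0 T /\ ~ eigendistribution a laplacian (T 0).
Proof.
have a0' := ltW a0; have tn : t != 0 by rewrite gt_eqF.
have [z1 [z2 [z10 z12 b1 b2]]] := @bes_two_zeros R n.
have ea : `|0 : R| <= a by rewrite normr0.
have F z : @bes R n z = 0 -> avg_expcos (z / t * t) (0 * t) +i* avg_expsin (z / t * t) (0 * t) = 0.
  by move=> bz; rewrite divfK// mul0r avg_expcos_s0 avg_expsin_s0 bz.
exists (fun k (f : V -> C) => 1 * planewave (z1 / t) 0 f + 1 * planewave (z2 / t) 0 f); split.
  apply: (two_wave_sequence a0' (c1 := fun=> 1) (c2 := fun=> 1) ea ea) => k; rewrite ?normc1//.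
    by rewrite F// mul0r mulr0.
  by rewrite F// mul0r mulr0.
have d12 : ((z1 / t) ^+ 2 - 0 ^+ 2) +i* (2 * (z1 / t) * 0) != ((z2 / t) ^+ 2 - 0 ^+ 2) +i* (2 * (z2 / t) * 0).
  apply/eqP => /(congr1 (@complex.Re R)) /=; rewrite expr0n !subr0 !exprMn => e.
  have := mulIf (expf_neq0 2 (invr_neq0 tn)) e => /eqP.
  by rewrite eqrXn2 ?ltW ?(lt_trans z10 z12)// lt_eqF.
have T0E (f : V -> C) : 1 * planewave (z1 / t) 0 f + 1 * planewave (z2 / t) 0 f =
    planewave (z1 / t) 0 f + planewave (z2 / t) 0 f by rewrite !mul1r.
have L1 (f : V -> C) : Sa a f -> planewave (z1 / t) 0 (laplacian f) = _ := @planewave_laplacian _ _ _ a0' (z1 / t) _ ea f.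
have L2 (f : V -> C) : Sa a f -> planewave (z2 / t) 0 (laplacian f) = _ := @planewave_laplacian _ _ _ a0' (z2 / t) _ ea f.
exact: (sum_not_eigen (@Sa_laplacian R n a) L1 L2
  (planewave_neq0 a0' (z1 / t) ea) (planewave_neq0 a0' (z2 / t) ea) d12 T0E).
Qed.

Lemma nonzero_average_sequence (A : C) : A != 0 -> normc A < Phi n a t ->
  exists T : int -> (V -> C) -> C, average_sequence t a A T /\
   ~ eigendistribution a laplacian (T 0) /\ ~ eigendistribution a (spherical_average t) (T 0).
Proof.
move=> A0 HA; have a0' := ltW a0; have tn : t != 0 by rewrite gt_eqF.
have Ap : 0 < normc A.
  by rewrite lt_neqAle normc_ge0 andbT; apply/eqP => /esym/eq0_normc/eqP; rewrite (negbTE A0).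
have HP : Phi n a t = Phi n (a * t) 1.
  by rewrite !Phi_avg; apply: (f_equal avg); apply/funext => w; rewrite mulr1.
have hA : 0 < normc A < Phi n (a * t) 1 by rewrite Ap -HP.
(* [level_point] lives at radius 1. Dividing by t gives the frequency, and s <= a t becomes eta <=
   a, which keeps the wave in the dual of S^a. *)
have [u [s [u0 /andP[s0 st] E pn]]] := level_point (mulr_gt0 a0 t0) hA.
pose xi := u / t; pose eta := s / t.
have xiE : xi * t = u by rewrite /xi divfK.
have etaE : eta * t = s by rewrite /eta divfK.
have xi0 : 0 < xi by rewrite divr_gt0.
have eta0 : 0 < eta by rewrite divr_gt0.
have ea : `|eta| <= a by rewrite gtr0_norm// /eta ler_pdivrMr.
pose f1 : C := avg_expcos u s +i* avg_expsin u s; pose f2 : C := avg_expcos u s +i* - avg_expsin u s.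
have F1 : avg_expcos (xi * t) (eta * t) +i* avg_expsin (xi * t) (eta * t) = f1 by rewrite xiE etaE.
have F2 : avg_expcos (- xi * t) (eta * t) +i* avg_expsin (- xi * t) (eta * t) = f2.
  by rewrite mulNr xiE etaE avg_expcosN avg_expsinN.
have nf1 : normc f1 = normc A.
  by rewrite /f1 /= -/(modsq u s) E sqrtr_sqr gtr0_norm.
have nf2 : normc f2 = normc A.
  by rewrite /f2 /= sqrrN -/(modsq u s) E sqrtr_sqr gtr0_norm.
have nq (f : C) : normc f = normc A -> normc (f / A) = 1.
  by move=> fA; rewrite normcM normcV fA mulfV// gt_eqF.
have q0 (f : C) : normc f = normc A -> f / A != 0.
  move=> fA; apply/eqP => e; have := nq f fA; rewrite e normc0 => /eqP.
  by rewrite eq_sym oner_eq0.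
have rec (f : C) (k : int) : normc f = normc A -> (f / A) ^ k * f = A * (f / A) ^ (k + 1).
  move=> fA; rewrite expfzDr ?q0// expr1z mulrCA; congr (_ * _).
  by rewrite mulrC divfK.
have d1 : f1 != f2.
  apply/eqP => /(congr1 (@complex.Im R)) /= e; move: pn; rewrite (_ : avg_expsin u s = 0) ?eqxx//.
  by move: e; move: (avg_expsin u s) => x; lra.
have T0E (f : V -> C) : (f1 / A) ^ 0 * planewave xi eta f + (f2 / A) ^ 0 * planewave (- xi) eta f =
    planewave xi eta f + planewave (- xi) eta f :> C by rewrite !expr0z !mul1r.
exists (fun k (f : V -> C) => (f1 / A) ^ k * planewave xi eta f + (f2 / A) ^ k * planewave (- xi) eta f).
split; [|split].
- apply: (two_wave_sequence a0' (c1 := fun k => (f1 / A) ^ k) (c2 := fun k => (f2 / A) ^ k) ea ea) => k.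
  + by rewrite normc_exp ?nq.
  + by rewrite normc_exp ?nq.
  + by rewrite F1 rec.
  + by rewrite F2 rec.
- have l12 : (xi ^+ 2 - eta ^+ 2) +i* (2 * xi * eta) != ((- xi) ^+ 2 - eta ^+ 2) +i* (2 * - xi * eta).
    apply/eqP => /(congr1 (@complex.Im R)) /= e.
    have : 0 < xi * eta by rewrite mulr_gt0.
    by move: e; rewrite mulrN mulNr -mulrA; move: (xi * eta) => x; lra.
  have L1 (f : V -> C) : Sa a f -> planewave xi eta (laplacian f) = _ := @planewave_laplacian _ _ _ a0' xi _ ea f.
  have L2 (f : V -> C) : Sa a f -> planewave (- xi) eta (laplacian f) = _ := @planewave_laplacian _ _ _ a0' (- xi) _ ea f.
  exact: (sum_not_eigen (@Sa_laplacian R n a) L1 L2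
    (planewave_neq0 a0' xi ea) (planewave_neq0 a0' (- xi) ea) l12 T0E).
- have A1 (f : V -> C) : Sa a f -> planewave xi eta (spherical_average t f) = f1 * planewave xi eta f.
    by move=> Sf; rewrite (planewave_average a0' xi ea t Sf) F1.
  have A2 (f : V -> C) : Sa a f -> planewave (- xi) eta (spherical_average t f) = f2 * planewave (- xi) eta f.
    by move=> Sf; rewrite (planewave_average a0' (- xi) ea t Sf) F2.
  exact: (sum_not_eigen (Sa_average a0' t) A1 A2
    (planewave_neq0 a0' xi ea) (planewave_neq0 a0' (- xi) ea) d1 T0E).
Qed.

End counterexamples.

Theorem theorem3p3 (R : realType) (d : nat) (hd : (2 <= d)%N)
  (t a : R) (ht : 0 < t) (ha : 0 < a) :
  let phi_ia : R[i] := phi ('i * a%:C) (t *: unit_e1 R d) in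
  [/\ forall (A : R[i]) (T : int -> ('rV[R]_d -> R[i]) -> R[i]),
        average_sequence t a A T -> `|A| = phi_ia ->
        distr_eq a (distr_op laplacian (T 0)) (fun f => - a%:C ^+ 2 * T 0 f),
      forall (A : R[i]) (T : int -> ('rV[R]_d -> R[i]) -> R[i]),
        average_sequence t a A T -> phi_ia < `|A| ->
        distr_eq a (T 0) (fun=> 0) &
      forall A : R[i], `|A| < phi_ia ->
        (exists T : int -> ('rV[R]_d -> R[i]) -> R[i],
           average_sequence t a A T /\
           ~ eigendistribution a laplacian (T 0)) /\
        (A != 0 ->
         exists T : int -> ('rV[R]_d -> R[i]) -> R[i],
           average_sequence t a A T /\
           ~ eigendistribution a (spherical_average t) (T 0))].
Proof.
case: d hd => [//|[//|n]] _; have a0 := ltW ha; split.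
- move=> A T HT HA; exact: (average_sequence_eigen a0 ht HT HA).
- move=> A T HT HA; exact: (average_sequence_zero a0 ht HT HA).
move=> A; rewrite phi_iaE normr_normc ltcR => HA; split.
  have [->|A0] := eqVneq A 0; first exact: zero_average_sequence.
  by have [T [T1 [T2 _]]] := nonzero_average_sequence ht ha A0 HA; exists T.
by move=> A0; have [T [T1 [_ T2]]] := nonzero_average_sequence ht ha A0 HA; exists T.
Qed.
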